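(* Let the collision kernels $B_{ij}$ satisfy assumptions (A1)–(A4) (listed in the context). Then there exists a constant $\lambda>0$ such that $$-(f,L(f))_{L^2_v}\ge\lambda\,\|f-\varPi^L(f)\|_{\mathcal{H}}^2\quad\text{for all }f\in\mathcal{D},$$ where $\varPi^L$ is the projection onto the null space $\mathcal{N}(L)$. If additionally (A6) holds, the constant $\lambda$ can be computed explicitly: the inequality holds with $$\lambda=\frac{\eta D^b}{8C_k},\qquad \eta=\min\left\{1,\frac{4C^mC_k}{16C_k+D^b}\right\},$$ where $C^m$, $D^b$ and $C_k$ are the constants defined in the context.
   Context: Setting. Fix an integer $n\ge2$ (number of species) and constants $\rho_{\infty,1},\dots,\rho_{\infty,n}>0$, $\rho_\infty=\sum_i\rho_{\infty,i}$. For $v\in\mathbb{R}^3$ put $M_i(v)=\rho_{\infty,i}(2\pi)^{-3/2}e^{-|v|^2/2}$. For $v,v^*\in\mathbb{R}^3$, $\sigma\in\mathbb{S}^2$ put $v'=\frac{v+v^*}{2}+\frac{|v-v^*|}{2}\sigma$, $v'^*=\frac{v+v^*}{2}-\frac{|v-v^*|}{2}\sigma$, and $\cos\vartheta=\sigma\cdot(v-v^* )/|v-v^*|$, $\vartheta\in[0,\pi]$. For a function $g$ of velocity write $g=g(v)$, $g^*=g(v^* )$, $g'=g(v')$, $g'^*=g(v'^* )$. The collision kernels $B_{ij}=B_{ij}(|v-v^*|,\cos\vartheta)\ge0$, $1\le i,j\le n$, are given functions. Assumptions on the kernels: (A1) $B_{ij}=B_{ji}$ for all $i,j$. (A2) $B_{ij}(|v-v^*|,\cos\vartheta)=\Phi_{ij}(|v-v^*|)\,b_{ij}(\cos\vartheta)$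 with $\Phi_{ij}\ge0$, $b_{ij}\ge0$. (A3) There are $C_1,C_2>0$, $\gamma\in[0,1]$, $\delta\in(0,1)$ with $C_1r^\gamma\le\Phi_{ij}(r)\le C_2(r+r^{-\delta})$ for all $i,j$ and $r>0$. (A4) There are $C_3,C_4>0$ such that for all $i,j$ and $\vartheta\in[0,\pi]$: $b_{ij}(\cos\vartheta)\le C_3|\sin\vartheta||\cos\vartheta|$, $b_{ij}(\cos\vartheta)>0$ whenever $\sin\vartheta\cos\vartheta\ne0$, and $b_{ij}'(\cos\vartheta)\le C_4$; moreover $C^b:=\min_{1\le i\le n}\inf_{\sigma_1,\sigma_2\in\mathbb{S}^2}\int_{\mathbb{S}^2}\min\{b_{ii}(\sigma_1\cdot\sigma_3),b_{ii}(\sigma_2\cdot\sigma_3)\}\,d\sigma_3>0$. (A6) There is $\beta>0$ such that $B_{ij}(s,\sigma)\le\beta B_{ii}(s,\sigma)$ for all $i,j$, $s>0$, $\sigma\in[-1,1]$. Operators and spaces. $\nu_i(v)=\sum_{j=1}^n\int_{\mathbb{R}^3\times\mathbb{S}^2}B_{ij}M_j^*\,dv^*d\sigma$. $L^2_v=L^2(\mathbb{R}^3;\mathbb{R}^n)$ with its usual scalar product; $\mathcal{H}=\{f\in L^2_v:\|f\|_{\mathcal{H}}^2=\sum_i\int_{\mathbb{R}^3}f_i^2\nu_i\,dv<\infty\}$; $\mathcal{D}=\{f\in L^2_v:\sum_i\int_{\mathbb{R}^3}f_i^2\nu_i^2\,dv<\infty\}$. The linearized collision operator $L=(L_1,\dots,L_n)$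 with domain $\mathcal{D}$ in $L^2_v$ is $L_i(f)=\sum_{j=1}^nL_{ij}(f_i,f_j)$, $$L_{ij}(f_i,f_j)=\int_{\mathbb{R}^3\times\mathbb{S}^2}B_{ij}M_i^{1/2}M_j^*(h_i'+h_j'^*-h_i-h_j^* )\,dv^*d\sigma,\quad h_i=M_i^{-1/2}f_i.$$ The mono-species part is $L^m=(L^m_1,\dots,L^m_n)$, $L^m_i(f_i)=L_{ii}(f_i,f_i)$. $\varPi^L$ and $\varPi^m$ denote the $L^2_v$-orthogonal projections onto $\mathcal{N}(L)$ and $\mathcal{N}(L^m)$ (null spaces); $\dim\mathcal{N}(L^m)=5n$. Constants. • $C^m=\lambda^m/(\beta\rho_\infty)$, where $\beta$ is from (A6) and $\lambda^m>0$ is a (known, explicitly computable) mono-species spectral-gap constant, i.e. a constant such that for every $i\in\{1,\dots,n\}$ and every $f\in L^2_v$ with $\nu_{ii}f_i\in L^2(\mathbb{R}^3)$, $$\frac14\int_{\mathbb{R}^6\times\mathbb{S}^2}B_{ii}(h_i'+h_i'^*-h_i-h_i^* )^2M_iM_i^*\,dvdv^*d\sigma\ge\frac{\lambda^m}{\rho_{\infty,i}}\int_{\mathbb{R}^3}(f_i-\varPi^m(f)_i)^2\nu_{ii}\,dv,\qquad \nu_{ii}(v)=\int_{\mathbb{R}^3\times\mathbb{S}^2}B_{ii}M_i^*\,dv^*d\sigma.$$ • $D^b=\min_{1\le i,j\le n}\int_{\mathbb{R}^6\times\mathbb{S}^2}B_{ij}\min\{\tfrac13|v-v'|^2,(|v'|^2-|v|^2)^2\}M_iM_j^*\,dvdv^*d\sigma$.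 • $C_k=60\,n\,\rho_\infty\max_{1\le k,\ell\le5n}\big|\sum_{i=1}^n\int_{\mathbb{R}^3}\psi_{k,i}\psi_{\ell,i}\nu_i\,dv\big|$, where $(\psi_k)_{1\le k\le5n}$, $\psi_k=(\psi_{k,1},\dots,\psi_{k,n})$, is an arbitrary orthonormal basis of $\mathcal{N}(L^m)$ in $L^2_v$. *)

(* Defs.v *)
From HB Require Import structures.
From mathcomp Require Import all_boot all_order all_algebra.
From mathcomp Require Import all_classical all_reals all_analysis.
From mathcomp Require Import measurable_realfun lra.
Set Implicit Arguments.
Unset Strict Implicit.
Unset Printing Implicit Defensive.
Import Order.TTheory GRing.Theory Num.Theory numFieldNormedType.Exports.
Local Open Scope classical_set_scope.
Local Open Scope ring_scope.

(* [m1 \x m2] has no usable canonical sigma-finite instance in the library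
   (the instance is shadowed by the one for subprobabilities); the wrapper
   below is [m1 \x m2] together with that instance. *)
Section sfprod.
Context d1 d2 (T1 : measurableType d1) (T2 : measurableType d2) (R : realType).
Variable m1 : {sigma_finite_measure set T1 -> \bar R}.
Variable m2 : {sigma_finite_measure set T2 -> \bar R}.

Definition sfprod : set (T1 * T2) -> \bar R := (m1 \x m2)%E.

HB.instance Definition _ := Measure.on sfprod.

Let sfprod_sigma_finite : sigma_finite setT sfprod.
Proof.
have /sigma_finiteP[F [TF ndF Foo]] := sigma_finiteT m1.
have /sigma_finiteP[G [TG ndG Goo]] := sigma_finiteT m2.
exists (fun n => F n `*` G n).
  rewrite -setXTT TF TG predeqE => -[x y]; split.
    move=> [/= [n _ Fnx] [k _ Gky]]; exists (maxn n k) => //; split.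
    - by move: x Fnx; exact/subsetPset/ndF/leq_maxl.
    - by move: y Gky; exact/subsetPset/ndG/leq_maxr.
  by move=> [n _ []/= ? ?]; split; exists n.
move=> k; have [? ?] := Foo k; have [? ?] := Goo k.
split; first exact: measurableX.
by rewrite /sfprod product_measure1E// lte_mul_pinfty// ge0_fin_numE.
Qed.

HB.instance Definition _ := Measure_isSigmaFinite.Build _ _ _ sfprod
  sfprod_sigma_finite.

End sfprod.

(* R^3; the library's norm on a product type is the max norm, so the Euclidean
   one is defined here. *)
Notation vel R :=
  (measurableTypeR R * measurableTypeR R * measurableTypeR R)%type.

Definition dot {R : realType} (v w : vel R) : R :=
  v.1.1 * w.1.1 + v.1.2 * w.1.2 + v.2 * w.2.

Definition enorm {R : realType} (v : vel R) : R := Num.sqrt (dot v v).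

Definition leb3 {R : realType} : {sigma_finite_measure set (vel R) -> \bar R} :=
  sfprod (sfprod (@lebesgue_measure R) (@lebesgue_measure R))
         (@lebesgue_measure R).

Definition S2 {R : realType} : set (vel R) := [set s | enorm s = 1].

(* Surface measure on the unit sphere, as a measure on R^3 carried by S2:
   sigma(A) is 3 times the volume of the cone {r s | 0 < r <= 1, s in A},
   normalised by polar coordinates, so that sigma(S2) = 4 pi. *)
Definition surf {R : realType} (A : set (vel R)) : \bar R :=
  (3%:E * leb3 [set x | (0 < enorm x <= 1)%R /\ A ((enorm x)^-1 *: x)])%E.

Section surf_measure.
Context {R : realType}.

Let m11 : measurable_fun setT (fun v : vel R => v.1.1 : R).
Proof. exact: measurableT_comp measurable_fst measurable_fst. Qed.

Let m12 : measurable_fun setT (fun v : vel R => v.1.2 : R).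
Proof. exact: measurableT_comp measurable_snd measurable_fst. Qed.

Let m2 : measurable_fun setT (fun v : vel R => v.2 : R).
Proof. exact: measurable_snd. Qed.

Let mdot : measurable_fun setT (fun v : vel R => dot v v).
Proof. by do !apply: measurable_funD; apply: measurable_funM. Qed.

Let menorm : measurable_fun setT (@enorm R).
Proof.
apply: measurableT_comp mdot.
by apply: continuous_measurable_fun; exact: sqrt_continuous.
Qed.

Let mdir : measurable_fun setT (fun x : vel R => (enorm x)^-1 *: x : vel R).
Proof.
have mV : measurable_fun setT (fun x : vel R => (enorm x)^-1).
  rewrite (_ : (fun x : vel R => _) = (fun x => enorm x `^ (-1))); last first.
    by apply/funext => x; rewrite powR_inv1// sqrtr_ge0.
  exact: (measurableT_comp (measurable_powR (-1)) menorm).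
apply/measurable_fun_pairP; split; [apply/measurable_fun_pairP; split|].
- by apply: measurable_funM mV _.
- by apply: measurable_funM mV _.
- by apply: measurable_funM mV _.
Qed.

Let B1 : set (vel R) := [set x | 0 < enorm x <= 1].

Let mB1 : measurable B1.
Proof.
have -> : B1 = (fun x => (0 < enorm x) && (enorm x <= 1)) @^-1` [set true].
  by apply/seteqP; split => x.
rewrite -[X in measurable X]setTI.
by apply: measurable_and => //;
  [apply: measurable_fun_ltr|apply: measurable_fun_ler].
Qed.

Let surfE A : surf A = (3%:E * leb3 (((fun x => (enorm x)^-1 *: x) @^-1` A)
  `&` B1))%E.
Proof. by rewrite setIC. Qed.

Let mcone A : measurable A ->
  measurable (((fun x : vel R => (enorm x)^-1 *: x) @^-1` A) `&` B1).
Proof.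
by move=> mA; apply: measurableI => //; rewrite -[X in measurable X]setTI;
  exact: mdir.
Qed.

Let surf0 : surf (set0 : set (vel R)) = 0%E.
Proof. by rewrite surfE preimage_set0 set0I measure0 mule0. Qed.

Let surf_ge0 (A : set (vel R)) : (0 <= surf A)%E.
Proof. by rewrite surfE mule_ge0. Qed.

Let surf_sigma_additive : semi_sigma_additive (@surf R).
Proof.
move=> F mF tF mUF; rewrite surfE preimage_bigcup setI_bigcupl.
under eq_fun.
  move=> n; rewrite (eq_bigr _ (fun i _ => surfE (F i))).
  rewrite -ge0_sume_distrr//.
  over.
apply: cvgeZl => //; apply: measure_semi_sigma_additive.
- by move=> n; apply: mcone; exact: mF.
- apply/trivIsetP => i j _ _ ij; rewrite setIACA -preimage_setI.
  by move/trivIsetP : tF => /(_ _ _ _ _ ij) ->//; rewrite preimage_set0 set0I.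
- by apply: bigcup_measurable => n _; apply: mcone; exact: mF.
Qed.

HB.instance Definition _ := isMeasure.Build _ _ _ (@surf R)
  surf0 surf_ge0 surf_sigma_additive.

Let surf_fin : fin_num_fun (@surf R).
Proof.
apply: lty_fin_num_fun.
rewrite /= surfE preimage_setT setTI lte_mul_pinfty//.
set I : set (measurableTypeR R) := `[(-1), 1]%classic.
have mI : measurable I by exact: measurable_itv.
apply: (@le_lt_trans _ _ (leb3 (I `*` I `*` I))).
  apply: le_measure; rewrite ?inE//; first by do !apply: measurableX.
  move=> [[a b] c] /andP[_]; rewrite /enorm /dot/= => h.
  have {}h : a * a + b * b + c * c <= 1.
    rewrite leNgt; apply/negP => h1; move: h; apply/negP; rewrite -ltNge.
    by rewrite -{1}sqrtr1 ltr_sqrt// (lt_trans _ h1).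
  have a0 := sqr_ge0 a; have b0 := sqr_ge0 b; have c0 := sqr_ge0 c.
  rewrite -!expr2 in h.
  by split; [split|]; rewrite /I/= in_itv/= -ler_norml -sqrtr_sqr -sqrtr1
    ler_sqrt//; lra.
pose mu := @lebesgue_measure R.
have -> : leb3 (I `*` I `*` I) = (mu I * mu I * mu I)%E.
  rewrite [LHS](@product_measure1E _ _ _ _ _ (sfprod mu mu) mu)//; last first.
    exact: measurableX.
  by congr (_ * _)%E; rewrite [LHS](@product_measure1E _ _ _ _ _ mu mu).
rewrite /mu lebesgue_measure_itv/=.
by case: ifP => _; rewrite ?mule0// -!EFinM ltry.
Qed.

HB.instance Definition _ := Measure_isFinite.Build _ _ _ (@surf R) surf_fin.

End surf_measure.

Section boltzmann.
Context {R : realType} {n : nat}.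
(* rho i is rho_(oo, i); the kernel B i j r x is read at r = |v - v*| and
   x = cos theta, and only its values at r > 0 and -1 <= x <= 1 matter. *)
Variables (rho : 'I_n -> R) (B : 'I_n -> 'I_n -> R -> R -> R).
Implicit Types (i j : 'I_n) (v w s : vel R) (f g : 'I_n -> vel R -> R).

Definition rho_tot : R := \sum_i rho i.

Definition maxw i v : R :=
  rho i * (2 * pi) `^ (- (3 / 2)) * expR (- (enorm v ^+ 2 / 2)).

Definition vpost v w s : vel R :=
  2^-1 *: (v + w) + (enorm (v - w) / 2) *: s.

Definition vpost_star v w s : vel R :=
  2^-1 *: (v + w) - (enorm (v - w) / 2) *: s.

Definition cosdev v w s : R := dot s (v - w) / enorm (v - w).

Definition kern i j v w s : R := B i j (enorm (v - w)) (cosdev v w s).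

Definition nu_ij i j v : R :=
  \int[sfprod leb3 surf]_(p in setT `*` S2)
    (kern i j v p.1 p.2 * maxw j p.1).

Definition nu i v : R := \sum_j nu_ij i j v.

Definition ip f g : R := \sum_i \int[leb3]_v (f i v * g i v).

(* Elements of L^2(R^3; R^n) are represented by functions and equality in L^2
   is equality almost everywhere. *)
Definition L2v : set ('I_n -> vel R -> R) :=
  [set f | forall i, f i \in Lfun leb3 2%:E].

Definition normH2 f : \bar R :=
  (\sum_i \int[leb3]_v ((f i v) ^+ 2 * nu i v)%:E)%E.

Definition domL : set ('I_n -> vel R -> R) :=
  [set f | L2v f /\
    (\sum_i \int[leb3]_v ((f i v) ^+ 2 * (nu i v) ^+ 2)%:E < +oo)%E].

Definition hfun i (fi : vel R -> R) v : R := fi v / Num.sqrt (maxw i v).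

Definition Lij i j (fi fj : vel R -> R) v : R :=
  \int[sfprod leb3 surf]_(p in setT `*` S2)
    (let w := p.1 in let s := p.2 in
     kern i j v w s * Num.sqrt (maxw i v) * maxw j w *
     (hfun i fi (vpost v w s) + hfun j fj (vpost_star v w s)
      - hfun i fi v - hfun j fj w)).

Definition Lop f i v : R := \sum_j Lij i j (f i) (f j) v.

Definition Lmono f i v : R := Lij i i (f i) (f i) v.

Definition nullspace (T : ('I_n -> vel R -> R) -> 'I_n -> vel R -> R) :
    set ('I_n -> vel R -> R) :=
  [set f | domL f /\ forall i, {ae leb3, forall v, T f i v = 0}].

(* L^2-orthogonal projection onto the subspace N: a chosen representative of
   the (a.e. unique) g in N with f - g orthogonal to N. *)
Definition orth_proj (N : set ('I_n -> vel R -> R)) f : 'I_n -> vel R -> R :=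
  get [set g | N g /\ forall h, N h -> ip (f - g) h = 0].

Definition orthonormal_basis (N : set ('I_n -> vel R -> R)) (m : nat)
    (psi : 'I_m -> 'I_n -> vel R -> R) : Prop :=
  [/\ forall k, N (psi k),
      forall k l, ip (psi k) (psi l) = (k == l)%:R
    & forall f, N f -> exists c : 'I_m -> R,
        forall i, {ae leb3, forall v, f i v = \sum_k c k * psi k i v}].

Definition spectral_gap (lam : R) : Prop :=
  forall f, domL f ->
    (lam%:E * normH2 (f - orth_proj (nullspace Lop) f)%R <= (- ip f (Lop f))%:E)%E.

Definition mono_spectral_gap (lm : R) : Prop :=
  forall i f, L2v f -> (fun v => nu_ij i i v * f i v) \in Lfun leb3 2%:E ->
    ((lm / rho i)%:E *
       \int[leb3]_v ((f i v - orth_proj (nullspace Lmono) f i v) ^+ 2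
                     * nu_ij i i v)%:E
     <= (1 / 4)%:E *
       \int[sfprod (sfprod leb3 leb3) surf]_(p in setT `*` S2)
         (let v := p.1.1 in let w := p.1.2 in let s := p.2 in
          kern i i v w s *
          (hfun i (f i) (vpost v w s) + hfun i (f i) (vpost_star v w s)
           - hfun i (f i) v - hfun i (f i) w) ^+ 2
          * maxw i v * maxw i w)%:E)%E.

Definition Db : R :=
  fine (\big[mine/+oo]_(i < n) \big[mine/+oo]_(j < n)
    \int[sfprod (sfprod leb3 leb3) surf]_(p in setT `*` S2)
      (let v := p.1.1 in let w := p.1.2 in let s := p.2 in
       kern i j v w s *
       Num.min (1 / 3 * enorm (v - vpost v w s) ^+ 2)
               ((enorm (vpost v w s) ^+ 2 - enorm v ^+ 2) ^+ 2)
       * maxw i v * maxw j w)%:E)%E.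

Definition Ck (psi : 'I_(5 * n) -> 'I_n -> vel R -> R) : R :=
  60 * n%:R * rho_tot *
  \big[Num.max/0]_(k < 5 * n) \big[Num.max/0]_(l < 5 * n)
    `| \sum_i \int[leb3]_v (psi k i v * psi l i v * nu i v) |.

End boltzmann.

Section kernel_assumptions.
Context {R : realType} {n : nat}.
Variables (B : 'I_n -> 'I_n -> R -> R -> R) (Phi b : 'I_n -> 'I_n -> R -> R).

Definition collision_kernel : Prop :=
  forall i j,
    measurable_fun (`]0, +oo[ `*` `[-1, 1] : set (R * R))
      (fun p => B i j p.1 p.2) /\
    forall r x, 0 < r -> -1 <= x <= 1 -> 0 <= B i j r x.

Definition kernel_sym : Prop :=
  forall i j r x, 0 < r -> -1 <= x <= 1 -> B i j r x = B j i r x.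

Definition kernel_factor : Prop :=
  forall i j,
    [/\ forall r, 0 < r -> 0 <= Phi i j r,
        forall x, -1 <= x <= 1 -> 0 <= b i j x
      & forall r x, 0 < r -> -1 <= x <= 1 -> B i j r x = Phi i j r * b i j x].

Definition kinetic_growth : Prop :=
  exists C1 C2 gamma delta : R,
    [/\ 0 < C1, 0 < C2, 0 <= gamma <= 1, 0 < delta < 1
      & forall i j r, 0 < r ->
          C1 * r `^ gamma <= Phi i j r <= C2 * (r + r `^ (- delta))].

Definition Cb : \bar R :=
  (\big[mine/+oo]_(i < n)
     ereal_inf [set \int[surf]_(s in S2)
                      (Num.min (b i i (dot s12.1 s)) (b i i (dot s12.2 s)))%:E
               | s12 in S2 `*` S2])%E.

(* Derivative of h : [-1, 1] -> R at x, one-sided at the end points. *)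
Definition has_derivative_itv (h : R -> R) (x l : R) : Prop :=
  (fun y => (h y - h x) / (y - x)) @ within `[-1, 1] x^' --> l.

Definition angular_cutoff : Prop :=
  (exists C3 C4 : R, [/\ 0 < C3, 0 < C4 &
     forall i j theta, 0 <= theta <= pi ->
       [/\ b i j (cos theta) <= C3 * `|sin theta| * `|cos theta|,
           sin theta * cos theta != 0 -> 0 < b i j (cos theta)
         & exists2 l, has_derivative_itv (b i j) (cos theta) l & l <= C4]]) /\
  (0 < Cb)%E.

Definition diag_control (beta : R) : Prop :=
  forall i j r x, 0 < r -> -1 <= x <= 1 -> B i j r x <= beta * B i i r x.

End kernel_assumptions.

(* Main.v *)
(* The weak form is -(f, L f) = 1/4 sum_ij |S_ij f|^2 with
   S_ij f = (B_ij M_i M_j^* )^(1/2) (h_i' + h_j'^* - h_i - h_j^* ). Expanding the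
   squares gives |f|_H^2 plus cross terms, whose kernels have singularities that
   Schur's test controls; away from these the joint law of the two velocities
   involved has a bounded density, hence is approximated by finite-rank kernels.
   So the form dominates |f|_H^2 up to finitely many L^2 functionals, and a
   sequence violating the gap would have a subsequence converging to a nonzero
   element of the null space orthogonal to it.

   For the explicit constant, the null space of L^m is identified by Bessel's
   identity: the 5n functions M_i^(1/2) (alpha_i + u_i.v + e_i |v|^2) are
   orthonormalised and compared with the 5n given psi_k. Let p be the projection
   of f on it. The mono-species gap controls f - p, while the bi-species
   collisions applied to p control sum_ij |u_i - u_j|^2 + |e_i - e_j|^2 through
   D_b, by invariance of the collisions under coordinate reflections and
   permutations. Elements with u_i and e_i independent of i are in the null space
   of L, so this sum bounds the distance of p to it, and C_k compares the L^2 and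
   H norms on the null space of L^m. *)
Require Import Defs.
From HB Require Import structures.
From mathcomp Require Import all_boot all_order all_algebra.
From mathcomp Require Import all_classical all_reals all_analysis.
From mathcomp Require Import measurable_realfun ring lra.
Set Implicit Arguments.
Unset Strict Implicit.
Unset Printing Implicit Defensive.
Import Order.TTheory GRing.Theory Num.Theory numFieldNormedType.Exports.
Local Open Scope classical_set_scope.
Local Open Scope ring_scope.

(** * Measure-preserving maps *)

(** The form is studied on all functions with finite H norm, a space containing the domain of L,
    where it is closed. Its null vectors must then be shown to lie in the domain: the weak form
    tested with a truncation of nu f bounds nu f in L^2, because the cross terms are bounded in L^2.

    No Jacobian is computed. Shears conjugate the collision map to the exchange of two spherical
    variables in polar coordinates, which preserves measure by Tonelli. The density of a
    post-collisional velocity is bounded because the displacement expands lengths along suitable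
    lines; the density itself comes from Radon-Nikodym, not from an explicit gain kernel.

    Projections and limits are built from sequences with geometric rates, so that completeness
    reduces to pointwise limits of real sequences.

    In lambda the factor 8 is 2 * 4: one half from |a - c|^2 <= 2 |a|^2 + 2 |c|^2 on the bi-species
    part, one quarter from the weak form. The value of eta balances the loss 4 eta |f - p|_H^2 of
    that step against the mono-species gap. *)

Section measurability.
Context {R : realType}.

Lemma mf_pair d1 d2 d3 (X : measurableType d1) (Y : measurableType d2)
    (Z : measurableType d3) (f : X -> Y) (g : X -> Z) :
  measurable_fun setT f -> measurable_fun setT g ->
  measurable_fun setT (fun x => (f x, g x)).
Proof. by move=> mf mg; apply/measurable_fun_pairP; split. Qed.

Lemma mf_fst d1 d2 d3 (X : measurableType d1) (Y : measurableType d2)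
    (Z : measurableType d3) (f : X -> Y * Z) :
  measurable_fun setT f -> measurable_fun setT (fun x => (f x).1).
Proof. by move=> mf; apply: (measurableT_comp measurable_fst mf). Qed.

Lemma mf_snd d1 d2 d3 (X : measurableType d1) (Y : measurableType d2)
    (Z : measurableType d3) (f : X -> Y * Z) :
  measurable_fun setT f -> measurable_fun setT (fun x => (f x).2).
Proof. by move=> mf; apply: (measurableT_comp measurable_snd mf). Qed.

Lemma mf_inv d (X : measurableType d) (f : X -> R) :
  measurable_fun setT f -> measurable_fun setT (fun x => (f x)^-1).
Proof.
(* The power with exponent -1 is the inverse on nonnegative numbers only, hence the detour through
   the square; at 0 both sides vanish. *)
move=> mf; have -> : (fun x => (f x)^-1) = (fun x => f x * ((f x ^+ 2) `^ (-1))).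
  apply/funext => x; rewrite powR_inv1 ?sqr_ge0//.
  have [->|fx0] := eqVneq (f x) 0; first by rewrite invr0 mul0r.
  by field.
apply: measurable_funM => //; apply: (measurableT_comp (measurable_powR (-1))).
exact: measurable_funX.
Qed.

Lemma mf_sqrt d (X : measurableType d) (f : X -> R) :
  measurable_fun setT f -> measurable_fun setT (fun x => Num.sqrt (f x)).
Proof.
move=> mf; apply: (measurableT_comp (f := @Num.sqrt R)) mf.
by apply: continuous_measurable_fun; exact: sqrt_continuous.
Qed.

Lemma mf_expR d (X : measurableType d) (f : X -> R) :
  measurable_fun setT f -> measurable_fun setT (fun x => expR (f x)).
Proof. by move=> mf; apply: measurableT_comp mf. Qed.

Lemma mf_opp d (X : measurableType d) (f : X -> R) :
  measurable_fun setT f -> measurable_fun setT (fun x => - f x).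
Proof. by move=> mf; apply: measurableT_comp mf. Qed.

Lemma mf_norm d (X : measurableType d) (f : X -> R) :
  measurable_fun setT f -> measurable_fun setT (fun x => `|f x|).
Proof. by move=> mf; apply: measurableT_comp mf. Qed.

Lemma mf_powR d (X : measurableType d) (f : X -> R) (p : R) :
  measurable_fun setT f -> measurable_fun setT (fun x => f x `^ p).
Proof. by move=> mf; apply: (measurableT_comp (measurable_powR p) mf). Qed.

Lemma mf_EFin d (X : measurableType d) (f : X -> R) :
  measurable_fun setT f -> measurable_fun setT (fun x => (f x)%:E).
Proof. by move=> mf; apply/measurable_EFinP. Qed.

Lemma mf_sum d (X : measurableType d) (I : Type) (r : seq I) (P : pred I) (f : I -> X -> R) :
  (forall i, measurable_fun setT (f i)) ->
  measurable_fun setT (fun x => \sum_(i <- r | P i) f i x).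
Proof.
move=> mf; under eq_fun do rewrite big_mkcond.
by apply: measurable_sum => i; case: (P i).
Qed.

End measurability.

Ltac mf :=
  first [assumption |
  lazymatch goal with
  | |- measurable_fun _ (fun x => x) => exact: measurable_id
  | |- measurable_fun _ (fun x => (@?f x, @?g x)) => apply: (mf_pair (f := f) (g := g)); mf
  | |- measurable_fun _ (fun x => fst (@?f x)) => apply: (mf_fst (f := f)); mf
  | |- measurable_fun _ (fun x => snd (@?f x)) => apply: (mf_snd (f := f)); mf
  | |- measurable_fun _ (fun x => ((@?f x) + - (@?g x))%R) => apply: (measurable_funB (f := f) (g := g)); mf
  | |- measurable_fun _ (fun x => ((@?f x) + (@?g x))%R) => apply: (measurable_funD (f := f) (g := g)); mf
  | |- measurable_fun _ (fun x => ((@?f x) * (@?g x))%R) => apply: (measurable_funM (f := f) (g := g)); mf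
  | |- measurable_fun _ (fun x => (- (@?f x))%R) => apply: (mf_opp (f := f)); mf
  | |- measurable_fun _ (fun x => ((@?f x) ^+ ?n)%R) => apply: (measurable_funX n (f := f)); mf
  | |- measurable_fun _ (fun x => ((@?f x)^-1)%R) => apply: (mf_inv (f := f)); mf
  | |- measurable_fun _ (fun x => Num.sqrt (@?f x)) => apply: (mf_sqrt (f := f)); mf
  | |- measurable_fun _ (fun x => expR (@?f x)) => apply: (mf_expR (f := f)); mf
  | |- measurable_fun _ (fun x => (Num.norm (@?f x))%R) => apply: (mf_norm (f := f)); mf
  | |- measurable_fun _ (fun x => powR (@?f x) ?p) => apply: (mf_powR p (f := f)); mf
  | |- measurable_fun _ (fun x => EFin (@?f x)) => apply: (mf_EFin (f := f)); mf
  | H : measurable_fun setT ?f |- measurable_fun _ (fun x => ?f (@?g x)) =>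
      apply: (measurableT_comp (f := f) (g := g) H); mf
  | |- measurable_fun _ (fun x => ?c) => exact: measurable_cst
  | _ => idtac
  end].

Section pushforward_measure.
Context d1 d2 (X : measurableType d1) (Y : measurableType d2) (R : realType).
Variables (m : {measure set X -> \bar R}) (f : {mfun X >-> Y}).

Definition pfw : set Y -> \bar R := pushforward m f.

HB.instance Definition _ := Measure.copy pfw
  (measure_function_pushforward__canonical__measure_function_Measure m (measurable_funP f)).

End pushforward_measure.

Section measure_preserving.
Context {R : realType}.

Definition mp d1 d2 (X : measurableType d1) (Y : measurableType d2)
    (m1 : set X -> \bar R) (m2 : set Y -> \bar R) (T : X -> Y) : Prop :=
  measurable_fun setT T /\ forall A, measurable A -> m1 (T @^-1` A) = m2 A.

Section change_of_variables.
Context d1 d2 (X : measurableType d1) (Y : measurableType d2).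
Variables (m1 : {measure set X -> \bar R}) (m2 : {measure set Y -> \bar R}).
Variables (T : X -> Y) (mpT : mp m1 m2 T).

Lemma mp_ge0_integral (f : Y -> \bar R) : measurable_fun setT f ->
  (forall y, 0 <= f y)%E -> (\int[m1]_x f (T x) = \int[m2]_y f y)%E.
Proof.
move=> mf f0; have [mT TE] := mpT.
pose T' : {mfun X >-> Y} := HB.pack T (isMeasurableFun.Build _ _ _ _ _ mT).
rewrite [RHS](@eq_measure_integral _ _ _ _ (pfw m1 T')).
  by rewrite [RHS](ge0_integral_pushforward mT).
by move=> A mA _; rewrite -TE.
Qed.

Lemma mp_integral (f : Y -> \bar R) : measurable_fun setT f ->
  (\int[m1]_x f (T x) = \int[m2]_y f y)%E.
Proof.
move=> mf; rewrite integralE [RHS]integralE.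
rewrite -(mp_ge0_integral (measurable_funepos mf))//.
rewrite -(mp_ge0_integral (measurable_funeneg mf))//.
by rewrite -[fun x => f (T x)]/(f \o T) funepos_comp funeneg_comp.
Qed.

Lemma mp_Rintegral (f : Y -> R) : measurable_fun setT f ->
  \int[m1]_x f (T x) = \int[m2]_y f y.
Proof.
by move=> mf; rewrite /Rintegral (mp_integral (f := EFin \o f))//;
  exact/measurable_EFinP.
Qed.

Lemma mp_integrable (f : Y -> \bar R) : m2.-integrable setT f ->
  m1.-integrable setT (f \o T).
Proof.
move=> /integrableP[mf foo]; apply/integrableP; split.
  exact: measurableT_comp mf mpT.1.
by rewrite (mp_ge0_integral (f := fun y => `|f y|%E))//; exact: measurableT_comp.
Qed.

End change_of_variables.

Lemma mp_id d (X : measurableType d) (m : set X -> \bar R) : mp m m id.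
Proof. by split => // A mA. Qed.

Lemma mp_comp d1 d2 d3 (X : measurableType d1) (Y : measurableType d2)
    (Z : measurableType d3) (m1 : set X -> \bar R) (m2 : set Y -> \bar R)
    (m3 : set Z -> \bar R) (T : X -> Y) (S : Y -> Z) :
  mp m1 m2 T -> mp m2 m3 S -> mp m1 m3 (S \o T).
Proof.
move=> [mT TE] [mS SE]; split; first exact: measurableT_comp.
move=> A mA; rewrite comp_preimage TE ?SE//.
by rewrite -[X in measurable X]setTI; apply: mS.
Qed.

Lemma sf_fubini1 d1 d2 (X : measurableType d1) (Y : measurableType d2)
    (m1 : {sigma_finite_measure set X -> \bar R})
    (m2 : {sigma_finite_measure set Y -> \bar R}) (f : X * Y -> \bar R) :
  measurable_fun setT f -> (forall p, 0 <= f p)%E ->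
  (\int[sfprod m1 m2]_p f p = \int[m1]_x \int[m2]_y f (x, y))%E.
Proof. by move=> mf f0; rewrite /sfprod (fubini_tonelli1 f). Qed.

Lemma sf_fubini2 d1 d2 (X : measurableType d1) (Y : measurableType d2)
    (m1 : {sigma_finite_measure set X -> \bar R})
    (m2 : {sigma_finite_measure set Y -> \bar R}) (f : X * Y -> \bar R) :
  measurable_fun setT f -> (forall p, 0 <= f p)%E ->
  (\int[sfprod m1 m2]_p f p = \int[m2]_y \int[m1]_x f (x, y))%E.
Proof. by move=> mf f0; rewrite /sfprod (fubini_tonelli2 f). Qed.

Lemma sf_fubini1R d1 d2 (X : measurableType d1) (Y : measurableType d2)
    (m1 : {sigma_finite_measure set X -> \bar R})
    (m2 : {sigma_finite_measure set Y -> \bar R}) (f : X * Y -> R) :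
  measurable_fun setT f -> (forall p, 0 <= f p) ->
  (\int[sfprod m1 m2]_p (f p)%:E = \int[m1]_x \int[m2]_y (f (x, y))%:E)%E.
Proof.
by move=> /measurable_EFinP mf f0; apply: (sf_fubini1 m1 m2 mf) => p; rewrite lee_fin.
Qed.

Lemma sf_fubini2R d1 d2 (X : measurableType d1) (Y : measurableType d2)
    (m1 : {sigma_finite_measure set X -> \bar R})
    (m2 : {sigma_finite_measure set Y -> \bar R}) (f : X * Y -> R) :
  measurable_fun setT f -> (forall p, 0 <= f p) ->
  (\int[sfprod m1 m2]_p (f p)%:E = \int[m2]_y \int[m1]_x (f (x, y))%:E)%E.
Proof.
by move=> /measurable_EFinP mf f0; apply: (sf_fubini2 m1 m2 mf) => p; rewrite lee_fin.
Qed.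

Lemma measurable_fubini1R d1 d2 (X : measurableType d1) (Y : measurableType d2)
    (m2 : {sigma_finite_measure set Y -> \bar R}) (f : X * Y -> R) :
  measurable_fun setT f -> (forall p, 0 <= f p) ->
  measurable_fun setT (fun x => \int[m2]_y (f (x, y))%:E)%E.
Proof.
move=> /measurable_EFinP mf f0.
by apply: (measurable_fun_fubini_tonelli_F _ mf) => p; rewrite lee_fin.
Qed.

Lemma sf_unique d1 d2 (X : measurableType d1) (Y : measurableType d2)
    (m1 : {sigma_finite_measure set X -> \bar R})
    (m2 : {sigma_finite_measure set Y -> \bar R})
    (m' : {measure set (X * Y) -> \bar R}) :
  (forall A B, measurable A -> measurable B -> m' (A `*` B) = m1 A * m2 B)%E ->
  forall E, measurable E -> sfprod m1 m2 E = m' E.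
Proof. exact: product_measure_unique. Qed.

Lemma sfprodE d1 d2 (X : measurableType d1) (Y : measurableType d2)
    (m1 : {sigma_finite_measure set X -> \bar R})
    (m2 : {sigma_finite_measure set Y -> \bar R}) A B :
  measurable A -> measurable B -> sfprod m1 m2 (A `*` B) = (m1 A * m2 B)%E.
Proof. by move=> mA mB; rewrite /sfprod product_measure1E. Qed.

(** Indicators are among the tested functions. Invariance can thus be checked on iterated integrals,
    where Tonelli applies. *)
Lemma mp_of_integral d1 d2 (X : measurableType d1) (Y : measurableType d2)
    (m1 : {measure set X -> \bar R}) (m2 : {measure set Y -> \bar R})
    (T : X -> Y) : measurable_fun setT T ->
  (forall f : Y -> R, measurable_fun setT f -> (forall y, (0 <= f y)%R) ->
     \int[m1]_x (f (T x))%:E = \int[m2]_y (f y)%:E)%E ->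
  mp m1 m2 T.
Proof.
move=> mT H; split => // A mA.
have mTA : measurable (T @^-1` A) by rewrite -[X in measurable X]setTI; apply: mT.
have := H (\1_A) (measurable_indic mA) (fun=> ler0n _ _).
by rewrite (integral_indic _ measurableT mTA) (integral_indic _ measurableT mA) !setIT.
Qed.

Lemma mp_prod d1 d2 d3 d4 (X : measurableType d1) (Y : measurableType d2)
    (X' : measurableType d3) (Y' : measurableType d4)
    (m1 : {sigma_finite_measure set X -> \bar R})
    (m2 : {sigma_finite_measure set Y -> \bar R})
    (n1 : {sigma_finite_measure set X' -> \bar R})
    (n2 : {sigma_finite_measure set Y' -> \bar R}) T S :
  mp m1 n1 T -> mp m2 n2 S ->
  mp (sfprod m1 m2) (sfprod n1 n2) (fun p => (T p.1, S p.2)).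
Proof.
move=> mpT mpS.
have mTS : measurable_fun setT (fun p : X * Y => (T p.1, S p.2)).
  apply/measurable_fun_pairP; split => /=.
    exact: measurableT_comp mpT.1 measurable_fst.
  exact: measurableT_comp mpS.1 measurable_snd.
apply: mp_of_integral => // f mf f0.
apply: (etrans (sf_fubini1R m1 m2 (measurableT_comp mf mTS) (fun p => f0 _))).
apply/esym/(etrans (sf_fubini1R n1 n2 mf f0))/esym.
rewrite -(mp_ge0_integral mpT (f := fun x => (\int[n2]_y (f (x, y))%:E)%E)); last first.
- by move=> y; apply: integral_ge0 => z _; rewrite lee_fin.
- exact: measurable_fubini1R.
apply: eq_integral => x _ /=.
rewrite (mp_ge0_integral mpS (f := fun y => (f (T x, y))%:E))//.
  by apply/measurable_EFinP; exact: measurableT_comp mf (pair1_measurable _).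
by move=> y; rewrite lee_fin.
Qed.

Lemma mp_swap d1 d2 (X : measurableType d1) (Y : measurableType d2)
    (m1 : {sigma_finite_measure set X -> \bar R})
    (m2 : {sigma_finite_measure set Y -> \bar R}) :
  mp (sfprod m1 m2) (sfprod m2 m1) (fun p => (p.2, p.1)).
Proof.
have mswap : measurable_fun setT (fun p : X * Y => (p.2, p.1)).
  by mf.
apply: mp_of_integral => // f mf f0.
apply: (etrans (sf_fubini2R m1 m2 (measurableT_comp mf mswap) (fun p => f0 _))).
by apply/esym/(etrans (sf_fubini1R m2 m1 mf f0)).
Qed.

(** Integrating first over the fibre above a fixed x reduces the claim to the invariance assumed
    there. All shears of velocity space used later are of this kind. *)
Lemma mp_skew d1 d2 d3 (X : measurableType d1) (Y : measurableType d2)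
    (Z : measurableType d3)
    (m1 : {sigma_finite_measure set X -> \bar R})
    (m2 : {sigma_finite_measure set Y -> \bar R})
    (m3 : {sigma_finite_measure set Z -> \bar R}) (T : X -> Y -> Z) :
  measurable_fun setT (fun p : X * Y => T p.1 p.2) ->
  (forall x, mp m2 m3 (T x)) ->
  mp (sfprod m1 m2) (sfprod m1 m3) (fun p => (p.1, T p.1 p.2)).
Proof.
move=> mT mpT.
have mT' : measurable_fun setT (fun p : X * Y => (p.1, T p.1 p.2)).
  by mf.
apply: mp_of_integral => // f mf f0.
apply: (etrans (sf_fubini1R m1 m2 (measurableT_comp mf mT') (fun p => f0 _))).
apply/esym/(etrans (sf_fubini1R m1 m3 mf f0))/esym.
apply: eq_integral => x _ /=.
rewrite (mp_ge0_integral (mpT x) (f := fun y => (f (x, y))%:E))//.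
  by apply/measurable_EFinP; exact: measurableT_comp mf (pair1_measurable _).
by move=> y; rewrite lee_fin.
Qed.

Lemma mp_assoc d1 d2 d3 (X : measurableType d1) (Y : measurableType d2)
    (Z : measurableType d3)
    (m1 : {sigma_finite_measure set X -> \bar R})
    (m2 : {sigma_finite_measure set Y -> \bar R})
    (m3 : {sigma_finite_measure set Z -> \bar R}) :
  mp (sfprod (sfprod m1 m2) m3) (sfprod m1 (sfprod m2 m3))
    (fun p => (p.1.1, (p.1.2, p.2))).
Proof.
have mT : measurable_fun setT (fun p : X * Y * Z => (p.1.1, (p.1.2, p.2))).
  by mf.
apply: mp_of_integral => // f mf f0.
have mf2 := measurableT_comp mf mT.
apply: (etrans (sf_fubini1R (sfprod m1 m2) m3 mf2 (fun p => f0 _))).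
apply/esym/(etrans (sf_fubini1R m1 (sfprod m2 m3) mf f0))/esym => /=.
rewrite (sf_fubini1 m1 m2 (f := fun p => (\int[m3]_z (f (p.1, (p.2, z)))%:E)%E)); last 2 first.
- exact: (measurable_fubini1R m3 mf2 (fun p => f0 _)).
- by move=> p; apply: integral_ge0 => z _; rewrite lee_fin.
apply: eq_integral => x _ /=.
rewrite (sf_fubini1R m2 m3 (f := fun q => f (x, q)))//.
exact: measurableT_comp mf (pair1_measurable _).
Qed.

Lemma mp_assocV d1 d2 d3 (X : measurableType d1) (Y : measurableType d2)
    (Z : measurableType d3)
    (m1 : {sigma_finite_measure set X -> \bar R})
    (m2 : {sigma_finite_measure set Y -> \bar R})
    (m3 : {sigma_finite_measure set Z -> \bar R}) :
  mp (sfprod m1 (sfprod m2 m3)) (sfprod (sfprod m1 m2) m3)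
    (fun p => (p.1, p.2.1, p.2.2)).
Proof.
have mT : measurable_fun setT (fun p : X * (Y * Z) => (p.1, p.2.1, p.2.2)).
  by mf.
have [ma aE] := mp_assoc m1 m2 m3.
split => // A mA; rewrite -aE; last first.
  by rewrite -[X in measurable X]setTI; apply: mT.
by congr (sfprod _ _ _); apply/seteqP; split => -[[x y] z].
Qed.

End measure_preserving.

(** * Lebesgue measure on the line under translation, reflection and dilation *)

Section lebesgue1.
Context {R : realType}.
Notation leb := (@lebesgue_measure R).

Lemma mp_leb_add (a : R) : mp leb leb (fun x : measurableTypeR R => x + a : measurableTypeR R).
Proof.
have mT : measurable_fun setT (fun x : measurableTypeR R => x + a : measurableTypeR R).
  by apply: measurable_funD.
split => // A mA.
pose T' : {mfun (measurableTypeR R) >-> (measurableTypeR R)} :=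
  HB.pack (fun x : measurableTypeR R => x + a : measurableTypeR R)
  (isMeasurableFun.Build _ _ _ _ _ mT).
symmetry; apply: (lebesgue_measure_unique (mu := pfw leb T')) => //.
move=> _ [[x y] /= _ <-]; rewrite /pfw /pushforward.
have -> : T' @^-1` `]x, y]%classic = `]x - a, y - a]%classic.
  by apply/seteqP; split => z /=; rewrite !in_itv/= ltrBlDr lerBrDr.
rewrite !lebesgue_measure_itv/= !lte_fin ltrD2r; case: ifP => // _.
by rewrite -!EFinB; congr EFin; ring.
Qed.

Lemma mp_leb_opp : mp leb leb (fun x : measurableTypeR R => - x : measurableTypeR R).
Proof.
have mT : measurable_fun setT (fun x : measurableTypeR R => - x : measurableTypeR R).
  exact: measurableT_comp.
by split => // A mA; exact: lebesgue_measureN.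
Qed.

(** The image of Lebesgue measure under the dilation, multiplied by c, has the right value on
    half-open intervals, which determine the measure. *)
Lemma leb_scale (c : R) (A : set (measurableTypeR R)) : 0 < c -> measurable A ->
  leb ((fun x => c * x) @^-1` A) = (c^-1%:E * leb A)%E.
Proof.
move=> c0 mA.
have mT : measurable_fun setT (fun x : measurableTypeR R => c * x : measurableTypeR R).
  by apply: measurable_funM.
pose T' : {mfun (measurableTypeR R) >-> (measurableTypeR R)} :=
  HB.pack (fun x : measurableTypeR R => c * x : measurableTypeR R)
  (isMeasurableFun.Build _ _ _ _ _ mT).
have c0' : 0 <= c by exact: ltW.
pose mu0 : {measure set (measurableTypeR R) -> \bar R} := pfw leb T'.
pose mu : {measure set (measurableTypeR R) -> \bar R} := mscale (NngNum c0') mu0.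
have -> : leb A = mu A.
  apply: (lebesgue_measure_unique (mu := mu)) => // _ [[x y] /= _ <-].
  rewrite /mu/= /mscale/= /mu0/= /pfw /pushforward.
  have -> : T' @^-1` `]x, y]%classic = `](x / c), (y / c)]%classic.
    apply/seteqP; split => z /=; rewrite !in_itv/=.
      by rewrite ltr_pdivrMr// ler_pdivlMr// [z * c]mulrC.
    by rewrite ltr_pdivrMr// ler_pdivlMr// [z * c]mulrC.
  rewrite !lebesgue_measure_itv/= !lte_fin ltr_pM2r ?invr_gt0//.
  case: ifP => _; last by rewrite mule0.
  by rewrite -!EFinB -EFinM; congr EFin; field; rewrite gt_eqF.
rewrite /mu/= /mscale/= /mu0/= /pfw muleA -EFinM mulVf ?gt_eqF// mul1e.
by [].
Qed.

End lebesgue1.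

(** * Euclidean space and polar coordinates *)

Section euclidean.
Context {R : realType}.
Implicit Types u v w : vel R.

Lemma dotC v w : dot v w = dot w v.
Proof. by rewrite /dot; ring. Qed.

Lemma dotDl u v w : dot (u + v) w = dot u w + dot v w.
Proof. by rewrite /dot/=; ring. Qed.

Lemma dotDr u v w : dot w (u + v) = dot w u + dot w v.
Proof. by rewrite /dot/=; ring. Qed.

Lemma dotZl (c : R) v w : dot (c *: v) w = c * dot v w.
Proof. by rewrite /dot/= /GRing.scale/=; ring. Qed.

Lemma dotZr (c : R) v w : dot v (c *: w) = c * dot v w.
Proof. by rewrite dotC dotZl dotC. Qed.

Lemma dotNl v w : dot (- v) w = - dot v w.
Proof. by rewrite /dot/=; ring. Qed.

Lemma dotNr v w : dot v (- w) = - dot v w.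
Proof. by rewrite dotC dotNl dotC. Qed.

Definition dotE := (dotDl, dotDr, dotZl, dotZr, dotNl, dotNr).

Lemma dot_ge0 v : 0 <= dot v v.
Proof. by rewrite /dot !addr_ge0// -expr2 sqr_ge0. Qed.

Lemma enorm_sqr v : enorm v ^+ 2 = dot v v.
Proof. by rewrite /enorm sqr_sqrtr// dot_ge0. Qed.

Lemma enorm_ge0 v : 0 <= enorm v.
Proof. exact: sqrtr_ge0. Qed.

Lemma dot0_eq0 v : dot v v = 0 -> v = 0.
Proof.
case: v => [[a b] c]; rewrite /dot/= => h.
have := sqr_ge0 a; have := sqr_ge0 b; have := sqr_ge0 c.
rewrite !expr2 => c0 b0 a0.
have /eqP : a * a = 0 by lra.
have /eqP : b * b = 0 by lra.
have /eqP : c * c = 0 by lra.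
by rewrite !mulf_eq0 !orbb => /eqP -> /eqP -> /eqP ->.
Qed.

Lemma enorm0_eq0 v : enorm v = 0 -> v = 0.
Proof. by move=> h; apply: dot0_eq0; rewrite -enorm_sqr h expr0n. Qed.

Lemma enorm0 : enorm (0 : vel R) = 0.
Proof. by rewrite /enorm /dot/= !mulr0 !addr0 sqrtr0. Qed.

Lemma enorm_eq0 v : (enorm v == 0) = (v == 0).
Proof.
by apply/eqP/eqP => [/enorm0_eq0//|->]; exact: enorm0.
Qed.

Lemma enorm_gt0 v : (0 < enorm v) = (v != 0).
Proof. by rewrite lt_neqAle enorm_ge0 andbT eq_sym enorm_eq0. Qed.

Lemma enormZ (c : R) v : enorm (c *: v) = `|c| * enorm v.
Proof.
by rewrite /enorm !dotE mulrA -expr2 sqrtrM ?sqr_ge0// sqrtr_sqr.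
Qed.

Lemma enormN v : enorm (- v) = enorm v.
Proof. by rewrite /enorm !dotE opprK. Qed.

Lemma enormB v w : enorm (v - w) = enorm (w - v).
Proof. by rewrite -enormN opprB. Qed.

(** Lagrange's identity: the difference of the two sides is the squared norm of the cross
    product. *)
Lemma cauchy_dot v w : dot v w ^+ 2 <= dot v v * dot w w.
Proof.
have := sqr_ge0 (v.1.1 * w.1.2 - v.1.2 * w.1.1).
have := sqr_ge0 (v.1.1 * w.2 - v.2 * w.1.1).
have := sqr_ge0 (v.1.2 * w.2 - v.2 * w.1.2).
rewrite /dot; nra.
Qed.

Lemma dot_le v w : `|dot v w| <= enorm v * enorm w.
Proof.
rewrite -sqrtr_sqr /enorm -sqrtrM ?dot_ge0// ler_sqrt ?mulr_ge0 ?dot_ge0//.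
exact: cauchy_dot.
Qed.

Lemma enormD v w : enorm (v + w) <= enorm v + enorm w.
Proof.
rewrite -(@ler_pXn2r _ 2)// ?nnegrE ?addr_ge0 ?enorm_ge0//.
rewrite sqrrD !enorm_sqr !dotE (dotC w v).
have := dot_le v w; rewrite ler_norml => /andP[_]; lra.
Qed.

Lemma enorm_coord1 v : `|v.1.1| <= enorm v.
Proof.
rewrite -sqrtr_sqr /enorm ler_sqrt ?dot_ge0// /dot !expr2.
have := sqr_ge0 v.1.2; have := sqr_ge0 v.2; rewrite !expr2; lra.
Qed.

Lemma enorm_coord2 v : `|v.1.2| <= enorm v.
Proof.
rewrite -sqrtr_sqr /enorm ler_sqrt ?dot_ge0// /dot !expr2.
have := sqr_ge0 v.1.1; have := sqr_ge0 v.2; rewrite !expr2; lra.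
Qed.

Lemma enorm_coord3 v : `|v.2| <= enorm v.
Proof.
rewrite -sqrtr_sqr /enorm ler_sqrt ?dot_ge0// /dot !expr2.
have := sqr_ge0 v.1.1; have := sqr_ge0 v.1.2; rewrite !expr2; lra.
Qed.

(** With the convention that the inverse of 0 is 0, [dir 0] is 0, so that [enormK] holds for every
    vector. *)
Definition dir v : vel R := (enorm v)^-1 *: v.

Lemma enorm_dir v : v != 0 -> enorm (dir v) = 1.
Proof.
by move=> v0; rewrite /dir enormZ ger0_norm ?invr_ge0 ?enorm_ge0// mulVf// enorm_eq0.
Qed.

Lemma enormK v : enorm v *: dir v = v.
Proof.
have [->|v0] := eqVneq v 0; first by rewrite /dir !scaler0.
by rewrite /dir scalerA divff ?scale1r// enorm_eq0.
Qed.

Lemma dirZ (c : R) v : 0 < c -> dir (c *: v) = dir v.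
Proof.
move=> c0; rewrite /dir enormZ gtr0_norm// scalerA invfM.
by rewrite (mulrC c^-1) -mulrA mulVf ?gt_eqF// mulr1.
Qed.

Section measurability.
Context d (X : measurableType d).
Implicit Types f g : X -> vel R.

Lemma mf_addv f g : measurable_fun setT f -> measurable_fun setT g ->
  measurable_fun setT (fun x => f x + g x : vel R).
Proof.
move=> mf mg.
have : measurable_fun setT (fun x => (((f x).1.1 + (g x).1.1 : measurableTypeR R,
  (f x).1.2 + (g x).1.2 : measurableTypeR R), (f x).2 + (g x).2 : measurableTypeR R)) by mf.
exact.
Qed.

Lemma mf_oppv f : measurable_fun setT f ->
  measurable_fun setT (fun x => - f x : vel R).
Proof.
move=> mf.
have : measurable_fun setT (fun x => ((- (f x).1.1 : measurableTypeR R,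
  - (f x).1.2 : measurableTypeR R), - (f x).2 : measurableTypeR R)) by mf.
exact.
Qed.

Lemma mf_scalev (c : X -> R) f : measurable_fun setT c -> measurable_fun setT f ->
  measurable_fun setT (fun x => c x *: f x : vel R).
Proof.
move=> mc mf.
have : measurable_fun setT (fun x => ((c x * (f x).1.1 : measurableTypeR R,
  c x * (f x).1.2 : measurableTypeR R), c x * (f x).2 : measurableTypeR R)) by mf.
exact.
Qed.

Lemma mf_dot f g : measurable_fun setT f -> measurable_fun setT g ->
  measurable_fun setT (fun x => dot (f x) (g x)).
Proof. by move=> mf mg; rewrite /dot; mf. Qed.

Lemma mf_enorm f : measurable_fun setT f ->
  measurable_fun setT (fun x => enorm (f x)).
Proof. by move=> mf; apply: mf_sqrt; exact: mf_dot. Qed.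

Lemma mf_dir f : measurable_fun setT f ->
  measurable_fun setT (fun x => dir (f x)).
Proof. by move=> mf; apply: mf_scalev => //; apply: mf_inv; exact: mf_enorm. Qed.

End measurability.
End euclidean.

(** Sums and opposites are tried as real-valued first and as vector-valued second, since their
    syntax does not tell them apart. *)
Ltac mfv :=
  first [assumption |
  lazymatch goal with
  | |- measurable_fun _ (fun x => x) => exact: measurable_id
  | |- measurable_fun _ (fun x => (@?f x, @?g x)) => apply: (mf_pair (f := f) (g := g)); mfv
  | |- measurable_fun _ (fun x => fst (@?f x)) => apply: (mf_fst (f := f)); mfv
  | |- measurable_fun _ (fun x => snd (@?f x)) => apply: (mf_snd (f := f)); mfv
  | |- measurable_fun _ (fun x => dot (@?f x) (@?g x)) => apply: (mf_dot (f := f) (g := g)); mfv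
  | |- measurable_fun _ (fun x => enorm (@?f x)) => apply: (mf_enorm (f := f)); mfv
  | |- measurable_fun _ (fun x => dir (@?f x)) => apply: (mf_dir (f := f)); mfv
  | |- measurable_fun _ (fun x => (@?c x) *: (@?f x)) => apply: (mf_scalev (c := c) (f := f)); mfv
  | |- measurable_fun _ (fun x => ((@?f x) + (@?g x))%R) =>
      first [apply: (measurable_funD (f := f) (g := g)); mfv
            |apply: (mf_addv (f := f) (g := g)); mfv]
  | |- measurable_fun _ (fun x => ((@?f x) * (@?g x))%R) => apply: (measurable_funM (f := f) (g := g)); mfv
  | |- measurable_fun _ (fun x => (- (@?f x))%R) =>
     first [apply: (mf_opp (f := f)); mfv | apply: (mf_oppv (f := f)); mfv]
  | |- measurable_fun _ (fun x => ((@?f x) ^+ ?n)%R) => apply: (measurable_funX n (f := f)); mfv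
  | |- measurable_fun _ (fun x => ((@?f x)^-1)%R) => apply: (mf_inv (f := f)); mfv
  | |- measurable_fun _ (fun x => Num.sqrt (@?f x)) => apply: (mf_sqrt (f := f)); mfv
  | |- measurable_fun _ (fun x => expR (@?f x)) => apply: (mf_expR (f := f)); mfv
  | |- measurable_fun _ (fun x => (Num.norm (@?f x))%R) => apply: (mf_norm (f := f)); mfv
  | |- measurable_fun _ (fun x => powR (@?f x) ?p) => apply: (mf_powR p (f := f)); mfv
  | |- measurable_fun _ (fun x => EFin (@?f x)) => apply: (mf_EFin (f := f)); mfv
  | H : measurable_fun setT ?f |- measurable_fun _ (fun x => ?f (@?g x)) =>
      apply: (measurableT_comp (f := f) (g := g) H); mfv
  | |- measurable_fun _ (fun x => ?c) => exact: measurable_cst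
  | _ => idtac
  end].

(** * Invariance and scaling of Lebesgue measure on R^3 *)

Section leb3_invariance.
Context {R : realType}.
Notation leb := (@lebesgue_measure R).

Lemma mp_leb3_add (a : vel R) : mp leb3 leb3 (fun v : vel R => v + a : vel R).
Proof.
exact: (mp_prod (mp_prod (mp_leb_add a.1.1) (mp_leb_add a.1.2)) (mp_leb_add a.2)).
Qed.

Lemma mp_leb3_opp : mp leb3 leb3 (fun v : vel R => - v : vel R).
Proof. exact: (mp_prod (mp_prod mp_leb_opp mp_leb_opp) mp_leb_opp). Qed.

Lemma mp_leb3_refl (b1 b2 b3 : bool) : mp leb3 leb3 (fun v : vel R =>
  (((-1) ^+ b1 * v.1.1 : measurableTypeR R, (-1) ^+ b2 * v.1.2 : measurableTypeR R),
    (-1) ^+ b3 * v.2 : measurableTypeR R)).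
Proof.
have h (b : bool) : mp leb leb (fun x : measurableTypeR R => (-1) ^+ b * x : measurableTypeR R).
  case: b; rewrite ?expr1 ?expr0.
    by under eq_fun do rewrite mulN1r; exact: mp_leb_opp.
  by under eq_fun do rewrite mul1r; exact: mp_id.
exact: (mp_prod (mp_prod (h b1) (h b2)) (h b3)).
Qed.

Lemma mp_leb3_cycle : mp leb3 leb3 (fun v : vel R => (v.1.2, v.2, v.1.1) : vel R).
Proof.
exact: (mp_comp (mp_assoc _ _ _) (mp_swap _ _)).
Qed.

(** On rectangles the two factors multiply; dividing the image measure by a b therefore gives a
    measure that uniqueness identifies with the product. *)
Lemma scale_prod d1 d2 (X : measurableType d1) (Y : measurableType d2)
    (m1 : {sigma_finite_measure set X -> \bar R})
    (m2 : {sigma_finite_measure set Y -> \bar R}) (a b : R)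
    (T : X -> X) (S : Y -> Y) :
  0 < a -> 0 < b -> measurable_fun setT T -> measurable_fun setT S ->
  (forall A, measurable A -> m1 (T @^-1` A) = a%:E * m1 A)%E ->
  (forall A, measurable A -> m2 (S @^-1` A) = b%:E * m2 A)%E ->
  forall A, measurable A ->
    (sfprod m1 m2 ((fun p => (T p.1, S p.2)) @^-1` A) = (a * b)%:E * sfprod m1 m2 A)%E.
Proof.
move=> a0 b0 mT mS T1 S2 A mA.
have mTS : measurable_fun setT (fun p : X * Y => (T p.1, S p.2)) by mf.
pose f : {mfun (X * Y)%type >-> (X * Y)%type} := HB.pack (fun p : X * Y => (T p.1, S p.2))
  (isMeasurableFun.Build _ _ _ _ _ mTS).
have ab0 : 0 <= (a * b)^-1 by rewrite invr_ge0 ltW// mulr_gt0.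
pose mu0 : {measure set (X * Y) -> \bar R} := pfw (sfprod m1 m2) f.
pose mu : {measure set (X * Y) -> \bar R} := mscale (NngNum ab0) mu0.
have -> : sfprod m1 m2 A = mu A.
  apply: (sf_unique (m' := mu)) => // {mA}A B mA mB.
  rewrite /mu/= /mscale/= /mu0/= /pfw /pushforward.
  have -> : f @^-1` (A `*` B) = (T @^-1` A) `*` (S @^-1` B) by [].
  rewrite sfprodE ?T1 ?S2//; last 2 first.
  - by rewrite -[X in measurable X]setTI; exact: mT.
  - by rewrite -[X in measurable X]setTI; exact: mS.
  rewrite muleACA (muleA _ (a%:E * b%:E))%E -!EFinM mulVf ?mul1e// gt_eqF// mulr_gt0//.
rewrite /mu/= /mscale/= /mu0/= /pfw /pushforward muleA -EFinM divff ?mul1e//.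
by rewrite gt_eqF// mulr_gt0.
Qed.

Lemma leb3_scale (c : R) (A : set (vel R)) : 0 < c -> measurable A ->
  leb3 ((fun v => c *: v : vel R) @^-1` A) = ((c ^- 3)%:E * leb3 A)%E.
Proof.
move=> c0 mA; have ci0 : 0 < c^-1 by rewrite invr_gt0.
have mc : measurable_fun setT (fun x : measurableTypeR R => c * x : measurableTypeR R).
  exact: measurable_funM.
have mc2 : measurable_fun setT (fun p : measurableTypeR R * measurableTypeR R =>
   (c * p.1 : measurableTypeR R, c * p.2 : measurableTypeR R)) by mf.
have h A' mA' := @leb_scale R c A' c0 mA'.
have h2 := scale_prod ci0 ci0 mc mc h h.
have cc0 : 0 < c^-1 * c^-1 by rewrite mulr_gt0.
have -> : c ^- 3 = c^-1 * c^-1 * c^-1 by field; rewrite gt_eqF.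
exact: (scale_prod cc0 ci0 mc2 mc h2 h).
Qed.

End leb3_invariance.

(** * Surface measure of the unit sphere *)

Section surface_measure.
Context {R : realType}.

Definition ball1 : set (vel R) := [set x | 0 < enorm x <= 1].

Lemma measurable_ball1 : measurable ball1.
Proof.
have -> : ball1 = (fun x => (0 < enorm x) && (enorm x <= 1)) @^-1` [set true].
  by apply/seteqP; split => x.
rewrite -[X in measurable X]setTI.
have me : measurable_fun setT (@enorm R) by apply: mf_enorm.
by apply: measurable_and => //;
  [apply: measurable_fun_ltr|apply: measurable_fun_ler].
Qed.

Lemma surfE (A : set (vel R)) : surf A = (3%:E * leb3 ((dir @^-1` A) `&` ball1))%E.
Proof. by rewrite setIC. Qed.

Lemma measurable_dir : measurable_fun setT (@dir R).
Proof. by apply: mf_dir. Qed.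

Lemma integral_mrestr d (T : measurableType d) (m : {measure set T -> \bar R})
    (D : set T) (mD : measurable D) (f : T -> \bar R) :
  measurable_fun setT f -> (forall x, 0 <= f x)%E ->
  (\int[mrestr m mD]_x f x = \int[m]_(x in D) f x)%E.
Proof.
move=> mf f0.
have e : (\int[mrestr m mD]_(x in D) f x = \int[m]_(x in D) f x)%E.
  apply: eq_measure_integral => A mA AD.
  by rewrite -[LHS]/(m (A `&` D)) setIidl.
rewrite -e -[in LHS](setUv D) (@ge0_integral_setU _ _ _ (mrestr m mD))//.
- rewrite [X in (_ + X)%E]null_set_integral ?adde0//.
  + exact: measurableC.
  + exact: measurable_funS mf.
  + by rewrite -[LHS]/(m (~` D `&` D)) setIC setICr measure0.
- exact: measurableC.
- by rewrite setUv.
- by rewrite disj_set2E setICr.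
Qed.

Lemma measurable_S2 : measurable (@S2 R).
Proof.
have me : measurable_fun setT (@enorm R) by apply: mf_enorm.
rewrite -[S2]setTI; exact: (me measurableT [set 1] (measurable_set1 1)).
Qed.

Lemma surfC0 : surf (~` @S2 R) = 0%E.
Proof.
rewrite surfE (_ : _ `&` _ = set0) ?measure0 ?mule0//.
apply/seteqP; split => // x [] /= h /andP[x0 _]; apply: h.
by apply: enorm_dir; rewrite -enorm_gt0.
Qed.

Lemma surf_ae_S2 : {ae surf, forall s : vel R, S2 s}.
Proof.
exists (~` @S2 R); split => //.
  by apply: measurableC; exact: measurable_S2.
exact: surfC0.
Qed.

(** A homogeneous norm-preserving map commutes with [dir] and preserves [ball1], so the cone over a
    preimage is the preimage of the cone. *)
Lemma mp_surf (g : vel R -> vel R) : mp leb3 leb3 g ->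
  (forall c x, g (c *: x) = c *: g x) -> (forall x, enorm (g x) = enorm x) ->
  mp surf surf g.
Proof.
move=> [mg gE] gZ gn; split=> [|A mA]; first exact: mg.
rewrite !surfE -[in RHS]gE; last first.
  apply: measurableI; last exact: measurable_ball1.
  by rewrite -[X in measurable X]setTI; exact: measurable_dir.
congr (_ * leb3 _)%E; apply/seteqP; split => x /=.
  by rewrite /dir gZ /ball1/= !gn.
by rewrite /dir gZ /ball1/= !gn.
Qed.

End surface_measure.

(** * Polar coordinates *)

Section polar.
Context {R : realType}.

Lemma LS_itvoc (f : cumulative R R) (a b : R) : a <= b ->
  lebesgue_stieltjes_measure f `]a, b]%classic = (f b - f a)%:E.
Proof.
move=> ab; rewrite /lebesgue_stieltjes_measure/= /measure_extension/=.
rewrite measurable_mu_extE; first exact: (wlength_itv_bnd f _ _ ab).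
exact: is_ocitv.
Qed.

Definition cumZ (c : {nonneg R}) (f : R -> R) : R -> R := fun x => c%:num * f x.

(* Polar coordinates: with r |-> r^3 / 3 as distribution function, [surf] times
   this radial measure is Lebesgue measure. *)
Definition radF (r : R) : R := (Num.max r 0) ^+ 3 / 3.

Lemma radF_nd : {homo radF : x y / x <= y}.
Proof.
move=> x y xy; rewrite /radF ler_pM2r ?invr_gt0//.
have m0 (z : R) : 0 <= Num.max z 0 by rewrite le_max lexx orbT.
by apply: lerXn2r; rewrite ?nnegrE//; rewrite ge_max m0 andbT le_max xy.
Qed.

Lemma radF_rc : right_continuous radF.
Proof.
apply: right_continuousW => x; rewrite /radF.
apply: cvgM; last exact: cvg_cst.
apply: (continuous_comp (f := fun x => Num.max x (0 : R)) (g := fun x => x ^+ 3)).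
  apply: continuous_max; [exact: cvg_id|exact: cvg_cst].
exact: exprn_continuous.
Qed.

HB.instance Definition _ := isCumulative.Build R _ R radF radF_nd radF_rc.

Section scaled.
Variable c : {nonneg R}.

Lemma cumZ_nd : {homo cumZ c radF : x y / x <= y}.
Proof. by move=> x y xy; rewrite /cumZ ler_wpM2l// radF_nd. Qed.

Lemma cumZ_rc : right_continuous (cumZ c radF).
Proof. by move=> x; apply: cvgM; [exact: cvg_cst|exact: radF_rc]. Qed.

HB.instance Definition _ := isCumulative.Build R _ R (cumZ c radF) cumZ_nd cumZ_rc.

End scaled.

Definition rad : {sigma_finite_measure set (measurableTypeR R) -> \bar R} :=
  lebesgue_stieltjes_measure radF.

(** Both sides are the Stieltjes measure of c [radF], by uniqueness from half-open intervals. The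
    constant c will be the surface measure of a set of directions. *)
Lemma radE (c : {nonneg R}) (mu : {measure set (measurableTypeR R) -> \bar R}) :
  (forall a b, a <= b -> mu `]a, b]%classic = (c%:num * (radF b - radF a))%:E) ->
  forall A, measurable A -> mu A = (c%:num%:E * rad A)%E.
Proof.
move=> H A mA.
have h1 : lebesgue_stieltjes_measure (cumZ c radF) A = mu A.
  apply: lebesgue_stieltjes_measure_unique => // _ [[a b] /= _ <-].
  have [ab|/ltW ba] := leP a b; first by rewrite LS_itvoc// H// /cumZ mulrBr.
  by rewrite set_itv_ge ?measure0// bnd_simp -leNgt.
pose mu' : {measure set (measurableTypeR R) -> \bar R} := mscale c rad.
rewrite -h1; have -> : (c%:num%:E * rad A)%E = mu' A by [].
apply: lebesgue_stieltjes_measure_unique => // _ [[a b] /= _ <-].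
have [ab|/ltW ba] := leP a b.
  by rewrite LS_itvoc// /mu'/= /mscale/= LS_itvoc// -EFinM /cumZ mulrBr.
by rewrite set_itv_ge ?measure0// bnd_simp -leNgt.
Qed.

Lemma leb3_box (A B C : set (measurableTypeR R)) :
  measurable A -> measurable B -> measurable C ->
  leb3 (A `*` B `*` C) = (@lebesgue_measure R A * lebesgue_measure B * lebesgue_measure C)%E.
Proof.
move=> mA mB mC.
apply: (etrans (sfprodE (sfprod lebesgue_measure lebesgue_measure) lebesgue_measure (measurableX mA mB) mC)).
by congr (_ * _)%E; exact: (sfprodE lebesgue_measure lebesgue_measure mA mB).
Qed.

Lemma set0_boxE : [set 0 : vel R] = ([set (0 : measurableTypeR R)] `*` [set (0 : measurableTypeR R)]) `*` [set (0 : measurableTypeR R)].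
Proof. by apply/seteqP; split => [x /= -> //|[[x y] z] /= [[-> ->] ->]]. Qed.

Lemma leb3_set0 : leb3 [set 0 : vel R] = 0%E.
Proof. by rewrite set0_boxE leb3_box// lebesgue_measure_set1 !mul0e. Qed.

(** Dilation by 1/r maps the truncated cone to the one in the unit ball and contributes r^3; the
    factor 3 in [surf] turns this into r^3 / 3. *)
Lemma cone_measure (A : set (vel R)) (r : R) : measurable A -> 0 < r ->
  leb3 ((dir @^-1` A) `&` [set x | 0 < enorm x <= r]) = ((radF r)%:E * surf A)%E.
Proof.
move=> mA r0; have ri0 : 0 < r^-1 by rewrite invr_gt0.
have mB : measurable ((dir @^-1` A) `&` @ball1 R).
  apply: measurableI; last exact: measurable_ball1.
  by rewrite -[X in measurable X]setTI; exact: measurable_dir.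
have -> : (dir @^-1` A) `&` [set x | 0 < enorm x <= r] =
    (fun x => r^-1 *: x : vel R) @^-1` ((dir @^-1` A) `&` @ball1 R).
  apply/seteqP; split => x /=.
    move=> [Ax /andP[x0 xr]]; rewrite dirZ//; split => //; rewrite /ball1/=.
    by rewrite enormZ gtr0_norm// mulr_gt0//= mulrC ler_pdivrMr ?mul1r.
  rewrite dirZ// /ball1/= enormZ gtr0_norm// => -[Ax /andP[x0 xr]]; split => //.
  by move: x0 xr; rewrite pmulr_rgt0// mulrC ler_pdivrMr ?mul1r// => -> ->.
rewrite leb3_scale// surfE muleA -EFinM /radF max_l ?ltW// exprVn invrK.
by congr (_ * _)%E; congr EFin; field.
Qed.

(** For a fixed set of directions the law of |u| on the cone over it is computed on intervals, as a
    difference of two truncated cones, and is then known by [radE]. *)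
Lemma mp_polar : mp leb3 (sfprod rad surf) (fun u : vel R => (enorm u : measurableTypeR R, dir u)).
Proof.
have mT : measurable_fun setT (fun u : vel R => (enorm u : measurableTypeR R, dir u)).
  by mfv.
split => // E mE.
pose T' : {mfun (vel R) >-> (measurableTypeR R * vel R)%type} := HB.pack
  (fun u : vel R => (enorm u : measurableTypeR R, dir u))
  (isMeasurableFun.Build _ _ _ _ _ mT).
apply/esym; apply: (sf_unique (m' := pfw leb3 T')) => // {E mE} I A mI mA.
rewrite -[LHS]/(leb3 (T' @^-1` (I `*` A))).
have mdA : measurable (dir @^-1` A) by rewrite -[X in measurable X]setTI; exact: measurable_dir.
have me : measurable_fun setT (fun u : vel R => enorm u : measurableTypeR R) by mfv.
pose e' : {mfun (vel R) >-> (measurableTypeR R)} := HB.pack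
  (fun u : vel R => enorm u : measurableTypeR R) (isMeasurableFun.Build _ _ _ _ _ me).
pose mu0 : {measure set (vel R) -> \bar R} := mrestr leb3 mdA.
pose mu : {measure set (measurableTypeR R) -> \bar R} := pfw mu0 e'.
have sA0 : 0 <= fine (surf A) by rewrite fine_ge0.
have sAf : surf A \is a fin_num by exact: fin_num_measure.
have -> : leb3 (T' @^-1` (I `*` A)) = mu I.
  apply: (congr1 (fun X => leb3 X)).
  by apply/seteqP; split.
rewrite (@radE (NngNum sA0) mu _ I mI)/=; last first.
  move=> a b ab; rewrite /mu /= /pfw /pushforward /mu0 /= /mrestr.
  pose C r := (dir @^-1` A) `&` [set x : vel R | 0 < enorm x <= r].
  have mC r : measurable (C r).
    apply: measurableI => //.
    have -> : [set x : vel R | 0 < enorm x <= r] = (fun x => (0 < enorm x) && (enorm x <= r)) @^-1` [set true].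
      by apply/seteqP; split => x.
    rewrite -[X in measurable X]setTI.
    by apply: measurable_and => //;
      [apply: measurable_fun_ltr|apply: measurable_fun_ler].
  have CE r : leb3 (C r) = ((radF r)%:E * surf A)%E.
    have [r0|r0] := ltP 0 r; first exact: cone_measure.
    rewrite /radF max_r// expr0n/= mul0r mul0e.
    rewrite (_ : C r = set0) ?measure0//; apply/seteqP; split => // x [_ /=] /andP[x0 xr].
    by move: (lt_le_trans x0 xr); rewrite ltNge r0.
  have CD : C a `<=` C b.
    by move=> x [? /= /andP[? xa]]; split => //=; apply/andP; split => //; exact: le_trans xa ab.
  have Cfin r : (leb3 (C r) < +oo)%E.
    by rewrite CE -[surf A]fineK// -EFinM ltry.
  transitivity (leb3 (C b `\` C a)).
    have m1 : measurable (e' @^-1` `]a, b] `&` dir @^-1` A).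
      apply: measurableI => //; rewrite -[X in measurable X]setTI.
      exact: (me measurableT _ (measurable_itv `]a, b])).
    have m0 : measurable [set (0 : vel R)].
      by rewrite set0_boxE; do 2 apply: measurableX => //.
    have mD : measurable (C b `\` C a) by apply: measurableD.
    (* The two sets can differ only by the origin, which the truncated cones exclude and which is a
       null set. *)
    apply/eqP; rewrite eq_le; apply/andP; split.
      apply: (@le_trans _ _ (leb3 ((C b `\` C a) `|` [set 0]))).
        apply: le_measure; rewrite ?inE//; first exact: measurableU.
        move=> x [/=]; rewrite in_itv/= => /andP[ax xb] Ax.
        have [->|x0] := eqVneq x 0; [by right|left].
        split; first by split => //=; rewrite enorm_gt0 x0.
        by move=> [_ /= /andP[_]]; rewrite leNgt ax.
      have h := @measureU2 _ _ _ leb3 _ _ mD m0; apply: (le_trans h).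
      rewrite -[leRHS]adde0; apply: leeD => //.
      by rewrite le_eqVlt; apply/orP; left; apply/eqP; exact: leb3_set0.
    apply: le_measure; rewrite ?inE// => x [[Ax /= /andP[x0 xb]] nC].
    split => //=; rewrite in_itv/= xb andbT ltNge; apply/negP => xa; apply: nC.
    by split => //=; rewrite x0.
  have hD : leb3 (C b `\` C a) = (leb3 (C b) - leb3 (C b `&` C a))%E :=
    @measureD _ _ _ leb3 _ _ (mC b) (mC a) (Cfin b).
  apply: (etrans hD); rewrite (setIidr CD) !CE -[surf A]fineK// -!EFinM -EFinB/=.
  by congr EFin; ring.
by rewrite fineK// muleC.
Qed.

(** Writing u = r w in polar coordinates, the map exchanges the unit vectors w and s while r stays
    fixed; this is Tonelli on the square of [surf]. *)
Lemma mp_polar_swap : mp (sfprod leb3 surf) (sfprod leb3 surf)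
  (fun p : vel R * vel R => (enorm p.1 *: p.2 : vel R, dir p.1)).
Proof.
have mT : measurable_fun setT (fun p : vel R * vel R => (enorm p.1 *: p.2 : vel R, dir p.1)).
  by mfv.
apply: mp_of_integral => // f mf f0.
apply: (etrans (sf_fubini1R leb3 surf (measurableT_comp mf mT) (fun p => f0 _))).
apply/esym/(etrans (sf_fubini1R leb3 surf mf f0))/esym => /=.
pose g1 (q : measurableTypeR R * vel R) := (\int[surf]_s (f (q.1 *: s, q.2))%:E)%E.
pose g2 (q : measurableTypeR R * vel R) := (\int[surf]_s (f (q.1 *: q.2, s))%:E)%E.
have mf1 : measurable_fun setT (fun t : (measurableTypeR R * vel R) * vel R => f (t.1.1 *: t.2, t.1.2)).
  by mfv.
have mf2 : measurable_fun setT (fun t : (measurableTypeR R * vel R) * vel R => f (t.1.1 *: t.1.2, t.2)).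
  by mfv.
rewrite -[LHS]/(\int[leb3]_x g1 (enorm x, dir x))%E.
transitivity (\int[leb3]_x g2 (enorm x, dir x))%E; last first.
  by apply: eq_integral => x _; rewrite /g2/= enormK.
have g10 q : (0 <= g1 q)%E by apply: integral_ge0 => s _; rewrite lee_fin.
have g20 q : (0 <= g2 q)%E by apply: integral_ge0 => s _; rewrite lee_fin.
have mg1 : measurable_fun setT g1 by exact: (measurable_fubini1R surf mf1 (fun p => f0 _)).
have mg2 : measurable_fun setT g2 by exact: (measurable_fubini1R surf mf2 (fun p => f0 _)).
apply: (etrans (mp_ge0_integral mp_polar mg1 g10)).
apply/esym/(etrans (mp_ge0_integral mp_polar mg2 g20))/esym.
apply: (etrans (sf_fubini1 rad surf mg1 g10)).
apply/esym/(etrans (sf_fubini1 rad surf mg2 g20))/esym.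
apply: eq_integral => r _; rewrite /g1 /g2/=.
have mh : measurable_fun setT (fun q : vel R * vel R => (f (r *: q.2, q.1))%:E) by mfv.
rewrite (fubini_tonelli (m1 := surf) (m2 := surf) _ mh)//.
by move=> q; rewrite lee_fin.
Qed.

End polar.

(** * The collision map *)

Section collision_map.
Context {R : realType}.
Notation trip := (vel R * vel R * vel R)%type.
Implicit Types (p : trip) (v w s : vel R).

Definition Pi3 : {sigma_finite_measure set trip -> \bar R} := sfprod (sfprod leb3 leb3) surf.

Lemma vel_ext v w : v.1.1 = w.1.1 -> v.1.2 = w.1.2 -> v.2 = w.2 -> v = w.
Proof. by case: v => [[? ?] ?]; case: w => [[? ?] ?] /= -> -> ->. Qed.

Lemma mp_ext d1 d2 (X : measurableType d1) (Y : measurableType d2)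
    (m1 : set X -> \bar R) (m2 : set Y -> \bar R) (f g : X -> Y) :
  f =1 g -> mp m1 m2 f -> mp m1 m2 g.
Proof. by move=> /funext ->. Qed.

(* The third component is the direction of v - w, which makes the collision map
   an involution on [good]; elsewhere (a null set of v, w, s in S2) [Tc] is the
   identity. *)
Definition Tc0 p : trip :=
  (vpost p.1.1 p.1.2 p.2, vpost_star p.1.1 p.1.2 p.2, dir (p.1.1 - p.1.2)).

Definition good p : bool := (p.1.1 != p.1.2) && (enorm p.2 == 1).

Definition Tc p : trip := if good p then Tc0 p else p.

Definition Sw p : trip := (p.1.2, p.1.1, - p.2).

Definition Fl p : trip := (p.1.1, p.1.2, - p.2).

Lemma mp_leb3_sub v : mp leb3 leb3 (fun x : vel R => x - v : vel R).
Proof. exact: mp_leb3_add (- v). Qed.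

(** In the coordinates of centre of mass and relative velocity u the collision fixes the former and
    sends u, s to |u| s, [dir] u. Here [Psi] passes to these coordinates by shears and swaps, and
    [Phi] returns. *)
Lemma mp_Tc0 : mp Pi3 Pi3 Tc0.
Proof.
have e1 (r x y a : R) : r * a + (y + 2^-1 * (x - y) - 2^-1 * (r * a)) = 2^-1 * (x + y) + r / 2 * a by lra.
have e2 (r x y a : R) : y + 2^-1 * (x - y) - 2^-1 * (r * a) = 2^-1 * (x + y) - r / 2 * a by lra.
have mp1 : mp (sfprod leb3 leb3) (sfprod leb3 leb3) (fun q : vel R * vel R => (q.1, q.2 - q.1 : vel R)).
  by apply: (@mp_skew R _ _ _ _ _ _ leb3 leb3 leb3 (fun x y : vel R => y - x : vel R)); [mfv|move=> x; exact: mp_leb3_sub].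
have mp2 : mp (sfprod leb3 leb3) (sfprod leb3 leb3) (fun q : vel R * vel R => (q.1, q.2 + 2^-1 *: q.1 : vel R)).
  by apply: (@mp_skew R _ _ _ _ _ _ leb3 leb3 leb3 (fun x y : vel R => y + 2^-1 *: x : vel R)); [mfv|move=> x; exact: mp_leb3_add].
have mp3 : mp (sfprod leb3 leb3) (sfprod leb3 leb3) (fun q : vel R * vel R => (q.1, q.2 - 2^-1 *: q.1 : vel R)).
  by apply: (@mp_skew R _ _ _ _ _ _ leb3 leb3 leb3 (fun x y : vel R => y - 2^-1 *: x : vel R)); [mfv|move=> x; exact: mp_leb3_sub].
have mp4 : mp (sfprod leb3 leb3) (sfprod leb3 leb3) (fun q : vel R * vel R => (q.1, q.2 + q.1 : vel R)).
  by apply: (@mp_skew R _ _ _ _ _ _ leb3 leb3 leb3 (fun x y : vel R => y + x : vel R)); [mfv|move=> x; exact: mp_leb3_add].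
have sw := mp_swap (@leb3 R) (@leb3 R).
have Psi := mp_comp (mp_comp (mp_comp (mp_comp sw mp1) sw) mp2) sw.
have Phi := mp_comp (mp_comp (mp_comp (mp_comp sw mp3) sw) mp4) sw.
have id1 := mp_id (@surf R).
have h1 := mp_comp (mp_prod Psi id1) (mp_assoc _ _ _).
have h2 := mp_comp (mp_prod (mp_id (@leb3 R)) (@mp_polar_swap R)) (mp_assocV _ _ _).
have h3 := mp_comp h1 (mp_comp h2 (mp_prod Phi id1)).
apply: mp_ext h3 => -[[v w] s] /=; rewrite /Tc0/= /vpost /vpost_star.
by congr (_, _, _); apply: vel_ext; by [exact: e1|exact: e2].
Qed.

Lemma le_eq (x y : \bar R) : x = y -> (x <= y)%E.
Proof. by move=> ->. Qed.

Lemma sfprod_null1 d1 d2 (X : measurableType d1) (Y : measurableType d2)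
    (m1 : {sigma_finite_measure set X -> \bar R})
    (m2 : {sigma_finite_measure set Y -> \bar R}) A C :
  measurable A -> measurable C -> m1 A = 0%E -> sfprod m1 m2 (A `*` C) = 0%E.
Proof. by move=> mA mC A0; rewrite sfprodE// A0 mul0e. Qed.

Lemma sfprod_null2 d1 d2 (X : measurableType d1) (Y : measurableType d2)
    (m1 : {sigma_finite_measure set X -> \bar R})
    (m2 : {sigma_finite_measure set Y -> \bar R}) A C :
  measurable A -> measurable C -> m2 C = 0%E -> sfprod m1 m2 (A `*` C) = 0%E.
Proof. by move=> mA mC A0; rewrite sfprodE// A0 mule0. Qed.

Lemma measure_ae_eq d (T : measurableType d) (m : {measure set T -> \bar R}) (A C : set T) :
  measurable A -> measurable C -> {ae m, forall x, A x <-> C x} -> m A = m C.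
Proof.
have h (A' C' : set T) : measurable A' -> measurable C' ->
    {ae m, forall x, A' x <-> C' x} -> (m A' <= m C')%E.
  move=> mA mC [N [mN N0 sub]].
  apply: (@le_trans _ _ (m (C' `|` N))).
    apply: le_measure; rewrite ?inE//; first exact: measurableU.
    move=> x Ax; have [Nx|nN] := pselect (N x); [by right|left].
    by apply: contrapT => nC; apply: nN; apply: sub => /= -[/(_ Ax)].
  have hU := @measureU2 _ _ _ m _ _ mC mN.
  apply: (le_trans hU); rewrite -[leRHS]adde0; apply: leeD => //.
  exact: (le_eq N0).
move=> mA mC e; apply/eqP; rewrite eq_le !h//.
by apply: filterS e => x [? ?]; split.
Qed.

Lemma null_setU d (T : measurableType d) (m : {measure set T -> \bar R}) (A C : set T) :
  measurable A -> measurable C -> m A = 0%E -> m C = 0%E -> m (A `|` C) = 0%E.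
Proof.
move=> mA mC A0 C0; apply/eqP; rewrite eq_le measure_ge0 andbT.
have hU := @measureU2 _ _ _ m _ _ mA mC.
have e : (m A + m C = 0)%E by rewrite A0 C0 adde0.
exact: (le_trans hU (le_eq e)).
Qed.

Lemma leb3_set1 v : leb3 [set v] = 0%E.
Proof.
rewrite (_ : [set v] = [set (v.1.1 : measurableTypeR R)] `*` [set (v.1.2 : measurableTypeR R)]
      `*` [set (v.2 : measurableTypeR R)]).
  by rewrite leb3_box// lebesgue_measure_set1 !mul0e.
by apply/seteqP; split => [x /= -> //|[[x y] z] /= [[-> ->] ->]]; case: v => -[].
Qed.

Lemma measurable_vel1 v : measurable [set v].
Proof.
rewrite (_ : [set v] = [set (v.1.1 : measurableTypeR R)] `*` [set (v.1.2 : measurableTypeR R)]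
      `*` [set (v.2 : measurableTypeR R)]).
  by do 2 apply: measurableX => //.
by apply/seteqP; split => [x /= -> //|[[x y] z] /= [[-> ->] ->]]; case: v => -[].
Qed.

Lemma measurable_neq0 (u : trip -> vel R) : measurable_fun setT u ->
  measurable [set p | u p != 0].
Proof.
move=> mu; have -> : [set p | u p != 0] = (fun p => enorm (u p)) @^-1` (~` [set 0]).
  by apply/seteqP; split => p /=; rewrite -enorm_eq0; move/eqP.
have me : measurable_fun setT (fun p => enorm (u p)) by mfv.
rewrite -[X in measurable X]setTI; apply: (me measurableT).
by apply: measurableC; exact: measurable_set1.
Qed.

Lemma measurable_good : measurable [set p | good p].
Proof.
have -> : [set p | good p] = [set p | p.1.1 - p.1.2 != 0] `&` (snd @^-1` (@S2 R)).
  apply/seteqP; split => p /=; rewrite /good subr_eq0 /S2/=.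
    by move=> /andP[-> /eqP].
  by move=> [-> /eqP ->].
apply: measurableI; first by apply: measurable_neq0; mfv.
rewrite -[X in measurable X]setTI; apply: measurable_snd => //; exact: measurable_S2.
Qed.

Lemma mf_good : measurable_fun setT (fun p => good p).
Proof.
apply: (measurable_fun_bool true).
by rewrite setTI; exact: measurable_good.
Qed.

Lemma ae_good2 v : {ae sfprod leb3 surf, forall q : vel R * vel R, good (v, q.1, q.2)}.
Proof.
have mS2C : measurable (~` @S2 R) by apply: measurableC; exact: measurable_S2.
have m1 : measurable ([set v] `*` [set: vel R]) by apply: measurableX => //; exact: measurable_vel1.
have m2 : measurable ([set: vel R] `*` (~` @S2 R)) by apply: measurableX.
exists (([set v] `*` setT) `|` (setT `*` (~` @S2 R))); split.
- exact: measurableU.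
- apply: (null_setU m1 m2).
    exact: (sfprod_null1 surf (measurable_vel1 v) measurableT (leb3_set1 v)).
  exact: (sfprod_null2 leb3 measurableT mS2C surfC0).
- move=> [w s] /= /negP; rewrite /good/= negb_and negbK => /orP[/eqP ->|/eqP s1]; first by left.
  by right.
Qed.

Lemma mp_diff : mp (sfprod leb3 leb3) (sfprod leb3 leb3) (fun q : vel R * vel R => (q.1, q.2 - q.1 : vel R)).
Proof.
by apply: (@mp_skew R _ _ _ _ _ _ leb3 leb3 leb3 (fun x y : vel R => y - x : vel R)); [mfv|move=> x; exact: mp_leb3_sub].
Qed.

Lemma ae_good : {ae Pi3, forall p, good p}.
Proof.
have mS2C : measurable (~` @S2 R) by apply: measurableC; exact: measurable_S2.
pose g := fun q : vel R * vel R => (q.1, q.2 - q.1 : vel R).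
pose A0 : set (vel R * vel R) := [set: vel R] `*` [set (0 : vel R)].
have mA0 : measurable A0 by apply: measurableX => //; exact: measurable_vel1.
have mD : measurable (g @^-1` A0).
  by rewrite -[X in measurable X]setTI; exact: (mp_diff.1).
have D0 : sfprod leb3 leb3 (g @^-1` A0) = 0%E.
  apply: (etrans (mp_diff.2 A0 mA0)).
  exact: (sfprod_null2 leb3 measurableT (measurable_vel1 0) (leb3_set1 0)).
have m1 : measurable ((g @^-1` A0) `*` [set: vel R]) by apply: measurableX.
have m2 : measurable ([set: vel R * vel R] `*` (~` @S2 R)) by apply: measurableX.
exists (((g @^-1` A0) `*` setT) `|` (setT `*` (~` @S2 R))); split.
- exact: measurableU.
- apply: (null_setU m1 m2).
    exact: (sfprod_null1 surf mD measurableT D0).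
  exact: (sfprod_null2 (sfprod leb3 leb3) measurableT mS2C surfC0).
- move=> [[v w] s] /= /negP; rewrite /good/= negb_and negbK => /orP[/eqP ->|/eqP s1].
    by left; split => //; rewrite /g /A0/=; split => //=; rewrite subrr.
  by right.
Qed.

Lemma good_rel p : good p ->
  (Tc0 p).1.1 - (Tc0 p).1.2 = enorm (p.1.1 - p.1.2) *: p.2.
Proof.
move=> _; rewrite /Tc0/= /vpost /vpost_star; by apply: vel_ext => /=; rewrite /GRing.scale/=; field.
Qed.

Lemma enorm_rel p : good p -> enorm ((Tc0 p).1.1 - (Tc0 p).1.2) = enorm (p.1.1 - p.1.2).
Proof.
move=> gp; rewrite good_rel// enormZ ger0_norm ?enorm_ge0//.
by move/andP : gp => [_ /eqP ->]; rewrite mulr1.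
Qed.

Lemma good_Tc0 p : good p -> good (Tc0 p).
Proof.
move=> gp; rewrite /good; apply/andP; split.
  by rewrite -subr_eq0 -enorm_eq0 enorm_rel// enorm_eq0 subr_eq0; case/andP : gp.
by apply/eqP; apply: enorm_dir; rewrite subr_eq0; case/andP : gp.
Qed.

(** After one collision the relative velocity is |v - w| s. Its direction s is what the second
    application records, while centre of mass and relative speed are conserved and rebuild v and
    w. *)
Lemma Tc0K p : good p -> Tc0 (Tc0 p) = p.
Proof.
move=> gp; have er := enorm_rel gp; have gr := good_rel gp.
have r0 : 0 < enorm (p.1.1 - p.1.2) by rewrite enorm_gt0 subr_eq0; case/andP : gp.
have s1 : enorm p.2 = 1 by apply/eqP; case/andP : gp.
have sE : p.1.1 + p.1.2 = (Tc0 p).1.1 + (Tc0 p).1.2.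
  by apply: vel_ext => /=; rewrite /GRing.scale/=; field.
have d3 : dir ((Tc0 p).1.1 - (Tc0 p).1.2) = p.2.
  by rewrite gr dirZ// /dir s1 invr1 scale1r.
rewrite {1}/Tc0 d3 /vpost /vpost_star er -sE.
have -> : (Tc0 p).2 = dir (p.1.1 - p.1.2) by [].
have -> : (enorm (p.1.1 - p.1.2) / 2) *: dir (p.1.1 - p.1.2) = 2^-1 *: (p.1.1 - p.1.2) :> vel R.
  by rewrite mulrC -scalerA enormK.
move: gp; case: p {er gr r0 s1 sE d3} => -[v w] s /= _.
by congr (_, _, _); apply: vel_ext => /=; rewrite /GRing.scale/=; field.
Qed.

Lemma TcK p : Tc (Tc p) = p.
Proof.
rewrite /Tc; case: (boolP (good p)) => [gp|/negbTE ->//].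
by rewrite good_Tc0// Tc0K.
Qed.

Lemma good_Tc p : good (Tc p) = good p.
Proof. by rewrite /Tc; case: (boolP (good p)) => [/good_Tc0//|/negbTE]. Qed.

Lemma mp_Tc : mp Pi3 Pi3 Tc.
Proof.
have mT : measurable_fun setT Tc.
  apply: measurable_fun_ifT => //; first exact: mf_good.
  exact: mp_Tc0.1.
split; [exact: mT|move=> A mA]; apply: (etrans _ (mp_Tc0.2 A mA)).
apply: measure_ae_eq.
- by rewrite -[X in measurable X]setTI; exact: (mT measurableT A mA).
- by rewrite -[X in measurable X]setTI; exact: (mp_Tc0.1 measurableT A mA).
- by apply: filterS ae_good => p gp; rewrite /preimage/= /Tc gp.
Qed.

Lemma mp_Sw : mp Pi3 Pi3 Sw.
Proof.
have sopp : mp surf surf (fun s : vel R => - s : vel R).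
  apply: mp_surf; first exact: mp_leb3_opp.
  - by move=> c x; rewrite scalerN.
  - exact: enormN.
exact: (mp_prod (mp_swap _ _) sopp).
Qed.

Lemma mp_Fl : mp Pi3 Pi3 Fl.
Proof.
have sopp : mp surf surf (fun s : vel R => - s : vel R).
  apply: mp_surf; first exact: mp_leb3_opp.
  - by move=> c x; rewrite scalerN.
  - exact: enormN.
have h := mp_prod (mp_id (sfprod (@leb3 R) leb3)) sopp.
by apply: mp_ext h => -[[]].
Qed.

Lemma SwK p : Sw (Sw p) = p.
Proof. by case: p => -[v w] s; rewrite /Sw/= opprK. Qed.

Lemma good_Sw p : good (Sw p) = good p.
Proof. by rewrite /good/= enormN eq_sym. Qed.

Lemma energy_Tc p : enorm (Tc p).1.1 ^+ 2 + enorm (Tc p).1.2 ^+ 2 =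
  enorm p.1.1 ^+ 2 + enorm p.1.2 ^+ 2.
Proof.
rewrite /Tc; case: ifPn => // gp.
have sE : (Tc0 p).1.1 + (Tc0 p).1.2 = p.1.1 + p.1.2.
  by apply: vel_ext => /=; rewrite /GRing.scale/=; field.
have := enorm_rel gp; move/(congr1 (fun x => x ^+ 2)); rewrite !enorm_sqr.
move/(congr1 (fun x => dot x x)) : sE; move: (Tc0 p) => q.
rewrite !dotE (dotC q.1.2 q.1.1) (dotC p.1.2 p.1.1); lra.
Qed.

Lemma momentum_Tc p : (Tc p).1.1 + (Tc p).1.2 = p.1.1 + p.1.2.
Proof.
rewrite /Tc; case: ifPn => // gp.
by by apply: vel_ext => /=; rewrite /GRing.scale/=; field.
Qed.

Lemma enorm_rel_Tc p : enorm ((Tc p).1.1 - (Tc p).1.2) = enorm (p.1.1 - p.1.2).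
Proof. by rewrite /Tc; case: ifPn => // gp; exact: enorm_rel. Qed.

(** A collision exchanges s with the direction of v - w, and the deflection cosine is symmetric in
    these two unit vectors. *)
Lemma cosdev_Tc0 p : good p ->
  cosdev (Tc0 p).1.1 (Tc0 p).1.2 (Tc0 p).2 = cosdev p.1.1 p.1.2 p.2.
Proof.
move=> gp; rewrite /cosdev enorm_rel// good_rel// /dir dotZl dotZr.
have r0 : enorm (p.1.1 - p.1.2) != 0 by rewrite enorm_eq0 subr_eq0; case/andP : gp.
by rewrite [in RHS]dotC; field.
Qed.

Lemma cosdev_Sw p : cosdev (Sw p).1.1 (Sw p).1.2 (Sw p).2 = cosdev p.1.1 p.1.2 p.2.
Proof. by rewrite /cosdev/= enormB -opprB !dotE opprK. Qed.

Lemma cosdev_le1 p : good p -> -1 <= cosdev p.1.1 p.1.2 p.2 <= 1.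
Proof.
move=> gp; rewrite -ler_norml /cosdev normrM normfV (ger0_norm (enorm_ge0 _)).
have r0 : 0 < enorm (p.1.1 - p.1.2) by rewrite enorm_gt0 subr_eq0; case/andP : gp.
rewrite ler_pdivrMr// mul1r; apply: (le_trans (dot_le _ _)).
by case/andP : gp => _ /eqP ->; rewrite mul1r.
Qed.

End collision_map.

Section kernel.
Context {R : realType} {n : nat}.
Notation trip := (vel R * vel R * vel R)%type.
Variables (rho : 'I_n -> R) (B : 'I_n -> 'I_n -> R -> R -> R).
Hypotheses (hrho : forall i, 0 < rho i) (hB : collision_kernel B) (hS : kernel_sym B).
Implicit Types (i j : 'I_n) (p : trip).

(* Putting 0 off [good] turns integrals over R^3 x R^3 x S2 into integrals over
   the whole product, on which [Tc] acts. *)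
Definition kk i j p : R := if good p then kern B i j p.1.1 p.1.2 p.2 else 0.

Lemma kk_ge0 i j p : 0 <= kk i j p.
Proof.
rewrite /kk; case: ifPn => // gp; apply: (hB i j).2; last exact: cosdev_le1.
by rewrite enorm_gt0 subr_eq0; case/andP : gp.
Qed.

Lemma kk_Tc i j p : kk i j (Tc p) = kk i j p.
Proof.
rewrite /kk good_Tc; case: (boolP (good p)) => // gp.
by rewrite /Tc gp /kern enorm_rel// cosdev_Tc0.
Qed.

Lemma kk_Sw i j p : kk i j (Sw p) = kk j i p.
Proof.
rewrite /kk good_Sw; case: (boolP (good p)) => // gp.
rewrite /kern cosdev_Sw/= enormB hS//; last exact: cosdev_le1.
by rewrite enorm_gt0 subr_eq0; case/andP : gp.
Qed.

(** The kernel is assumed measurable only at positive distances and cosines in [-1, 1]. On [good]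
    its arguments lie in that set, and elsewhere [kk] is constant. *)
Lemma mf_kk i j : measurable_fun setT (kk i j).
Proof.
pose F (q : R * R) := B i j q.1 q.2.
pose g p := (enorm (p.1.1 - p.1.2), cosdev p.1.1 p.1.2 p.2).
have mg : measurable_fun setT (g : trip -> measurableTypeR R * measurableTypeR R).
  by rewrite /g /cosdev; mfv.
have -> : kk i j = (F \o g) \_ [set p | good p].
  by apply/funext => p; rewrite /kk patchE mem_setE.
apply/(measurable_restrictT _ measurable_good).
have mD : measurable (`]0, +oo[ `*` `[-1, 1] : set (measurableTypeR R * measurableTypeR R)).
  by apply: measurableX; exact: measurable_itv.
apply: (measurable_comp mD).
- move=> _ [p gp <-]; split => /=; rewrite in_itv/=; last exact: cosdev_le1.
  by rewrite enorm_gt0 subr_eq0 andbT; case/andP : gp.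
- exact: (hB i j).1.
- exact: measurable_funTS mg.
Qed.

End kernel.

(** * Square-integrable functions *)

Section square_integrable.
Context {R : realType} d (T : measurableType d) (m : {measure set T -> \bar R}).
Implicit Types (f g h : T -> R).

Definition sqi f : Prop :=
  measurable_fun setT f /\ (\int[m]_x ((f x) ^+ 2)%:E < +oo)%E.

Definition L2ip f g : R := \int[m]_x (f x * g x).

Lemma integrable_sqr f : sqi f -> m.-integrable setT (EFin \o (fun x => f x ^+ 2)).
Proof.
move=> [mf foo]; apply/integrableP; split; first by apply/measurable_EFinP; exact: measurable_funX.
by under eq_integral do rewrite /= ger0_norm ?sqr_ge0//.
Qed.

Lemma integrable_sqi f : measurable_fun setT f ->
  m.-integrable setT (EFin \o (fun x => f x ^+ 2)) -> sqi f.
Proof.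
move=> mf /integrableP[_ h]; split => //; move: h.
by under eq_integral do rewrite /= ger0_norm ?sqr_ge0//.
Qed.

Lemma integrable_le (f g : T -> R) : measurable_fun setT f ->
  m.-integrable setT (EFin \o g) -> (forall x, `|f x| <= g x) ->
  m.-integrable setT (EFin \o f).
Proof.
move=> mf ig fg; apply: (le_integrable measurableT _ _ ig).
  exact/measurable_EFinP.
move=> x _ /=; rewrite lee_fin; apply: (le_trans (fg x)); exact: ler_norm.
Qed.

Lemma integrableDR f g : m.-integrable setT (EFin \o f) ->
  m.-integrable setT (EFin \o g) -> m.-integrable setT (EFin \o (fun x => f x + g x)).
Proof. by move=> fi gi; exact: (integrableD measurableT fi gi). Qed.

Lemma integrableZR (c : R) f : m.-integrable setT (EFin \o f) ->
  m.-integrable setT (EFin \o (fun x => c * f x)).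
Proof. by move=> fi; exact: (integrableZl measurableT c fi). Qed.

Lemma sqi_mul f g : sqi f -> sqi g -> m.-integrable setT (EFin \o (fun x => f x * g x)).
Proof.
move=> sf sg.
have h := integrableDR (integrable_sqr sf) (integrable_sqr sg).
apply: (integrable_le _ h); first by apply: measurable_funM; [exact: sf.1|exact: sg.1].
move=> x; rewrite normrM.
have := sqr_ge0 (`|f x| - `|g x|); rewrite sqrrB !real_normK ?num_real//.
have := normr_ge0 (f x); have := normr_ge0 (g x); nra.
Qed.

Lemma sqi_le f g : measurable_fun setT f -> sqi g -> (forall x, `|f x| <= `|g x|) -> sqi f.
Proof.
move=> mf sg fg; apply: (integrable_sqi mf).
apply: (integrable_le _ (integrable_sqr sg)); first exact: measurable_funX.
by move=> x; rewrite ger0_norm ?sqr_ge0// -(real_normK (num_real (f x))) -(real_normK (num_real (g x))) lerXn2r ?nnegrE.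
Qed.

Lemma sqiD f g : sqi f -> sqi g -> sqi (fun x => f x + g x).
Proof.
move=> sf sg.
have mfg : measurable_fun setT (fun x => f x + g x) by apply: measurable_funD; [exact: sf.1|exact: sg.1].
apply: (integrable_sqi mfg).
have h := integrableZR 2 (integrableDR (integrable_sqr sf) (integrable_sqr sg)).
apply: (integrable_le _ h); first exact: measurable_funX.
move=> x; rewrite ger0_norm ?sqr_ge0//; have := sqr_ge0 (f x - g x); nra.
Qed.

Lemma sqiZ c f : sqi f -> sqi (fun x => c * f x).
Proof.
move=> sf; have mf : measurable_fun setT (fun x => c * f x) by apply: measurable_funM => //; exact: sf.1.
apply: (integrable_sqi mf).
have := integrableZR (c ^+ 2) (integrable_sqr sf).
by under eq_fun do rewrite -exprMn.
Qed.

Lemma sqiN f : sqi f -> sqi (fun x => - f x).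
Proof. by move=> /(sqiZ (-1)); under eq_fun do rewrite mulN1r. Qed.

Lemma sqiB f g : sqi f -> sqi g -> sqi (fun x => f x - g x).
Proof. by move=> sf sg; apply: sqiD => //; exact: sqiN. Qed.

Lemma sqi0 : sqi (fun=> 0).
Proof.
split; first exact: measurable_cst.
by under eq_integral do rewrite expr0n/=; rewrite integral0.
Qed.

Lemma sqi_sum (I : Type) (r : seq I) (F : I -> T -> R) :
  (forall i, sqi (F i)) -> sqi (fun x => \sum_(i <- r) F i x).
Proof.
move=> sF; elim: r => [|i r IH].
  by under eq_fun do rewrite big_nil; exact: sqi0.
by under eq_fun do rewrite big_cons; exact: sqiD.
Qed.

Lemma RintegralDR f g : m.-integrable setT (EFin \o f) -> m.-integrable setT (EFin \o g) ->
  \int[m]_x (f x + g x) = \int[m]_x f x + \int[m]_x g x.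
Proof. by move=> fi gi; exact: (RintegralD measurableT fi gi). Qed.

Lemma RintegralZR c f : m.-integrable setT (EFin \o f) ->
  \int[m]_x (c * f x) = c * \int[m]_x f x.
Proof. by move=> fi; exact: (RintegralZl _ measurableT fi). Qed.

Lemma L2ipC f g : L2ip f g = L2ip g f.
Proof. by rewrite /L2ip; under eq_Rintegral do rewrite mulrC. Qed.

Lemma L2ipDl f g h : sqi f -> sqi g -> sqi h ->
  L2ip (fun x => f x + g x) h = L2ip f h + L2ip g h.
Proof.
move=> sf sg sh; rewrite /L2ip -RintegralDR; [|exact: sqi_mul|exact: sqi_mul].
by under eq_Rintegral do rewrite mulrDl.
Qed.

Lemma L2ipZl c f g : sqi f -> sqi g -> L2ip (fun x => c * f x) g = c * L2ip f g.
Proof.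
move=> sf sg; rewrite /L2ip -RintegralZR; last exact: sqi_mul.
by under eq_Rintegral do rewrite -mulrA.
Qed.

Lemma L2ipNl f g : sqi f -> sqi g -> L2ip (fun x => - f x) g = - L2ip f g.
Proof.
move=> sf sg; rewrite -mulN1r -L2ipZl//.
by congr (L2ip _ _); apply/funext => x; rewrite mulN1r.
Qed.

Lemma L2ipBl f g h : sqi f -> sqi g -> sqi h ->
  L2ip (fun x => f x - g x) h = L2ip f h - L2ip g h.
Proof. by move=> sf sg sh; rewrite L2ipDl ?L2ipNl//; exact: sqiN. Qed.

Lemma L2ipDr f g h : sqi f -> sqi g -> sqi h ->
  L2ip h (fun x => f x + g x) = L2ip h f + L2ip h g.
Proof. by move=> sf sg sh; rewrite L2ipC L2ipDl// (L2ipC f) (L2ipC g). Qed.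

Lemma L2ipZr c f g : sqi f -> sqi g -> L2ip f (fun x => c * g x) = c * L2ip f g.
Proof. by move=> sf sg; rewrite L2ipC L2ipZl// L2ipC. Qed.

Lemma L2ipNr f g : sqi f -> sqi g -> L2ip f (fun x => - g x) = - L2ip f g.
Proof. by move=> sf sg; rewrite L2ipC L2ipNl// L2ipC. Qed.

Lemma L2ipBr f g h : sqi f -> sqi g -> sqi h ->
  L2ip h (fun x => f x - g x) = L2ip h f - L2ip h g.
Proof. by move=> sf sg sh; rewrite L2ipC L2ipBl// (L2ipC f) (L2ipC g). Qed.

Lemma L2ip_ge0 f : 0 <= L2ip f f.
Proof. by apply: Rintegral_ge0 => x _; rewrite -expr2 sqr_ge0. Qed.

Lemma L2ipE f : sqi f -> (L2ip f f)%:E = (\int[m]_x ((f x) ^+ 2)%:E)%E.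
Proof.
move=> sf; rewrite /L2ip /Rintegral fineK; last first.
  rewrite (_ : (\int[m]_x _)%E = (\int[m]_x ((f x) ^+ 2)%:E)%E)//.
  by rewrite ge0_fin_numE ?sf.2//; apply: integral_ge0 => x _; rewrite lee_fin sqr_ge0.
by [].
Qed.

Lemma L2ip_young (t : R) f g : 0 < t -> sqi f -> sqi g ->
  2 * `|L2ip f g| <= t * L2ip f f + t^-1 * L2ip g g.
Proof.
move=> t0 sf sg.
have h (s : R) : s ^+ 2 = 1 -> 2 * (s * L2ip f g) <= t * L2ip f f + t^-1 * L2ip g g.
  move=> s1; have sh : sqi (fun x => t * f x - s * g x) by apply: sqiB; apply: sqiZ.
  have := L2ip_ge0 (fun x => t * f x - s * g x).
  have stf := sqiZ t sf; have stg := sqiZ s sg.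
  rewrite L2ipBl// !L2ipBr// !L2ipZl// !L2ipZr// (L2ipC g f).
  have -> : t * (t * L2ip f f) - t * (s * L2ip f g) - (s * (t * L2ip f g) - s * (s * L2ip g g)) =
    t * (t * L2ip f f + t^-1 * (s ^+ 2 * L2ip g g) - 2 * (s * L2ip f g)).
    by field; rewrite gt_eqF.
  by rewrite s1 mul1r pmulr_rge0// subr_ge0.
have [p|p] := leP 0 (L2ip f g).
  by have := h 1 (expr1n _ _); rewrite mul1r (ger0_norm p).
have := h (-1); rewrite sqrrN expr1n mulN1r => /(_ erefl).
by rewrite (ltr0_norm p).
Qed.

Lemma L2ip_cs f g : sqi f -> sqi g -> L2ip f g ^+ 2 <= L2ip f f * L2ip g g.
Proof.
move=> sf sg.
have sh t : sqi (fun x => t * f x - g x) by apply: sqiB => //; apply: sqiZ.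
have h t : 0 <= t ^+ 2 * L2ip f f - 2 * t * L2ip f g + L2ip g g.
  have := L2ip_ge0 (fun x => t * f x - g x).
  have stf := sqiZ t sf.
  rewrite L2ipBl// !L2ipBr// !L2ipZl// !L2ipZr// (L2ipC g f); lra.
have a0 := L2ip_ge0 f; have b0 := L2ip_ge0 g.
move: (L2ip f f) (L2ip f g) (L2ip g g) h a0 b0 => a b c h a0 c0.
have [a_eq0|an0] := eqVneq a 0; first rewrite a_eq0.
  have [->|bn0] := eqVneq b 0; first by rewrite expr0n mul0r.
  (* When |f| = 0 the quadratic polynomial degenerates to c - 2 t b, and this t gives it the value
     -1. *)
  have := h ((c + 1) / (2 * b)); rewrite a_eq0 mulr0 sub0r.
  by rewrite (_ : - _ + c = -1) ?ler0N1//; field.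
have {}a0 : 0 < a by rewrite lt_neqAle eq_sym an0.
have := h (b / a); rewrite -(pmulr_rge0 _ a0).
have -> : a * ((b / a) ^+ 2 * a - 2 * (b / a) * b + c) = a * c - b ^+ 2 by field.
by rewrite subr_ge0.
Qed.

Lemma sqi_ae f g : measurable_fun setT g -> {ae m, forall x, f x = g x} -> sqi f -> sqi g.
Proof.
move=> mg fg [mf foo]; split => //.
rewrite (_ : (\int[m]_x _)%E = \int[m]_x ((f x) ^+ 2)%:E)%E//.
apply: ae_eq_integral => //.
- by apply/measurable_EFinP; exact: measurable_funX.
- by apply/measurable_EFinP; exact: measurable_funX.
- by apply: filterS fg => x /= -> _.
Qed.

Lemma L2ip_ae f g h : measurable_fun setT f -> measurable_fun setT g -> measurable_fun setT h ->
  {ae m, forall x, f x = g x} -> L2ip f h = L2ip g h.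
Proof.
move=> mf mg mh fg; rewrite /L2ip /Rintegral; congr fine; apply: ae_eq_integral => //.
- by apply/measurable_EFinP; exact: measurable_funM.
- by apply/measurable_EFinP; exact: measurable_funM.
- by apply: filterS fg => x /= -> _.
Qed.

Lemma L2ip_eq0 f : sqi f -> L2ip f f = 0 -> {ae m, forall x, f x = 0}.
Proof.
move=> sf f0.
have e : (\int[m]_x `|(f x ^+ 2)%:E| = 0)%E.
  under eq_integral do rewrite /= ger0_norm ?sqr_ge0//.
  by rewrite -L2ipE// f0.
have mf2 : measurable_fun setT (fun x => (f x ^+ 2)%:E).
  by apply/measurable_EFinP; apply: measurable_funX; exact: sf.1.
have := (ae_eq_integral_abs m measurableT mf2).1 e.
by apply: filterS => x /= /(_ I) [] /eqP; rewrite sqrf_eq0 => /eqP.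
Qed.

Lemma ae_L2ip0 f : measurable_fun setT f -> {ae m, forall x, f x = 0} -> L2ip f f = 0.
Proof.
move=> mf f0; rewrite (L2ip_ae (g := fun=> 0))//.
by rewrite /L2ip; under eq_Rintegral do rewrite mul0r; rewrite Rintegral_cst// mul0r.
Qed.

End square_integrable.

Section square_integrable_mp.
Context {R : realType} d1 d2 (X : measurableType d1) (Y : measurableType d2).
Variables (m1 : {measure set X -> \bar R}) (m2 : {measure set Y -> \bar R}).
Variables (T : X -> Y) (mpT : mp m1 m2 T).

Lemma sqi_mp f : sqi m2 f -> sqi m1 (fun x => f (T x)).
Proof.
move=> [mf foo]; split; first exact: measurableT_comp mf mpT.1.
rewrite (mp_ge0_integral mpT (f := fun y => (f y ^+ 2)%:E))//.
- by apply/measurable_EFinP; exact: measurable_funX.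
- by move=> y; rewrite lee_fin sqr_ge0.
Qed.

Lemma L2ip_mp f g : measurable_fun setT f -> measurable_fun setT g ->
  L2ip m1 (fun x => f (T x)) (fun x => g (T x)) = L2ip m2 f g.
Proof.
move=> mf mg; rewrite /L2ip (mp_Rintegral mpT (f := fun y => f y * g y))//.
exact: measurable_funM.
Qed.

End square_integrable_mp.

Section Lfun2.
Context {R : realType} d (T : measurableType d) (m : {measure set T -> \bar R}).

Lemma Lfun2P (f : T -> R) : (f \in Lfun m 2%:E) <-> sqi m f.
Proof.
split.
  move=> lf; apply: integrable_sqi; last exact: Lfun2_integrable_sqr.
  by move: lf; rewrite inE => /andP[+ _]; rewrite inE.
move=> [mf foo]; rewrite inE; apply/andP; split; first by rewrite inE.
rewrite inE/= /finite_norm unlock /Lnorm.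
apply: poweR_lty; apply: le_lt_trans foo.
apply: le_eq; apply: eq_integral => x _.
by rewrite /= powR_mulrn// real_normK ?num_real.
Qed.

End Lfun2.

(** * The collision form *)

Section integrals_over_S2.
Context {R : realType}.
Notation trip := (vel R * vel R * vel R)%type.

(** The integrand [F0], as written in a definition, may fail to be measurable off D. It is replaced
    by a measurable [F] equal to it on D, and [F] may then be altered on a null set. *)
Lemma ae_integral_cond d (T : measurableType d) (m : {measure set T -> \bar R})
    (D : set T) (F0 F G : T -> \bar R) : measurable D ->
  measurable_fun setT F -> measurable_fun setT G ->
  (forall x, D x -> F0 x = F x) -> {ae m, forall x, D x /\ F x = G x} ->
  (\int[m]_(x in D) F0 x = \int[m]_x G x)%E.
Proof.
move=> mD mF mG F0F FG.
rewrite (eq_integral F); last by move=> x; rewrite inE => /F0F.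
rewrite integral_mkcond; apply: ae_eq_integral => //.
  exact/(measurable_restrictT _ mD)/measurable_funTS.
by apply: filterS FG => x [Dx FGx] _; rewrite patchE mem_set.
Qed.

Lemma Pi3_fubini (F : trip -> R) : measurable_fun setT F -> (forall p, 0 <= F p) ->
  (\int[Pi3]_p (F p)%:E = \int[leb3]_v \int[sfprod leb3 surf]_q (F (v, q.1, q.2))%:E)%E.
Proof.
move=> mF F0.
have mp1 := mp_assocV (@leb3 R) (@leb3 R) (@surf R).
have mFE : measurable_fun setT (fun p => (F p)%:E) by exact/measurable_EFinP.
have F0E p : (0 <= (F p)%:E)%E by rewrite lee_fin.
apply: (etrans (esym (mp_ge0_integral mp1 mFE F0E))).
exact: (sf_fubini1R leb3 (sfprod leb3 surf) (measurableT_comp mF mp1.1) (fun p => F0 _)).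
Qed.

Lemma Pi3_integrable_assoc (F : trip -> R) : Pi3.-integrable setT (EFin \o F) ->
  (sfprod (@leb3 R) (sfprod leb3 surf)).-integrable setT (EFin \o (fun t => F (t.1, t.2.1, t.2.2))).
Proof.
by move=> iF; exact: (mp_integrable (mp_assocV (@leb3 R) (@leb3 R) (@surf R)) iF).
Qed.

Lemma Pi3_ae_integrable (F : trip -> R) : Pi3.-integrable setT (EFin \o F) ->
  {ae leb3, forall v, (sfprod leb3 surf).-integrable setT (EFin \o (fun q => F (v, q.1, q.2)))}.
Proof.
move=> /Pi3_integrable_assoc h.
exact: (ae_integrable1 (m1 := leb3) (m2 := sfprod leb3 surf) h).
Qed.

Lemma Pi3_fubini_F (F : trip -> R) : Pi3.-integrable setT (EFin \o F) ->
  leb3.-integrable setT (fun v => \int[sfprod leb3 surf]_q (F (v, q.1, q.2))%:E)%E.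
Proof.
move=> /Pi3_integrable_assoc h.
exact: (integrable_fubini_F (m1 := leb3) (m2 := sfprod leb3 surf) h).
Qed.

Lemma Pi3_fubini_int (F : trip -> R) : Pi3.-integrable setT (EFin \o F) ->
  (\int[Pi3]_p (F p)%:E = \int[leb3]_v \int[sfprod leb3 surf]_q (F (v, q.1, q.2))%:E)%E.
Proof.
move=> iF; have h := Pi3_integrable_assoc iF.
have mF : measurable_fun setT (EFin \o F) by case/integrableP : iF.
apply: (etrans (esym (mp_integral (mp_assocV (@leb3 R) (@leb3 R) (@surf R)) mF))).
exact: (esym (integral12_prod_meas1 (m1 := leb3) (m2 := sfprod leb3 surf) h)).
Qed.

Section kern_integrals.
Context {n : nat}.
Variables (B : 'I_n -> 'I_n -> R -> R -> R) (hB : collision_kernel B).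
Implicit Types (i j : 'I_n).

(** On the diagonal v = w the convention for the inverse of 0 makes the kernel read its value at (0,
    0), a constant. For unit s the function [kern] thus has a measurable expression, although
    nothing is assumed on B at distance 0. *)
Lemma kernE i j v w (s : vel R) : enorm s = 1 ->
  kern B i j v w s = kk B i j (v, w, s) + (v == w)%:R * B i j 0 0.
Proof.
move=> s1; rewrite /kk /good/= s1 eqxx andbT; have [->|vw] := eqVneq v w => /=.
  by rewrite add0r mul1r /kern /cosdev subrr enorm0 invr0 mulr0.
by rewrite mul0r addr0.
Qed.

Lemma mf_eqv d (T : measurableType d) (u : T -> vel R) : measurable_fun setT u ->
  measurable_fun setT (fun x => (u x == 0)%:R : R).
Proof.
move=> mu; have me : measurable_fun setT (fun x => enorm (u x)) by mfv.
have m1 : measurable [set x | u x == 0].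
  have -> : [set x | u x == 0] = (fun x => enorm (u x)) @^-1` [set 0].
    by apply/seteqP; split => x /=; rewrite -enorm_eq0; move/eqP.
  by rewrite -[X in measurable X]setTI; exact: (me measurableT _ (measurable_set1 0)).
have -> : (fun x => (u x == 0)%:R : R) = \1_[set x | u x == 0].
  by apply/funext => x; rewrite indicE mem_setE.
exact: measurable_indic.
Qed.

Lemma kern_integral2 i j v (X : vel R * vel R -> R) : measurable_fun setT X ->
  (\int[sfprod leb3 surf]_(q in setT `*` S2) (kern B i j v q.1 q.2 * X q)%:E =
   \int[sfprod leb3 surf]_q (kk B i j (v, q.1, q.2) * X q)%:E)%E.
Proof.
move=> mX; have mk := mf_kk hB i j.
have mk2 : measurable_fun setT (fun q : vel R * vel R => kk B i j (v, q.1, q.2)) by mfv.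
apply: (ae_integral_cond (F := fun q : vel R * vel R =>
  ((kk B i j (v, q.1, q.2) + (v - q.1 == 0)%:R * B i j 0 0) * X q)%:E)).
- by apply: measurableX => //; exact: measurable_S2.
- have me : measurable_fun setT (fun q : vel R * vel R => (v - q.1 == 0)%:R : R).
    by apply: mf_eqv; mfv.
  by mfv.
- by mfv.
- by move=> [w s] [_ /= s1]; rewrite kernE// subr_eq0.
- apply: filterS (ae_good2 v) => -[w s] /= /andP[/= vw /eqP s1]; split; first by split.
  by rewrite subr_eq0 (negbTE vw) mul0r addr0.
Qed.

Lemma kern_integral3 i j (X : trip -> R) : measurable_fun setT X ->
  (\int[Pi3]_(p in setT `*` S2) (kern B i j p.1.1 p.1.2 p.2 * X p)%:E =
   \int[Pi3]_p (kk B i j p * X p)%:E)%E.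
Proof.
move=> mX; have mk := mf_kk hB i j.
apply: (ae_integral_cond (F := fun p : trip =>
  ((kk B i j p + (p.1.1 - p.1.2 == 0)%:R * B i j 0 0) * X p)%:E)).
- by apply: measurableX => //; exact: measurable_S2.
- have me : measurable_fun setT (fun p : trip => (p.1.1 - p.1.2 == 0)%:R : R).
    by apply: mf_eqv; mfv.
  by mfv.
- by mfv.
- by move=> [[v w] s] [_ /= s1]; rewrite kernE// subr_eq0.
- apply: filterS (@ae_good R) => -[[v w] s] /= /andP[/= vw /eqP s1]; split; first by split.
  by rewrite subr_eq0 (negbTE vw) mul0r addr0.
Qed.

End kern_integrals.
End integrals_over_S2.

(** * Loss and gain terms, and the weak form *)

Section collision_forms.
Context {R : realType} {n : nat}.
Notation trip := (vel R * vel R * vel R)%type.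
Variables (rho : 'I_n -> R) (B : 'I_n -> 'I_n -> R -> R -> R).
Hypotheses (hrho : forall i, 0 < rho i) (hB : collision_kernel B) (hS : kernel_sym B).
Implicit Types (i j : 'I_n) (p : trip) (f g : 'I_n -> vel R -> R).

Lemma maxw_gt0 i v : 0 < maxw rho i v.
Proof. by rewrite /maxw !mulr_gt0 ?expR_gt0// powR_gt0// mulr_gt0// pi_gt0. Qed.

Definition smw i (v : vel R) : R := Num.sqrt (maxw rho i v).

Lemma smw_gt0 i v : 0 < smw i v.
Proof. by rewrite sqrtr_gt0 maxw_gt0. Qed.

Lemma smw_sqr i v : smw i v ^+ 2 = maxw rho i v.
Proof. by rewrite sqr_sqrtr// ltW// maxw_gt0. Qed.

Lemma mf_maxw i : measurable_fun setT (maxw rho i).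
Proof. by rewrite /maxw; mfv. Qed.

Lemma mf_smw i : measurable_fun setT (smw i).
Proof. by have := mf_maxw i => mM; rewrite /smw; mfv. Qed.

Lemma maxw_Tc i j p :
  maxw rho i (Tc p).1.1 * maxw rho j (Tc p).1.2 = maxw rho i p.1.1 * maxw rho j p.1.2.
Proof.
have := energy_Tc p; rewrite /maxw.
move: (enorm (Tc p).1.1) (enorm (Tc p).1.2) (enorm p.1.1) (enorm p.1.2) (_ `^ _) => a b c d k e.
transitivity (rho i * k * (rho j * k) * (expR (- (a ^+ 2 / 2)) * expR (- (b ^+ 2 / 2)))).
  by ring.
rewrite -expRD (_ : - (a ^+ 2 / 2) + _ = - (c ^+ 2 / 2) - (d ^+ 2 / 2)); last by lra.
by rewrite expRD; ring.
Qed.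

Lemma smw_Tc i j p :
  smw i (Tc p).1.1 * smw j (Tc p).1.2 = smw i p.1.1 * smw j p.1.2.
Proof.
have h k v : 0 <= maxw rho k v by exact/ltW/maxw_gt0.
exact: etrans (esym (sqrtrM _ (h _ _))) (etrans (congr1 Num.sqrt (maxw_Tc i j p)) (sqrtrM _ (h _ _))).
Qed.

Definition skk i j p : R := Num.sqrt (kk B i j p).

Lemma skk_sqr i j p : skk i j p ^+ 2 = kk B i j p.
Proof. by rewrite sqr_sqrtr//; exact: kk_ge0. Qed.

Lemma mf_skk i j : measurable_fun setT (skk i j).
Proof. by have mk := mf_kk hB i j; rewrite /skk; mfv. Qed.

(* [SS i j f] is (B_ij M_i M_j)^(1/2) (h_i' + h_j*' - h_i - h_j* ), since
   M_i M_j* is invariant under collisions. *)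
Definition U1 i j f p : R := skk i j p * (f i p.1.1 * smw j p.1.2).
Definition U2 i j f p : R := U1 j i f (Sw p).
Definition U3 i j f p : R := U1 i j f (Tc p).
Definition U4 i j f p : R := U2 i j f (Tc p).
Definition SS i j f p : R := U3 i j f p + U4 i j f p - U1 i j f p - U2 i j f p.

Lemma U2E i j f p : U2 i j f p = skk i j p * (f j p.1.2 * smw i p.1.1).
Proof. by rewrite /U2 /U1 /skk kk_Sw. Qed.

Lemma U3E i j f p : U3 i j f p = skk i j p * (f i (Tc p).1.1 * smw j (Tc p).1.2).
Proof. by rewrite /U3 /U1 /skk kk_Tc. Qed.

Lemma U4E i j f p : U4 i j f p = skk i j p * (f j (Tc p).1.2 * smw i (Tc p).1.1).
Proof. by rewrite /U4 U2E /skk kk_Tc. Qed.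

Lemma SSE i j f p : SS i j f p = skk i j p * (smw i p.1.1 * smw j p.1.2) *
  (hfun rho i (f i) (Tc p).1.1 + hfun rho j (f j) (Tc p).1.2
   - hfun rho i (f i) p.1.1 - hfun rho j (f j) p.1.2).
Proof.
have fE k v : f k v = hfun rho k (f k) v * smw k v.
  by rewrite /hfun divfK// gt_eqF// smw_gt0.
rewrite /SS U3E U4E U2E /U1 (fE i (Tc p).1.1) (fE j (Tc p).1.2) (fE i p.1.1) (fE j p.1.2).
have e := smw_Tc i j p.
rewrite mulrBr mulrBr mulrDr -{1}e -{1}e.
move: (hfun _ _ _ _) (hfun _ _ _ _) (hfun _ _ _ _) (hfun _ _ _ _) => h1 h2 h3 h4.
move: (smw i _) (smw j _) (smw i _) (smw j _) (skk _ _ _) => a b c d k.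
ring.
Qed.

(** Extended-valued collision frequency. The real integral [nu_ij] is 0 where this one diverges, so
    finiteness is stated on [nuE]. *)
Definition nuE i j v : \bar R :=
  (\int[sfprod leb3 surf]_q (kk B i j (v, q.1, q.2) * maxw rho j q.1)%:E)%E.

Lemma nuE_ge0 i j v : (0 <= nuE i j v)%E.
Proof.
apply: integral_ge0 => q _; rewrite lee_fin mulr_ge0//; first exact: kk_ge0.
by rewrite ltW// maxw_gt0.
Qed.

Lemma nu_ijE i j v : nu_ij rho B i j v = fine (nuE i j v).
Proof.
rewrite /nu_ij /Rintegral /nuE (kern_integral2 hB i j v)//.
have mM := mf_maxw j; mfv.
Qed.

Lemma mf_nuE i j : measurable_fun setT (nuE i j).
Proof.
have mk := mf_kk hB i j; have mM := mf_maxw j.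
apply: (measurable_fubini1R (sfprod leb3 surf)
  (f := fun t : vel R * (vel R * vel R) => kk B i j (t.1, t.2.1, t.2.2) * maxw rho j t.2.1)).
  by mfv.
by move=> t; rewrite mulr_ge0// ?kk_ge0// ltW// maxw_gt0.
Qed.

Lemma mf_nu_ij i j : measurable_fun setT (nu_ij rho B i j).
Proof.
rewrite (_ : nu_ij _ _ _ _ = fine \o nuE i j); last by apply/funext => v; exact: nu_ijE.
by apply: measurableT_comp => //; exact: mf_nuE.
Qed.

Lemma mf_nu i : measurable_fun setT (nu rho B i).
Proof. by apply: mf_sum => j; exact: mf_nu_ij. Qed.

Lemma nu_ij_ge0 i j v : 0 <= nu_ij rho B i j v.
Proof. by rewrite nu_ijE fine_ge0// nuE_ge0. Qed.

Lemma nu_ge0 i v : 0 <= nu rho B i v.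
Proof. by apply: sumr_ge0 => j _; exact: nu_ij_ge0. Qed.

Lemma nu_ij_le i j v : nu_ij rho B i j v <= nu rho B i v.
Proof.
rewrite /nu (bigD1 j)//= lerDl; apply: sumr_ge0 => k _; exact: nu_ij_ge0.
Qed.

Hypothesis nufin : forall i j v, (nuE i j v < +oo)%E.

Lemma nuEE i j v : nuE i j v = (nu_ij rho B i j v)%:E.
Proof. by rewrite nu_ijE fineK// ge0_fin_numE ?nuE_ge0. Qed.

Lemma mf_U1 i j f : measurable_fun setT (f i) -> measurable_fun setT (U1 i j f).
Proof. by move=> mfi; have mk := mf_skk i j; have ms := mf_smw j; rewrite /U1; mfv. Qed.

(** For fixed v, integrating B_ij M_j over w and s leaves exactly nu_ij(v). *)
Lemma U1_norm i j f : measurable_fun setT (f i) ->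
  (\int[Pi3]_p (U1 i j f p ^+ 2)%:E = \int[leb3]_v (f i v ^+ 2 * nu_ij rho B i j v)%:E)%E.
Proof.
move=> mfi; have mU := mf_U1 j mfi.
apply: (etrans (Pi3_fubini _ _)).
- by mfv.
- by move=> p; exact: sqr_ge0.
apply: eq_integral => v _.
have mk := mf_kk hB i j; have mM := mf_maxw j.
have mkM : measurable_fun setT (fun q : vel R * vel R => (kk B i j (v, q.1, q.2) * maxw rho j q.1)%:E) by mfv.
have kM0 q : (setT q -> 0 <= (kk B i j (v, q.1, q.2) * maxw rho j q.1)%:E)%E.
  by move=> _; rewrite lee_fin mulr_ge0// ?kk_ge0// ltW// maxw_gt0.
rewrite EFinM -nuEE /nuE -(ge0_integralZl_EFin _ measurableT kM0 mkM (sqr_ge0 (f i v))).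
apply: eq_integral => q _; rewrite -EFinM /U1/= exprMn exprMn skk_sqr smw_sqr; congr EFin; ring.
Qed.

(** The form domain. Membership in L^2 is not built in; it follows in [Hsp_sqi0] once nu is bounded
    below. *)
Definition Hsp f : Prop := forall i, measurable_fun setT (f i) /\
  (\int[leb3]_v (f i v ^+ 2 * nu rho B i v)%:E < +oo)%E.

Lemma sqi_U1 i j f : Hsp f -> sqi Pi3 (U1 i j f).
Proof.
move=> /(_ i)[mfi foo]; split; first exact: mf_U1.
apply: (le_lt_trans _ foo); rewrite U1_norm//.
have mnu := mf_nu i; have mnuij := mf_nu_ij i j.
apply: ge0_le_integral => //.
- by move=> v _; rewrite lee_fin mulr_ge0 ?sqr_ge0 ?nu_ij_ge0.
- by mfv.
- by mfv.
- by move=> v _; rewrite lee_fin ler_wpM2l ?sqr_ge0// nu_ij_le.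
Qed.

Lemma sqi_U2 i j f : Hsp f -> sqi Pi3 (U2 i j f).
Proof. by move=> hf; apply: (sqi_mp (@mp_Sw R)); exact: sqi_U1. Qed.

Lemma sqi_U3 i j f : Hsp f -> sqi Pi3 (U3 i j f).
Proof. by move=> hf; apply: (sqi_mp (@mp_Tc R)); exact: sqi_U1. Qed.

Lemma sqi_U4 i j f : Hsp f -> sqi Pi3 (U4 i j f).
Proof. by move=> hf; apply: (sqi_mp (@mp_Tc R)); exact: sqi_U2. Qed.

Lemma sqi_SS i j f : Hsp f -> sqi Pi3 (SS i j f).
Proof.
move=> hf; apply: sqiB; last exact: sqi_U2.
apply: sqiB; last exact: sqi_U1.
by apply: sqiD; [exact: sqi_U3|exact: sqi_U4].
Qed.

Lemma SS_Tc i j f p : SS i j f (Tc p) = - SS i j f p.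
Proof.
rewrite /SS /U3 /U4 !TcK.
by move: (U1 _ _ _ _) (U2 _ _ _ _) (U1 _ _ _ _) (U2 _ _ _ _) => a b c d; ring.
Qed.

Lemma Tc_Sw p : Tc (Sw p) = Sw (Tc p).
Proof.
rewrite /Tc good_Sw; case: ifPn => // gp; rewrite /Tc0 /Sw/=.
rewrite /vpost /vpost_star (enormB p.1.2) (addrC p.1.2) scalerN opprK.
by rewrite -[p.1.2 - p.1.1]opprB /dir enormN scalerN.
Qed.

Lemma SS_Sw i j f p : SS i j f (Sw p) = SS j i f p.
Proof.
rewrite /SS /U3 /U4 /U2 !Tc_Sw !SwK.
by move: (U1 _ _ _ _) (U1 _ _ _ _) (U1 _ _ _ _) (U1 _ _ _ _) => a b c d; ring.
Qed.

Definition bq f g : R := 4^-1 * \sum_i \sum_j L2ip Pi3 (SS i j f) (SS i j g).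

(** [SS] is odd under the collision map, so each gain term pairs with it as minus the corresponding
    loss term. The exchange of the two particles then moves the partner's loss term to the pair (j,
    i). *)
Lemma SS_weak i j f g : Hsp f -> Hsp g ->
  L2ip Pi3 (SS i j f) (SS i j g) =
    - 2 * L2ip Pi3 (U1 i j f) (SS i j g) - 2 * L2ip Pi3 (U1 j i f) (SS j i g).
Proof.
move=> hf hg.
have t1 : L2ip Pi3 (U3 i j f) (SS i j g) = - L2ip Pi3 (U1 i j f) (SS i j g).
  rewrite -[in RHS](L2ip_mp (@mp_Tc R)); [|exact: (sqi_U1 i j hf).1|exact: (sqi_SS i j hg).1].
  rewrite -L2ipNr; [|exact: sqi_U3|]; last first.
    by apply: (sqi_mp (@mp_Tc R)); exact: sqi_SS.
  by congr (L2ip _ _ _); apply/funext => p; rewrite SS_Tc opprK.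
have t2 : L2ip Pi3 (U4 i j f) (SS i j g) = - L2ip Pi3 (U2 i j f) (SS i j g).
  rewrite -[in RHS](L2ip_mp (@mp_Tc R)); [|exact: (sqi_U2 i j hf).1|exact: (sqi_SS i j hg).1].
  rewrite -L2ipNr; [|exact: sqi_U4|]; last first.
    by apply: (sqi_mp (@mp_Tc R)); exact: sqi_SS.
  by congr (L2ip _ _ _); apply/funext => p; rewrite SS_Tc opprK.
have t3 : L2ip Pi3 (U2 i j f) (SS i j g) = L2ip Pi3 (U1 j i f) (SS j i g).
  rewrite -[in RHS](L2ip_mp (@mp_Sw R)); [|exact: (sqi_U1 j i hf).1|exact: (sqi_SS j i hg).1].
  by congr (L2ip _ _ _); apply/funext => p; rewrite SS_Sw.
have s1 := sqi_U1 i j hf; have s2 := sqi_U2 i j hf.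
have s3 := sqi_U3 i j hf; have s4 := sqi_U4 i j hf; have ss := sqi_SS i j hg.
have s34 := sqiD s3 s4; have s341 := sqiB s34 s1.
have e (a b c d x y : R) : c = - a -> d = - b -> b = y -> x = a -> c + d - a - b = - 2 * x - 2 * y.
  by move=> -> -> -> ->; ring.
apply: etrans (e _ _ _ _ _ _ t1 t2 t3 erefl).
apply: etrans (L2ipBl s341 s2 ss) _; congr (_ - _).
by apply: etrans (L2ipBl s34 s1 ss) _; congr (_ - _); exact: (L2ipDl s3 s4 ss).
Qed.

(** After summation each ordered pair occurs twice with coefficient -2, which the factor 1/4 in [bq]
    turns into -1. *)
Lemma weak_form f g : Hsp f -> Hsp g ->
  \sum_i \sum_j L2ip Pi3 (U1 i j f) (SS i j g) = - bq f g.
Proof.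
move=> hf hg; have e i j := SS_weak i j hf hg.
rewrite /bq; under [in RHS]eq_bigr do under eq_bigr do rewrite e.
under [in RHS]eq_bigr do rewrite sumrB.
rewrite sumrB [X in _ - X]exchange_big/= -sumrB.
under [in RHS]eq_bigr do rewrite -sumrB.
under [in RHS]eq_bigr do under eq_bigr do rewrite -mulrBl.
under [in RHS]eq_bigr do rewrite -mulr_sumr.
rewrite -mulr_sumr; move: (\sum_i _) => X; by field.
Qed.

End collision_forms.

Section integral_sums.
Context {R : realType} d (T : measurableType d) (m : {measure set T -> \bar R}).

Lemma Rintegral_bigsum (I : Type) (r : seq I) (F : I -> T -> R) :
  (forall i, m.-integrable setT (EFin \o F i)) ->
  m.-integrable setT (EFin \o (fun x => \sum_(i <- r) F i x)) /\
  \int[m]_x (\sum_(i <- r) F i x) = \sum_(i <- r) \int[m]_x F i x.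
Proof.
move=> iF; elim: r => [|i r [IH1 IH2]].
  split; first by under eq_fun do rewrite big_nil; exact: integrable0.
  by under eq_Rintegral do rewrite big_nil; rewrite big_nil Rintegral_cst// mul0r.
split; first by under eq_fun do rewrite big_cons; exact: integrableDR.
by under eq_Rintegral do rewrite big_cons; rewrite big_cons RintegralDR// IH2.
Qed.

Lemma ae_eq_integrable (f g : T -> \bar R) : measurable_fun setT f ->
  {ae m, forall x, f x = g x} -> m.-integrable setT g -> m.-integrable setT f.
Proof.
move=> mf fg /integrableP[mg goo]; apply/integrableP; split => //.
rewrite (_ : (\int[m]_x _)%E = (\int[m]_x `|g x|)%E)//.
apply: ae_eq_integral => //; [exact: measurableT_comp|exact: measurableT_comp|].
by apply: filterS fg => x -> _.
Qed.

Lemma Rintegral_ae0 (h : T -> R) : measurable_fun setT h ->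
  {ae m, forall x, h x = 0} -> \int[m]_x h x = 0.
Proof.
move=> mh h0; rewrite /Rintegral.
have -> : (\int[m]_x (h x)%:E = \int[m]_x (cst 0 x))%E.
  apply: ae_eq_integral => //; first exact/measurable_EFinP.
  by apply: filterS h0 => x /= -> _.
by rewrite integral0.
Qed.

End integral_sums.

(** Integrability of F is not assumed: Tonelli applies to the positive and to the negative part, and
    the difference is measurable whatever values it takes. *)
Lemma measurable_fubini_int {R : realType} d1 d2 (X : measurableType d1)
    (Y : measurableType d2) (m2 : {sigma_finite_measure set Y -> \bar R}) (F : X * Y -> R) :
  measurable_fun setT F -> measurable_fun setT (fun x => \int[m2]_y F (x, y)).
Proof.
move=> mF; rewrite /Rintegral; apply: measurableT_comp => //.
have mF' : measurable_fun setT (EFin \o F) by exact/measurable_EFinP.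
under eq_fun do rewrite integralE.
apply: emeasurable_funB.
  under eq_fun => x do rewrite -[fun y => (F (x, y))%:E]/((EFin \o F) \o (pair x)) funepos_comp.
  exact: (measurable_fun_fubini_tonelli_F (m2 := m2) ((EFin \o F)^\+)%E
    (measurable_funepos mF') (fun p => funepos_ge0 _ p)).
under eq_fun => x do rewrite -[fun y => (F (x, y))%:E]/((EFin \o F) \o (pair x)) funeneg_comp.
exact: (measurable_fun_fubini_tonelli_F (m2 := m2) ((EFin \o F)^\-)%E
  (measurable_funeneg mF') (fun p => funeneg_ge0 _ p)).
Qed.

(** * The operator, its form and its null space *)

Section operator_form.
Context {R : realType} {n : nat}.
Notation trip := (vel R * vel R * vel R)%type.
Variables (rho : 'I_n -> R) (B : 'I_n -> 'I_n -> R -> R -> R).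
Hypotheses (hrho : forall i, 0 < rho i) (hB : collision_kernel B) (hS : kernel_sym B).
Hypothesis nufin : forall i j v, (nuE rho B i j v < +oo)%E.
Implicit Types (i j : 'I_n) (p : trip) (f g : 'I_n -> vel R -> R).

Notation SS := (SS rho B).
Notation U1 := (U1 rho B).

(** Integrand of [Lij]: what remains of [U1 f * SS g] when the factor f_i(v) is removed. *)
Definition VV i j f p : R := skk B i j p * smw rho j p.1.2 * SS i j f p.

Lemma mf_SS i j f : (forall k, measurable_fun setT (f k)) -> measurable_fun setT (SS i j f).
Proof.
move=> mf; have h k l : measurable_fun setT (U1 k l f) by exact: mf_U1.
have h1 k l : measurable_fun setT (U2 rho B k l f) := measurableT_comp (h l k) (@mp_Sw R).1.
have h2 k l : measurable_fun setT (U3 rho B k l f) := measurableT_comp (h k l) (@mp_Tc R).1.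
have h3 k l : measurable_fun setT (U4 rho B k l f) := measurableT_comp (h1 k l) (@mp_Tc R).1.
exact: (measurable_funB (measurable_funB (measurable_funD (h2 i j) (h3 i j)) (h i j)) (h1 i j)).
Qed.

Lemma mf_VV i j f : (forall k, measurable_fun setT (f k)) -> measurable_fun setT (VV i j f).
Proof.
move=> mf; have h := mf_SS i j mf; have mk := mf_skk hB i j; have ms := mf_smw rho j.
by rewrite /VV; mfv.
Qed.

Lemma mf_hfun i (u : vel R -> R) : measurable_fun setT u -> measurable_fun setT (hfun rho i u).
Proof. by move=> mu; have mM := mf_maxw rho i; rewrite /hfun; mfv. Qed.

Lemma LijE i j f v : (forall k, measurable_fun setT (f k)) ->
  Lij rho B i j (f i) (f j) v = \int[sfprod leb3 surf]_q VV i j f (v, q.1, q.2).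
Proof.
move=> mf; have mi := mf_hfun i (mf i); have mj := mf_hfun j (mf j).
pose X (q : vel R * vel R) : R := smw rho i v * maxw rho j q.1 *
  (hfun rho i (f i) (vpost v q.1 q.2) + hfun rho j (f j) (vpost_star v q.1 q.2)
      - hfun rho i (f i) v - hfun rho j (f j) q.1).
have mX : measurable_fun setT X.
  have gen (a b c d : vel R * vel R -> R) k : measurable_fun setT a -> measurable_fun setT b ->
    measurable_fun setT c -> measurable_fun setT d ->
    measurable_fun setT (fun q => k * a q * (b q + c q - hfun rho i (f i) v - d q)).
    move=> ma mb mc md; apply: measurable_funM (measurable_funM (measurable_cst _) ma) _.
    exact: measurable_funB (measurable_funB (measurable_funD mb mc) (measurable_cst _)) md.
  have m1 : measurable_fun setT (fun q : vel R * vel R => vpost v q.1 q.2 : vel R) by rewrite /vpost; mfv.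
  have m2 : measurable_fun setT (fun q : vel R * vel R => vpost_star v q.1 q.2 : vel R) by rewrite /vpost_star; mfv.
  exact: (gen _ _ _ _ _ (measurableT_comp (mf_maxw rho j) measurable_fst) (measurableT_comp mi m1)
    (measurableT_comp mj m2) (measurableT_comp mj measurable_fst)).
rewrite /Lij /Rintegral; congr fine.
transitivity (\int[sfprod leb3 surf]_(q in setT `*` S2) (kern B i j v q.1 q.2 * X q)%:E)%E.
  by apply: eq_integral => q _; rewrite /X !mulrA.
rewrite (kern_integral2 hB i j v mX); apply: eq_integral => -[w s] _; congr EFin.
rewrite /VV (SSE hrho hS).
rewrite /X; cbn [fst snd]; rewrite -(smw_sqr hrho).
rewrite -[kk B i j _](skk_sqr hB) /skk /kk; case: (boolP (good (v, w, s))) => gp; last first.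
  by rewrite sqrtr0 expr0n/= !mul0r.
rewrite /Tc gp /=.
move: (hfun _ _ _ _) (hfun _ _ _ _) (hfun _ _ _ _) (hfun _ _ _ _) => h1 h2 h3 h4.
by move: (Num.sqrt _) (smw _ _ _) (smw _ _ _) => a b c; ring.
Qed.

Lemma mf_Lij i j f : (forall k, measurable_fun setT (f k)) ->
  measurable_fun setT (Lij rho B i j (f i) (f j)).
Proof.
move=> mf; have mV := mf_VV i j mf.
have -> : Lij rho B i j (f i) (f j) = fun v => \int[sfprod leb3 surf]_q VV i j f (v, q.1, q.2).
  by apply/funext => v; exact: LijE.
apply: (measurable_fubini_int (sfprod leb3 surf)
  (F := fun t : vel R * (vel R * vel R) => VV i j f (t.1, t.2.1, t.2.2))).
by mfv.
Qed.

Lemma U1_VV i j f g p : U1 i j f p * SS i j g p = f i p.1.1 * VV i j g p.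
Proof. by rewrite /U1 /VV; ring. Qed.

Lemma Lij_pairing i j f g : Hsp rho B f -> Hsp rho B g ->
  leb3.-integrable setT (EFin \o (fun v => f i v * Lij rho B i j (g i) (g j) v)) /\
  \int[leb3]_v (f i v * Lij rho B i j (g i) (g j) v) = L2ip Pi3 (U1 i j f) (SS i j g).
Proof.
move=> hf hg.
have mf k := (hf k).1; have mg k := (hg k).1.
have iF : Pi3.-integrable setT (EFin \o (fun p => U1 i j f p * SS i j g p)).
  by apply: sqi_mul; [exact: sqi_U1|exact: sqi_SS].
have ae1 := Pi3_ae_integrable iF.
have ae2 : {ae leb3, forall v, (f i v * Lij rho B i j (g i) (g j) v)%:E =
    (\int[sfprod leb3 surf]_q (U1 i j f (v, q.1, q.2) * SS i j g (v, q.1, q.2))%:E)%E}.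
  apply: filterS ae1 => v iv; rewrite LijE//.
  (* Only the product with f_i(v) is known to be integrable on the fibre. Where f_i(v) is nonzero
     one divides by it; where it is 0 both sides vanish, whether or not [VV] is integrable. *)
  have [f0|f0] := eqVneq (f i v) 0.
    rewrite f0 mul0r; under eq_integral do rewrite U1_VV/= f0 mul0r.
    by rewrite integral0.
  have iV : (sfprod leb3 surf).-integrable setT (EFin \o (fun q => VV i j g (v, q.1, q.2))).
    have := integrableZR (f i v)^-1 iv.
    by under eq_fun do rewrite U1_VV/= mulrA mulVf// mul1r.
  have -> : (\int[sfprod leb3 surf]_q (U1 i j f (v, q.1, q.2) * SS i j g (v, q.1, q.2))%:E =
      (f i v)%:E * \int[sfprod leb3 surf]_q (VV i j g (v, q.1, q.2))%:E)%E.
    rewrite -(integralZl measurableT iV); apply: eq_integral => q _.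
    by rewrite U1_VV.
  rewrite /Rintegral EFinM fineK//.
  exact: (integrable_fin_num measurableT iV).
have mL := mf_Lij i j mg; have mfi := mf i.
have mfL : measurable_fun setT (fun v => (f i v * Lij rho B i j (g i) (g j) v)%:E) by mfv.
have iFF := Pi3_fubini_F iF.
split; first exact: (ae_eq_integrable mfL ae2 iFF).
rewrite /L2ip /Rintegral; congr fine.
rewrite (Pi3_fubini_int iF).
apply: (ae_eq_integral _ _ measurableT mfL); first by case/integrableP : iFF.
by apply: filterS ae2 => v + _.
Qed.

Lemma ip_Lop f g : Hsp rho B f -> Hsp rho B g -> ip f (Lop rho B g) = - bq rho B f g.
Proof.
move=> hf hg; rewrite -weak_form// /ip; apply: eq_bigr => i _.
have h j := Lij_pairing i j hf hg.
under eq_Rintegral do rewrite /Lop mulr_sumr.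
rewrite (Rintegral_bigsum _ (fun j => (h j).1)).2.
by apply: eq_bigr => j _; exact: (h j).2.
Qed.

Lemma ip_Lii i f g : Hsp rho B f -> Hsp rho B g ->
  \int[leb3]_v (f i v * Lmono rho B g i v) = - 4^-1 * L2ip Pi3 (SS i i f) (SS i i g).
Proof.
move=> hf hg; rewrite /Lmono (Lij_pairing i i hf hg).2 SS_weak//.
by move: (L2ip _ _ _) => x; field.
Qed.

Lemma domL_Hsp f : domL rho B f -> Hsp rho B f.
Proof.
move=> [hL hD] i; have [mf foo] := (Lfun2P _ _).1 (hL i); split => //.
have mn := mf_nu hrho hB i.
have hDi : (\int[leb3]_v (f i v ^+ 2 * nu rho B i v ^+ 2)%:E < +oo)%E.
  move: hD; rewrite (bigD1 i)//=; apply: le_lt_trans.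
  rewrite leeDl//; apply: sume_ge0 => k _; apply: integral_ge0 => v _.
  by rewrite lee_fin mulr_ge0 ?sqr_ge0.
(* The bound used is nu <= 1 + nu^2. *)
apply: (@le_lt_trans _ _ (\int[leb3]_v ((f i v ^+ 2)%:E + (f i v ^+ 2 * nu rho B i v ^+ 2)%:E))%E).
  apply: ge0_le_integral => //.
  - by move=> v _; rewrite lee_fin mulr_ge0 ?sqr_ge0// nu_ge0.
  - by mfv.
  - by apply: emeasurable_funD; mfv.
  - move=> v _; rewrite -EFinD lee_fin.
    have := nu_ge0 hrho hB i v; have := sqr_ge0 (f i v); move: (f i v ^+ 2) (nu _ _ _ _) => a b a0 b0.
    have := sqr_ge0 (b - 1); nra.
rewrite ge0_integralD//.
- exact: lte_add_pinfty.
- by move=> v _; rewrite lee_fin sqr_ge0.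
- by mfv.
- by move=> v _; rewrite lee_fin mulr_ge0 ?sqr_ge0.
- by mfv.
Qed.

Lemma ae_SS0_Lij i j f : Hsp rho B f -> L2ip Pi3 (SS i j f) (SS i j f) = 0 ->
  {ae leb3, forall v, Lij rho B i j (f i) (f j) v = 0}.
Proof.
move=> hf h0; have mf k := (hf k).1.
have mS := mf_SS i j mf; have ss : sqi Pi3 (SS i j f) by exact: sqi_SS.
have e : (\int[leb3]_v \int[sfprod leb3 surf]_q (SS i j f (v, q.1, q.2) ^+ 2)%:E = 0)%E.
  have mS2 : measurable_fun setT (fun p => SS i j f p ^+ 2) by mfv.
  rewrite -(Pi3_fubini mS2 (fun p => sqr_ge0 _)).
  by apply: (etrans (esym (L2ipE ss))); rewrite h0.
pose G v := (\int[sfprod leb3 surf]_q (SS i j f (v, q.1, q.2) ^+ 2)%:E)%E.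
have mG : measurable_fun setT G.
  apply: (measurable_fubini1R (sfprod leb3 surf)
    (f := fun t : vel R * (vel R * vel R) => SS i j f (t.1, t.2.1, t.2.2) ^+ 2)).
    by mfv.
  by move=> t; exact: sqr_ge0.
have G0 v : (0 <= G v)%E by apply: integral_ge0 => q _; rewrite lee_fin sqr_ge0.
have e' : (\int[leb3]_v `|G v| = 0)%E.
  by under eq_integral do rewrite gee0_abs//.
have := (ae_eq_integral_abs leb3 measurableT mG).1 e'.
apply: filterS => v /(_ I) Gv; rewrite LijE//.
have mi : measurable_fun setT (fun q : vel R * vel R => (v, q.1, q.2)) by mfv.
have mSv : measurable_fun setT (fun q : vel R * vel R => (SS i j f (v, q.1, q.2) ^+ 2)%:E).
  by apply/measurable_EFinP; exact: (measurable_funX 2 (measurableT_comp mS mi)).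
have e2 : (\int[sfprod leb3 surf]_q `|(SS i j f (v, q.1, q.2) ^+ 2)%:E| = 0)%E.
  by under eq_integral do rewrite gee0_abs ?lee_fin ?sqr_ge0//.
have h := (ae_eq_integral_abs (sfprod leb3 surf) measurableT mSv).1 e2.
apply: Rintegral_ae0; first exact: (measurableT_comp (mf_VV i j mf) mi).
apply: filterS h => q /= /(_ I)[] /eqP; rewrite sqrf_eq0 => /eqP h.
by rewrite /VV h mulr0.
Qed.

Lemma bq_eq0 f : Hsp rho B f -> bq rho B f f = 0 ->
  forall i j, L2ip Pi3 (SS i j f) (SS i j f) = 0.
Proof.
move=> hf /eqP; rewrite mulf_eq0 invr_eq0 pnatr_eq0/= psumr_eq0; last first.
  by move=> i _; apply: sumr_ge0 => j _; exact: L2ip_ge0.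
move=> /allP h i j; have /eqP := h i (mem_index_enum i).
move=> /eqP; rewrite psumr_eq0; last by move=> k _; exact: L2ip_ge0.
by move=> /allP /(_ j (mem_index_enum j)) /eqP.
Qed.

Lemma ae_forall_sum0 (F : 'I_n -> vel R -> R) :
  (forall j, {ae leb3, forall v, F j v = 0}) -> {ae leb3, forall v, \sum_j F j v = 0}.
Proof.
move=> h; have : {ae leb3, forall v j, F j v = 0}.
  by apply: filter_forall => j; exact: h.
by apply: filterS => v h'; apply: big1.
Qed.

(** One direction tests L f = 0 against f. Conversely a vanishing form makes every |S_ij f|^2
    vanish, and then each L_ij f is 0 almost everywhere on its own. *)
Lemma nullspace_LopP f : nullspace rho B (Lop rho B) f <-> domL rho B f /\ bq rho B f f = 0.
Proof.
split=> -[dL h]; have hf := domL_Hsp dL; split => //.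
  apply/eqP; rewrite -oppr_eq0; apply/eqP; rewrite -(ip_Lop hf hf) /ip.
  apply: big1 => i _.
  have mL : measurable_fun setT (Lop rho B f i).
    by apply: mf_sum => j; apply: mf_Lij => k; exact: (hf k).1.
  have mfi := (hf i).1.
  apply: Rintegral_ae0; first by mfv.
  by apply: filterS (h i) => v /= ->; rewrite mulr0.
by move=> i; apply: ae_forall_sum0 => j; apply: ae_SS0_Lij => //; exact: bq_eq0.
Qed.

Lemma nullspace_LmonoP f : nullspace rho B (Lmono rho B) f <->
  domL rho B f /\ forall i, L2ip Pi3 (SS i i f) (SS i i f) = 0.
Proof.
split=> -[dL h]; have hf := domL_Hsp dL; split => // i.
  have := ip_Lii i hf hf.
  have mL : measurable_fun setT (Lmono rho B f i) by apply: mf_Lij => k; exact: (hf k).1.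
  have mfi := (hf i).1.
  rewrite Rintegral_ae0; last 2 first.
  - by mfv.
  - by apply: filterS (h i) => v /= ->; rewrite mulr0.
  by move/esym/eqP; rewrite mulf_eq0 oppr_eq0 invr_eq0 pnatr_eq0/= => /eqP.
exact: ae_SS0_Lij.
Qed.

Lemma nullspace_Lop_sub f : nullspace rho B (Lop rho B) f -> nullspace rho B (Lmono rho B) f.
Proof.
move=> /nullspace_LopP[dL h]; apply/nullspace_LmonoP; split => // i.
by apply: bq_eq0 => //; exact: domL_Hsp.
Qed.

End operator_form.

(** * Coercive forms *)

Section coercive_form.
Context {R : realType} (E : lmodType R).
Variables (D : set E) (b0 b1 q : E -> E -> R).

(** Symmetric bilinear and nonnegative on D, but only semi-definite, because functions equal almost
    everywhere are not identified. *)
Definition semi_inner (b : E -> E -> R) : Prop :=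
  [/\ forall x y, D x -> D y -> b x y = b y x,
      forall x y z, D x -> D y -> D z -> b (x + y) z = b x z + b y z,
      forall c x y, D x -> D y -> b (c *: x) y = c * b x y
    & forall x, D x -> 0 <= b x x].

Hypotheses (D0 : D 0) (DD : forall x y, D x -> D y -> D (x + y))
  (DZ : forall c x, D x -> D (c *: x)).

Lemma DB x y : D x -> D y -> D (x - y).
Proof. by move=> Dx Dy; apply: DD => //; rewrite -scaleN1r; exact: DZ. Qed.

Section semi_inner_theory.
Variable b : E -> E -> R.
Hypothesis hb : semi_inner b.

Let bC x y : D x -> D y -> b x y = b y x. Proof. by case: hb => h _ _ _; exact: h. Qed.
Let bD x y z : D x -> D y -> D z -> b (x + y) z = b x z + b y z.
Proof. by case: hb => _ h _ _; exact: h. Qed.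
Let bZ c x y : D x -> D y -> b (c *: x) y = c * b x y.
Proof. by case: hb => _ _ h _; exact: h. Qed.
Let b_ge0 x : D x -> 0 <= b x x. Proof. by case: hb => _ _ _ h; exact: h. Qed.

Lemma semi_innerB x y z : D x -> D y -> D z -> b (x - y) z = b x z - b y z.
Proof.
move=> Dx Dy Dz; rewrite -[- y]scaleN1r bD ?bZ ?mulN1r//; exact: DZ.
Qed.

Lemma semi_innerDD x y : D x -> D y -> b (x + y) (x + y) = b x x + 2 * b x y + b y y.
Proof.
move=> Dx Dy; have Dxy := DD Dx Dy.
rewrite bD// (bC Dx Dxy) (bC Dy Dxy) !bD// (bC Dy Dx); ring.
Qed.

Lemma semi_innerZZ c x : D x -> b (c *: x) (c *: x) = c ^+ 2 * b x x.
Proof. by move=> Dx; have Dc := DZ c Dx; rewrite bZ// bC// bZ//; ring. Qed.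

Lemma semi_innerBB x y : D x -> D y -> b (x - y) (x - y) = b x x - 2 * b x y + b y y.
Proof.
move=> Dx Dy; have Dy' : D (- y) by rewrite -scaleN1r; exact: DZ.
rewrite semi_innerDD// -[- y]scaleN1r (bC Dx (DZ _ Dy)) bZ// (semi_innerZZ _ Dy) (bC Dy Dx).
ring.
Qed.

Lemma semi_innerBB_le x y : D x -> D y -> b (x - y) (x - y) <= 2 * b x x + 2 * b y y.
Proof.
move=> Dx Dy; rewrite semi_innerBB//.
by have := b_ge0 (DD Dx Dy); rewrite semi_innerDD//; lra.
Qed.

Lemma semi_inner_triangle x y z : D x -> D y -> D z ->
  b (x - z) (x - z) <= 2 * b (x - y) (x - y) + 2 * b (y - z) (y - z).
Proof.
move=> Dx Dy Dz; have -> : x - z = (x - y) - (z - y) by rewrite opprB addrA subrK.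
apply: (le_trans (semi_innerBB_le (DB Dx Dy) (DB Dz Dy))).
have -> // : b (z - y) (z - y) = b (y - z) (y - z).
by rewrite !semi_innerBB// (bC Dz Dy); ring.
Qed.

Lemma semi_inner_null x y : D x -> D y -> b x x = 0 -> b x y = 0.
Proof.
move=> Dx Dy x0; apply/eqP/negPn/negP => xy0.
(* As b x x = 0, the form at y + t x is affine in t; this t gives it the value -1. *)
have := b_ge0 (DD Dy (DZ (- (b y y + 1) / (2 * b x y)) Dx)).
rewrite semi_innerDD//; last exact: DZ.
rewrite semi_innerZZ// x0 mulr0 addr0 (bC Dy (DZ _ Dx)) bZ// => h.
have : b y y + 2 * (- (b y y + 1) / (2 * b x y) * b x y) = - 1 by field.
by move: h => /[swap] ->; rewrite ler0N1.
Qed.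

Lemma semi_inner_young t x y : 0 < t -> D x -> D y ->
  2 * b x y <= t * b x x + t^-1 * b y y.
Proof.
move=> t0 Dx Dy; have := b_ge0 (DB (DZ t Dx) Dy).
rewrite semi_innerBB//; last exact: DZ.
rewrite semi_innerZZ// bZ// => h.
rewrite -(ler_pM2l t0).
have -> : t * (t * b x x + t^-1 * b y y) = t ^+ 2 * b x x + b y y by field; rewrite gt_eqF.
lra.
Qed.

End semi_inner_theory.

Hypotheses (h0 : semi_inner b0) (h1 : semi_inner b1) (hq : semi_inner q).
Variables (c0 C2 C3 : R).
Hypotheses (c0_gt0 : 0 < c0) (C2_gt0 : 0 < C2) (C3_gt0 : 0 < C3).
Hypothesis b0_le : forall x, D x -> c0 * b0 x x <= b1 x x.
Hypothesis b1_le : forall x, D x -> b1 x x <= C2 * (q x x + b0 x x).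
Variables (m : nat) (l : 'I_m -> E -> R).
Hypothesis lB : forall k x y, D x -> D y -> l k (x - y) = l k x - l k y.
Hypothesis b1_compact : forall x, D x -> b1 x x <= C3 * (q x x + \sum_k (l k x) ^+ 2).
Hypothesis l_le : forall k x, D x -> (l k x) ^+ 2 <= C3 * b1 x x.
(** Closedness is asked only along sequences with geometric rates. Both constructions below can
    arrange them, and they are what makes an almost everywhere limit available later. *)
Hypothesis closed : forall (x : nat -> E), (forall j, D (x j)) ->
  (exists C, forall j, b1 (x j.+1 - x j) (x j.+1 - x j) <= C * (4^-1) ^+ j) ->
  (exists C, forall j, q (x j) (x j) <= C * (4^-1) ^+ j) ->
  exists y, [/\ D y, q y y = 0 &
    forall e, 0 < e -> exists J, forall j, (J <= j)%N -> b1 (x j - y) (x j - y) < e].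

Definition null : set E := [set x | D x /\ q x x = 0].

Lemma null_sub x y : null x -> null y -> null (x - y).
Proof.
move=> [Dx qx] [Dy qy]; split; first exact: DB.
rewrite (semi_innerBB hq)// qx qy (semi_inner_null hq Dx Dy qx); ring.
Qed.

Lemma nullZ c x : null x -> null (c *: x).
Proof. by move=> [Dx qx]; split; [exact: DZ|rewrite (semi_innerZZ hq)// qx mulr0]. Qed.

Lemma nullD x y : null x -> null y -> null (x + y).
Proof.
by move=> nx ny; rewrite -[y]opprK; apply: null_sub => //; rewrite -scaleN1r; exact: nullZ.
Qed.

(* Minimising sequence and parallelogram law: on the null space of [q] the two
   norms are equivalent, so closedness makes it complete. *)
Lemma null_projection x : D x -> exists2 p, null p & forall h, null h -> b0 (x - p) h = 0.
Proof.
move=> Dx.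
pose A := [set b0 (x - h) (x - h) | h in null].
have n0 : null 0.
  split => //; rewrite -(scale0r 0) (semi_innerZZ hq) ?expr0n ?mul0r//.
have A0 : A (b0 (x - 0) (x - 0)) by exists 0.
have lbA : has_lbound A.
  by exists 0 => _ [h [Dh _] <-]; case: h0 => _ _ _; apply; exact: DB.
have infA : has_inf A by split => //; exists (b0 (x - 0) (x - 0)).
pose d := inf A.
have dle h : null h -> d <= b0 (x - h) (x - h).
  by move=> nh; apply: ge_inf => //; exists h.
have ex j : exists h, null h /\ b0 (x - h) (x - h) < d + (4^-1) ^+ j.
  have e0 : (0 : R) < (4^-1) ^+ j by rewrite exprn_gt0.
  have [_ [h nh <-] hlt] := inf_adherent e0 infA.
  by exists h.
have [y yP] := choice ex.
have Dy j : D (y j) by case: (yP j) => -[].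
have half (u v : E) : null u -> null v ->
  b0 (u - v) (u - v) <= 2 * (b0 (x - u) (x - u) - d) + 2 * (b0 (x - v) (x - v) - d).
  move=> nu nv; have [Du _] := nu; have [Dv _] := nv.
  have nm : null (2^-1 *: (u + v)) by apply: nullZ; exact: nullD.
  have := dle _ nm; have [Dm _] := nm.
  have -> : x - 2^-1 *: (u + v) = 2^-1 *: ((x - u) + (x - v)).
    rewrite addrACA -opprD scalerBr; congr (_ - _).
    by rewrite scalerDr -scalerDl -[LHS]scale1r; congr (_ *: _); lra.
  have Dxu := DB Dx Du; have Dxv := DB Dx Dv.
  rewrite (semi_innerZZ h0)//; last exact: DD.
  rewrite (semi_innerDD h0 Dxu Dxv).
  have -> : u - v = (x - v) - (x - u) by rewrite opprB [RHS]addrC addrA subrK.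
  rewrite (semi_innerBB h0 Dxv Dxu).
  have [bC _ _ _] := h0; rewrite (bC _ _ Dxv Dxu) expr2.
  lra.
have [||z [Dz qz zP]] := closed Dy.
- exists (C2 * (2 + 2)) => j.
  have nyd : null (y j.+1 - y j) by apply: null_sub; [exact: (yP _).1|exact: (yP _).1].
  apply: (le_trans (b1_le nyd.1)); rewrite nyd.2 add0r -mulrA ler_pM2l//.
  apply: (le_trans (half _ _ (yP _).1 (yP _).1)).
  have h1' := (yP j.+1).2; have h2 := (yP j).2.
  have : (4^-1 : R) ^+ j.+1 <= (4^-1) ^+ j.
    by rewrite exprS ger_pMl ?exprn_gt0// invf_le1// ler1n.
  lra.
- exists 0 => j; by rewrite mul0r (yP j).1.2.
exists z => // h nh; have nz : null z by [].
have d0 : 0 <= d.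
  by apply: lb_le_inf; [exists (b0 (x - 0) (x - 0))|move=> _ [k [Dk _] <-]; case: h0 => _ _ _; apply; exact: DB].
have dz : b0 (x - z) (x - z) <= d.
  apply/ler_addgt0Pr => e e0.
  (* The vector x - z is split at y_j by Young's inequality. This t makes t |x - y_j|^2 at most e/3;
     the defect 4^-j of the minimising sequence and (1 + 1/t) |y_j - z|^2 take the other two
     thirds. *)
  pose t := e / (3 * (d + 1)).
  have dp : 0 < d + 1 by rewrite ltr_wpDl.
  have t0 : 0 < t by rewrite divr_gt0// mulr_gt0.
  pose e1 := c0 * (e / 3 / (1 + t^-1)).
  have tp : 0 < 1 + t^-1 by rewrite addr_gt0// invr_gt0.
  have e10 : 0 < e1 by rewrite !mulr_gt0// invr_gt0.
  have [J JP] := zP _ e10.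
  have [k kP] : exists k, (4^-1 : R) ^+ k <= e / 3.
    have e3 : 0 < e / 3 by rewrite divr_gt0.
    have /cvgrPdist_le /(_ _ e3) [k _ kP] : (fun k => (4^-1 : R) ^+ k) @ \oo --> (0 : R).
      by apply: cvg_expr; rewrite ger0_norm// invf_lt1// ltr1n.
    exists k; have := kP k (leqnn k); rewrite sub0r normrN; exact/le_trans/ler_norm.
  pose j := maxn J k.
  have bv := JP j (leq_maxl _ _).
  have bu := (yP j).2.
  have Dxy := DB Dx (Dy j); have Dyz := DB (Dy j) Dz.
  have -> : x - z = (x - y j) + (y j - z) by rewrite addrA subrK.
  rewrite (semi_innerDD h0)//.
  have yg := semi_inner_young h0 t0 Dxy Dyz.
  have b0v : (1 + t^-1) * b0 (y j - z) (y j - z) <= e / 3.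
    rewrite mulrC -ler_pdivlMr// -(ler_pM2l c0_gt0).
    by apply: (le_trans (b0_le Dyz)); exact: ltW.
  have k4 : (4^-1 : R) ^+ j <= e / 3.
    apply: le_trans kP; apply: ler_wiXn2l; rewrite ?invr_ge0// ?invf_le1// ?ler1n//.
    exact: leq_maxr.
  have k1 : (4^-1 : R) ^+ j <= 1.
    by apply: exprn_ile1; rewrite ?invr_ge0// invf_le1// ler1n.
  have tu : t * b0 (x - y j) (x - y j) <= e / 3.
    apply: (@le_trans _ _ (t * (d + 1))).
      rewrite ler_pM2l//; lra.
    by rewrite /t le_eqVlt; apply/orP; left; apply/eqP; field; rewrite gt_eqF.
  lra.
have Dh := nh.1; have Dxz := DB Dx Dz.
set w := b0 (x - z) h; apply/eqP/negPn/negP => w0.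
have [_ _ _ pos0] := h0.
have H0 := pos0 _ Dh.
(* Moving z by c h within the null space would go below the minimum. The added 1 allows [b0 h h] to
   be 0. *)
pose c := w / (b0 h h + 1).
have := dle (z + c *: h) (nullD (conj Dz qz) (nullZ c nh)).
rewrite opprD addrA (semi_innerBB h0)//; last exact: DZ.
rewrite (semi_innerZZ h0)//.
have [bC _ bZ _] := h0; rewrite (bC _ _ Dxz (DZ c Dh)) bZ// (bC _ _ Dh Dxz) -/w => hh.
have H1 : 0 < b0 h h + 1 by rewrite ltr_wpDl.
have : 2 * (c * w) <= c ^+ 2 * b0 h h by lra.
rewrite -(ler_pM2r (exprn_gt0 2 H1)).
have -> : 2 * (c * w) * (b0 h h + 1) ^+ 2 = 2 * w ^+ 2 * (b0 h h + 1).
  by rewrite /c; field; rewrite gt_eqF.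
have -> : c ^+ 2 * b0 h h * (b0 h h + 1) ^+ 2 = w ^+ 2 * b0 h h.
  by rewrite /c; field; rewrite gt_eqF.
have w2 : 0 < w ^+ 2 by rewrite exprn_even_gt0.
nra.
Qed.

(* A sequence violating the inequality is made Cauchy by extracting a
   convergent subsequence of the finitely many functionals [l k]; its limit is
   both in the null space and orthogonal to it. *)
Lemma coercive_gap : exists2 lam, 0 < lam & forall x p, D x -> null p ->
  (forall h, null h -> b0 (x - p) h = 0) -> lam * b1 (x - p) (x - p) <= q x x.
Proof.
apply: contrapT => nex.
have [_ _ _ pos0] := h0; have [b1C _ b1Z pos1] := h1; have [_ _ _ posq] := hq.
have ex (j : nat) : exists y, [/\ D y, b1 y y = 1, q y y <= (4^-1) ^+ j &
    forall h, null h -> b0 y h = 0].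
  (* If 4^-j is not a gap constant, a violating pair gives x - p, which is orthogonal to the null
     space and has the same q as x; normalised, it is the required vector. *)
  apply: contrapT => nexj; apply: nex; exists ((4^-1) ^+ j); first by rewrite exprn_gt0.
  move=> x p Dx np orth; rewrite leNgt; apply/negP => lt.
  have Dp := np.1; have Dxp := DB Dx Dp.
  have qE : q (x - p) (x - p) = q x x.
    have [qC _ _ _] := hq.
    have xp0 : q x p = 0 by rewrite (qC x p)//; exact: (semi_inner_null hq Dp Dx np.2).
    by rewrite (semi_innerBB hq)// np.2 xp0; ring.
  have b1p : 0 < b1 (x - p) (x - p).
    rewrite -(pmulr_rgt0 _ (exprn_gt0 j (_ : 0 < 4^-1))) ?invr_gt0//.
    by apply: le_lt_trans lt; exact: posq.
  pose s := (Num.sqrt (b1 (x - p) (x - p)))^-1.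
  have s2 : s ^+ 2 = (b1 (x - p) (x - p))^-1 by rewrite exprVn sqr_sqrtr// ltW.
  apply: nexj; exists (s *: (x - p)); split.
  - exact: DZ.
  - by rewrite (semi_innerZZ h1)// s2 mulVf// gt_eqF.
  - rewrite (semi_innerZZ hq)// s2 qE mulrC ler_pdivrMr//; exact: ltW.
  - by move=> h nh; have [_ _ b0Z _] := h0; rewrite b0Z ?orth ?mulr0//; exact: nh.1.
have [y yP] := choice ex.
(* The values of the functionals at the normalised vectors stay in a compact box of R^m. *)
pose u (j : nat) : 'rV[R]_m := \row_k l k (y j).
have ub j k : u j ord0 k \in `[- (C3 + 1), C3 + 1].
  rewrite in_itv/= -ler_norml mxE.
  have [Dyj byj _ _] := yP j; have := l_le k Dyj; rewrite byj mulr1 => lC.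
  rewrite -(@ler_pXn2r _ 2)// ?nnegrE ?normr_ge0 ?addr_ge0 ?(ltW C3_gt0)//.
  rewrite real_normK ?num_real//; nra.
have [p pP] : exists p : 'rV[R]_m, forall e N, 0 < e ->
    exists2 j, (N <= j)%N & forall i, `|p ord0 i - u j ord0 i| < e.
  have cpt : compact [set v : 'rV[R]_m | forall k, `[- (C3 + 1), C3 + 1]%classic (v ord0 k)].
    apply: (@rV_compact R m (fun _ => `[- (C3 + 1), C3 + 1]%classic)) => k.
    exact: segment_compact.
  have [] := cpt (u @ \oo) _ _; first by exists 0%N => // j _ k; exact: ub.
  move=> p [_ cp]; exists p => e N e0.
  have [] := cp [set x | exists2 j, (N <= j)%N & x = u j] (ball p e).
  - by exists N => // j /= Nj; exists j.
  - exact: nbhsx_ballx.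
  - by move=> x [[j Nj ->] xp]; exists j => // i; have [_ /(_ ord0 i)] := xp.
have ex2 (j : nat) : exists k, (j <= k)%N /\ forall i, (l i (y k) - p ord0 i) ^+ 2 <= (4^-1) ^+ j.
  have e0 : (0 : R) < 2^-1 ^+ j by rewrite exprn_gt0.
  have [k jk kP] := pP _ j e0.
  exists k; split => // i; have := kP i; rewrite mxE => lt.
  have -> : (4^-1 : R) ^+ j = (2^-1 ^+ j) ^+ 2 by rewrite exprAC; congr (_ ^+ _); field.
  rewrite -[leLHS]real_normK ?num_real// distrC ler_pXn2r// ?nnegrE ?(ltW e0)//.
  exact: ltW.
have [k kP] := choice ex2.
pose z j := y (k j).
have Dz j : D (z j) by case: (yP (k j)).
have qz j : q (z j) (z j) <= (4^-1) ^+ j.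
  have [_ _ h _] := yP (k j); apply: (le_trans h).
  by apply: ler_wiXn2l; rewrite ?invr_ge0// ?invf_le1// ?ler1n//; exact: (kP j).1.
have e4 j : (4^-1 : R) ^+ j.+1 <= (4^-1) ^+ j.
  by rewrite exprS ger_pMl ?exprn_gt0// invf_le1// ler1n.
have [||w [Dw qw wP]] := closed Dz.
- exists (C3 * (4 + m%:R * 4)) => j; have Dd := DB (Dz j.+1) (Dz j).
  apply: (le_trans (b1_compact Dd)); rewrite -mulrA ler_pM2l// mulrDl; apply: lerD.
    apply: (le_trans (semi_innerBB_le hq (Dz _) (Dz _))).
    have := qz j; have := qz j.+1; have := e4 j; lra.
  apply: (@le_trans _ _ (\sum_(i < m) 4 * (4^-1) ^+ j)); last first.
    by rewrite sumr_const card_ord -[leLHS]mulr_natl mulrA.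
  apply: ler_sum => i _; rewrite lB//.
  have := (kP j).2 i; have := (kP j.+1).2 i; have := e4 j; rewrite /z.
  move: (l i (y (k j))) (l i (y (k j.+1))) (p ord0 i) => a b c h1' h2 h3.
  have := sqr_ge0 ((b - c) + (a - c)); nra.
- by exists 1 => j; rewrite mul1r.
have b0w : b0 w w = 0.
  apply/eqP; rewrite eq_le pos0// andbT; apply/ler_addgt0Pr => e e0; rewrite add0r.
  have [J /(_ J (leqnn _)) JP] := wP (c0 * e) (mulr_gt0 c0_gt0 e0).
  have Dzw := DB (Dz J) Dw.
  have := b0_le Dzw; rewrite (semi_innerBB h0)//.
  have [_ _ _ orth] := yP (k J); rewrite (orth w (conj Dw qw)) mulr0 subr0.
  have := pos0 _ (Dz J) => zz h; rewrite -(ler_pM2l c0_gt0).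
  apply: le_trans (ltW JP); apply: le_trans h; rewrite ler_pM2l//; rewrite /z in zz; lra.
have b1w : b1 w w = 0.
  apply/eqP; rewrite eq_le pos1// andbT.
  by apply: (le_trans (b1_le Dw)); rewrite qw b0w addr0 mulr0.
(* The limit w has b1 w w = 0 while every z_j has norm 1, so the distance between them never falls
   below 1. *)
have [J /(_ J (leqnn _)) JP] := wP 2^-1 (ltac:(by rewrite invr_gt0)).
have b1zw : b1 (z J) w = 0 by rewrite b1C//; exact: (semi_inner_null h1 Dw (Dz J) b1w).
have := JP; rewrite (semi_innerBB h1)// b1zw b1w.
have [_ -> _ _] := yP (k J); rewrite mulr0 subr0 addr0.
by rewrite ltNge invf_le1// ler1n.
Qed.

End coercive_form.

(** * Finite-rank approximation *)

Lemma eq_lte {R : realType} (x y z : \bar R) : x = y -> (y < z)%E -> (x < z)%E.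
Proof. by move=> ->. Qed.

Section tensor.
Context {R : realType} d1 d2 (X : measurableType d1) (Y : measurableType d2).
Variables (m1 : {sigma_finite_measure set X -> \bar R}) (m2 : {sigma_finite_measure set Y -> \bar R}).

Lemma mf_tensor (F : X -> R) (G : Y -> R) : measurable_fun setT F -> measurable_fun setT G ->
  measurable_fun setT (fun p : X * Y => F p.1 * G p.2).
Proof.
move=> mF mG; apply: measurable_funM.
  exact: (measurableT_comp mF measurable_fst).
exact: (measurableT_comp mG measurable_snd).
Qed.

Lemma sqi_tensor (F : X -> R) (G : Y -> R) : sqi m1 F -> sqi m2 G ->
  sqi (sfprod m1 m2) (fun p => F p.1 * G p.2).
Proof.
move=> [mF iF] [mG iG]; have mT := mf_tensor mF mG; split => //.
have mT2 : measurable_fun setT (fun p : X * Y => (F p.1 * G p.2) ^+ 2) by mf.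
have h := sf_fubini1R m1 m2 mT2 (fun p => sqr_ge0 _).
apply: (eq_lte h).
have -> : (\int[m1]_x \int[m2]_y ((F x * G y) ^+ 2)%:E =
    \int[m1]_x ((F x ^+ 2)%:E * \int[m2]_y (G y ^+ 2)%:E))%E.
  apply: eq_integral => x _; under eq_integral do rewrite exprMn EFinM.
  by rewrite ge0_integralZl_EFin ?sqr_ge0//; [move=> y _; rewrite lee_fin sqr_ge0|apply/measurable_EFinP; mf].
rewrite ge0_integralZr//; last 3 first.
- by apply/measurable_EFinP; mf.
- by move=> x _; rewrite lee_fin sqr_ge0.
- by apply: integral_ge0 => y _; rewrite lee_fin sqr_ge0.
rewrite lte_mul_pinfty//; first by apply: integral_ge0 => y _; rewrite lee_fin sqr_ge0.
by rewrite ge0_fin_numE//; apply: integral_ge0 => y _; rewrite lee_fin sqr_ge0.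
Qed.

Lemma L2ip_tensor (F F' : X -> R) (G G' : Y -> R) : sqi m1 F -> sqi m1 F' ->
  sqi m2 G -> sqi m2 G' ->
  L2ip (sfprod m1 m2) (fun p => F p.1 * G p.2) (fun p => F' p.1 * G' p.2) =
  L2ip m1 F F' * L2ip m2 G G'.
Proof.
move=> sF sF' sG sG'; have iT := sqi_mul (sqi_tensor sF sG) (sqi_tensor sF' sG').
have iG := sqi_mul sG sG'; have iF := sqi_mul sF sF'.
have h := esym (integral12_prod_meas1 (m1 := m1) (m2 := m2) iT).
have Gfin : (\int[m2]_y (G y * G' y)%:E)%E = (L2ip m2 G G')%:E.
  by rewrite /L2ip /Rintegral fineK//; exact: integrable_fin_num iG.
have Ffin : (\int[m1]_x (F x * F' x)%:E)%E = (L2ip m1 F F')%:E.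
  by rewrite /L2ip /Rintegral fineK//; exact: integrable_fin_num iF.
rewrite {1}/L2ip /Rintegral; apply: (etrans (congr1 fine h)) => /=.
have -> : (\int[m1]_x \int[m2]_y (F x * G y * (F' x * G' y))%:E =
    \int[m1]_x ((L2ip m2 G G')%:E * (F x * F' x)%:E))%E.
  apply: eq_integral => x _.
  transitivity (\int[m2]_y ((F x * F' x)%:E * (G y * G' y)%:E))%E.
    by apply: eq_integral => y _; rewrite -EFinM mulrACA.
  by rewrite integralZl// Gfin muleC.
by rewrite integralZl// Ffin -EFinM/= mulrC.
Qed.

End tensor.

(** Multiplication by h >= 0 commutes with taking positive and negative parts, which extends the
    formula from nonnegative functions to real ones. *)
Lemma integral_density {R : realType} d (T : measurableType d)
    (mu m : {measure set T -> \bar R}) (h : T -> R) : (forall x, 0 <= h x) ->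
  (forall f : T -> \bar R, measurable_fun setT f -> (forall x, 0 <= f x)%E ->
     \int[mu]_x f x = \int[m]_x (f x * (h x)%:E))%E ->
  forall f : T -> R, measurable_fun setT f -> L2ip m f h = \int[mu]_x f x.
Proof.
move=> h0 H f mf; rewrite /L2ip /Rintegral; congr fine.
have mE : measurable_fun setT (EFin \o f) by exact/measurable_EFinP.
rewrite [LHS]integralE [RHS]integralE; congr (_ - _)%E.
- rewrite [RHS](H _ (measurable_funepos mE) (fun x => funepos_ge0 _ x)).
  apply: eq_integral => x _.
  by rewrite !funeposE/= EFinM maxe_pMl ?lee_fin// mul0e.
- rewrite [RHS](H _ (measurable_funeneg mE) (fun x => funeneg_ge0 _ x)).
  apply: eq_integral => x _.
  by rewrite !funenegE/= -mulNr EFinM maxe_pMl ?lee_fin// mul0e.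
Qed.

Section finite_rank.
Context {R : realType} d1 d2 (X : measurableType d1) (Y : measurableType d2).
Variables (m1 : {finite_measure set X -> \bar R}) (m2 : {finite_measure set Y -> \bar R}).

Let m12 : {sigma_finite_measure set (X * Y)%type -> \bar R} := sfprod m1 m2.

Let m12_fin : (m12 setT < +oo)%E.
Proof.
rewrite -setXTT; have -> : m12 (setT `*` setT) = (m1 setT * m2 setT)%E.
  exact: (@product_measure1E _ _ _ _ _ m1 m2).
by rewrite lte_mul_pinfty// ?fin_num_measure// -ge0_fin_numE// fin_num_measure.
Qed.

Lemma sqi_bounded d (T : measurableType d) (m : {measure set T -> \bar R}) (f : T -> R) (C : R) :
  (m setT < +oo)%E -> measurable_fun setT f -> (forall x, `|f x| <= C) -> sqi m f.
Proof.
move=> mT mf fC; split => //; apply: (@le_lt_trans _ _ (\int[m]_x (C ^+ 2)%:E)%E).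
  apply: ge0_le_integral => //.
  - by move=> x _; rewrite lee_fin sqr_ge0.
  - by apply/measurable_EFinP; mf.
  - by move=> x _; rewrite lee_fin -(real_normK (num_real (f x))) ler_pXn2r// ?nnegrE ?(le_trans _ (fC x)).
rewrite integral_cst// lte_mul_pinfty// ?lee_fin ?sqr_ge0//.
Qed.

Lemma sqi_indic d (T : measurableType d) (m : {measure set T -> \bar R}) (A : set T) :
  (m setT < +oo)%E -> measurable A -> sqi m (\1_A : T -> R).
Proof.
move=> mT mA; apply: (@sqi_bounded _ _ _ _ 1) => // x.
by rewrite indicE; case: (_ \in _); rewrite ?normr1 ?normr0.
Qed.

(** L^2 approximation by finite combinations of indicators of rectangles; read as integral kernels,
    these combinations have finite rank. *)
Definition fin_rank (h : (X * Y)%type -> R) : Prop := sqi m12 h /\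
  forall e, 0 < e -> exists N : nat, exists c : nat -> R, exists A : nat -> set X,
   exists B : nat -> set Y, [/\ forall k, measurable (A k), forall k, measurable (B k) &
     L2ip m12 (fun p => h p - \sum_(k < N) c k * (\1_(A k) p.1 * \1_(B k) p.2))
              (fun p => h p - \sum_(k < N) c k * (\1_(A k) p.1 * \1_(B k) p.2)) <= e].

Let sqi_rect (A : set X) (B : set Y) : measurable A -> measurable B ->
  sqi m12 (fun p => \1_A p.1 * \1_B p.2 : R).
Proof.
move=> mA mB; apply: (@sqi_bounded _ _ _ _ 1) => //.
  by apply: measurable_funM; [exact: (measurableT_comp (measurable_indic mA) measurable_fst)|
   exact: (measurableT_comp (measurable_indic mB) measurable_snd)].
move=> p; rewrite normrM !indicE.
by case: (_ \in _); case: (_ \in _); rewrite ?(normr1, normr0, mulr1, mul1r, mul0r, mulr0).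
Qed.

Let sqi_rects N (c : nat -> R) (A : nat -> set X) (B : nat -> set Y) :
  (forall k, measurable (A k)) -> (forall k, measurable (B k)) ->
  sqi m12 (fun p => \sum_(k < N) c k * (\1_(A k) p.1 * \1_(B k) p.2)).
Proof.
by move=> mA mB; apply: sqi_sum => k; apply: sqiZ; exact: sqi_rect.
Qed.

Let L2ip_le2 d (T : measurableType d) (m : {measure set T -> \bar R}) (f g h : T -> R) :
  sqi m f -> sqi m g -> (forall x, h x = f x + g x) ->
  L2ip m h h <= 2 * L2ip m f f + 2 * L2ip m g g.
Proof.
move=> sf sg hE; have -> : h = fun x => f x + g x by exact/funext.
rewrite L2ipDl ?L2ipDr//; try exact: sqiD.
by have := L2ip_young ltr01 sf sg; rewrite invr1 !mul1r => h2; have := ler_norm (L2ip m f g); rewrite (L2ipC m g f); lra.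
Qed.

Lemma fin_rank_close h : sqi m12 h ->
  (forall e, 0 < e -> exists2 g, fin_rank g &
     L2ip m12 (fun p => h p - g p) (fun p => h p - g p) <= e) -> fin_rank h.
Proof.
move=> sh hP; split => // e e0; have e4 : 0 < e / 4 by rewrite divr_gt0.
have [g [sg gP] hg] := hP _ e4.
have [N [c [A [B [mA mB le]]]]] := gP _ e4.
exists N, c, A, B; split => //.
have sS := sqi_rects N c mA mB.
apply: (le_trans (@L2ip_le2 _ _ _ _ _ _ (sqiB sh sg) (sqiB sg sS) _)); last lra.
by move=> p; rewrite addrA subrK.
Qed.

Lemma fin_rankD h g : fin_rank h -> fin_rank g -> fin_rank (fun p => h p + g p).
Proof.
move=> [sh hP] [sg gP]; split; first exact: sqiD.
move=> e e0; have e4 : 0 < e / 4 by rewrite divr_gt0.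
have [N [c [A [B [mA mB le1]]]]] := hP _ e4.
have [N' [c' [A' [B' [mA' mB' le2]]]]] := gP _ e4.
pose mix (T : Type) (a a' : nat -> T) k := if (k < N)%N then a k else a' (k - N)%N.
exists (N + N')%N, (mix _ c c'), (mix _ A A'), (mix _ B B'); split.
- by move=> k; rewrite /mix; case: ifP.
- by move=> k; rewrite /mix; case: ifP.
apply: (le_trans (@L2ip_le2 _ _ _ _ _ _ (sqiB sh (sqi_rects N c mA mB))
  (sqiB sg (sqi_rects N' c' mA' mB')) _)); last lra.
move=> p; rewrite big_split_ord/=.
have -> : \sum_(i < N) mix R c c' i * (\1_(mix _ A A' i) p.1 * \1_(mix _ B B' i) p.2) =
   \sum_(k < N) c k * (\1_(A k) p.1 * \1_(B k) p.2).
  by apply: eq_bigr => k _; rewrite /mix ltn_ord.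
have -> : \sum_(i < N') mix R c c' (N + i)%N *
    (\1_(mix _ A A' (N + i)%N) p.1 * \1_(mix _ B B' (N + i)%N) p.2) =
   \sum_(k < N') c' k * (\1_(A' k) p.1 * \1_(B' k) p.2).
  by apply: eq_bigr => k _; rewrite /mix ltnNge leq_addr/= addKn.
by rewrite opprD addrACA.
Qed.

Lemma fin_rankZ a h : fin_rank h -> fin_rank (fun p => a * h p).
Proof.
move=> [sh hP]; split; first exact: sqiZ.
move=> e e0; have a0 : 0 < a ^+ 2 + 1 by rewrite ltr_wpDl ?sqr_ge0.
have [N [c [A [B [mA mB le1]]]]] := hP _ (divr_gt0 e0 a0).
exists N, (fun k => a * c k), A, B; split => //.
have sd := sqiB sh (sqi_rects N c mA mB).
set d := (fun p => _) in sd.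
have -> : (fun p => a * h p - \sum_(k < N) a * c k * (\1_(A k) p.1 * \1_(B k) p.2)) =
    (fun p => a * d p).
  apply/funext => p; rewrite /d mulrBr mulr_sumr; congr (_ - _).
  by apply: eq_bigr => k _; rewrite -!mulrA.
rewrite L2ipZl ?L2ipZr//; last exact: sqiZ.
have := L2ip_ge0 m12 d; move: le1; rewrite ler_pdivlMr// -/d; nra.
Qed.

(** Monotone class argument. Rectangles are stable under intersection, and the property passes to
    proper differences and to increasing unions, the latter by continuity of the finite measure
    [m12]. *)
Lemma fin_rank_indic (Z : set (X * Y)%type) : measurable Z -> fin_rank (\1_Z).
Proof.
move=> mZ; move: (mZ); rewrite measurable_prod_measurableType => sZ.
pose C : set (set (X * Y)%type) := [set A `*` B | A in @measurable d1 X & B in @measurable d2 Y].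
have rect (A : set X) (B : set Y) : measurable A -> measurable B -> fin_rank (\1_(A `*` B)).
  move=> mA mB; have mAB := measurableX mA mB.
  split; first exact: sqi_indic.
  move=> e e0; exists 1%N, (fun=> 1), (fun=> A), (fun=> B); split => //.
  rewrite (_ : (fun p => _) = fun=> 0); first by rewrite /L2ip mul0r Rintegral_cst// mul0r ltW.
  apply/funext => p; rewrite big_ord1 mul1r !indicE in_setX.
  by case: (_ \in _); case: (_ \in _); rewrite /= ?(mulr1, mul1r, mul0r, mulr0) subrr.
suff [CI LS CG] : [/\ setI_closed C, lambda_system setT [set Z | measurable Z /\ fin_rank (\1_Z)] &
    C `<=` [set Z | measurable Z /\ fin_rank (\1_Z)]].
  by have [] := lambda_system_subset CI LS CG (fun _ _ => @subsetT _ _) sZ.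
split.
- move=> _ _ [X1 mX1 [X2 mX2 <-]] [Y1 mY1 [Y2 mY2 <-]].
  exists (X1 `&` Y1); first exact: measurableI.
  by exists (X2 `&` Y2); [exact: measurableI|rewrite setXI].
- split => //.
  + by split => //; rewrite -setXTT; exact: rect.
  + move=> A B BA [mA fA] [mB fB]; split; first exact: measurableD.
    have -> : \1_(A `\` B) = (fun p => \1_A p + (-1) * \1_B p) :> ((X * Y)%type -> R).
      apply/funext => p; rewrite !indicE in_setD mulN1r.
      case: (boolP (p \in B)) => pB; last by rewrite andbT subr0.
      by rewrite (mem_set (BA _ (set_mem pB))) subrr.
    by apply: fin_rankD => //; exact: fin_rankZ.
  + move=> F ndF FP; have mU : measurable (\bigcup_k F k).
      by apply: bigcup_measurable => k _; exact: (FP k).1.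
    split => //; apply: fin_rank_close; first exact: sqi_indic.
    move=> e e0.
    have cv : m12 (F k) @[k --> \oo] --> m12 (\bigcup_k F k).
      by apply: nondecreasing_cvg_mu => // k; exact: (FP k).1.
    have Ufin : m12 (\bigcup_k F k) \is a fin_num.
      by rewrite ge0_fin_numE//; apply: le_lt_trans m12_fin; apply: le_measure; rewrite ?inE.
    have [k kP] : exists k, `|fine (m12 (\bigcup_k F k)) - fine (m12 (F k))| <= e.
      have := cv; rewrite -(fineK Ufin) => /fine_cvgP[_ /cvgrPdist_le /(_ e e0)[k _]].
      by move=> /(_ k (leqnn _)) h; exists k.
    exists (\1_(F k)); first exact: (FP k).2.
    have -> : (fun p => \1_(\bigcup_k F k) p - \1_(F k) p) =
        \1_((\bigcup_k F k) `\` F k) :> ((X * Y)%type -> R).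
      apply/funext => p; rewrite !indicE in_setD.
      case: (boolP (p \in F k)) => pF; last by rewrite andbT subr0.
      have -> : p \in \bigcup_k F k by apply/mem_set; exists k => //; exact: set_mem.
      by rewrite subrr.
    have mD : measurable ((\bigcup_k F k) `\` F k) by apply: measurableD => //; exact: (FP k).1.
    rewrite -lee_fin L2ipE; last exact: sqi_indic.
    rewrite (eq_integral (fun p => (\1_((\bigcup_k F k) `\` F k) p)%:E)); last first.
      by move=> p _; rewrite indicE; case: (_ \in _); rewrite ?expr1n ?expr0n.
    rewrite integral_indic// setIT.
    have Fk : F k `<=` \bigcup_k F k by exact: bigcup_sup.
    rewrite measureD// ?setIidr//; [|exact: (FP k).1|by rewrite -ge0_fin_numE].
    have kf : m12 (F k) \is a fin_num.
      rewrite ge0_fin_numE//; apply: le_lt_trans m12_fin; apply: le_measure; rewrite ?inE//.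
      exact: (FP k).1.
    apply: (@le_trans _ _ ((fine (m12 (\bigcup_k F k)))%:E - (fine (m12 (F k)))%:E)%E).
      by rewrite !fineK.
    by rewrite -EFinB lee_fin; exact: le_trans (ler_norm _) kP.
- move=> _ [A mA [B mB <-]]; split; [exact: measurableX|exact: rect].
Qed.

Lemma fin_rank_bounded (h : (X * Y)%type -> R) (C : R) : measurable_fun setT h ->
  (forall p, 0 <= h p <= C) -> fin_rank h.
Proof.
move=> mh hC; have C0 : (X * Y)%type -> 0 <= C by move=> p; have /andP[] := hC p; exact: le_trans.
have sh : sqi m12 h.
  apply: (@sqi_bounded _ _ _ _ C) => // p.
  by have /andP[h0 hc] := hC p; rewrite ger0_norm.
apply: fin_rank_close => // e e0.
have [K [K0 KP]] : exists K : R, 0 < K /\ K^-1 ^+ 2 * fine (m12 setT) <= e.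
  pose V := fine (m12 setT); have V0 : 0 <= V by rewrite fine_ge0.
  (* Since K >= 1, V / K^2 <= V / K <= e. *)
  exists (1 + V / e); have K1 : 1 <= 1 + V / e by rewrite lerDl divr_ge0// ltW.
  have K0 : 0 < 1 + V / e by apply: lt_le_trans K1.
  split => //; rewrite exprVn mulrC -/V ler_pdivrMr ?exprn_gt0//.
  apply: (@le_trans _ _ (e * (1 + V / e))).
    by rewrite mulrDr mulr1 mulrCA divff ?gt_eqF// mulr1 lerDr ltW.
  by rewrite ler_pM2l// expr2 ler_peMl// ltW.
pose N := (Num.truncn (K * C)).+1.
(* Layer-cake sum over the sets where h >= (k + 1) / K. It equals the integer part of K h divided by
   K, hence is within 1/K of h. *)
pose g p : R := \sum_(k < N) K^-1 * \1_([set p | k.+1%:R / K <= h p]) p.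
have fg : fin_rank g.
  rewrite /g; elim: (N) => [|N' ih].
    under eq_fun do rewrite big_ord0.
    rewrite (_ : (fun=> 0) = fun p => 0 * \1_(set0) p); last by apply/funext => p; rewrite mul0r.
    apply: fin_rankZ; exact: fin_rank_indic.
  under eq_fun do rewrite big_ord_recr/=.
  apply: fin_rankD => //; apply: fin_rankZ; apply: fin_rank_indic.
  rewrite -[X in measurable X]setTI; apply: measurable_fun_le => //.
exists g => //.
have hg p : `|h p - g p| <= K^-1.
  have /andP[hp hc] := hC p.
  have Kh : 0 <= K * h p by rewrite mulr_ge0// ltW.
  have -> : g p = (Num.truncn (K * h p))%:R / K.
    have tN : (Num.truncn (K * h p) <= N)%N.
      by rewrite /N; apply: leqW; apply: le_truncn; rewrite ler_pM2l.
    rewrite /g -mulr_sumr mulrC; congr (_ / K).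
    rewrite (eq_bigr (fun k : 'I_N => (k < Num.truncn (K * h p))%N%:R)).
      rewrite -natr_sum; congr (_%:R).
      rewrite -[RHS](minn_idPr tN); elim: (N) => [|M ih]; first by rewrite big_ord0 min0n.
      rewrite big_ord_recr/= ih; case: (ltnP M (Num.truncn (K * h p))) => hM.
        by rewrite (minn_idPl hM) addn1.
      by rewrite (minn_idPr (leqW hM)) addn0.
    move=> k _; rewrite indicE; congr (_%:R); congr nat_of_bool.
    rewrite truncn_ge_nat//; apply/idP/idP.
      by move=> /set_mem/=; rewrite ler_pdivrMr// mulrC.
    by move=> kk; apply/mem_set => /=; rewrite ler_pdivrMr// mulrC.
  have /andP[t1 t2] := truncn_itv Kh.
  rewrite ger0_norm ?subr_ge0; last by rewrite ler_pdivrMr// [leRHS]mulrC.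
  rewrite lerBlDr -[X in _ <= X + _]mul1r -mulrDl ler_pdivlMr// mulrC ltW//.
  by rewrite -natr1 addrC in t2.
have mg : measurable_fun setT g by case: fg => -[].
have mhg : measurable_fun setT (fun p => h p - g p) by apply: measurable_funB.
have shg : sqi m12 (fun p => h p - g p) by apply: (@sqi_bounded _ _ _ _ K^-1).
rewrite -lee_fin L2ipE//.
apply: (@le_trans _ _ (\int[m12]_x (K^-1 ^+ 2)%:E)%E).
  apply: ge0_le_integral => //.
  - by move=> p _; rewrite lee_fin sqr_ge0.
  - by apply/measurable_EFinP; mf.
  - move=> p _; rewrite lee_fin -(real_normK (num_real (h p - g p))).
    by rewrite ler_pXn2r// nnegrE ?invr_ge0 ltW.
rewrite integral_cst//.
apply: (@le_trans _ _ ((K^-1 ^+ 2)%:E * (fine (m12 setT))%:E)%E); last by rewrite -EFinM lee_fin.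
by rewrite fineK ?ge0_fin_numE.
Qed.

(** Radon-Nikodym gives mu a density bounded by C, hence square integrable for a finite measure and
    approximable by rectangles. The remainder is estimated by Cauchy-Schwarz on the product, the
    rectangles by the finitely many functionals. *)
Lemma bounded_law_finite_rank (mu : {finite_measure set (X * Y)%type -> \bar R}) (C : R) :
  (forall A, measurable A -> mu A <= C%:E * m12 A)%E -> 0 <= C ->
  forall e, 0 < e -> exists N : nat, exists K : R, exists A : nat -> set X, exists B : nat -> set Y,
  [/\ 0 < K, forall k, measurable (A k), forall k, measurable (B k) &
  forall F G, sqi m1 F -> sqi m2 G ->
    `|\int[mu]_p (F p.1 * G p.2)| <= e * (L2ip m1 F F + L2ip m2 G G) +
       K * \sum_(k < N) (L2ip m1 F \1_(A k) ^+ 2 + L2ip m2 G \1_(B k) ^+ 2)].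
Proof.
move=> muC C0 e e0.
have dom : mu `<< m12.
  apply/null_content_dominatesP => A mA A0; apply/eqP; rewrite eq_le measure_ge0 andbT.
  by apply: (le_trans (muC A mA)); rewrite [X in (_ * X)%E]A0 mule0.
pose f := Radon_Nikodym_SigmaFinite.f mu m12.
have f0 := Radon_Nikodym_SigmaFinite.f_ge0 dom.
have ffin := Radon_Nikodym_SigmaFinite.f_fin_num dom.
have fint := Radon_Nikodym_SigmaFinite.f_integrable dom.
have fI := Radon_Nikodym_SigmaFinite.f_integral dom.
pose h p := fine (f p).
have fh p : f p = (h p)%:E by rewrite /h fineK.
have h0 p : 0 <= h p by rewrite fine_ge0.
have mh : measurable_fun setT h.
  by apply/measurable_EFinP; rewrite (_ : EFin \o h = f); [case/integrableP : fint|apply/funext => p; exact/esym/fh].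
(* On Z the integral of h - C is at most 0 because mu Z <= C m12 Z, while its integrand is positive;
   so Z is null. *)
pose Z := [set p | C < h p].
have mZ : measurable Z.
  rewrite (_ : Z = (fun p => C < h p) @^-1` [set true]); last by apply/seteqP; split.
  by rewrite -[X in measurable X]setTI; exact: measurable_fun_ltr.
have hC : {ae m12, forall p, h p <= C}.
  have mhC : measurable_fun Z (fun p => (h p - C)%:E).
    by apply/measurable_EFinP; apply: measurable_funTS; mf.
  have Zfin : m12 Z \is a fin_num.
    by rewrite ge0_fin_numE//; apply: le_lt_trans m12_fin; apply: le_measure; rewrite ?inE.
  have I0 : (\int[m12]_(p in Z) (h p - C)%:E = 0)%E.
    apply/eqP; rewrite eq_le; apply/andP; split; last first.
      by apply: integral_ge0 => p /= hp; rewrite lee_fin subr_ge0 ltW.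
    under eq_integral do rewrite EFinB -fh.
    rewrite integralB//; last 2 first.
    - exact: integrableS fint.
    - by apply/integrableP; split => //; rewrite /= integral_cst// lte_mul_pinfty// -?ge0_fin_numE.
    rewrite integral_cst//= -fI// sube_le0//; exact: muC.
  have /(ae_eq_integral_abs m12 mZ mhC) aeZ : (\int[m12]_(p in Z) `|(h p - C)%:E| = 0)%E.
    rewrite -[RHS]I0; apply: eq_integral => p /set_mem/= hp.
    by rewrite /= ger0_norm// subr_ge0 ltW.
  apply: filterS aeZ => p /= hz; rewrite leNgt; apply/negP => hp.
  by have [/eqP] := hz hp; rewrite subr_eq0 => /eqP hE; rewrite hE ltxx in hp.
pose h' p := Num.min (h p) C.
have mh' : measurable_fun setT h' by apply: measurable_minr.
have h'C p : 0 <= h' p <= C by rewrite /h' le_min h0 C0 ge_min lexx orbT.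
have h'0 p : 0 <= h' p by have /andP[] := h'C p.
have [sh' happ] := fin_rank_bounded mh' h'C.
have muE := integral_density h'0.
have {}muE : forall g : (X * Y)%type -> R, measurable_fun setT g -> L2ip m12 g h' = \int[mu]_x g x.
  apply: (integral_density h'0) => g mg g0.
  rewrite -(Radon_Nikodym_SigmaFinite.change_of_variables dom g0 measurableT mg).
  apply: ae_eq_integral => //.
  - by apply: emeasurable_funM => //; case/integrableP : fint.
  - by apply: emeasurable_funM => //; exact/measurable_EFinP.
  - apply: filterS hC => p hp _; rewrite -/f fh /h' min_l//.
(* The tolerance is e^2 because Cauchy-Schwarz bounds the square of the pairing. *)
have [N [c [A [B [mA mB le]]]]] := happ _ (exprn_gt0 2 e0).
pose K := 1 + \sum_(k < N) `|c k|.
have K0 : 0 < K by rewrite ltr_pwDl// sumr_ge0.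
exists N, K, A, B; split => // F G sF sG.
have sT := sqi_tensor sF sG.
rewrite -muE; last exact: sT.1.
have sS := sqi_rects N c mA mB.
set S := (fun p => \sum_(k < N) _) in sS.
pose d p := h' p - S p; have sd : sqi m12 d := sqiB sh' sS.
have -> : h' = fun p => d p + S p by apply/funext => p; rewrite /d subrK.
rewrite L2ipDr//; apply: (le_trans (ler_normD _ _)); apply: lerD.
- have a0 := L2ip_ge0 m1 F; have b0 := L2ip_ge0 m2 G.
  have hh : 0 <= e * (L2ip m1 F F + L2ip m2 G G) by rewrite mulr_ge0 ?addr_ge0// ltW.
  rewrite -(@ler_pXn2r _ 2)// ?nnegrE// real_normK ?num_real//.
  apply: (le_trans (L2ip_cs sT sd)).
  apply: (@le_trans _ _ (L2ip m1 F F * L2ip m2 G G * e ^+ 2)).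
    rewrite L2ip_tensor//; apply: ler_wpM2l; [exact: mulr_ge0|exact: le].
  rewrite exprMn [leRHS]mulrC; apply: ler_wpM2r; first exact: sqr_ge0.
  nra.
- have SE : L2ip m12 (fun p => F p.1 * G p.2) S =
      \sum_(k < N) c k * (L2ip m1 F \1_(A k) * L2ip m2 G \1_(B k)).
    rewrite /L2ip; under eq_Rintegral do rewrite mulr_sumr.
    have [|_ ->] := @Rintegral_bigsum R _ _ m12 _ (index_enum 'I_N)
      (fun k p => F p.1 * G p.2 * (c k * (\1_(A k) p.1 * \1_(B k) p.2))).
      by move=> k; apply: (sqi_mul sT); apply: sqiZ; exact: sqi_rect.
    apply: eq_bigr => k _.
    have sA : sqi m1 (\1_(A k)) by apply: sqi_indic => //; rewrite -ge0_fin_numE// fin_num_measure.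
    have sB : sqi m2 (\1_(B k)) by apply: sqi_indic => //; rewrite -ge0_fin_numE// fin_num_measure.
    rewrite -(L2ip_tensor sF sA sG sB).
    by rewrite -[LHS]/(L2ip m12 _ _) L2ipZr//; exact: sqi_rect.
  rewrite SE; apply: (le_trans (ler_norm_sum _ _ _)).
  rewrite mulr_sumr; apply: ler_sum => k _; rewrite !normrM.
  have ck : `|c k| <= K.
    rewrite /K (bigD1 k)//= addrCA lerDl addr_ge0// sumr_ge0//.
  apply: ler_pM => //.
  rewrite -(real_normK (num_real (L2ip m1 F _))) -(real_normK (num_real (L2ip m2 G _))).
  move: `|_| (normr_ge0 (L2ip m1 F \1_(A k))) `|_| (normr_ge0 (L2ip m2 G \1_(B k))) => x x0 y y0.
  nra.
Qed.

End finite_rank.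

(** * Law of the post-collisional velocity *)

Section expanding.
Context {R : realType}.
Local Notation mR := (measurableTypeR R).
Local Notation leb := (@lebesgue_measure R).

(** Two points of J whose images lie in an interval of length l are at distance at most l / c, so
    the preimage lies in an interval of length 2 l / c centred at any of its points. Taking the
    infimum over interval covers of A concludes, with no differentiability of phi. *)
Lemma leb_expanding (J A : set mR) (phi : mR -> mR) (c : R) : measurable J -> measurable A ->
  measurable_fun setT phi -> 0 < c ->
  (forall x y, J x -> J y -> c * `|x - y| <= `|phi x - phi y|) ->
  (leb (J `&` phi @^-1` A) <= (2 / c)%:E * leb A)%E.
Proof.
move=> mJ mA mphi c0 phic.
have k0 : 0 < 2 / c by rewrite divr_gt0.
have mpre B : measurable B -> measurable (J `&` phi @^-1` B).
  by move=> mB; apply: measurableI => //; rewrite -[X in measurable X]setTI; exact: mphi.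
have itv (a b : R) : a < b -> (leb (J `&` phi @^-1` `]a, b]%classic) <= (2 / c * (b - a))%:E)%E.
  move=> ab; have [->|/set0P[x0 [Jx0 /= px0]]] := eqVneq (J `&` phi @^-1` `]a, b]%classic) set0.
    by rewrite measure0 lee_fin mulr_ge0// ?(ltW k0)// subr_ge0 ltW.
  pose L := (b - a) / c; have L0 : 0 <= L by rewrite divr_ge0// ?subr_ge0 ltW.
  apply: (@le_trans _ _ (leb `[x0 - L, x0 + L]%classic)).
    apply: le_measure; rewrite ?inE//; first exact: mpre.
    move=> x [Jx /= px]; rewrite in_itv/= -ler_distl /L ler_pdivlMr// mulrC.
    apply: (le_trans (phic _ _ Jx Jx0)); move: px px0; rewrite !in_itv/= ler_norml.
    by move=> /andP[? ?] /andP[? ?]; apply/andP; split; lra.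
  rewrite lebesgue_measure_itv/= lte_fin; case: ifP => _; last by rewrite lee_fin mulr_ge0// ?(ltW k0)// subr_ge0 ltW.
  by rewrite -EFinD lee_fin /L le_eqVlt; apply/orP; left; apply/eqP; field; rewrite gt_eqF.
rewrite muleC -lee_pdivrMr// muleC.
have -> : leb A = mu_ext (wlength idfun) A by [].
apply: le_ereal_inf_tmp => _ [F [mF AF] <-].
rewrite lee_pdivrMl//.
apply: (@le_trans _ _ (leb (\bigcup_k (J `&` phi @^-1` (F k))))).
  apply: le_measure; rewrite ?inE//; first exact: mpre.
    by apply: bigcup_measurable => k _; apply: mpre; have [[a b] _ <-] := mF k; exact: measurable_itv.
  by move=> x [Jx Ax]; have [k _ Fk] := AF _ Ax; exists k.
have mFk k : measurable (J `&` phi @^-1` (F k)).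
  by apply: mpre; have [[a b] _ <-] := mF k; exact: measurable_itv.
apply: (le_trans (measure_sigma_subadditive leb mFk (bigcup_measurable (fun k _ => mFk k)) (@subset_refl _ _))).
rewrite -nneseriesZl; last first.
  by move=> k _; have [[a b] _ <-] := mF k; exact: wlength_itv_ge0.
apply: lee_nneseries => // k _; have [[a b] _ <-] /= := mF k.
have [ab|ba] := ltP a b.
  by rewrite (wlength_itv_bnd idfun _ _ (ltW ab)) -EFinM; exact: itv.
by rewrite set_itv_ge ?bnd_simp -?leNgt// preimage_set0 setI0 measure0 wlength0 mule0.
Qed.

End expanding.

Section collision_law.
Context {R : realType}.
Local Notation mR := (measurableTypeR R).
Local Notation leb := (@lebesgue_measure R).

Lemma sfprod_xsection d1 d2 (X : measurableType d1) (Y : measurableType d2)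
    (m1 : {sigma_finite_measure set X -> \bar R})
    (m2 : {sigma_finite_measure set Y -> \bar R}) (A : set (X * Y)) :
  sfprod m1 m2 A = (\int[m1]_x m2 (xsection A x))%E.
Proof. by []. Qed.

(* The map (u, s) |-> (|u| s + u) / 2 is the displacement v' - v when u = w - v.
   Along the lines parallel to s it is monotone, and its derivative there is
   |Y|^2 / |u|^2. *)
Definition Ydisp (u s : vel R) : vel R := 2^-1 *: (enorm u *: s + u).

Lemma mf_Ydisp : measurable_fun setT (fun q : vel R * vel R => Ydisp q.1 q.2).
Proof. by rewrite /Ydisp; mfv. Qed.

(** With a = s_1 / s_3 and b = s_2 / s_3 the vertical lines become lines parallel to s, and Lebesgue
    measure is preserved. *)
Definition line_shear (a b : R) (x : vel R) : vel R := (x.1.1 + x.2 * a, x.1.2 + x.2 * b, x.2).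

Lemma mp_line_shear a b : mp leb3 leb3 (line_shear a b).
Proof.
have h := @mp_skew R _ _ _ _ _ _ leb (sfprod leb leb) (sfprod leb leb)
  (fun (h : mR) (p : mR * mR) => (p.1 + h * a, p.2 + h * b) : mR * mR).
have {}h : mp (sfprod leb (sfprod leb leb)) (sfprod leb (sfprod leb leb))
    (fun p : mR * (mR * mR) => (p.1, (p.2.1 + p.1 * a : mR, p.2.2 + p.1 * b : mR))).
  apply: h; first by mf.
  by move=> x; exact: (mp_prod (mp_leb_add (x * a)) (mp_leb_add (x * b))).
exact: (mp_comp (mp_comp (mp_swap _ _) h) (mp_swap _ _)).
Qed.

(** On the line z = z' + k s, k >= 0, the quantity h + s_3 |z| changes by s_3 (k + |z| - |z'|). By
    Cauchy-Schwarz |z| - |z'| >= k (z'.s) / |z'|, and |Y|^2 = |z'| (|z'| + z'.s) / 2 at z', so k +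
    |z| - |z'| >= 2 k |Y|^2 / |z'|^2 >= 2 k m^-4. *)
Let line_expand (s : vel R) (a b x1 x2 m h h' : R) : enorm s = 1 -> s.2 != 0 ->
  a = s.1.1 / s.2 -> b = s.1.2 / s.2 -> 0 < m ->
  let z := line_shear a b (x1, x2, h) in let z' := line_shear a b (x1, x2, h') in
  0 <= (h - h') / s.2 -> enorm z' <= m -> m^-1 <= enorm (Ydisp z' s) ->
  m ^- 4 * `|h - h'| <= `|(h + s.2 * enorm z) / 2 - (h' + s.2 * enorm z') / 2|.
Proof.
move=> s1 s3 aE bE m0 z z' k0 zm Ym; pose k := (h - h') / s.2.
have hk : h - h' = s.2 * k by rewrite /k; field.
have zE : z = z' + k *: s.
  apply: vel_ext; rewrite /z /z' /line_shear/= /GRing.scale/= ?aE ?bE /k; field; exact: s3.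
have z'0 : 0 < enorm z'.
  rewrite enorm_gt0; apply/eqP => z0; move: Ym.
  have -> : enorm (Ydisp z' s) = 0.
    by apply/eqP; rewrite enorm_eq0 /Ydisp z0; apply/eqP; apply: vel_ext; rewrite /= /GRing.scale/= /enorm /dot/= !mulr0 !addr0 sqrtr0 mul0r mulr0.
  by rewrite leNgt invr_gt0 m0.
have Y2 : enorm (Ydisp z' s) ^+ 2 = (enorm z' ^+ 2 + enorm z' * dot z' s) / 2.
  have s2 : dot s s = 1 by rewrite -enorm_sqr s1 expr1n.
  have z2 : dot z' z' = enorm z' ^+ 2 by rewrite enorm_sqr.
  rewrite enorm_sqr /Ydisp; move: s2 z2; move: (enorm z') => e.
  rewrite /dot /= /GRing.scale/=; nra.
have conv : enorm z' ^+ 2 + k * dot z' s <= enorm z' * enorm z.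
  have := dot_le z' z; rewrite ler_norml => /andP[_]; apply: le_trans.
  rewrite enorm_sqr zE /dot/= /GRing.scale/=; lra.
have Yk : k * (2 * enorm (Ydisp z' s) ^+ 2) <= enorm z' ^+ 2 * (k + enorm z - enorm z').
  rewrite Y2; nra.
have m4 : m ^- 4 * enorm z' ^+ 2 <= enorm (Ydisp z' s) ^+ 2.
  apply: (@le_trans _ _ (m^-1 ^+ 2)); last by rewrite ler_pXn2r// ?nnegrE ?enorm_ge0// invr_ge0 ltW.
  have -> : (m^-1 ^+ 2 = m ^- 4 * m ^+ 2) by field; rewrite gt_eqF.
  rewrite ler_wpM2l ?invr_ge0 ?exprn_ge0 ?(ltW m0)// ler_pXn2r// ?nnegrE ?enorm_ge0// ltW//.
have key : m ^- 4 * k <= (k + enorm z - enorm z') / 2.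
  rewrite -(ler_pM2l (exprn_gt0 2 z'0)); move: m4 Yk k0; rewrite -/k; nra.
have -> : (h + s.2 * enorm z) / 2 - (h' + s.2 * enorm z') / 2 = s.2 * ((k + enorm z - enorm z') / 2).
  have -> : h = h' + s.2 * k by rewrite -hk addrC subrK.
  ring.
have kk : `|k| = k by exact: ger0_norm.
clearbody k; rewrite hk [`|s.2 * k|]normrM kk [leRHS]normrM mulrCA ler_pM2l ?normr_gt0//.
by apply: (le_trans key); exact: ler_norm.
Qed.

(** In sheared coordinates the displacement sends (x_1, x_2, h) to (x_1 / 2, x_2 / 2, phi h), where
    phi expands distances by m^-4 on the relevant set. The halvings cost a factor 4 and
    [leb_expanding] a factor 2 m^4. *)
Lemma Ydisp_line_law (s : vel R) (m : R) (A : set (vel R)) : enorm s = 1 -> s.2 != 0 -> 0 < m ->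
  measurable A ->
  (leb3 ([set u | (enorm u <= m)%R /\ (m^-1 <= enorm (Ydisp u s))%R] `&` (fun u => Ydisp u s) @^-1` A)
   <= (8 * m ^+ 4)%:E * leb3 A)%E.
Proof.
move=> s1 s3 m0 mA; pose a := s.1.1 / s.2; pose b := s.1.2 / s.2.
pose sh := line_shear a b; have [msh shE] := mp_line_shear a b.
have mY : measurable_fun setT (fun u => Ydisp u s) by rewrite /Ydisp; mfv.
pose G := [set u | enorm u <= m /\ m^-1 <= enorm (Ydisp u s)].
have mG : measurable G.
  have -> : G = (fun u => (enorm u <= m) && (m^-1 <= enorm (Ydisp u s))) @^-1` [set true].
    by apply/seteqP; split => u /=; [move=> [-> ->]|move=> /andP].
  rewrite -[X in measurable X]setTI; apply: measurable_and => //.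
    by apply: measurable_fun_ler => //; apply: mf_enorm; mfv.
  by apply: measurable_fun_ler => //; apply: mf_enorm.
have mGA : measurable (G `&` (fun u => Ydisp u s) @^-1` A).
  by apply: measurableI => //; rewrite -[X in measurable X]setTI; exact: mY.
have mA' : measurable (sh @^-1` A) by rewrite -[X in measurable X]setTI; exact: msh.
rewrite -shE// -(shE A)//.
pose half (q : vel R) : vel R := ((2^-1 * q.1.1, 2^-1 * q.1.2), q.2).
have mhalf : measurable_fun setT half by rewrite /half; mf.
have hE : leb3 (half @^-1` (sh @^-1` A)) = (4%:E * leb3 (sh @^-1` A))%E.
  have mc : measurable_fun setT (fun x : mR => 2^-1 * x : mR) by exact: measurable_funM.
  have mc2 : measurable_fun setT (fun p : mR * mR => (2^-1 * p.1 : mR, 2^-1 * p.2 : mR)) by mf.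
  have i0 : (0 : R) < 2^-1 by [].
  have h (B : set mR) : measurable B -> leb ((fun x => 2^-1 * x) @^-1` B) = ((2^-1)^-1%:E * leb B)%E.
    by move=> mB; exact: leb_scale.
  have i2 : (0 : R) < (2^-1)^-1 by [].
  have h2 := scale_prod i2 i2 mc mc h h.
  have i4 : (0 : R) < (2^-1)^-1 * (2^-1)^-1 by [].
  have h3 (B : set mR) : measurable B -> leb (id @^-1` B) = (1%:E * leb B)%E by move=> _; rewrite mul1e.
  have := scale_prod i4 ltr01 mc2 (@measurable_id _ mR setT) h2 h3 mA'.
  rewrite (_ : (2^-1)^-1 * (2^-1)^-1 * 1 = 4 :> R)//; by field.
have -> : ((8 * m ^+ 4)%:E * leb3 (sh @^-1` A) = (2 / m ^- 4)%:E * leb3 (half @^-1` (sh @^-1` A)))%E.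
  by rewrite hE muleA -EFinM; congr (_%:E * _)%E; field; rewrite gt_eqF.
have mhA : measurable (half @^-1` (sh @^-1` A)) by rewrite -[X in measurable X]setTI; exact: mhalf.
have mGA' : measurable (sh @^-1` (G `&` (fun u => Ydisp u s) @^-1` A)).
  by rewrite -[X in measurable X]setTI; exact: msh.
have e1 : leb3 (sh @^-1` (G `&` (fun u => Ydisp u s) @^-1` A)) =
  (\int[sfprod leb leb]_p leb (xsection (sh @^-1` (G `&` (fun u => Ydisp u s) @^-1` A)) p))%E.
  exact: sfprod_xsection.
have e2 : leb3 (half @^-1` (sh @^-1` A)) =
  (\int[sfprod leb leb]_p leb (xsection (half @^-1` (sh @^-1` A)) p))%E.
  exact: sfprod_xsection.
rewrite e1 e2 -ge0_integralZl//; last 2 first.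
- exact: measurable_fun_xsection.
- by rewrite lee_fin divr_ge0// invr_ge0 exprn_ge0// ltW.
apply: ge0_le_integral => //.
- exact: measurable_fun_xsection.
- by apply: measurable_funeM; exact: measurable_fun_xsection.
move=> [x1 x2] _.
pose phi (h : mR) : mR := (h + s.2 * enorm (sh (x1, x2, h))) / 2.
have mphi : measurable_fun setT phi.
  by rewrite /phi /sh /line_shear; mfv.
pose J := [set h : mR | G (sh (x1, x2, h))].
have mpair : measurable_fun setT (fun h : mR => sh (x1, x2, h)).
  by rewrite /sh /line_shear; mf.
have mJ : measurable J by rewrite -[X in measurable X]setTI; exact: (mpair measurableT G mG).
have mX : measurable (xsection (half @^-1` (sh @^-1` A)) (x1, x2)) by exact: measurable_xsection.
have Jphi h h' : J h -> J h' -> m ^- 4 * `|h - h'| <= `|phi h - phi h'|.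
  move=> [h1 h2] [h1' h2']; have [k0|k0] := leP 0 ((h - h') / s.2).
    exact: (@line_expand s a b x1 x2 m h h').
  rewrite distrC [leRHS]distrC; apply: (@line_expand s a b x1 x2 m h' h) => //.
  by rewrite -(opprB h h') mulNr oppr_ge0 ltW.
apply: le_trans (leb_expanding mJ mX mphi _ Jphi); last by rewrite invr_gt0 exprn_gt0.
apply: le_measure; rewrite ?inE//.
- exact: measurable_xsection.
- by apply: measurableI => //; rewrite -[X in measurable X]setTI; exact: mphi.
move=> h; rewrite /xsection/= inE => -[Gh /= Ah]; split => //=.
rewrite inE/= /half/=; move: Ah; congr (A _).
rewrite /Ydisp /sh /line_shear /phi; apply: vel_ext => /=; rewrite /GRing.scale/= -/(line_shear a b _).
- by rewrite /a; field.
- by rewrite /b; field.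
- by field.
Qed.

Lemma surf_equator : surf [set s : vel R | s.2 = 0] = 0%E.
Proof.
have m0 : measurable ([set: mR * mR] `*` [set (0 : mR)]) by exact: measurableX.
have null : leb3 ([set: mR * mR] `*` [set (0 : mR)]) = 0%E.
  by apply: (sfprod_null2 (sfprod leb leb)) => //; exact: lebesgue_measure_set1.
have mE : measurable [set s : vel R | s.2 = 0].
  have -> : [set s : vel R | s.2 = 0] = [set: mR * mR] `*` [set (0 : mR)].
    by apply/seteqP; split => s //= [].
  by [].
rewrite surfE; set D := (_ `&` _); suff -> : leb3 D = 0%E by rewrite mule0.
apply/eqP; rewrite eq_le measure_ge0 andbT -[leRHS]null; apply: le_measure; rewrite ?inE//.
  apply: measurableI; last exact: measurable_ball1.
  by rewrite -[X in measurable X]setTI; exact: measurable_dir.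
move=> x [/= dx /andP[x0 _]]; split => //=; move: dx; rewrite /dir/= /GRing.scale/=.
by move=> /eqP; rewrite mulf_eq0 invr_eq0 gt_eqF//= => /eqP.
Qed.

Definition surfT : R := fine (surf [set: vel R]).

Lemma surfTE : surf [set: vel R] = surfT%:E.
Proof. by rewrite fineK// fin_num_measure. Qed.

Lemma surfT_ge0 : 0 <= surfT.
Proof. by rewrite fine_ge0. Qed.

Definition Ygood (m : R) : set (vel R * vel R) :=
  [set q | enorm q.1 <= m /\ m^-1 <= enorm (Ydisp q.1 q.2)].

Lemma measurable_Ygood m : measurable (Ygood m).
Proof.
have -> : Ygood m = (fun q => (enorm q.1 <= m) && (m^-1 <= enorm (Ydisp q.1 q.2))) @^-1` [set true].
  by apply/seteqP; split => q /=; [move=> [-> ->]|move=> /andP].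
rewrite -[X in measurable X]setTI; apply: measurable_and => //.
  by apply: measurable_fun_ler => //; apply: mf_enorm; mfv.
by apply: measurable_fun_ler => //; apply: mf_enorm; exact: mf_Ydisp.
Qed.

(** The bound for a fixed direction is integrated over s; the equator s_3 = 0, where the shear is
    undefined, is null for [surf]. *)
Lemma Ydisp_law (m : R) (A : set (vel R)) : 0 < m -> measurable A ->
  (sfprod leb3 surf (Ygood m `&` (fun q => Ydisp q.1 q.2) @^-1` A)
   <= (8 * m ^+ 4 * surfT)%:E * leb3 A)%E.
Proof.
move=> m0 mA; set E := _ `&` _.
have mE : measurable E.
  apply: measurableI; first exact: measurable_Ygood.
  by rewrite -[X in measurable X]setTI; exact: mf_Ydisp.
have [msw swE] := mp_swap (@surf R) (@leb3 R).
rewrite -swE//.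
have mE' : measurable ((fun p : vel R * vel R => (p.2, p.1)) @^-1` E).
  by rewrite -[X in measurable X]setTI; exact: msw.
have c0 : (0 <= (8 * m ^+ 4)%:E :> \bar R)%E by rewrite lee_fin mulr_ge0// exprn_ge0// ltW.
apply: (@le_trans _ _ (\int[surf]_s ((8 * m ^+ 4)%:E * leb3 A))%E); last first.
  apply: le_eq; apply: (etrans (integral_cst _ measurableT _)).
  apply: (etrans (congr1 (fun z => ((8 * m ^+ 4)%:E * leb3 A * z)%E) surfTE)).
  by rewrite muleAC -EFinM.
apply: (@le_trans _ _ (\int[surf]_s leb3 (xsection ((fun p : vel R * vel R => (p.2, p.1)) @^-1` E) s))%E) => //.
apply: ae_ge0_le_integral => //.
- exact: measurable_fun_xsection.
- by move=> s _; rewrite mule_ge0.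
have mEq : measurable [set s : vel R | s.2 = 0].
  have -> : [set s : vel R | s.2 = 0] = [set: mR * mR] `*` [set (0 : mR)].
    by apply/seteqP; split => s //= [].
  exact: measurableX.
have ae3 : {ae surf, forall s : vel R, s.2 != 0}.
  exists [set s : vel R | s.2 = 0]; split => //; first exact: surf_equator.
  by move=> s /= /negP; rewrite negbK => /eqP.
apply: filterS2 surf_ae_S2 ae3 => s s1 s3 _.
apply: le_trans (Ydisp_line_law s1 s3 m0 mA).
apply: le_measure; rewrite ?inE//.
- exact: measurable_xsection.
- have mY : measurable_fun setT (fun u => Ydisp u s) by rewrite /Ydisp; mfv.
  apply: measurableI; last by rewrite -[X in measurable X]setTI; exact: mY.
  have mp1 : measurable_fun setT (fun u : vel R => (u, s)) by mf.
  by have := mp1 measurableT (Ygood m) (measurable_Ygood m); rewrite setTI.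
- by move=> u; rewrite /xsection/= inE.
Qed.

Local Notation Pi3 := (sfprod (sfprod leb3 leb3) (@surf R)).
Local Notation trip := (vel R * vel R * vel R)%type.

Lemma vpost_Ydisp v u s : vpost v (v + u) s = v + Ydisp u s.
Proof.
rewrite /vpost /Ydisp opprD addNKr enormN; by apply: vel_ext; rewrite /= /GRing.scale/=; field.
Qed.

Lemma vpost_starN (v w s : vel R) : vpost_star v w s = vpost v w (- s).
Proof. by rewrite /vpost_star /vpost scalerN. Qed.

Definition sep_set (V : trip -> vel R) (m : R) : set trip :=
  [set p | enorm (p.1.1 - p.1.2) <= m /\ m^-1 <= enorm (p.1.1 - V p)].

Lemma measurable_sep_set V m : measurable_fun setT V -> measurable (sep_set V m).
Proof.
move=> mV.
have -> : sep_set V m = (fun p => (enorm (p.1.1 - p.1.2) <= m) && (m^-1 <= enorm (p.1.1 - V p))) @^-1` [set true].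
  by apply/seteqP; split => q /=; [move=> [-> ->]|move=> /andP].
rewrite -[X in measurable X]setTI; apply: measurable_and => //.
  by apply: measurable_fun_ler => //; apply: mf_enorm; mfv.
by apply: measurable_fun_ler => //; apply: mf_enorm; mfv.
Qed.

Definition vpost3 (p : trip) : vel R := vpost p.1.1 p.1.2 p.2.
Definition vstar3 (p : trip) : vel R := vpost_star p.1.1 p.1.2 p.2.

Lemma mf_vpost3 : measurable_fun setT vpost3.
Proof. by rewrite /vpost3 /vpost; mfv. Qed.

Lemma mf_vstar3 : measurable_fun setT vstar3.
Proof. by rewrite /vstar3 /vpost_star; mfv. Qed.

(** With w = v + u one has v' = v + [Ydisp] u s, so for fixed v the law of v' is a translate of that
    of the displacement. *)
Lemma law_vpost (m : R) (Z : set (vel R * vel R)) : 0 < m -> measurable Z ->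
  (Pi3 (sep_set vpost3 m `&` [set p | Z (p.1.1, vpost3 p)])
   <= (8 * m ^+ 4 * surfT)%:E * sfprod leb3 leb3 Z)%E.
Proof.
move=> m0 mZ; set E := _ `&` _.
have mE : measurable E.
  apply: measurableI; first by apply: measurable_sep_set; exact: mf_vpost3.
  have mvv : measurable_fun setT (fun p : trip => (p.1.1, vpost3 p)).
    by apply: measurable_fun_pair; [mfv|exact: mf_vpost3].
  by have := mvv measurableT Z mZ; rewrite setTI.
pose D (q : vel R * (vel R * vel R)) : trip := (q.1, q.1 + q.2.1, q.2.2).
have mpD : mp (sfprod leb3 (sfprod leb3 surf)) Pi3 D.
  have h : mp (sfprod leb3 leb3) (sfprod leb3 leb3) (fun q : vel R * vel R => (q.1, q.1 + q.2 : vel R)).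
    apply: (@mp_skew R _ _ _ _ _ _ leb3 leb3 leb3 (fun x y : vel R => x + y : vel R)); first mfv.
    by move=> x; apply: mp_ext (mp_leb3_add x) => y; rewrite addrC.
  exact: (mp_comp (mp_assocV _ _ _) (mp_prod h (mp_id _))).
rewrite -mpD.2//.
have mDE : measurable (D @^-1` E) by rewrite -[X in measurable X]setTI; exact: mpD.1.
pose ad (q : vel R * vel R) : vel R * vel R := (q.1, q.1 + q.2).
have mpa : mp (sfprod leb3 leb3) (sfprod leb3 leb3) ad.
  apply: (@mp_skew R _ _ _ _ _ _ leb3 leb3 leb3 (fun x y : vel R => x + y : vel R)); first mfv.
  by move=> x; apply: mp_ext (mp_leb3_add x) => y; rewrite addrC.
rewrite -(mpa.2 Z)//.
have maZ : measurable (ad @^-1` Z) by rewrite -[X in measurable X]setTI; exact: mpa.1.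
have c0 : (0 <= (8 * m ^+ 4 * surfT)%:E :> \bar R)%E.
  by rewrite lee_fin mulr_ge0 ?surfT_ge0// mulr_ge0// exprn_ge0// ltW.
apply: (@le_trans _ _ (\int[leb3]_v ((8 * m ^+ 4 * surfT)%:E * leb3 (xsection (ad @^-1` Z) v)))%E); last first.
  by rewrite ge0_integralZl//; exact: measurable_fun_xsection.
apply: (@le_trans _ _ (\int[leb3]_v sfprod leb3 surf (xsection (D @^-1` E) v))%E) => //.
apply: ge0_le_integral; first exact: measurableT.
- by move=> v _; exact: measure_ge0.
- exact: measurable_fun_xsection.
- by apply: measurable_funeM; exact: measurable_fun_xsection.
move=> v _; have mx : measurable (xsection (ad @^-1` Z) v) by exact: measurable_xsection.
apply: le_trans (Ydisp_law m0 mx).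
apply: le_measure; rewrite ?inE//.
- exact: measurable_xsection.
- apply: measurableI; first exact: measurable_Ygood.
  by rewrite -[X in measurable X]setTI; exact: mf_Ydisp.
move=> [u s]; rewrite /xsection/= inE/= /D/= => -[[/= h1 h2] h3].
rewrite /vpost3/= vpost_Ydisp in h2 h3.
split; last by rewrite /= inE.
by move: h1 h2; rewrite !opprD !addNKr !enormN.
Qed.

(** Replacing s by -s exchanges the two post-collisional velocities and preserves the measure. *)
Lemma law_vstar (m : R) (Z : set (vel R * vel R)) : 0 < m -> measurable Z ->
  (Pi3 (sep_set vstar3 m `&` [set p | Z (p.1.1, vstar3 p)])
   <= (8 * m ^+ 4 * surfT)%:E * sfprod leb3 leb3 Z)%E.
Proof.
move=> m0 mZ; apply: le_trans (law_vpost m0 mZ).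
set E := _ `&` _; have -> : E = (@Fl R) @^-1` (sep_set vpost3 m `&` [set p | Z (p.1.1, vpost3 p)]).
  by apply/seteqP; split => -[[v w] s]; rewrite /E /sep_set /Fl /vstar3 /vpost3/= vpost_starN.
apply: le_eq; apply: mp_Fl.2.
apply: measurableI; first by apply: measurable_sep_set; exact: mf_vpost3.
have mvv : measurable_fun setT (fun p : trip => (p.1.1, vpost3 p)).
  by apply: measurable_fun_pair; [mfv|exact: mf_vpost3].
by have := mvv measurableT Z mZ; rewrite setTI.
Qed.

Lemma law_snd (Z : set (vel R * vel R)) : measurable Z ->
  (Pi3 [set p | Z (p.1.1, p.1.2)] <= surfT%:E * sfprod leb3 leb3 Z)%E.
Proof.
move=> mZ; have -> : [set p : trip | Z (p.1.1, p.1.2)] = Z `*` setT.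
  by apply/seteqP; split => -[[v w] s] //= [].
apply: le_eq; apply: (etrans (sfprodE (sfprod leb3 leb3) surf mZ measurableT)).
by apply: (etrans (congr1 (fun z => (sfprod leb3 leb3 Z * z)%E) surfTE)); rewrite muleC.
Qed.

End collision_law.

(** * Schur bounds for the gain weights *)

Section singular_weight.
Context {R : realType}.
Local Notation mR := (measurableTypeR R).
Local Notation leb := (@lebesgue_measure R).
Variable kap : R.
Hypotheses (kap_gt0 : 0 < kap) (kap_lt1 : kap < 1).

Let q : R := 2 `^ kap.

Let q_gt0 : 0 < q. Proof. by rewrite powR_gt0. Qed.

Let q_lt2 : q < 2.
Proof.
rewrite -[ltRHS](powRr1 (ler0n R 2)) /q /powR pnatr_eq0/= ltr_expR.
by rewrite ltr_pM2r// ln_gt0// ltr1n.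
Qed.

(* A dyadic majorant of [1 + |u|^-kap]: unlike the power itself, whose value at 0
   is 0, it is nonincreasing in [|u|]. *)
Definition dyad (u : R) : \bar R :=
  (1 + \sum_(0 <= k <oo) (q ^+ k.+1 * (`|u| <= 2^-1 ^+ k)%R%:R)%:E)%E.

Let term_ge0 (u : R) k : (0 <= (q ^+ k.+1 * (`|u| <= 2^-1 ^+ k)%R%:R)%:E)%E.
Proof. by rewrite lee_fin mulr_ge0// exprn_ge0// ltW. Qed.

Lemma dyad_ge1 u : (1 <= dyad u)%E.
Proof. by rewrite leeDl//; apply: nneseries_ge0 => k _ _; exact: term_ge0. Qed.

Lemma dyad_ge0 u : (0 <= dyad u)%E.
Proof. by apply: le_trans (dyad_ge1 u); rewrite lee_fin. Qed.

Lemma le_dyad x y : `|x| <= `|y| -> (dyad y <= dyad x)%E.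
Proof.
move=> xy; apply: leeD2l; apply: lee_nneseries => [k _ _|k _]; first exact: term_ge0.
have [h|_] := boolP (`|y| <= 2^-1 ^+ k); first by rewrite (le_trans xy h).
by rewrite mulr0; exact: term_ge0.
Qed.

Let powR_ge1 (x : R) : 1 <= x -> 1 <= x `^ kap.
Proof.
move=> x1; have <- : 1 `^ kap = 1 :> R by rewrite powR1.
 apply: ge0_ler_powR => //.
- exact: ltW.
- by rewrite nnegrE.
- by rewrite nnegrE (le_trans _ x1).
Qed.

(** For 2^-(k+1) < |u| <= 2^-k the single term of index k is 2^(kap (k+1)) >= |u|^-kap; this is why
    the exponent in [dyad] is k + 1. For |u| >= 1 the constant 1 suffices. *)
Lemma dyad_powR u : ((`|u| `^ (- kap))%:E <= dyad u)%E.
Proof.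
have [->|u0] := eqVneq u 0.
  by rewrite normr0 powR0 ?oppr_eq0 ?gt_eqF//; exact: dyad_ge0.
have nu0 : 0 < `|u| by rewrite normr_gt0.
have [u1|u1] := leP 1 `|u|.
  apply: le_trans (dyad_ge1 u); rewrite lee_fin powRN invf_le1 ?powR_gt0//.
  exact: powR_ge1.
have ex : exists k, (2^-1 : R) ^+ k < `|u|.
  have /cvgrPdist_lt /(_ _ nu0) [k _ kP] : (fun k => (2^-1 : R) ^+ k) @ \oo --> (0 : R).
    by apply: cvg_expr; rewrite ger0_norm// invf_lt1// ltr1n.
  exists k; have := kP k (leqnn k); rewrite sub0r normrN; exact/le_lt_trans/ler_norm.
case: (ex_minnP ex) => -[|k]; first by rewrite expr0 => h; rewrite ltNge (ltW u1) in h.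
move=> ku kmin; have ku' : `|u| <= 2^-1 ^+ k.
  by rewrite leNgt; apply/negP => /kmin; rewrite ltnn.
apply: (@le_trans _ _ (\sum_(0 <= k <oo) (q ^+ k.+1 * (`|u| <= 2^-1 ^+ k)%R%:R)%:E)%E); last first.
  by rewrite leeDr.
apply: le_trans (nneseries_lim_ge k.+1 (fun k _ _ => term_ge0 u k)).
rewrite big_nat_recr//= ku' mulr1 -[leLHS]add0e; apply: leeD.
  by apply: sume_ge0 => i _; exact: term_ge0.
have -> : q ^+ k.+1 = (2 ^+ k.+1) `^ kap.
  by rewrite -(powR_mulrn _ (ltW q_gt0)) -(powR_mulrn k.+1 (ler0n R 2)) /q -!powRrM mulrC.
rewrite lee_fin powRN -[leLHS]mul1r ler_pdivrMr ?powR_gt0// -powRM ?exprn_ge0//.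
apply: powR_ge1; move: ku; rewrite exprVn => /ltW ku.
by rewrite mulrC -ler_pdivrMr ?exprn_gt0// mul1r.
Qed.

Lemma mf_dyad d (T : measurableType d) (f : T -> R) : measurable_fun setT f ->
  measurable_fun setT (fun x => dyad (f x)).
Proof.
move=> mf; apply: emeasurable_funD => //.
apply: (ge0_emeasurable_sum (P := xpredT)) => [k x _ _|k _]; first exact: term_ge0.
apply/measurable_EFinP; apply: measurable_funM => //.
pose A := [set x | `|f x| <= 2^-1 ^+ k].
have mA : measurable A.
  rewrite (_ : A = (fun x => `|f x| <= 2^-1 ^+ k) @^-1` [set true]); last by apply/seteqP; split.
  by rewrite -[X in measurable X]setTI; apply: measurable_fun_ler => //; exact: mf_norm.
rewrite (_ : (fun x => _) = \1_A :> (T -> R)); first exact: measurable_indic.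
by apply/funext => x; rewrite indicE; congr (_%:R); congr nat_of_bool; apply/idP/idP => [h|/set_mem//]; exact/mem_set.
Qed.

Let geo_bound (k : nat) : \sum_(0 <= i < k) q ^+ i.+1 * (8 * 2^-1 ^+ i) <= 8 * q / (1 - q / 2).
Proof.
have z0 : 0 <= q / 2 by rewrite divr_ge0// ltW.
have z1 : 0 < 1 - q / 2 by rewrite subr_gt0 ltr_pdivrMr// mul1r.
rewrite (eq_bigr (fun i => 8 * q * (q / 2) ^+ i)); last first.
  by move=> i _; rewrite exprMn exprS; ring.
rewrite -mulr_sumr ler_pM2l ?mulr_gt0// -[leRHS]div1r ler_pdivlMr//.
have -> : (\sum_(0 <= i < k) (q / 2) ^+ i) * (1 - q / 2) = 1 - (q / 2) ^+ k.
  by rewrite big_mkord; have := subrX1 (q / 2) k; move: (\sum_(i < k) _) => S; lra.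
by rewrite gerBl exprn_ge0.
Qed.

(** The set |a x + b| <= 2^-k has length at most 8 * 2^-k, whatever b is, and q = 2^kap < 2 makes
    the series of q^(k+1) * 8 * 2^-k geometric. The bound h <= 1 is used on the series and the
    integral of h pays for the constant 1. *)
Lemma integral_dyad : exists2 K : R, 0 <= K & forall (h : R -> R) (a b : R),
  measurable_fun setT h -> (forall x, 0 <= h x <= 1) -> 2^-1 <= `|a| ->
  (\int[leb]_x ((h x)%:E * dyad (a * x + b)) <= K%:E + \int[leb]_x (h x)%:E)%E.
Proof.
have z1 : 0 < 1 - q / 2 by rewrite subr_gt0 ltr_pdivrMr// mul1r.
exists (8 * q / (1 - q / 2)); first by rewrite divr_ge0 ?mulr_ge0// ltW.
move=> h a b mh h01 ha.
have h0 x : 0 <= h x by have /andP[] := h01 x.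
have h1 x : h x <= 1 by have /andP[] := h01 x.
have a0 : 0 < `|a| by apply: lt_le_trans ha.
have mab : measurable_fun setT (fun x : mR => a * x + b) by mf.
pose A k := [set x : mR | `|a * x + b| <= 2^-1 ^+ k].
have mA k : measurable (A k).
  rewrite (_ : A k = (fun x => `|a * x + b| <= 2^-1 ^+ k) @^-1` [set true]); last by apply/seteqP; split.
  by rewrite -[X in measurable X]setTI; apply: measurable_fun_ler => //; exact: mf_norm.
have Ak k : (leb (A k) <= (8 * 2^-1 ^+ k)%:E)%E.
  have e0 : 0 <= (2^-1 : R) ^+ k by rewrite exprn_ge0.
  apply: (@le_trans _ _ (leb `[- b / a - 2 * 2^-1 ^+ k, - b / a + 2 * 2^-1 ^+ k]%classic)).
    apply: le_measure; rewrite ?inE// => x /= hx; rewrite in_itv/= -ler_distl.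
    have an0 : a != 0 by rewrite -normr_gt0.
    have -> : x - - b / a = (a * x + b) / a by field.
    rewrite normrM normfV ler_pdivrMr//; apply: (le_trans hx); nra.
  rewrite lebesgue_measure_itv/= lte_fin; case: ifP => _; last by rewrite lee_fin mulr_ge0.
  by rewrite -EFinD lee_fin; lra.
rewrite /dyad.
have t0 x : (0 <= \sum_(0 <= k <oo) (q ^+ k.+1 * (`|a * x + b| <= 2^-1 ^+ k)%R%:R)%:E)%E.
  by apply: nneseries_ge0 => k _ _; exact: term_ge0.
have mI k : measurable_fun setT (fun x : mR => (`|a * x + b| <= 2^-1 ^+ k)%R%:R : R).
  rewrite (_ : (fun x => _) = \1_(A k)); first exact: measurable_indic.
  by apply/funext => x; rewrite indicE; congr (_%:R); congr nat_of_bool; apply/idP/idP => [hh|/set_mem//]; exact/mem_set.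
pose F k (x : mR) := ((h x)%:E * (q ^+ k.+1 * (`|a * x + b| <= 2^-1 ^+ k)%R%:R)%:E)%E.
have F0 k x : (0 <= F k x)%E by rewrite mule_ge0 ?term_ge0 ?lee_fin.
have mF k : measurable_fun setT (F k).
  by apply: emeasurable_funM; apply/measurable_EFinP => //; apply: measurable_funM.
rewrite (eq_integral (fun x : mR => (h x)%:E + \sum_(0 <= k <oo) F k x)%E); last first.
  move=> x _; rewrite ge0_muleDr ?mule1//; congr (_ + _)%E.
  by rewrite -nneseriesZl// => k _; exact: term_ge0.
rewrite ge0_integralD//; last 4 first.
- by move=> x _; rewrite lee_fin.
- exact/measurable_EFinP.
- by move=> x _; apply: nneseries_ge0 => k _ _; exact: F0.
- by apply: (ge0_emeasurable_sum (P := xpredT)) => [k x _ _|k _]; [exact: F0|exact: mF].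
rewrite addeC; apply: leeD2r; rewrite integral_nneseries//.
apply: (@le_trans _ _ (\sum_(0 <= k <oo) (q ^+ k.+1 * (8 * 2^-1 ^+ k))%:E)%E).
  apply: lee_nneseries => [k _ _|k _]; first by apply: integral_ge0 => x _; exact: F0.
  apply: (@le_trans _ _ (\int[leb]_x ((q ^+ k.+1)%:E * (\1_(A k) x)%:E))%E).
    apply: ge0_le_integral => //.
    - by apply: emeasurable_funM => //; apply/measurable_EFinP; exact: measurable_indic.
    move=> x _; rewrite /F -!EFinM lee_fin indicE mulrCA ler_wpM2l ?exprn_ge0 ?(ltW q_gt0)//.
    have [hx|_] := boolP (`|a * x + b| <= 2^-1 ^+ k); last by rewrite mulr0.
    by have -> : x \in A k; [exact/mem_set|rewrite mulr1].
  rewrite ge0_integralZl_EFin//; last 2 first.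
  - by apply/measurable_EFinP; exact: measurable_indic.
  - by rewrite exprn_ge0// ltW.
  rewrite integral_indic// setIT EFinM; apply: lee_wpmul2l; last exact: Ak.
  by rewrite lee_fin exprn_ge0// ltW.
apply: lime_le.
  by apply: is_cvg_nneseries => k _ _; rewrite lee_fin !mulr_ge0 ?exprn_ge0// ltW.
apply: nearW => k; rewrite sumEFin lee_fin; exact: geo_bound.
Qed.

End singular_weight.
Arguments dyad {R} kap%_ring_scope u%_ring_scope.

(** * Finiteness of Gaussian integrals *)

Section gauss.
Context {R : realType}.
Local Notation mR := (measurableTypeR R).
Local Notation leb := (@lebesgue_measure R).

Lemma gauss1_fin (c : R) : 0 < c -> (\int[leb]_x (expR (- c * x ^+ 2))%:E < +oo)%E.
Proof.
move=> c0; pose s := Num.sqrt ((2 * c)^-1).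
have c2 : 0 <= (2 * c)^-1 by rewrite invr_ge0 mulr_ge0// ltW.
have s0 : s != 0 by rewrite sqrtr_eq0 -ltNge invr_gt0 mulr_gt0.
have := integral_normal_pdf 0 s.
have pk := normal_peak_gt0 s0.
rewrite (eq_integral (fun x : mR => ((normal_peak s)%:E * (expR (- c * (x : R) ^+ 2))%:E)%E)); last first.
  move=> x _; rewrite normal_pdfE// /normal_fun subr0 -EFinM; congr (_ * expR _)%:E.
  rewrite /s sqr_sqrtr//; field; exact: lt0r_neq0.
rewrite ge0_integralZl_EFin//; last 2 first.
- by apply/measurable_EFinP; apply: mf_expR; mf.
- exact: ltW.
move=> h; rewrite ltey; apply/eqP => I; move: h; rewrite I.
by rewrite gt0_muley ?lte_fin.
Qed.

Definition gauss1 (c : R) : R := fine (\int[leb]_x (expR (- c * x ^+ 2))%:E)%E.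

Lemma gauss1E c : 0 < c -> (\int[leb]_x (expR (- c * x ^+ 2))%:E = (gauss1 c)%:E)%E.
Proof.
move=> c0; rewrite /gauss1 fineK// ge0_fin_numE ?gauss1_fin//.
by apply: integral_ge0 => x _; rewrite lee_fin expR_ge0.
Qed.

Lemma gauss1_ge0 c : 0 <= gauss1 c.
Proof. by rewrite fine_ge0//; apply: integral_ge0 => x _; rewrite lee_fin expR_ge0. Qed.

Lemma sf_int_tensor d1 d2 (X : measurableType d1) (Y : measurableType d2)
    (m1 : {sigma_finite_measure set X -> \bar R}) (m2 : {sigma_finite_measure set Y -> \bar R})
    (f : X -> \bar R) (g : Y -> \bar R) : measurable_fun setT f -> measurable_fun setT g ->
  (forall x, 0 <= f x)%E -> (forall y, 0 <= g y)%E ->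
  (\int[sfprod m1 m2]_p (f p.1 * g p.2) = \int[m1]_x f x * \int[m2]_y g y)%E.
Proof.
move=> mf mg f0 g0.
have mfg : measurable_fun setT (fun p : X * Y => (f p.1 * g p.2)%E).
  by apply: emeasurable_funM; [exact: measurableT_comp mf measurable_fst|exact: measurableT_comp mg measurable_snd].
apply: (etrans (sf_fubini1 m1 m2 mfg _)); first by move=> p; rewrite mule_ge0.
rewrite -ge0_integralZr//; last by apply: integral_ge0 => y _.
by apply: eq_integral => x _; rewrite /= ge0_integralZl.
Qed.

Lemma expR_enorm (c : R) (w : vel R) : expR (- c * enorm w ^+ 2) =
  expR (- c * w.1.1 ^+ 2) * expR (- c * w.1.2 ^+ 2) * expR (- c * w.2 ^+ 2).
Proof. by rewrite enorm_sqr /dot -!expRD; congr expR; ring. Qed.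

Let mexp (c : R) : measurable_fun setT (fun x : mR => (expR (- c * x ^+ 2))%:E).
Proof. by apply/measurable_EFinP; apply: mf_expR; mf. Qed.

Lemma gauss3_fin (c : R) : 0 < c -> (\int[leb3]_w (expR (- c * enorm w ^+ 2))%:E < +oo)%E.
Proof.
move=> c0; pose f (x : mR) := (expR (- c * x ^+ 2))%:E.
have f0 x : (0 <= f x)%E by rewrite lee_fin expR_ge0.
rewrite (eq_integral (fun w : vel R => (f w.1.1 * f w.1.2 * f w.2)%E)); last first.
  by move=> w _; rewrite expR_enorm !EFinM.
have mff : measurable_fun setT (fun p : mR * mR => (f p.1 * f p.2)%E).
  by apply: emeasurable_funM; [exact: measurableT_comp (mexp c) measurable_fst|exact: measurableT_comp (mexp c) measurable_snd].
apply: (eq_lte (sf_int_tensor (sfprod leb leb) leb mff (mexp c) _ f0)).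
  by move=> p; rewrite mule_ge0.
have -> : (\int[sfprod leb leb]_x (f x.1 * f x.2) = (gauss1 c)%:E * (gauss1 c)%:E)%E.
  by rewrite -!gauss1E//; exact: (sf_int_tensor leb leb (mexp c) (mexp c) f0 f0).
by rewrite gauss1E// -!EFinM ltry.
Qed.

End gauss.

(** * Schur bounds on the sphere and on R^3 x S2 *)

Section sphere_weight.
Context {R : realType}.
Local Notation mR := (measurableTypeR R).
Local Notation leb := (@lebesgue_measure R).

Lemma surf_integralE (f : vel R -> \bar R) : measurable_fun setT f -> (forall x, 0 <= f x)%E ->
  (\int[surf]_s f s = 3%:E * \int[leb3]_(x in ball1) f (dir x))%E.
Proof.
move=> mf f0.
pose mu0 : {measure set (vel R) -> \bar R} := mrestr leb3 (@measurable_ball1 R).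
pose f' : {mfun (vel R) >-> (vel R)} := HB.pack (@dir R)
  (isMeasurableFun.Build _ _ _ _ _ (@measurable_dir R)).
have n3 : (0 : R) <= 3 by [].
pose mu1 : {measure set (vel R) -> \bar R} := pfw mu0 f'.
pose mu : {measure set (vel R) -> \bar R} := mscale (NngNum n3) mu1.
rewrite (@eq_measure_integral _ _ _ _ mu); last first.
  by move=> A mA _; rewrite [LHS]surfE.
apply: (etrans (ge0_integral_mscale mu1 measurableT (NngNum n3) mf (fun x _ => f0 x))).
apply: (congr1 (fun x => (3%:E * x)%E)).
rewrite -(integral_mrestr leb3 (@measurable_ball1 R) (f := fun x => f (dir x))); last 2 first.
- exact: measurableT_comp mf (@measurable_dir R).
- by move=> x; exact: f0.
exact: (ge0_integral_pushforward (@measurable_dir R) mu0 measurableT mf (fun x _ => f0 x)).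
Qed.

Variable kap : R.
Hypotheses (kap_gt0 : 0 < kap) (kap_lt1 : kap < 1).
Local Notation dyad x := (dyad kap x%R).

Let I (x : mR) : R := \1_(`[(-1), 1]%classic : set mR) x.

Let mI : measurable_fun setT I.
Proof. by apply: measurable_indic; exact: measurable_itv. Qed.

Let I01 x : 0 <= I x <= 1.
Proof. by rewrite /I indicE; case: (_ \in _); rewrite ?lexx ?ler01. Qed.

Let I0 x : (0 <= (I x)%:E)%E.
Proof. by rewrite lee_fin; have /andP[] := I01 x. Qed.

Let intI : (\int[leb]_x (I x)%:E = 2%:E)%E.
Proof.
have mA : measurable (`[(-1), 1]%classic : set mR) by exact: measurable_itv.
rewrite /I integral_indic// setIT.
apply: (etrans (lebesgue_measure_itv _)); by rewrite /= lte_fin ifT ?gtrN// -EFinD opprK.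
Qed.

(** A horizontal unit vector c orthogonal to w gives |s - w| >= |c.s|, which no longer involves w.
    The sphere is unfolded into the unit ball, where |c.[dir] x| >= |c.x|, and one of |c_1|, |c_2|
    is at least 1/2, so the one-dimensional bound applies in that coordinate. *)
Lemma sphere_dyad : exists2 K : R, 0 <= K & forall w : vel R,
  (\int[surf]_s dyad (enorm (s - w)) <= K%:E)%E.
Proof.
have [K0 K0_ge0 K0P] := integral_dyad kap_lt1.
exists (3 * ((2 * (K0 + 2)) * 2)); first by rewrite !mulr_ge0// addr_ge0.
move=> w.
have [c1 [c2 [cn c0]]] : exists c1 c2, c1 ^+ 2 + c2 ^+ 2 = 1 /\ c1 * w.1.1 + c2 * w.1.2 = 0.
  pose t := w.1.1 ^+ 2 + w.1.2 ^+ 2.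
  have [t0|t0] := eqVneq t 0.
    have a0 := sqr_ge0 w.1.1; have b0 := sqr_ge0 w.1.2.
    have /eqP : w.1.1 ^+ 2 = 0 by move: t0; rewrite /t; lra.
    by rewrite sqrf_eq0 => /eqP a; exists 1, 0; rewrite a; split; ring.
  have tp : 0 < t by rewrite lt_neqAle eq_sym t0 addr_ge0 ?sqr_ge0.
  have st : Num.sqrt t ^+ 2 = t by rewrite sqr_sqrtr// ltW.
  have st0 : Num.sqrt t != 0 by rewrite gt_eqF// sqrtr_gt0.
  exists (w.1.2 / Num.sqrt t), (- w.1.1 / Num.sqrt t); split; last by field.
  by rewrite !exprMn exprVn st sqrrN -mulrDl addrC divff.
have mD d (T : measurableType d) (f : T -> R) : measurable_fun setT f ->
  measurable_fun setT (fun x => dyad (f x)) by exact: mf_dyad.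
rewrite surf_integralE; last 2 first.
- by apply: mD; mfv.
- by move=> x; exact: dyad_ge0.
rewrite EFinM; apply: lee_wpmul2l; first by rewrite lee_fin.
pose g (p : mR * mR) := ((I p.1)%:E * (I p.2)%:E * dyad (c1 * p.1 + c2 * p.2))%E.
have mg : measurable_fun setT g.
  apply: emeasurable_funM; last by apply: mD; mf.
  apply: emeasurable_funM; apply/measurable_EFinP.
    exact: measurableT_comp mI measurable_fst.
  exact: measurableT_comp mI measurable_snd.
have g0 p : (0 <= g p)%E by rewrite !mule_ge0// dyad_ge0.
have gint : (\int[sfprod leb leb]_p g p <= (2 * (K0 + 2))%:E)%E.
  have [h1|h1] := leP 2^-1 `|c1|.
  - apply: (le_trans (le_eq (sf_fubini2 leb leb mg g0))).
    apply: (@le_trans _ _ (\int[leb]_y ((I y)%:E * (K0 + 2)%:E))%E).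
      apply: ge0_le_integral => //.
      + by move=> y _; apply: integral_ge0 => x _; exact: g0.
      + exact: measurable_fun_fubini_tonelli_G.
      + by apply: emeasurable_funM => //; exact/measurable_EFinP.
      move=> y _; rewrite (eq_integral (fun x : mR => (I y)%:E * ((I x)%:E * dyad (c1 * x + c2 * y)))%E); last first.
        by move=> x _; rewrite /g/= muleAC muleC muleA.
      rewrite ge0_integralZl//; last 2 first.
      + apply: emeasurable_funM; [exact/measurable_EFinP|apply: mD; mf].
      + by move=> x _; rewrite mule_ge0// dyad_ge0.
      apply: lee_wpmul2l => //; rewrite EFinD -intI.
      exact: (K0P I c1 (c2 * y) mI I01 h1).
    rewrite ge0_integralZr ?lee_fin ?addr_ge0//; last exact/measurable_EFinP.
    by rewrite intI -EFinM.
  - have h2 : 2^-1 <= `|c2|.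
      rewrite leNgt; apply/negP => h2.
      have := cn; rewrite -(real_normK (num_real c1)) -(real_normK (num_real c2)).
      have := normr_ge0 c1; have := normr_ge0 c2; nra.
    apply: (le_trans (le_eq (sf_fubini1 leb leb mg g0))).
    apply: (@le_trans _ _ (\int[leb]_x ((I x)%:E * (K0 + 2)%:E))%E).
      apply: ge0_le_integral => //.
      + by move=> y _; apply: integral_ge0 => x _; exact: g0.
      + exact: measurable_fun_fubini_tonelli_F.
      + by apply: emeasurable_funM => //; exact/measurable_EFinP.
      move=> y _; rewrite (eq_integral (fun x : mR => (I y)%:E * ((I x)%:E * dyad (c2 * x + c1 * y)))%E); last first.
        by move=> x _; rewrite /g/= muleA addrC.
      rewrite ge0_integralZl//; last 2 first.
      + apply: emeasurable_funM; [exact/measurable_EFinP|apply: mD; mf].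
      + by move=> x _; rewrite mule_ge0// dyad_ge0.
      apply: lee_wpmul2l => //; rewrite EFinD -intI.
      exact: (K0P I c2 (c1 * y) mI I01 h2).
    rewrite ge0_integralZr ?lee_fin ?addr_ge0//; last exact/measurable_EFinP.
    by rewrite intI -EFinM.
have mIE : measurable_fun setT (fun x => (I x)%:E) by exact/measurable_EFinP.
have tens := sf_int_tensor (sfprod leb leb) leb mg mIE g0 I0.
apply: (@le_trans _ _ (\int[leb3]_x (g x.1 * (I x.2)%:E))%E); last first.
  apply: (le_trans (le_eq tens)); rewrite intI EFinM; apply: lee_wpmul2r => //.
rewrite integral_mkcond; apply: ge0_le_integral => //.
- by move=> x _; rewrite patchE; case: ifP => // _; exact: dyad_ge0.
- apply/(measurable_restrictT _ (@measurable_ball1 R)); apply: measurable_funTS.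
  by apply: mD; mfv.
- apply: emeasurable_funM; first exact: measurableT_comp mg measurable_fst.
  exact: measurableT_comp mIE measurable_snd.
move=> x _; rewrite patchE; case: ifPn => [/set_mem /andP[x0 x1]|_]; last first.
  by rewrite mule_ge0.
have Ie (a : R) : `|a| <= enorm x -> I a = 1.
  move=> ha; rewrite /I indicE mem_set//= in_itv/= -ler_norml; exact: (le_trans ha).
rewrite /g (Ie _ (enorm_coord1 x)) (Ie _ (enorm_coord2 x)) (Ie _ (enorm_coord3 x)) !mul1e mule1.
apply: le_dyad; rewrite [leRHS]ger0_norm ?enorm_ge0//.
pose c : vel R := (c1, c2, 0).
have cnorm : enorm c = 1 by rewrite /enorm /dot/= mul0r addr0 -!expr2 cn sqrtr1.
have := dot_le c (dir x - w); rewrite cnorm mul1r; apply: le_trans.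
have -> : dot c (dir x - w) = (c1 * x.1.1 + c2 * x.1.2) / enorm x.
  have -> : dot c (dir x - w) = (c1 * x.1.1 + c2 * x.1.2) / enorm x - (c1 * w.1.1 + c2 * w.1.2).
    by rewrite /dot /c /dir/= /GRing.scale/=; ring.
  by rewrite c0 subr0.
rewrite normrM normfV (ger0_norm (enorm_ge0 x)) ler_pdivlMr// ler_piMr//.
Qed.

(** The integral over s is bounded uniformly in its centre by [sphere_dyad]. Then |v - w| >= |v_1 -
    w_1| leaves a one-dimensional singularity, integrated against the Gaussian in w_1. *)
Lemma schur_dyad (c : R) : 0 < c -> exists2 K : R, 0 <= K & forall (v : vel R) (e : R),
  (\int[sfprod leb3 surf]_q ((expR (- c * enorm q.1 ^+ 2))%:E * dyad (enorm (v - q.1)) *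
     dyad (enorm (q.2 - e *: dir (v - q.1)))) <= K%:E)%E.
Proof.
move=> c0; have [K0 K0_ge0 K0P] := integral_dyad kap_lt1.
have [K1 K1_ge0 K1P] := sphere_dyad.
pose G := gauss1 c; have G0 : 0 <= G by exact: gauss1_ge0.
exists (((K0 + G) * G * G) * K1); first by rewrite !mulr_ge0// addr_ge0.
move=> v e.
have mD d (T : measurableType d) (f : T -> R) : measurable_fun setT f ->
  measurable_fun setT (fun x => dyad (f x)) by exact: mf_dyad.
have mexp : measurable_fun setT (fun x : mR => (expR (- c * x ^+ 2))%:E).
  by apply/measurable_EFinP; apply: mf_expR; mf.
have exp0 (x : R) : (0 <= (expR x)%:E)%E by rewrite lee_fin expR_ge0.
set F := (fun q : vel R * vel R => _).
have mF : measurable_fun setT F.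
  apply: emeasurable_funM; last by apply: mD; mfv.
  apply: emeasurable_funM; last by apply: mD; mfv.
  by apply/measurable_EFinP; apply: mf_expR; mfv.
have F0 q : (0 <= F q)%E by rewrite !mule_ge0// dyad_ge0.
apply: (le_trans (le_eq (sf_fubini1 leb3 surf mF F0))).
pose g1 (x : mR) := ((expR (- c * x ^+ 2))%:E * dyad (-1 * x + v.1.1))%E.
have mg1 : measurable_fun setT g1 by apply: emeasurable_funM => //; apply: mD; mf.
have g10 x : (0 <= g1 x)%E by rewrite mule_ge0// dyad_ge0.
pose g2 (p : mR * mR) := (g1 p.1 * (expR (- c * p.2 ^+ 2))%:E)%E.
have mg2 : measurable_fun setT g2.
  by apply: emeasurable_funM; [exact: measurableT_comp mg1 measurable_fst|exact: measurableT_comp mexp measurable_snd].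
have g20 x : (0 <= g2 x)%E by rewrite mule_ge0.
have int1 : (\int[leb]_x g1 x <= (K0 + G)%:E)%E.
  rewrite EFinD -gauss1E//; apply: (K0P (fun x => expR (- c * x ^+ 2)) (-1) v.1.1).
  - by apply: mf_expR; mf.
  - by move=> x; rewrite expR_ge0 -expR0 ler_expR mulNr oppr_le0 mulr_ge0 ?sqr_ge0// ltW.
  - by rewrite normrN1 invf_le1// ler1n.
have int2 : (\int[sfprod leb leb]_x g2 x <= ((K0 + G) * G)%:E)%E.
  apply: (le_trans (le_eq (sf_int_tensor leb leb mg1 mexp g10 (fun x => exp0 _)))).
  by rewrite gauss1E// EFinM; apply: lee_wpmul2r.
have int3 : (\int[leb3]_w (g2 w.1 * (expR (- c * w.2 ^+ 2))%:E) <= ((K0 + G) * G * G)%:E)%E.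
  apply: (le_trans (le_eq (sf_int_tensor (sfprod leb leb) leb mg2 mexp g20 (fun x => exp0 _)))).
  by rewrite gauss1E// [in leRHS]EFinM; apply: lee_wpmul2r.
have m3 : measurable_fun setT (fun w : vel R => (g2 w.1 * (expR (- c * w.2 ^+ 2))%:E)%E).
  by apply: emeasurable_funM; [exact: measurableT_comp mg2 measurable_fst|exact: measurableT_comp mexp measurable_snd].
apply: (@le_trans _ _ (\int[leb3]_w ((g2 w.1 * (expR (- c * w.2 ^+ 2))%:E) * K1%:E))%E); last first.
  rewrite ge0_integralZr//; last by move=> w _; rewrite mule_ge0.
  by rewrite [leRHS]EFinM; apply: lee_wpmul2r.
apply: ge0_le_integral; first exact: measurableT.
- by move=> w _; apply: integral_ge0 => s _; exact: F0.
- exact: measurable_fun_fubini_tonelli_F.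
- by apply: emeasurable_funM.
move=> w _; rewrite /F/= ge0_integralZl//; last 3 first.
- by apply: mD; mfv.
- by move=> s _; exact: dyad_ge0.
- by rewrite mule_ge0// dyad_ge0.
have K1' := K1P (e *: dir (v - w)).
apply: lee_pmul => //.
- by rewrite mule_ge0// dyad_ge0.
- by apply: integral_ge0 => s _; exact: dyad_ge0.
rewrite expR_enorm /g2 /g1 !EFinM -!muleA; apply: lee_wpmul2l => //.
rewrite muleA muleC; apply: lee_wpmul2r; first by rewrite mule_ge0.
apply: le_dyad; rewrite mulN1r addrC [leRHS]ger0_norm ?enorm_ge0//.
exact: (enorm_coord1 (v - w)).
Qed.

End sphere_weight.

(** * Measures with a density, and their images *)

Section densities.
Context {R : realType} d (T : measurableType d).
Variable m : {sigma_finite_measure set T -> \bar R}.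

(** The integral formula follows by identifying the Radon-Nikodym derivative of the new measure with
    w almost everywhere. *)
Lemma density_measure (w : T -> R) : (forall x, 0 <= w x) -> m.-integrable setT (EFin \o w) ->
  exists mu : {finite_measure set T -> \bar R},
    (forall A, measurable A -> mu A = \int[m]_(x in A) (w x)%:E)%E /\
    (forall f : T -> \bar R, measurable_fun setT f -> (forall x, 0 <= f x)%E ->
       \int[mu]_x f x = \int[m]_x (f x * (w x)%:E))%E.
Proof.
move=> w0 iw; have mw : measurable_fun setT (EFin \o w) by case/integrableP : iw.
pose md (A : set T) : \bar R := (\int[m]_(x in A) (w x)%:E)%E.
have md0 : md set0 = 0%E by rewrite /md integral_set0.
have md_ge0 A : (0 <= md A)%E by apply: integral_ge0 => x _; rewrite lee_fin.
have md_sa : semi_sigma_additive md.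
  move=> F mF tF mU; rewrite /md ge0_integral_bigcup//; last 2 first.
  - exact: measurable_funTS.
  - by move=> x _; rewrite lee_fin.
  apply: is_cvg_nneseries => k _ _; exact: md_ge0.
have mdfin : fin_num_fun md.
  move=> A mA; rewrite ge0_fin_numE//; apply: (@le_lt_trans _ _ (\int[m]_x (w x)%:E)%E).
    by apply: ge0_subset_integral => // x _; rewrite lee_fin.
  case/integrableP : iw => _; apply: le_lt_trans; apply: ge0_le_integral => //.
  - by move=> x _; rewrite lee_fin.
  - exact: measurableT_comp.
  - by move=> x _; rewrite lee_fin ler_norm.
pose md1 : {measure set T -> \bar R} := HB.pack md (isMeasure.Build _ _ _ md md0 md_ge0 md_sa).
pose mu : {finite_measure set T -> \bar R} := HB.pack (md1 : set T -> \bar R) (Measure.on md1)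
  (Measure_isFinite.Build _ _ _ md1 mdfin).
exists mu; split => // f mf f0.
have dom : mu `<< m.
  apply/null_content_dominatesP => A mA A0.
  by rewrite -[LHS]/(md A) /md null_set_integral//; exact: measurable_funTS.
rewrite -(Radon_Nikodym_SigmaFinite.change_of_variables dom f0 measurableT mf).
set g := Radon_Nikodym_SigmaFinite.f mu m.
have ig : m.-integrable setT g := Radon_Nikodym_SigmaFinite.f_integrable dom.
have gw : ae_eq m setT g (EFin \o w).
  apply: integral_ae_eq => // E _ mE.
  by rewrite -(Radon_Nikodym_SigmaFinite.f_integral dom).
apply: ae_eq_integral => //.
- by apply: emeasurable_funM => //; case/integrableP : ig.
- exact: emeasurable_funM.
- by apply: filterS gw => x h _; rewrite h.
Qed.

Lemma law_density d' (Z : measurableType d') (psi : T -> Z) (w : T -> R) :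
  measurable_fun setT psi -> (forall x, 0 <= w x) -> m.-integrable setT (EFin \o w) ->
  exists mu : {finite_measure set Z -> \bar R},
    (forall A, measurable A -> mu A = \int[m]_(x in psi @^-1` A) (w x)%:E)%E /\
    (forall f : Z -> R, measurable_fun setT f ->
       \int[mu]_x f x = \int[m]_x (f (psi x) * w x)).
Proof.
move=> mpsi w0 iw; have [mu0 [mu0E mu0I]] := density_measure w0 iw.
pose psi' : {mfun T >-> Z} := HB.pack psi (isMeasurableFun.Build _ _ _ _ _ mpsi).
pose mu1 : {measure set Z -> \bar R} := pfw mu0 psi'.
have fin1 : fin_num_fun mu1.
  move=> A mA; rewrite -[mu1 A]/(mu0 (psi @^-1` A)) fin_num_measure//.
  by rewrite -[X in measurable X]setTI; exact: (mpsi measurableT A mA).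
pose mu : {finite_measure set Z -> \bar R} := HB.pack (mu1 : set Z -> \bar R) (Measure.on mu1)
  (Measure_isFinite.Build _ _ _ mu1 fin1).
exists mu; split.
  move=> A mA; rewrite -mu0E//.
  by rewrite -[X in measurable X]setTI; exact: (mpsi measurableT A mA).
move=> f mf.
have mff : measurable_fun setT (fun x => f (psi x)) by exact: measurableT_comp mf mpsi.
have -> : \int[m]_x (f (psi x) * w x) = \int[mu0]_x f (psi x).
  exact: (integral_density (h := w) w0 mu0I mff).
have mp1 : mp mu0 mu psi by split.
exact/esym/(mp_Rintegral mp1 mf).
Qed.

End densities.

Lemma restr_finite {R : realType} d (T : measurableType d) (m : {measure set T -> \bar R}) (D : set T) :
  measurable D -> (m D < +oo)%E ->
  exists mu : {finite_measure set T -> \bar R}, [/\ forall B, mu B = m (B `&` D),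
    forall h : T -> R, measurable_fun setT h -> \int[mu]_x h x = \int[m]_x (h x * \1_D x)
  & forall h : T -> R, sqi m h -> sqi mu h /\ L2ip mu h h <= L2ip m h h].
Proof.
move=> mD mDfin; pose m1 : {measure set T -> \bar R} := mrestr m mD.
have m1fin : fin_num_fun m1.
  move=> B mB; rewrite ge0_fin_numE//; apply: le_lt_trans mDfin.
  rewrite -[m1 B]/(m (B `&` D)); apply: le_measure; rewrite ?inE.
  - exact: measurableI.
  - exact: mD.
  - exact: subIsetr.
pose mu : {finite_measure set T -> \bar R} := HB.pack (m1 : set T -> \bar R) (Measure.on m1)
  (Measure_isFinite.Build _ _ _ m1 m1fin).
have mI : measurable_fun setT (\1_D : T -> R) by exact: measurable_indic.
have muI (f : T -> \bar R) : measurable_fun setT f -> (forall x, 0 <= f x)%E ->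
    (\int[mu]_x f x = \int[m]_x (f x * (\1_D x)%:E))%E.
  move=> mf f0; apply: (etrans (integral_mrestr m mD mf f0)).
  rewrite integral_mkcond; apply: eq_integral => x _; rewrite patchE indicE.
  by case: (x \in D); rewrite ?mule1 ?mule0.
exists mu; split => //.
  move=> h mh; exact/esym/(integral_density (h := \1_D) _ muI mh).
move=> h sh; have mh := sh.1.
have mh2 : measurable_fun setT (fun x => (h x ^+ 2)%:E) by apply/measurable_EFinP; mf.
have le : (\int[mu]_x (h x ^+ 2)%:E <= \int[m]_x (h x ^+ 2)%:E)%E.
  rewrite muI//; last by move=> x; rewrite lee_fin sqr_ge0.
  apply: ge0_le_integral => //.
  - by move=> x _; rewrite mule_ge0// lee_fin// sqr_ge0.
  - by apply: emeasurable_funM => //; exact/measurable_EFinP.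
  - by move=> x _; rewrite -EFinM lee_fin ler_piMr ?sqr_ge0// indicE; case: (_ \in _).
have smu : sqi mu h by split => //; apply: le_lt_trans le _; exact: sh.2.
by split => //; rewrite -lee_fin !L2ipE.
Qed.

Lemma mul_le_half_sqr {R : realType} (x y : R) : x * y <= 2^-1 * (x ^+ 2 + y ^+ 2).
Proof. by have := sqr_ge0 (x - y); rewrite sqrrB; lra. Qed.

Section finite_rank_cross_term.
Context {R : realType} d1 d2 (T : measurableType d1) (V : measurableType d2).
Variables (m : {sigma_finite_measure set T -> \bar R}) (nu : {sigma_finite_measure set V -> \bar R}).

(** On A the weight and the joint law of (x, y) are bounded and both points stay in a set of finite
    measure, so [bounded_law_finite_rank] applies with e / 2. Off A, 2 |F G| <= F^2 + G^2 and the
    two Schur bounds contribute the other e / 2. *)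
Lemma cross_term_finite_rank (W : T -> R) (x y : T -> V) (A : set T) (E : set V) (C e : R) :
  measurable_fun setT W -> (forall p, 0 <= W p) ->
  measurable_fun setT x -> measurable_fun setT y ->
  measurable E -> (nu E < +oo)%E -> 0 < e -> measurable A -> 0 <= C ->
  (forall p, A p -> [/\ E (x p), E (y p) & W p <= C]) ->
  (forall Z, measurable Z -> (m (A `&` [set p | Z (x p, y p)]) <= C%:E * sfprod nu nu Z)%E) ->
  (forall F, sqi nu F -> (\int[m]_p (W p * \1_(~` A) p * F (x p) ^+ 2)%:E <= (e * L2ip nu F F)%:E)%E) ->
  (forall G, sqi nu G -> (\int[m]_p (W p * \1_(~` A) p * G (y p) ^+ 2)%:E <= (e * L2ip nu G G)%:E)%E) ->
  exists N : nat, exists K : R, exists a : nat -> V -> R, exists b : nat -> V -> R,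
    [/\ 0 < K, forall k, sqi nu (a k), forall k, sqi nu (b k)
      & forall F G, sqi nu F -> sqi nu G ->
        m.-integrable setT (EFin \o (fun p => W p * (F (x p) * G (y p)))) ->
        `|\int[m]_p (W p * (F (x p) * G (y p)))| <=
        e * (L2ip nu F F + L2ip nu G G) +
        K * \sum_(k < N) (L2ip nu F (a k) ^+ 2 + L2ip nu G (b k) ^+ 2)].
Proof.
move=> mW W0 mx my mE Efin e0 mA C0 AP AZ b1 b2; have e2 : 0 < e / 2 by rewrite divr_gt0.
pose psi p : V * V := (x p, y p).
have mpsi : measurable_fun setT psi by exact: mf_pair.
pose w p := W p * \1_A p.
have mIA : measurable_fun setT (\1_A : T -> R) by exact: measurable_indic.
have mw : measurable_fun setT w by exact: measurable_funM.
have w0 p : 0 <= w p by rewrite mulr_ge0// indicE.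
have wC p : w p <= C * \1_A p.
  rewrite /w indicE; case: (boolP (p \in A)) => [/set_mem/AP[_ _ h]|_]; last by rewrite !mulr0.
  by rewrite !mulr1.
have [m1f [m1E restrI sqi1]] := restr_finite mE Efin.
have leb6box : (sfprod nu nu (E `*` E) < +oo)%E.
  apply: (eq_lte (sfprodE nu nu mE mE)).
  by rewrite lte_mul_pinfty// ?Efin// ge0_fin_numE ?Efin.
have mbox2 : measurable (E `*` E) by exact: measurableX.
have m11E Z : measurable Z -> sfprod m1f m1f Z = sfprod nu nu (Z `&` (E `*` E)).
  move=> mZ; pose mr : {measure set (V * V)%type -> \bar R} := mrestr (sfprod nu nu) mbox2.
  apply: (sf_unique (m' := mr)); last exact: mZ.
  move=> B B' mB mB'.
  rewrite -[LHS]/(sfprod nu nu ((B `*` B') `&` (E `*` E))) -setXI.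
  apply: (etrans _ (esym (congr2 (fun x y => (x * y)%E) (m1E B) (m1E B')))).
  exact: (sfprodE nu nu (measurableI _ _ mB mE) (measurableI _ _ mB' mE)).
have Aebox : A `<=` [set p | (E `*` E) (psi p)].
  by move=> p /AP[h1 h2 _]; split.
have iw : m.-integrable setT (EFin \o w).
  apply/integrableP; split; first exact/measurable_EFinP.
  apply: (@le_lt_trans _ _ (\int[m]_p (C%:E * (\1_A p)%:E))%E).
    apply: ge0_le_integral.
    - exact: measurableT.
    - by move=> p _; exact: abse_ge0.
    - by apply: measurableT_comp => //; exact/measurable_EFinP.
    - by apply: emeasurable_funM => //; exact/measurable_EFinP.
    - by move=> p _; rewrite /= ger0_norm// -EFinM lee_fin.
  rewrite ge0_integralZl_EFin//; last exact/measurable_EFinP.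
  rewrite integral_indic// setIT lte_mul_pinfty//.
  have := AZ _ mbox2; rewrite (_ : A `&` _ = A); last exact/setIidPl.
  by move=> h; apply: (le_lt_trans h); rewrite lte_mul_pinfty.
have [mu [muE muI]] := law_density mpsi w0 iw.
(* One factor C bounds the weight on A, the other the joint law. *)
have muC Z : measurable Z -> (mu Z <= (C * C)%:E * sfprod m1f m1f Z)%E.
  move=> mZ; have mZb : measurable (Z `&` (E `*` E)) by exact: measurableI.
  rewrite muE// (m11E Z mZ).
  have mpZ B : measurable B -> measurable (psi @^-1` B).
    by move=> mB; rewrite -[X in measurable X]setTI; exact: (mpsi measurableT B mB).
  apply: (@le_trans _ _ (\int[m]_p (C%:E * (\1_(A `&` (psi @^-1` (Z `&` (E `*` E)))) p)%:E))%E).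
    rewrite integral_mkcond; apply: ge0_le_integral.
    - exact: measurableT.
    - by move=> p _; rewrite patchE; case: ifP => // _; rewrite lee_fin.
    - apply/(measurable_restrictT _ (mpZ _ mZ)); apply: measurable_funTS; exact/measurable_EFinP.
    - apply: emeasurable_funM => //; apply/measurable_EFinP; apply: measurable_indic.
      by apply: measurableI => //; exact: mpZ.
    - move=> p _; rewrite patchE; case: ifPn => [/set_mem Zp|_]; last by rewrite mule_ge0 ?lee_fin ?indicE.
      rewrite -EFinM lee_fin; apply: (le_trans (wC p)); apply: ler_wpM2l => //.
      rewrite !indicE ler_nat; case: (boolP (p \in A)) => // /set_mem Ap.
      by rewrite mem_set//; split => //; split => //; exact: Aebox.
  rewrite ge0_integralZl_EFin//; last first.
    apply/measurable_EFinP; apply: measurable_indic; apply: measurableI => //; exact: mpZ.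
  rewrite integral_indic; [|exact: measurableT|by apply: measurableI => //; exact: mpZ].
  rewrite setIT EFinM -muleA; apply: lee_wpmul2l; first by rewrite lee_fin.
  exact: AZ.
have [N [K [a [b [K0 ma mb le]]]]] := bounded_law_finite_rank muC (mulr_ge0 C0 C0) e2.
have mab k : measurable (a k `&` E) by exact: measurableI.
have mbE k : measurable (b k `&` E) by exact: measurableI.
have sqi_box B : measurable B -> sqi nu (\1_(B `&` E) : V -> R).
  move=> mB; have mBI : measurable (B `&` E) by exact: measurableI.
  split; first exact: measurable_indic.
  rewrite (eq_integral (fun x : V => (\1_(B `&` E) x)%:E)); last first.
    by move=> p _; rewrite indicE; case: (_ \in _); rewrite ?expr1n ?expr0n.
  rewrite integral_indic// setIT; apply: le_lt_trans (Efin).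
  by apply: le_measure; rewrite ?inE//; exact: subIsetr.
exists N, K, (fun k => \1_(a k `&` E)), (fun k => \1_(b k `&` E)).
split; [by []|by move=> k; exact: sqi_box|by move=> k; exact: sqi_box|].
move=> F G sF sG iWFG.
have [sF1 F1le] := sqi1 F sF; have [sG1 G1le] := sqi1 G sG.
have L1 h B : measurable_fun setT h -> measurable B ->
    L2ip m1f h \1_B = L2ip nu h \1_(B `&` E).
  move=> mh mB; rewrite /L2ip restrI; last by apply: measurable_funM => //; exact: measurable_indic.
  by apply: eq_Rintegral => v _; rewrite indicI -mulrA.
have {}le := le F G sF1 sG1.
have mFG : measurable_fun setT (fun q : V * V => F q.1 * G q.2).
  exact: mf_tensor sF.1 sG.1.
rewrite (muI _ mFG) in le.
pose f p := W p * (F (x p) * G (y p)).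
have mf : measurable_fun setT f by case/integrableP : iWFG => /measurable_EFinP.
pose fA p := F (psi p).1 * G (psi p).2 * w p.
pose fB p := W p * \1_(~` A) p * (F (x p) * G (y p)).
have fAB p : f p = fA p + fB p.
  have hI : \1_(~` A) p = 1 - \1_A p :> R.
    by rewrite !indicE in_setC; case: (_ \in A); rewrite /= ?subrr ?subr0.
  by rewrite /f /fA /fB hI /w /psi/=; ring.
have mIC : measurable_fun setT (\1_(~` A) : T -> R) by apply: measurable_indic; exact: measurableC.
have mfA : measurable_fun setT fA by apply: measurable_funM => //; exact: measurableT_comp mFG mpsi.
have mfB : measurable_fun setT fB.
  apply: measurable_funM; first exact: measurable_funM.
  exact: measurableT_comp mFG mpsi.
have ind1 (B : set T) p : `|\1_B p| <= 1 :> R by rewrite indicE; case: (_ \in _); rewrite ?normr1 ?normr0.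
have iN : m.-integrable setT (EFin \o (fun p => `|W p * (F (x p) * G (y p))|)).
  exact: (integrable_norm iWFG).
have ifA : m.-integrable setT (EFin \o fA).
  apply: (integrable_le mfA iN) => p; rewrite /fA /w /psi/=.
  rewrite (_ : F (x p) * G (y p) * (W p * \1_A p) = \1_A p * (W p * (F (x p) * G (y p)))); last by ring.
  by rewrite normrM ler_piMl.
have ifB : m.-integrable setT (EFin \o fB).
  apply: (integrable_le mfB iN) => p; rewrite /fB.
  rewrite (_ : W p * \1_(~` A) p * (F (x p) * G (y p)) = \1_(~` A) p * (W p * (F (x p) * G (y p)))); last by ring.
  by rewrite normrM ler_piMl.
have -> : \int[m]_p f p = \int[m]_p fA p + \int[m]_p fB p.
  by rewrite -(RintegralDR ifA ifB); apply: eq_Rintegral => p _; exact: fAB.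
pose Wb p := W p * \1_(~` A) p.
have mWb : measurable_fun setT Wb by exact: measurable_funM.
have Wb0 p : 0 <= Wb p by rewrite mulr_ge0// indicE.
have mF1 : measurable_fun setT (fun p => F (x p)) by exact: (measurableT_comp sF.1 mx).
have mG1 : measurable_fun setT (fun p => G (y p)) by exact: (measurableT_comp sG.1 my).
have mWF2 : measurable_fun setT (fun p => (Wb p * F (x p) ^+ 2)%:E).
  by apply/measurable_EFinP; apply: (measurable_funM mWb); mf.
have mWG2 : measurable_fun setT (fun p => (Wb p * G (y p) ^+ 2)%:E).
  by apply/measurable_EFinP; apply: (measurable_funM mWb); mf.
have {}b1 := b1 F sF; have {}b2 := b2 G sG.
have BB : `|\int[m]_p fB p| <= e / 2 * (L2ip nu F F + L2ip nu G G).
  apply: (le_trans (le_normr_Rintegral measurableT ifB)).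
  rewrite -lee_fin /Rintegral fineK; last first.
    by apply: integrable_fin_num => //; exact: integrable_norm.
  apply: (@le_trans _ _ (\int[m]_p ((2^-1)%:E * ((Wb p * F (x p) ^+ 2)%:E + (Wb p * G (y p) ^+ 2)%:E)))%E).
    apply: ge0_le_integral.
    - exact: measurableT.
    - by move=> p _; rewrite lee_fin.
    - by apply/measurable_EFinP; exact: mf_norm.
    - by apply: measurable_funeM; exact: emeasurable_funD mWF2 mWG2.
    - move=> p _; rewrite -EFinD -EFinM lee_fin /fB -/(Wb p) normrM (ger0_norm (Wb0 p)) normrM.
      rewrite -mulrDr [leRHS]mulrCA; apply: ler_wpM2l => //.
      rewrite -(real_normK (num_real (F (x p)))) -(real_normK (num_real (G (y p)))).
      exact: mul_le_half_sqr.
  rewrite ge0_integralZl_EFin//; last 2 first.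
  - by move=> p _; rewrite adde_ge0// lee_fin mulr_ge0 ?sqr_ge0.
  - exact: emeasurable_funD mWF2 mWG2.
  rewrite ge0_integralD; last 5 first.
  - exact: measurableT.
  - by move=> p _; rewrite lee_fin mulr_ge0 ?sqr_ge0.
  - exact: mWF2.
  - by move=> p _; rewrite lee_fin mulr_ge0 ?sqr_ge0.
  - exact: mWG2.
  rewrite [e / 2]mulrC -mulrA EFinM; apply: lee_wpmul2l; first by rewrite lee_fin.
  by rewrite mulrDr EFinD; exact: leeD.
apply: (le_trans (ler_normD _ _)).
have AA : `|\int[m]_p fA p| <= e / 2 * (L2ip nu F F + L2ip nu G G) +
   K * \sum_(k < N) (L2ip nu F \1_(a k `&` E) ^+ 2 + L2ip nu G \1_(b k `&` E) ^+ 2).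
  apply: (le_trans le); apply: lerD.
    by apply: ler_wpM2l; [exact: ltW|exact: lerD].
  apply: ler_wpM2l; first exact: ltW.
  by apply: ler_sum => k _; rewrite !L1//; [exact: sG.1|exact: sF.1].
by apply: (le_trans (lerD AA BB)); rewrite addrAC -mulrDl -splitr.
Qed.

End finite_rank_cross_term.

(** * Compactness of weighted cross terms *)

Section weighted_compact.
Context {R : realType}.
Local Notation trip := (vel R * vel R * vel R)%type.
Local Notation Pi3 := (sfprod (sfprod leb3 leb3) (@surf R)).

Definition ebox (b : R) : set (vel R) := [set v | enorm v <= b].

Lemma measurable_ebox b : measurable (ebox b).
Proof.
rewrite (_ : ebox b = (fun v => enorm v <= b) @^-1` [set true]); last by apply/seteqP; split.
rewrite -[X in measurable X]setTI; apply: measurable_fun_ler => //; apply: mf_enorm; mfv.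
Qed.

Lemma leb3_ebox b : (leb3 (ebox b) < +oo)%E.
Proof.
pose I : set (measurableTypeR R) := `[(- b), b]%classic.
have mI : measurable I by exact: measurable_itv.
apply: (@le_lt_trans _ _ (leb3 (I `*` I `*` I))).
  apply: le_measure; rewrite ?inE.
  - exact: measurable_ebox.
  - by do !apply: measurableX.
  move=> v vb; have h (x : R) : `|x| <= enorm v -> I x.
    by move=> xv; rewrite /I/= in_itv/= -ler_norml (le_trans xv).
  by split; [split|]; apply: h; [exact: enorm_coord1|exact: enorm_coord2|exact: enorm_coord3].
rewrite leb3_box//.
have hI : (lebesgue_measure I < +oo)%E.
  by rewrite /I lebesgue_measure_itv/=; case: ifP => _; rewrite ?ltry// -EFinD ltry.
have hf : lebesgue_measure I \is a fin_num by rewrite ge0_fin_numE.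
by rewrite lte_mul_pinfty// ?mule_ge0// ?fin_numM.
Qed.

Lemma schur_bound (W : trip -> R) (F : vel R -> R) (S : R) : measurable_fun setT W ->
  (forall p, 0 <= W p) -> 0 <= S ->
  (forall v, (\int[sfprod leb3 surf]_q (W (v, q.1, q.2))%:E <= S%:E)%E) -> sqi leb3 F ->
  (\int[Pi3]_p (W p * F p.1.1 ^+ 2)%:E <= (S * L2ip leb3 F F)%:E)%E.
Proof.
move=> mW W0 S0 WS sF; have mF := sF.1.
have mWF : measurable_fun setT (fun p : trip => W p * F p.1.1 ^+ 2).
  have mF1 : measurable_fun setT (fun p : trip => F p.1.1) by apply: (measurableT_comp mF); mfv.
  by apply: measurable_funM => //; mf.
apply: (le_trans (le_eq (Pi3_fubini mWF _))); first by move=> p; rewrite mulr_ge0 ?sqr_ge0.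
rewrite EFinM L2ipE// -ge0_integralZl_EFin//; last 2 first.
- by move=> x _; rewrite lee_fin sqr_ge0.
- by apply/measurable_EFinP; mf.
have mWq v : measurable_fun setT (fun q : vel R * vel R => W (v, q.1, q.2)).
  by apply: (measurableT_comp mW); mfv.
have e v : (\int[sfprod leb3 surf]_q (W (v, q.1, q.2) * F v ^+ 2)%:E =
    (F v ^+ 2)%:E * \int[sfprod leb3 surf]_q (W (v, q.1, q.2))%:E)%E.
  rewrite -ge0_integralZl_EFin ?sqr_ge0//; last 2 first.
  - by move=> q _; rewrite lee_fin.
  - exact/measurable_EFinP.
  by apply: eq_integral => q _; rewrite -EFinM mulrC.
apply: ge0_le_integral.
- exact: measurableT.
- by move=> v _; apply: integral_ge0 => q _; rewrite lee_fin mulr_ge0 ?sqr_ge0.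
- have mas : measurable_fun setT (fun t : vel R * (vel R * vel R) => W (t.1, t.2.1, t.2.2) * F t.1 ^+ 2).
    have mF1 : measurable_fun setT (fun p : vel R * (vel R * vel R) => F p.1).
      by apply: (measurableT_comp mF); mfv.
    by apply: measurable_funM; [apply: (measurableT_comp mW); mfv|mf].
  by apply: (measurable_fubini1R (sfprod leb3 surf) mas) => t; rewrite mulr_ge0 ?sqr_ge0.
- by apply: emeasurable_funM => //; apply/measurable_EFinP; mf.
- by move=> v _; rewrite e muleC; apply: lee_wpmul2r; rewrite ?lee_fin ?sqr_ge0.
Qed.

Definition tsnd (tau : trip -> trip) (p : trip) : vel R := (tau p).1.1.

(** Quantitative compactness of the bilinear form attached to W and tau: up to an arbitrarily small
    multiple of the norms it is controlled by finitely many L^2 functionals. *)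
Definition cross_cpt (W : trip -> R) (tau : trip -> trip) : Prop :=
  forall e, 0 < e -> exists N : nat, exists K : R, exists a : nat -> vel R -> R,
    exists b' : nat -> vel R -> R,
    [/\ 0 < K, forall k, sqi leb3 (a k), forall k, sqi leb3 (b' k)
      & forall F G, sqi leb3 F -> sqi leb3 G ->
        Pi3.-integrable setT (EFin \o (fun p => W p * (F p.1.1 * G (tsnd tau p)))) ->
        `|\int[Pi3]_p (W p * (F p.1.1 * G (tsnd tau p)))| <=
        e * (L2ip leb3 F F + L2ip leb3 G G) +
        K * \sum_(k < N) (L2ip leb3 F (a k) ^+ 2 + L2ip leb3 G (b' k) ^+ 2)].

(** The Schur bound in the second velocity is the one in the first velocity for the weight composed
    with tau, since tau is a measure-preserving involution. *)
Lemma weighted_compact (W : trip -> R) (tau : trip -> trip) :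
  measurable_fun setT W -> (forall p, 0 <= W p) -> mp Pi3 Pi3 tau ->
  (forall p, tau (tau p) = p) ->
  (forall e, 0 < e -> exists A : set trip, exists b : R, exists C : R,
    [/\ measurable A, 0 <= C,
      forall p, A p -> [/\ enorm p.1.1 <= b, enorm (tsnd tau p) <= b & W p <= C],
      forall Z, measurable Z ->
        (Pi3 (A `&` [set p | Z (p.1.1, tsnd tau p)]) <= C%:E * sfprod leb3 leb3 Z)%E
    & forall v, (\int[sfprod leb3 surf]_q (W (v, q.1, q.2) * \1_(~` A) (v, q.1, q.2))%:E <= e%:E)%E /\
       (\int[sfprod leb3 surf]_q (W (tau (v, q.1, q.2)) * \1_(~` A) (tau (v, q.1, q.2)))%:E <= e%:E)%E]) ->
  cross_cpt W tau.
Proof.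
move=> mW W0 mpt tK H e e0; have [A [bb [C [mA C0 AP AZ Asch]]]] := H _ e0.
have mt := mpt.1.
have my : measurable_fun setT (tsnd tau) by rewrite /tsnd; apply: mf_fst; apply: mf_fst.
have mx : measurable_fun setT (fun p : trip => p.1.1) by mfv.
pose Wb p := W p * \1_(~` A) p.
have mWb : measurable_fun setT Wb.
  by apply: measurable_funM mW _; apply: measurable_indic; exact: measurableC.
have Wb0 p : 0 <= Wb p by rewrite mulr_ge0// indicE.
have mWbt : measurable_fun setT (fun p => Wb (tau p)) by exact: measurableT_comp mWb mt.
apply: (@cross_term_finite_rank R _ _ _ _ Pi3 leb3 W (fun p => p.1.1) (tsnd tau) A (ebox bb) C e mW W0
  mx my (measurable_ebox bb) (leb3_ebox bb) e0 mA C0 AP AZ) => [F sF|G sG].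
  exact: (schur_bound mWb Wb0 (ltW e0) (fun v => (Asch v).1) sF).
have := schur_bound mWbt (fun p => Wb0 _) (ltW e0) (fun v => (Asch v).2) sG.
apply: le_trans; apply: le_eq.
have mg : measurable_fun setT (fun p => (Wb (tau p) * G p.1.1 ^+ 2)%:E).
  have mG1 := measurableT_comp sG.1 mx.
  by apply/measurable_EFinP; apply: (measurable_funM mWbt); exact: measurable_funX.
rewrite -(mp_ge0_integral mpt mg); last by move=> p; rewrite lee_fin mulr_ge0 ?sqr_ge0.
by apply: eq_integral => p _; rewrite tK.
Qed.

End weighted_compact.

(** * Pointwise estimates of the weights *)

Section weight_estimates.
Context {R : realType}.

Lemma powR_cvg0 (a t : R) : 0 < a -> 0 < t -> exists2 m0, 0 < m0 & forall m, m0 <= m -> m `^ (- a) <= t.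
Proof.
move=> a0 t0; exists (t `^ (- a^-1)); first by rewrite powR_gt0.
move=> m hm; have m0 : 0 < m by apply: lt_le_trans hm; rewrite powR_gt0.
rewrite powRN -[leRHS]invrK lef_pV2 ?posrE ?invr_gt0 ?powR_gt0//.
apply: (@le_trans _ _ ((t `^ (- a^-1)) `^ a)).
  by rewrite -powRrM mulNr mulVf ?gt_eqF// powR_inv1// ltW.
by apply: ge0_ler_powR => //; rewrite ?nnegrE ?powR_ge0 ?ltW.
Qed.

Lemma powR_half (a : R) : a <= 1 -> (2^-1 : R) `^ (- a) <= 2.
Proof.
move=> a1; rewrite powRN -[leRHS]invrK lef_pV2 ?posrE ?invr_gt0 ?powR_gt0//.
rewrite -[leLHS]powRr1//; apply: ger_powR => //.
by rewrite invr_gt0 ltr0n invf_le1// ler1n.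
Qed.

Lemma powRN_le1 (u a : R) : 1 <= u -> 0 <= a -> u `^ (- a) <= 1.
Proof.
by move=> u1 a0; rewrite -(powRr0 u); apply: ler_powR => //; rewrite oppr_le0.
Qed.

Lemma powRN_ge1 (u a : R) : 0 < u -> u <= 1 -> 0 <= a -> 1 <= u `^ (- a).
Proof.
by move=> u0 u1 a0; rewrite -{1}(powRr0 u); apply: ger_powR; rewrite ?u0// oppr_le0.
Qed.

(** Each regime supplies a small factor: r^-del for large r; rh^(kap - del), left over when the
    exponent del is raised to kap, for small rh; half of the Gaussian for large |w|. The threshold m
    adds the three requirements. *)
Lemma weight_real (del kap C eta : R) : 0 < del -> del < kap -> kap < 1 -> 0 < C -> 0 < eta ->
  exists2 m, 1 <= m & forall r t rh w2 : R, 0 < r -> 0 <= t -> 0 <= w2 -> rh = r * t / 2 ->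
    m < r \/ rh < m^-1 \/ m ^+ 2 < w2 ->
    C * (expR (- (w2 / 8)) * rh `^ (- del)) <=
    eta * (expR (- (16^-1) * w2) * Num.max 1 (r `^ (- kap)) * Num.max 1 (t `^ (- kap))).
Proof.
move=> d0 dk k1 C0 eta0; have k0 := lt_trans d0 dk.
pose t0 := eta / (2 * C); have t00 : 0 < t0 by rewrite divr_gt0// mulr_gt0.
have kd : 0 < kap - del by rewrite subr_gt0.
have [ma ma0 maP] := powR_cvg0 kd t00.
have [mb mb0 mbP] := powR_cvg0 d0 t00.
pose m := 1 + ma + mb + 16 / t0.
have tt0 : 0 < 16 / t0 by rewrite divr_gt0.
have m1 : 1 <= m by rewrite /m; lra.
have mma : ma <= m by rewrite /m; lra.
have mmb : mb <= m by rewrite /m; lra.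
have mt0 : 16 / t0 <= m by rewrite /m; lra.
have m0 : 0 < m by lra.
exists m => // r t rh w2 r0 tt w20 rhE cond.
set x := Num.max 1 (r `^ (- kap)); set y := Num.max 1 (t `^ (- kap)).
have x1 : 1 <= x by rewrite /x le_max lexx.
have y1 : 1 <= y by rewrite /y le_max lexx.
have rhs0 : 0 <= eta * (expR (- (16^-1) * w2) * x * y).
  by rewrite !mulr_ge0 ?expR_ge0 ?(ltW eta0) ?(le_trans ler01).
move: tt; rewrite le_eqVlt => /predU1P[tE|tp].
  by rewrite rhE -tE mulr0 mul0r powR0 ?mulr0// oppr_eq0 gt_eqF.
have rh0 : 0 < rh by rewrite rhE divr_gt0// mulr_gt0.
have xk : r `^ (- kap) <= x by rewrite /x le_max lexx orbT.
have yk : t `^ (- kap) <= y by rewrite /y le_max lexx orbT.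
have le_pow (u : R) : 0 < u -> u `^ (- del) <= Num.max 1 (u `^ (- kap)).
  move=> u0; rewrite le_max; have [u1|u1] := leP 1 u.
    by rewrite powRN_le1// ltW.
  by rewrite (@ger_powR R u) ?orbT// ?u0 ?(ltW u1)// lerN2 ltW.
have two_pow (a : R) : 0 < a -> a < 1 -> rh `^ (- a) <= 2 * (r `^ (- a) * t `^ (- a)).
  move=> a0 a1; have rt0 : 0 <= r * t by rewrite mulr_ge0// ltW.
  rewrite rhE (powRM _ rt0)// (powRM _ (ltW r0) (ltW tp)) mulrC.
  by apply: ler_wpM2r; [rewrite mulr_ge0 ?powR_ge0|apply: powR_half; exact: ltW].
have xd : r `^ (- del) <= x by exact: le_pow.
have yd : t `^ (- del) <= y by exact: le_pow.
have p0 (u a : R) : 0 <= u `^ a by exact: powR_ge0.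
have d1 := lt_trans dk k1.
have e8 : expR (- (w2 / 8)) <= expR (- (16^-1) * w2).
  by rewrite ler_expR mulNr lerN2 [leLHS]mulrC; apply: ler_wpM2l => //; rewrite lef_pV2 ?posrE// ler_nat.
have ct : 2 * C * t0 = eta by rewrite /t0; field; rewrite gt_eqF.
pose e := expR (- (16^-1) * w2); have e0 : 0 <= e by exact: expR_ge0.
have xy : r `^ (- del) * t `^ (- del) <= x * y by exact: ler_pM.
have xyk : r `^ (- kap) * t `^ (- kap) <= x * y by exact: ler_pM.
have xy1 : 1 <= x * y by rewrite mulr_ege1.
suff main : expR (- (w2 / 8)) * rh `^ (- del) <= 2 * t0 * (e * (x * y)).
  have -> : eta * (e * x * y) = C * (2 * t0 * (e * (x * y))) by rewrite -ct; ring.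
  by apply: ler_wpM2l => //; exact: ltW.
case: cond => [mr|[rhm|mw]].
- have h : rh `^ (- del) <= 2 * t0 * (x * y).
    apply: (le_trans (two_pow _ d0 d1)); rewrite -mulrA; apply: ler_wpM2l => //.
    have h1 : r `^ (- del) <= t0 by apply: mbP; exact: le_trans mmb (ltW mr).
    apply: ler_pM => //; apply: (le_trans yd); by rewrite ler_peMl//; exact: le_trans ler01 y1.
  have -> : 2 * t0 * (e * (x * y)) = e * (2 * t0 * (x * y)) by ring.
  by apply: ler_pM.
- have h : rh `^ (- del) <= 2 * t0 * (x * y).
    have -> : - del = (kap - del) + (- kap) by ring.
    rewrite powRD; last by apply/implyP => _; rewrite gt_eqF.
    apply: (@le_trans _ _ (t0 * (2 * (x * y)))); last by rewrite (_ : t0 * (2 * (x * y)) = 2 * t0 * (x * y))//; ring.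
    apply: ler_pM => //.
      apply: (@le_trans _ _ ((m^-1) `^ (kap - del))).
        by apply: ge0_ler_powR; rewrite ?nnegrE ?invr_ge0 ?ltW.
      rewrite -powR_inv1 ?(ltW m0)// -powRrM mulN1r; exact: maP.
    by apply: (le_trans (two_pow _ k0 k1)); apply: ler_wpM2l.
  have -> : 2 * t0 * (e * (x * y)) = e * (2 * t0 * (x * y)) by ring.
  by apply: ler_pM.
- have -> : 2 * t0 * (e * (x * y)) = (e * t0) * (2 * (x * y)) by ring.
  apply: ler_pM => //; rewrite ?expR_ge0//.
    have -> : - (w2 / 8) = - (16^-1) * w2 + - (16^-1) * w2 by field.
    rewrite expRD -/e; apply: ler_wpM2l => //.
    have h : 16^-1 * w2 < expR (16^-1 * w2) by apply: lt_le_trans (expR_ge1Dx _); rewrite ltrDr.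
    rewrite /e mulNr expRN -[leRHS]invrK lef_pV2 ?posrE ?invr_gt0 ?expR_gt0//.
    apply: le_trans (ltW h); rewrite -[leLHS]mul1r.
    have : m <= m ^+ 2 by rewrite expr2 ler_peMl// ltW.
    move: mt0; rewrite mul1r ler_pdivrMr// => mt0.
    have : t0^-1 <= 16^-1 * m by rewrite -[leLHS]mul1r ler_pdivrMr// -mulrA ler_pdivlMl// mulr1.
    move=> h1 h2; apply: (le_trans h1); rewrite ler_pM2l ?invr_gt0//; exact: le_trans h2 (ltW mw).
  apply: (le_trans (two_pow _ d0 d1)); exact: ler_wpM2l.
Qed.

(** In r^-del t the factor t turns r^-del into rh^-del because t / 2 <= 1. In r t = 2 rh the excess
    rh^(1 + del) is absorbed by exp(-rh^2 / 16), which rh^2 / 2 <= w2 + y2 extracts from the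
    Gaussian. The two parts cost 2 and 32, within 40. *)
Lemma kernel_weight_real (del r t rh w2 y2 : R) : 0 < del -> del < 1 -> 0 < r -> 0 <= t -> t <= 2 -> 0 <= y2 ->
  rh = r * t / 2 -> rh ^+ 2 / 2 <= w2 + y2 ->
  (r + r `^ (- del)) * t * expR (- ((w2 + y2) / 4)) <= 40 * (expR (- (w2 / 8)) * rh `^ (- del)).
Proof.
move=> d0 d1 r0 t0 t2 y0 rhE rhl.
have rh_ge0 : 0 <= rh by rewrite rhE divr_ge0// mulr_ge0// ltW.
have e1 : expR (- ((w2 + y2) / 4)) <= expR (- (w2 / 8)) * expR (- (rh ^+ 2 / 16)).
  by rewrite -!expRD ler_expR; lra.
move: t0; rewrite le_eqVlt => /predU1P[tE|tp].
  by rewrite -tE mulr0 mul0r !mulr_ge0 ?expR_ge0 ?powR_ge0.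
have rh0 : 0 < rh by rewrite rhE divr_gt0// mulr_gt0.
have p0 : 0 <= rh `^ (- del) by exact: powR_ge0.
have a1 : r `^ (- del) * t <= 2 * rh `^ (- del).
  have rt : rh = r * (t / 2) by rewrite rhE mulrA.
  have t20 : 0 < t / 2 by rewrite divr_gt0.
  rewrite rt powRM ?(ltW r0) ?(ltW t20)// [leRHS]mulrCA; apply: ler_wpM2l; first exact: powR_ge0.
  have := @powRN_ge1 (t / 2) del t20 _ (ltW d0); rewrite ler_pdivrMr// mul1r => /(_ t2) h; lra.
have a2 : r * t * expR (- (rh ^+ 2 / 16)) <= 32 * rh `^ (- del).
  have -> : r * t = 2 * rh by rewrite rhE; lra.
  have -> : 2 * rh = 2 * (rh `^ (1 + del)) * rh `^ (- del).
    rewrite -mulrA -powRD; last by apply/implyP => _; rewrite gt_eqF.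
    by rewrite addrK powRr1.
  rewrite mulrAC; apply: ler_wpM2r => //.
  have h1 : rh `^ (1 + del) <= 1 + rh ^+ 2.
    have [u1|u1] := leP 1 rh.
      apply: (@le_trans _ _ (rh ^+ 2)); last by rewrite lerDr.
      by rewrite -powR_mulrn//; apply: ler_powR => //; lra.
    apply: (@le_trans _ _ 1); last by rewrite lerDl sqr_ge0.
    rewrite -[leRHS](powRr0 rh); apply: ger_powR; [by rewrite rh0 ltW|lra].
  have h2 : expR (- (rh ^+ 2 / 16)) * (1 + rh ^+ 2 / 16) <= 1.
    by rewrite expRN ler_pdivrMl ?expR_gt0// mulr1; exact: expR_ge1Dx.
  have := expR_ge0 (- (rh ^+ 2 / 16)); have := sqr_ge0 rh.
  move: h1 h2; clear; move: (expR _) => b; move: (rh `^ _) => a; move: (rh ^+ 2) => c h1 h2 c0 b0.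
  have : b * a <= b * (1 + c) by exact: ler_wpM2l.
  have : 0 <= b * c by exact: mulr_ge0.
  nra.
apply: (@le_trans _ _ ((r + r `^ (- del)) * t * (expR (- (w2 / 8)) * expR (- (rh ^+ 2 / 16))))).
  by apply: ler_wpM2l => //; rewrite mulr_ge0 ?(ltW tp)// addr_ge0 ?powR_ge0// ltW.
have -> : (r + r `^ (- del)) * t * (expR (- (w2 / 8)) * expR (- (rh ^+ 2 / 16))) =
  expR (- (w2 / 8)) * (r * t * expR (- (rh ^+ 2 / 16)) + r `^ (- del) * t * expR (- (rh ^+ 2 / 16))) by ring.
rewrite mulrCA; apply: ler_wpM2l; first exact: expR_ge0.
have a3 : r `^ (- del) * t * expR (- (rh ^+ 2 / 16)) <= 2 * rh `^ (- del).
  apply: le_trans a1; rewrite ler_piMr ?mulr_ge0 ?powR_ge0 ?(ltW tp)//.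
  by rewrite -expR0 ler_expR oppr_le0 divr_ge0// sqr_ge0.
lra.
Qed.

End weight_estimates.

(** * Compactness of the cross terms *)

Section kernel_bounds.
Context {R : realType} {n : nat}.
Local Notation trip := (vel R * vel R * vel R)%type.
Local Notation Pi3 := (sfprod (sfprod leb3 leb3) (@surf R)).
Variables (rho : 'I_n -> R) (B : 'I_n -> 'I_n -> R -> R -> R) (Phi b : 'I_n -> 'I_n -> R -> R).
Hypotheses (hrho : forall i, 0 < rho i) (hB : collision_kernel B) (hS : kernel_sym B).
Hypotheses (hA2 : kernel_factor B Phi b).
Implicit Types (i j : 'I_n) (p : trip).

Definition rdist p : R := enorm (p.1.1 - p.1.2).
Definition tdist (e : R) p : R := enorm (p.2 - e *: dir (p.1.1 - p.1.2)).

Lemma good_rdist p : good p -> 0 < rdist p.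
Proof. by rewrite /rdist enorm_gt0 subr_eq0 => /andP[]. Qed.

Lemma cosdev_dir p : cosdev p.1.1 p.1.2 p.2 = dot p.2 (dir (p.1.1 - p.1.2)).
Proof. by rewrite /cosdev /dir dotZr mulrC. Qed.

Lemma tdist_sqr e p : good p -> e ^+ 2 = 1 -> tdist e p ^+ 2 = 2 - 2 * (e * cosdev p.1.1 p.1.2 p.2).
Proof.
move=> gp e1; rewrite cosdev_dir /tdist enorm_sqr.
have s1 : dot p.2 p.2 = 1 by rewrite -enorm_sqr; case/andP : gp => _ /eqP ->; rewrite expr1n.
have d1 : dot (dir (p.1.1 - p.1.2)) (dir (p.1.1 - p.1.2)) = 1.
  by rewrite -enorm_sqr enorm_dir ?expr1n// subr_eq0; case/andP : gp.
move: (dir _) d1 s1 => d; move: p.2 => s; rewrite /dot /= /GRing.scale/= => d1 s1.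
transitivity ((s.1.1 * s.1.1 + s.1.2 * s.1.2 + s.2 * s.2) +
  e ^+ 2 * (d.1.1 * d.1.1 + d.1.2 * d.1.2 + d.2 * d.2) -
  2 * (e * (s.1.1 * d.1.1 + s.1.2 * d.1.2 + s.2 * d.2))); first by ring.
by rewrite s1 d1 e1; ring.
Qed.

Lemma tdist_le2 e p : good p -> e ^+ 2 = 1 -> tdist e p <= 2.
Proof.
move=> gp e1; rewrite -(@ler_pXn2r _ 2)// ?nnegrE ?enorm_ge0// tdist_sqr//.
have /andP[c1 c2] := cosdev_le1 gp.
move: c1 c2; move: (cosdev _ _ _) => c c1 c2.
have : (e - 1) * (e + 1) = 0 by rewrite -subr_sqr e1 expr1n subrr.
by move=> /eqP; rewrite mulf_eq0 => /orP[/eqP h|/eqP h]; nra.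
Qed.

(** With c the cosine, 1 - c^2 <= 2 - 2 e c is (1 - e c)^2 >= 0, as e^2 = 1. *)
Lemma sin_tdist e p : good p -> e ^+ 2 = 1 -> `|sin (acos (cosdev p.1.1 p.1.2 p.2))| <= tdist e p.
Proof.
move=> gp e1; have c1 := cosdev_le1 gp.
rewrite sin_acos// ger0_norm ?sqrtr_ge0//.
rewrite -(@ler_pXn2r _ 2)// ?nnegrE ?enorm_ge0 ?sqrtr_ge0// sqr_sqrtr; last first.
  move: c1; move: (cosdev _ _ _) => c /andP[]; nra.
rewrite tdist_sqr//; move: (cosdev _ _ _) => c.
have := sqr_ge0 (1 - e * c); rewrite sqrrB exprMn e1; lra.
Qed.

Section growth.
Variables (C2 C3 del : R).
Hypothesis Phi_le : forall i j r, 0 < r -> Phi i j r <= C2 * (r + r `^ (- del)).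
Hypothesis b_le : forall i j x, -1 <= x <= 1 -> b i j x <= C3 * `|sin (acos x)|.
Hypotheses (C2_gt0 : 0 < C2) (C3_gt0 : 0 < C3) (del_gt0 : 0 < del) (del_lt1 : del < 1).

(** The angular bound by the sine is converted into the distance from s to either pole e [dir] (v -
    w), e being 1 or -1; each gain term uses the pole at which its two velocities meet. *)
Lemma kk_le e i j p : e ^+ 2 = 1 ->
  kk B i j p <= C2 * C3 * ((rdist p + rdist p `^ (- del)) * tdist e p).
Proof.
move=> e1; have rhs0 : 0 <= C2 * C3 * ((rdist p + rdist p `^ (- del)) * tdist e p).
  by rewrite !mulr_ge0 ?enorm_ge0 ?(ltW C2_gt0) ?(ltW C3_gt0)// addr_ge0 ?enorm_ge0 ?powR_ge0.
rewrite /kk; case: ifPn => // gp; have [P0 b0 BE] := hA2 i j.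
have r0 := good_rdist gp; have c1 := cosdev_le1 gp.
rewrite /kern BE//; apply: (@le_trans _ _ (C2 * (rdist p + rdist p `^ (- del)) * (C3 * tdist e p))).
  apply: ler_pM; [exact: P0|exact: b0|exact: Phi_le|].
  apply: (le_trans (b_le i j c1)); apply: ler_wpM2l; first exact: ltW.
  exact: sin_tdist.
by rewrite le_eqVlt; apply/orP; left; apply/eqP; ring.
Qed.

Lemma kk_le0 i j p : kk B i j p <= 2 * (C2 * C3) * (rdist p + rdist p `^ (- del)).
Proof.
have rr : 0 <= rdist p + rdist p `^ (- del) by rewrite addr_ge0 ?enorm_ge0 ?powR_ge0.
have [gp|ngp] := boolP (good p); last first.
  by rewrite /kk (negbTE ngp) !mulr_ge0 ?(ltW C2_gt0) ?(ltW C3_gt0).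
have e1 : (1 : R) ^+ 2 = 1 by rewrite expr1n.
apply: (le_trans (kk_le i j p e1)); have := tdist_le2 gp e1.
have : 0 <= C2 * C3 by rewrite mulr_ge0 ?ltW.
move: (C2 * C3) (rdist p + _) rr (tdist 1 p) => c r r0 t c0 t2.
have : 0 <= c * r by exact: mulr_ge0.
nra.
Qed.

(** The sum over the species bounds each amplitude, also for an empty index set. *)
Definition amp : R := \sum_i Num.sqrt (rho i * (2 * pi) `^ (- (3 / 2))).

Lemma smw_le i v : smw rho i v <= amp * expR (- (enorm v ^+ 2 / 4)).
Proof.
rewrite /smw /maxw sqrtrM; last by rewrite mulr_ge0 ?powR_ge0 ?ltW.
have -> : Num.sqrt (expR (- (enorm v ^+ 2 / 2))) = expR (- (enorm v ^+ 2 / 4)).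
  have -> : - (enorm v ^+ 2 / 2) = - (enorm v ^+ 2 / 4) + - (enorm v ^+ 2 / 4) by lra.
  by rewrite expRD -expr2 sqrtr_sqr ger0_norm ?expR_ge0.
apply: ler_wpM2r; first exact: expR_ge0.
by rewrite /amp (bigD1 i)//= lerDl; apply: sumr_ge0 => k _; exact: sqrtr_ge0.
Qed.

Lemma smw2_le i j v w : smw rho i v * smw rho j w <= amp ^+ 2 * expR (- ((enorm v ^+ 2 + enorm w ^+ 2) / 4)).
Proof.
have -> : - ((enorm v ^+ 2 + enorm w ^+ 2) / 4) = - (enorm v ^+ 2 / 4) + - (enorm w ^+ 2 / 4) by lra.
rewrite expRD expr2 mulrACA; apply: ler_pM; rewrite ?smw_le//; exact: ltW (smw_gt0 hrho _ _).
Qed.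

(** Weights of the products of [U1] with [U2], [U3] and [U4]. They couple f at v with f at w, at v'
    and at v'* respectively; the Maxwellian factors sit at the two remaining velocities. *)
Definition WA i j p : R := kk B i j p * (smw rho j p.1.2 * smw rho i p.1.1).
Definition WB i j p : R := kk B i j p * (smw rho j p.1.2 * smw rho j (Tc p).1.2).
Definition WC i j p : R := kk B i j p * (smw rho j p.1.2 * smw rho i (Tc p).1.1).

Lemma half_sqr_sub (v w : vel R) : enorm (v - w) ^+ 2 / 2 <= enorm w ^+ 2 + enorm v ^+ 2.
Proof.
rewrite !enorm_sqr /dot /=.
have := sqr_ge0 (v.1.1 + w.1.1); have := sqr_ge0 (v.1.2 + w.1.2); have := sqr_ge0 (v.2 + w.2).
rewrite !expr2; lra.
Qed.

Definition Cw : R := 40 * (amp ^+ 2 * (2 * (C2 * C3)) + 1).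

(** Here y carries the second Maxwellian factor. In each application |y - w| equals the distance
    between the two velocities at which f is evaluated, by conservation of momentum, and |y - w|^2 /
    2 <= |y|^2 + |w|^2 lets the Gaussians control it. *)
Lemma W_le_gen i j p (y : vel R) (t : R) k1 k2 : good p -> 0 <= t -> t <= 2 ->
  kk B i j p <= 2 * (C2 * C3) * ((rdist p + rdist p `^ (- del)) * t) ->
  enorm (y - p.1.2) = rdist p * t / 2 ->
  kk B i j p * (smw rho k1 p.1.2 * smw rho k2 y) <=
    Cw * (expR (- (enorm p.1.2 ^+ 2 / 8)) * (rdist p * t / 2) `^ (- del)).
Proof.
move=> gp t0 t2 hk hy; have r0 := good_rdist gp.
have CC : 0 <= 2 * (C2 * C3) by rewrite !mulr_ge0// ltW.
have h := @kernel_weight_real R del (rdist p) t (rdist p * t / 2) (enorm p.1.2 ^+ 2) (enorm y ^+ 2)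
  del_gt0 del_lt1 r0 t0 t2 (sqr_ge0 _) erefl.
rewrite -{1}hy in h; have {}h := h (half_sqr_sub _ _).
have X0 : 0 <= expR (- (enorm p.1.2 ^+ 2 / 8)) * (rdist p * t / 2) `^ (- del).
  by rewrite mulr_ge0 ?expR_ge0 ?powR_ge0.
have A0 : 0 <= amp ^+ 2 by exact: sqr_ge0.
apply: (@le_trans _ _ (2 * (C2 * C3) * ((rdist p + rdist p `^ (- del)) * t) *
   (amp ^+ 2 * expR (- ((enorm p.1.2 ^+ 2 + enorm y ^+ 2) / 4))))).
  apply: ler_pM => //; first exact: kk_ge0; last exact: smw2_le.
  by rewrite mulr_ge0// ltW ?smw_gt0.
rewrite /Cw; move: h X0; move: (expR (- (_ / 4))) (expR _ * _ `^ _) (rdist p + _) => E X r.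
move: (amp ^+ 2) A0 (2 * (C2 * C3)) CC => a a0 c c0 h X0.
have -> : c * (r * t) * (a * E) = (a * c) * (r * t * E) by ring.
have ac : 0 <= a * c by exact: mulr_ge0.
nra.
Qed.

(** Midpoint of del and 1: above del, so that a positive power is gained, and below 1, so that the
    dyadic sums converge. *)
Definition kap : R := (1 + del) / 2.

Lemma kap_gt : del < kap.
Proof. by rewrite /kap ltr_pdivlMr// mulr_natr mulr2n ltrD2r. Qed.
Lemma kap_lt1 : kap < 1.
Proof. by rewrite /kap ltr_pdivrMr// mul1r [ltRHS](_ : 2 = 1 + 1)// ltrD2l. Qed.
Lemma kap_gt0 : 0 < kap.
Proof. by rewrite divr_gt0// addr_gt0. Qed.

(* With p = (v, w, s), [y p] is one of w, v', w', and |v - y| = |v - w| t / 2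
   where t = |s -+ dir (v - w)|, or t = 2 for y = w. The angular cutoff bounds the
   kernel by a multiple of t, which turns |v - w|^-del into |v - y|^-del. *)
Definition Wok (W : trip -> R) (y : trip -> vel R) (e : R) : Prop :=
  [/\ measurable_fun setT W, measurable_fun setT y, forall p, 0 <= W p,
      forall p, ~~ good p -> W p = 0
    & forall p, good p -> exists t, [/\ 0 <= t <= 2, enorm (p.1.1 - y p) = rdist p * t / 2,
        ((Num.max 1 (t `^ (- kap)))%:E <= dyad kap (tdist e p))%E &
        W p <= Cw * (expR (- (enorm p.1.2 ^+ 2 / 8)) * (rdist p * t / 2) `^ (- del))]].

(* Off this set the weight has small Schur norm; on it the joint law of
   (v, y) has a bounded density. *)
Definition Abool (y : trip -> vel R) (m : R) p : bool :=
  [&& good p, rdist p <= m, m^-1 <= enorm (p.1.1 - y p), enorm p.1.1 <= 3 * m & enorm (y p) <= 3 * m].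
Definition Aset y m : set trip := [set p | Abool y m p].

Lemma measurable_Aset y m : measurable_fun setT y -> measurable (Aset y m).
Proof.
move=> my; rewrite (_ : Aset y m = Abool y m @^-1` [set true]); last by apply/seteqP; split.
rewrite -[X in measurable X]setTI.
have mx : measurable_fun setT (fun p : trip => p.1.1) by mfv.
have mw : measurable_fun setT (fun p : trip => p.1.2) by mfv.
have le_cst (z : trip -> vel R) (c : R) : measurable_fun setT z -> measurable_fun setT (fun p => enorm (z p) <= c).
  by move=> mz; apply: measurable_fun_ler; [exact: mf_enorm|exact: measurable_cst].
have h : measurable_fun setT (Abool y m); last exact: h.
apply: measurable_and; first exact: mf_good.
apply: measurable_and; first exact: le_cst (mf_addv mx (mf_oppv mw)).
apply: measurable_and.
  apply: measurable_fun_ler; [exact: measurable_cst|exact: mf_enorm (mf_addv mx (mf_oppv my))].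
by apply: measurable_and; exact: le_cst.
Qed.

Lemma Cw_gt0 : 0 < Cw.
Proof.
rewrite /Cw mulr_gt0//; apply: ltr_wpDl; last exact: ltr01.
by rewrite mulr_ge0 ?sqr_ge0// mulr_ge0// mulr_ge0// ltW.
Qed.

Lemma max_le_dyad u : 0 <= u -> ((Num.max 1 (u `^ (- kap)))%:E <= dyad kap u)%E.
Proof.
move=> u0; have [_|_] := leP 1 (u `^ (- kap)); last exact: dyad_ge1.
have := dyad_powR kap_gt0 u; by rewrite ger0_norm.
Qed.

Lemma bad_schur (eta : R) : 0 < eta -> exists2 m, 1 <= m & forall W y e, Wok W y e -> forall v,
  (\int[sfprod leb3 surf]_q (W (v, q.1, q.2) * \1_(~` Aset y m) (v, q.1, q.2))%:E <= eta%:E)%E.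
Proof.
move=> eta0; have c16 : (0 : R) < 16^-1 by [].
have [K K0 KP] := schur_dyad kap_lt1 c16.
have K1 : 0 < K + 1 by rewrite ltr_wpDl.
have [m m1 mP] := weight_real del_gt0 kap_gt kap_lt1 Cw_gt0 (divr_gt0 eta0 K1).
exists m => // W y e [mW my W0 Wng Wg] v.
have m0 : 0 < m by apply: lt_le_trans m1.
pose E (q : vel R * vel R) : \bar R := ((expR (- 16^-1 * enorm q.1 ^+ 2))%:E *
   dyad kap (enorm (v - q.1)%R) * dyad kap (enorm (q.2 - e *: dir (v - q.1))%R))%E.
have E0 q : (0 <= E q)%E by rewrite !mule_ge0 ?dyad_ge0// lee_fin expR_ge0.
have mE : measurable_fun setT E.
  apply: emeasurable_funM; last by apply: mf_dyad; mfv.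
  apply: emeasurable_funM; last by apply: mf_dyad; mfv.
  by apply/measurable_EFinP; apply: mf_expR; mfv.
have mA := measurable_Aset m my.
have mv : measurable_fun setT (fun q : vel R * vel R => (v, q.1, q.2)) by mfv.
have mI : measurable_fun setT (\1_(~` Aset y m) : trip -> R).
  by apply: measurable_indic; exact: measurableC.
have ek0 : 0 <= eta / (K + 1) by rewrite ltW// divr_gt0.
apply: (@le_trans _ _ (\int[sfprod leb3 surf]_q ((eta / (K + 1))%:E * E q))%E); last first.
  rewrite ge0_integralZl_EFin//.
  apply: (@le_trans _ _ ((eta / (K + 1))%:E * K%:E)%E); first exact: lee_wpmul2l (KP v e).
  by rewrite -EFinM lee_fin mulrAC ler_pdivrMr// ler_pM2l// lerDl.
apply: ge0_le_integral.
- exact: measurableT.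
- by move=> q _; rewrite lee_fin mulr_ge0// indicE.
- apply/measurable_EFinP; apply: measurable_funM.
    exact: (measurableT_comp mW mv).
  exact: (measurableT_comp mI mv).
- exact: measurable_funeM.
move=> q _; set p := (v, q.1, q.2).
have rhs0 : (0 <= (eta / (K + 1))%:E * E q)%E by rewrite mule_ge0.
have [gp|ngp] := boolP (good p); last by rewrite (Wng _ ngp) mul0r.
rewrite indicE in_setC; case: (boolP (p \in Aset y m)) => [_|/negP pA] /=; first by rewrite mulr0.
rewrite mulr1; have [t [/andP[t0 t2] yt td Wle]] := Wg _ gp.
have r0 := good_rdist gp.
(* If |v - w| <= m and |w| <= m, then |v| <= 2 m, and |y| <= 3 m because |v - y| <= |v - w|. Leaving
   [Aset] therefore forces one of the three regimes of [weight_real]. *)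
have cond : m < rdist p \/ rdist p * t / 2 < m^-1 \/ m ^+ 2 < enorm p.1.2 ^+ 2.
  apply: contrapT => nc; apply: pA; apply/mem_set; rewrite /Aset/= /Abool gp/=.
  have h1 : rdist p <= m by rewrite leNgt; apply/negP => h; apply: nc; left.
  have h2 : m^-1 <= rdist p * t / 2 by rewrite leNgt; apply/negP => h; apply: nc; right; left.
  have h3 : enorm p.1.2 <= m.
    rewrite -(@ler_pXn2r _ 2)// ?nnegrE ?enorm_ge0 ?(ltW m0)//.
    by rewrite leNgt; apply/negP => h; apply: nc; right; right.
  have hv : enorm p.1.1 <= 2 * m.
    rewrite -[p.1.1](subrK p.1.2); apply: (le_trans (enormD _ _)).
    by rewrite mulrDl mul1r; apply: lerD.
  have hy : enorm (y p) <= 3 * m.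
    have -> : y p = p.1.1 - (p.1.1 - y p) by rewrite opprB addrC subrK.
    apply: (le_trans (enormD _ _)); rewrite enormN yt.
    have -> : 3 * m = 2 * m + m by ring.
    apply: lerD => //; apply: le_trans h1; rewrite -mulrA ler_piMr ?(ltW r0)//.
    by rewrite ler_pdivrMr// mul1r.
  apply/and4P; split; [exact: h1|by rewrite -[v]/(p.1.1) yt| |exact: hy].
  by apply: (le_trans hv); apply: ler_wpM2r; [exact: ltW|rewrite ler_nat].
have := mP (rdist p) t _ (enorm p.1.2 ^+ 2) r0 t0 (sqr_ge0 _) erefl cond => hm.
apply: (@le_trans _ _ (eta / (K + 1) * (expR (- 16^-1 * enorm p.1.2 ^+ 2) *
   Num.max 1 (rdist p `^ (- kap)) * Num.max 1 (t `^ (- kap))))%:E).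
  by rewrite lee_fin; exact: le_trans Wle hm.
rewrite EFinM; apply: lee_wpmul2l => //; rewrite /E !EFinM.
have mx0 (u : R) : (0 <= (Num.max 1 u)%:E)%E by rewrite lee_fin le_max ler01.
apply: lee_pmul; [by rewrite mule_ge0// lee_fin expR_ge0|exact: mx0| |exact: td].
by apply: lee_wpmul2l; [rewrite lee_fin expR_ge0|apply: max_le_dyad; exact: enorm_ge0].
Qed.

Lemma cross_compact (W : trip -> R) (tau : trip -> trip) (e0 : R) :
  Wok W (tsnd tau) e0 -> Wok (fun p => W (tau p)) (tsnd tau) e0 ->
  mp Pi3 Pi3 tau -> (forall p, tau (tau p) = p) ->
  (forall p, good (tau p) = good p) -> (forall p, rdist (tau p) = rdist p) ->
  (forall m, 1 <= m -> exists C, forall Z, measurable Z ->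
     (Pi3 (Aset (tsnd tau) m `&` [set p | Z (p.1.1, tsnd tau p)]) <= C%:E * sfprod leb3 leb3 Z)%E) ->
  cross_cpt W tau.
Proof.
move=> Wk Wk' mpt tK gt rt law; have [mW my W0 Wng Wg] := Wk.
apply: (weighted_compact mW W0 mpt tK) => eta eta0.
have [m m1 mP] := bad_schur eta0; have [C CP] := law m m1.
have m0 : 0 < m by apply: lt_le_trans m1.
pose C' := Num.max 0 C + Cw * m; exists (Aset (tsnd tau) m), (3 * m), C'.
have C'0 : 0 <= C' by rewrite addr_ge0 ?le_max ?lexx// mulr_ge0 ?(ltW Cw_gt0)// ltW.
split.
- exact: measurable_Aset.
- exact: C'0.
- move=> p /and5P[gp rm ym vm ym']; split => //.
  have [t [/andP[t0 t2] yt td Wle]] := Wg _ gp; apply: (le_trans Wle).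
  rewrite yt in ym; have rh0 : 0 < rdist p * t / 2 by apply: lt_le_trans ym; rewrite invr_gt0.
  apply: (@le_trans _ _ (Cw * m)); last by rewrite lerDr le_max lexx.
  apply: ler_wpM2l; first exact: ltW Cw_gt0.
  rewrite -[leRHS]mul1r; apply: ler_pM; rewrite ?expR_ge0 ?powR_ge0//.
    by rewrite -expR0 ler_expR oppr_le0 divr_ge0// sqr_ge0.
  apply: (@le_trans _ _ ((m^-1) `^ (- del))).
    rewrite !powRN lef_pV2 ?posrE ?powR_gt0 ?invr_gt0//.
    by apply: ge0_ler_powR; rewrite ?nnegrE ?invr_ge0 ?(ltW rh0) ?(ltW m0) ?(ltW del_gt0).
  rewrite -powR_inv1 ?(ltW m0)// -powRrM mulrNN mul1r -[leRHS]powRr1 ?(ltW m0)//.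
  by apply: ler_powR => //; exact: ltW.
- move=> Z mZ; apply: (le_trans (CP Z mZ)); apply: lee_wpmul2r => //.
  rewrite lee_fin /C'; apply: (@le_trans _ _ (Num.max 0 C)); first by rewrite le_max lexx orbT.
  by rewrite lerDl mulr_ge0 ?(ltW Cw_gt0)// ltW.
- move=> v; split; first exact: (mP _ _ _ Wk).
  have := mP _ _ _ Wk' v; apply: le_trans; apply: le_eq; apply: eq_integral => q _.
  set p := (v, q.1, q.2); suff -> : (\1_(~` Aset (tsnd tau) m) (tau p) : R) = \1_(~` Aset (tsnd tau) m) p by [].
  rewrite !indicE !in_setC; congr ((~~ _)%:R).
  (* The conditions are symmetric in v and y, which tau exchanges. *)
  have AE : Abool (tsnd tau) m (tau p) = Abool (tsnd tau) m p.
    rewrite /Abool gt rt /tsnd tK -/(tsnd tau p) [in LHS]enormB; congr [&& _, _, _ & _]; exact: andbC.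
  by apply/idP/idP => /set_mem h; apply/mem_set; rewrite /Aset/= ?AE// -AE.
Qed.

Lemma mf_WX i j k1 k2 (y : trip -> vel R) : measurable_fun setT y ->
  measurable_fun setT (fun p => kk B i j p * (smw rho k1 p.1.2 * smw rho k2 (y p))).
Proof.
move=> my; apply: measurable_funM; first exact: mf_kk.
apply: measurable_funM; first by apply: (measurableT_comp (mf_smw rho k1)); mfv.
exact: (measurableT_comp (mf_smw rho k2) my).
Qed.

Lemma WX_ge0 i j k1 k2 p (y : vel R) : 0 <= kk B i j p * (smw rho k1 p.1.2 * smw rho k2 y).
Proof. by rewrite mulr_ge0 ?kk_ge0// mulr_ge0// ltW// smw_gt0. Qed.

Lemma kk_ng i j p : ~~ good p -> kk B i j p = 0.
Proof. by move=> ngp; rewrite /kk (negbTE ngp). Qed.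

Lemma vpost3_dist p : good p -> enorm (p.1.1 - vpost3 p) = rdist p * tdist 1 p / 2.
Proof.
move=> gp; have r0 := good_rdist gp.
have -> : p.1.1 - vpost3 p = (- (rdist p / 2)) *: (p.2 - 1 *: dir (p.1.1 - p.1.2)) :> vel R.
  rewrite scale1r /dir -/(rdist p) /vpost3 /vpost -/(rdist p).
  by apply: vel_ext => /=; rewrite /GRing.scale/=; field; rewrite gt_eqF.
by rewrite enormZ normrN ger0_norm ?divr_ge0 ?(ltW r0)// mulrAC.
Qed.

Lemma vstar3_dist p : good p -> enorm (p.1.1 - vstar3 p) = rdist p * tdist (-1) p / 2.
Proof.
move=> gp; have r0 := good_rdist gp.
have -> : p.1.1 - vstar3 p = (rdist p / 2) *: (p.2 - (-1) *: dir (p.1.1 - p.1.2)) :> vel R.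
  rewrite /dir -/(rdist p) /vstar3 /vpost_star -/(rdist p).
  by apply: vel_ext => /=; rewrite /GRing.scale/=; field; rewrite gt_eqF.
by rewrite enormZ ger0_norm ?divr_ge0 ?(ltW r0)// mulrAC.
Qed.

Lemma Tc_good p : good p -> (Tc p).1.1 = vpost3 p /\ (Tc p).1.2 = vstar3 p.
Proof. by move=> gp; rewrite /Tc gp. Qed.

Lemma momentum_vpost p : vstar3 p - p.1.2 = p.1.1 - vpost3 p.
Proof.
rewrite /vstar3 /vpost3 /vpost_star /vpost.
by apply: vel_ext => /=; rewrite /GRing.scale/=; field.
Qed.

Let e1 : (1 : R) ^+ 2 = 1. Proof. by rewrite expr1n. Qed.
Let em1 : (-1 : R) ^+ 2 = 1. Proof. by rewrite sqrrN expr1n. Qed.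

Lemma WA_ok i j : Wok (WA i j) (tsnd (@Sw R)) 1.
Proof.
split.
- by apply: (mf_WX i j j i); mfv.
- by apply: mf_fst; apply: mf_fst; exact: (@mp_Sw R).1.
- by move=> p; exact: WX_ge0.
- by move=> p ngp; rewrite /WA kk_ng// mul0r.
move=> p gp; have r0 := good_rdist gp; have r2 : rdist p * 2 / 2 = rdist p by rewrite mulfK// pnatr_eq0.
exists 2; split.
- by rewrite ler0n lexx.
- by rewrite r2.
- rewrite (_ : Num.max 1 _ = 1); first exact: dyad_ge1.
  by apply: max_l; apply: powRN_le1; [rewrite ler1n|exact: ltW kap_gt0].
- rewrite /WA; apply: W_le_gen; [exact: gp|by rewrite ler0n|exact: lexx| |by rewrite r2].
  apply: (le_trans (kk_le0 i j p)); apply: ler_wpM2l.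
    by rewrite !mulr_ge0 ?(ltW C2_gt0) ?(ltW C3_gt0).
  by rewrite ler_peMr ?ler1n ?addr_ge0 ?enorm_ge0 ?powR_ge0.
Qed.

Lemma kk_le_t e i j p : e ^+ 2 = 1 -> kk B i j p <= 2 * (C2 * C3) * ((rdist p + rdist p `^ (- del)) * tdist e p).
Proof.
move=> e2; apply: (le_trans (kk_le i j p e2)); apply: ler_wpM2r.
  by rewrite mulr_ge0 ?enorm_ge0// addr_ge0 ?enorm_ge0 ?powR_ge0.
by rewrite ler_peMl ?ler1n// mulr_ge0// ltW.
Qed.

Lemma WB_ok i j : Wok (WB i j) (tsnd (@Tc R)) 1.
Proof.
split.
- by apply: (mf_WX i j j j); apply: mf_snd; apply: mf_fst; exact: (@mp_Tc R).1.
- by apply: mf_fst; apply: mf_fst; exact: (@mp_Tc R).1.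
- by move=> p; exact: WX_ge0.
- by move=> p ngp; rewrite /WB kk_ng// mul0r.
move=> p gp; have [v1 v2] := Tc_good gp; exists (tdist 1 p); split.
- by rewrite enorm_ge0 tdist_le2.
- by rewrite /tsnd v1 vpost3_dist.
- exact: max_le_dyad (enorm_ge0 _).
- apply: W_le_gen => //; [exact: enorm_ge0|exact: tdist_le2|exact: kk_le_t|].
  by rewrite v2 momentum_vpost vpost3_dist.
Qed.

(** Collision followed by exchange: an involution that puts v'* in first place. *)
Definition ScTc (p : trip) : trip := Sw (Tc p).

Lemma mp_ScTc : mp Pi3 Pi3 ScTc.
Proof. exact: (mp_comp (@mp_Tc R) (@mp_Sw R)). Qed.

Lemma ScTcK p : ScTc (ScTc p) = p.
Proof. by rewrite /ScTc Tc_Sw SwK TcK. Qed.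

Lemma WC_ok i j : Wok (WC i j) (tsnd ScTc) (-1).
Proof.
split.
- by apply: (mf_WX i j j i); apply: mf_fst; apply: mf_fst; exact: (@mp_Tc R).1.
- by apply: mf_fst; apply: mf_fst; exact: mp_ScTc.1.
- by move=> p; exact: WX_ge0.
- by move=> p ngp; rewrite /WC kk_ng// mul0r.
move=> p gp; have [v1 v2] := Tc_good gp; exists (tdist (-1) p); split.
- by rewrite enorm_ge0 tdist_le2.
- by rewrite /tsnd/= v2 vstar3_dist.
- exact: max_le_dyad (enorm_ge0 _).
- apply: W_le_gen => //; [exact: enorm_ge0|exact: tdist_le2|exact: kk_le_t|].
  rewrite v1 -(vstar3_dist gp); congr enorm.
  have := momentum_vpost p; move: (vstar3 p) (vpost3 p) => a c h.
  by rewrite -[a](subrK p.1.2) h opprD opprB addrA [p.1.1 + _]addrC subrK.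
Qed.

Lemma WA_Sw i j p : WA i j (Sw p) = WA j i p.
Proof. by rewrite /WA (kk_Sw hS)/= [smw rho j _ * _]mulrC. Qed.

Lemma WB_Tc i j p : WB i j (Tc p) = WB i j p.
Proof. by rewrite /WB kk_Tc TcK [smw rho j _ * _]mulrC. Qed.

Lemma WC_ScTc i j p : WC i j (ScTc p) = WC j i p.
Proof.
rewrite /WC /ScTc (kk_Sw hS) kk_Tc Tc_Sw TcK/=.
by rewrite [smw rho j _ * _]mulrC.
Qed.

Let mZ3 (y : trip -> vel R) Z : measurable_fun setT y -> measurable Z ->
  measurable [set p : trip | Z (p.1.1, y p)].
Proof.
move=> my mZ; have mvv : measurable_fun setT (fun p : trip => (p.1.1, y p)).
  by apply: mf_pair => //; mfv.
by have := mvv measurableT Z mZ; rewrite setTI.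
Qed.

Let law_mono (tau : trip -> trip) (V : trip -> vel R) m Z (D : \bar R) : measurable Z ->
  measurable_fun setT (tsnd tau) -> measurable_fun setT V ->
  (forall p, good p -> tsnd tau p = V p) ->
  (Pi3 (sep_set V m `&` [set p | Z (p.1.1, V p)]) <= D)%E ->
  (Pi3 (Aset (tsnd tau) m `&` [set p | Z (p.1.1, tsnd tau p)]) <= D)%E.
Proof.
move=> mZ mt mV tV; apply: le_trans; apply: le_measure; rewrite ?inE.
- by apply: measurableI; [exact: measurable_Aset|exact: mZ3].
- by apply: measurableI; [exact: measurable_sep_set|exact: mZ3].
by move=> p [/and5P[gp h1 h2 _ _] h3]; have e := tV p gp; split; [split; [exact: h1|by rewrite -e]|by rewrite /= -e].
Qed.

Lemma crossA i j : cross_cpt (WA i j) (@Sw R).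
Proof.
have [mt _] := @mp_Sw R.
apply: (cross_compact (e0 := 1)).
- exact: WA_ok.
- by under eq_fun do rewrite WA_Sw; exact: WA_ok.
- exact: mp_Sw.
- exact: SwK.
- exact: good_Sw.
- by move=> p; rewrite /rdist/= enormB.
- move=> m m1; exists surfT => Z mZ; apply: le_trans (law_snd mZ).
  apply: le_measure; rewrite ?inE.
  + by apply: measurableI; [apply: measurable_Aset|apply: mZ3 => //]; apply: mf_fst; exact: mf_fst.
  + by apply: mZ3 => //; mfv.
  + by move=> p [].
Qed.

Lemma crossB i j : cross_cpt (WB i j) (@Tc R).
Proof.
have [mt _] := @mp_Tc R.
apply: (cross_compact (e0 := 1)).
- exact: WB_ok.
- by under eq_fun do rewrite WB_Tc; exact: WB_ok.
- exact: mp_Tc.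
- exact: TcK.
- exact: good_Tc.
- by move=> p; rewrite /rdist enorm_rel_Tc.
- move=> m m1; exists (8 * m ^+ 4 * surfT) => Z mZ.
  apply: (law_mono (V := @vpost3 R)) => //; [by apply: mf_fst; exact: mf_fst|exact: mf_vpost3| |].
    by move=> p /Tc_good[].
  by apply: law_vpost => //; apply: lt_le_trans m1.
Qed.

Lemma crossC i j : cross_cpt (WC i j) ScTc.
Proof.
have [mt _] := mp_ScTc.
apply: (cross_compact (e0 := -1)).
- exact: WC_ok.
- by under eq_fun do rewrite WC_ScTc; exact: WC_ok.
- exact: mp_ScTc.
- exact: ScTcK.
- by move=> p; rewrite /ScTc good_Sw good_Tc.
- by move=> p; rewrite /rdist/= enormB -[RHS]/(rdist p) /rdist enorm_rel_Tc.
- move=> m m1; exists (8 * m ^+ 4 * surfT) => Z mZ.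
  apply: (law_mono (V := @vstar3 R)) => //; [by apply: mf_fst; exact: mf_fst|exact: mf_vstar3| |].
    by move=> p /Tc_good[].
  by apply: law_vstar => //; apply: lt_le_trans m1.
Qed.

End growth.

End kernel_bounds.

(** * Collision frequency *)

(** The explicit bound, in place of a minimum, also covers an empty index set. *)
Lemma pos_lower_bound {R : realType} (n : nat) (F : 'I_n -> R) : (forall i, 0 < F i) ->
  exists2 m : R, 0 < m & forall i, m <= F i.
Proof.
move=> F0; have S0 : 0 <= \sum_j (F j)^-1 by apply: sumr_ge0 => j _; rewrite invr_ge0 ltW.
exists (1 + \sum_j (F j)^-1)^-1; first by rewrite invr_gt0 ltr_pwDl.
move=> i; rewrite -[leRHS]invrK lef_pV2 ?posrE ?invr_gt0// ?ltr_pwDl//.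
rewrite (bigD1 i)//= addrCA lerDl addr_ge0//; apply: sumr_ge0 => j _.
by rewrite invr_ge0 ltW.
Qed.

Lemma one_addr_le {R : realType} (y : R) (d : \bar R) :
  (1 <= d)%E -> (y%:E <= d)%E -> ((1 + y)%:E <= 2%:E * d)%E.
Proof.
case: d => [d| |//]; first by rewrite -EFinM !lee_fin; lra.
by move=> _ _; rewrite gt0_muley ?lte_fin// leey.
Qed.

Section collision_frequency.
Context {R : realType} {n : nat}.
Local Notation trip := (vel R * vel R * vel R)%type.
Variables (rho : 'I_n -> R) (B : 'I_n -> 'I_n -> R -> R -> R) (Phi b : 'I_n -> 'I_n -> R -> R).
Hypotheses (hrho : forall i, 0 < rho i) (hB : collision_kernel B).
Hypotheses (hA2 : kernel_factor B Phi b).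
Implicit Types (i j : 'I_n) (p : trip).

Lemma rho_le_tot i : rho i <= rho_tot rho.
Proof. by rewrite /rho_tot (bigD1 i)//= lerDl sumr_ge0// => j _; exact: ltW. Qed.

Section upper_bound.
Variables (C2 C3 del : R).
Hypothesis Phi_le : forall i j r, 0 < r -> Phi i j r <= C2 * (r + r `^ (- del)).
Hypothesis b_le : forall i j x, -1 <= x <= 1 -> b i j x <= C3 * `|sin (acos x)|.
Hypotheses (C2_gt0 : 0 < C2) (C3_gt0 : 0 < C3) (del_gt0 : 0 < del) (del_lt1 : del < 1).

(** Half of the Gaussian exponent absorbs the growth in |w|, the other half is kept for
    integrability. *)
Lemma dist_gauss_le (v w : vel R) (x : R) : 0 <= x ->
  (enorm (v - w) + x) * expR (- (enorm w ^+ 2 / 2)) <=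
  (1 + enorm v) * (1 + x) * expR (- 4^-1 * enorm w ^+ 2).
Proof.
move=> x0; have v0 := enorm_ge0 v; have w0 := enorm_ge0 w.
have r1 : enorm (v - w) <= enorm v + enorm w by rewrite -[enorm w]enormN enormD.
have e1 := expR_ge1Dx (4^-1 * enorm w ^+ 2).
have -> : - (enorm w ^+ 2 / 2) = - 4^-1 * enorm w ^+ 2 + - 4^-1 * enorm w ^+ 2 by field.
rewrite expRD mulrA ler_wpM2r ?expR_ge0// mulNr expRN.
have E0 : 0 < expR (4^-1 * enorm w ^+ 2) by exact: expR_gt0.
rewrite ler_pdivrMr//.
have e2 : 1 + 4^-1 * enorm w ^+ 2 <= expR (4^-1 * enorm w ^+ 2) by [].
have e3 : enorm w <= 1 + 4^-1 * enorm w ^+ 2.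
  by have := sqr_ge0 (2^-1 * enorm w - 1); move: (enorm w) => y; rewrite sqrrB exprMn; lra.
apply: (@le_trans _ _ ((1 + enorm v) * (1 + x) * (1 + 4^-1 * enorm w ^+ 2))); last first.
  by rewrite ler_wpM2l// mulr_ge0// addr_ge0.
have h1 : 0 <= 4^-1 * enorm w ^+ 2 by rewrite mulr_ge0 ?sqr_ge0 ?invr_ge0.
apply: (@le_trans _ _ (enorm v + (1 + 4^-1 * enorm w ^+ 2) + x)).
  by rewrite lerD2r (le_trans r1)// lerD2l.
move: (enorm v) (4^-1 * _) v0 h1 => a c a0 c0.
have -> : (1 + a) * (1 + x) * (1 + c) =
  a + (1 + c) + x + (a * x + a * c + x * c + a * x * c) by ring.
by rewrite lerDl !addr_ge0// !mulr_ge0.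
Qed.

Lemma nuE_le : exists2 K : R, 0 < K & forall i j v, (nuE rho B i j v <= (K * (1 + enorm v))%:E)%E.
Proof.
have q0 : 0 < 4^-1 :> R by rewrite invr_gt0.
have [K K0 hK] := schur_dyad del_lt1 q0.
have rt0 i : 0 <= rho_tot rho by apply: le_trans (rho_le_tot i); exact: ltW.
exists ((2 * (C2 * C3) * (`|rho_tot rho| * (2 * pi) `^ (- (3 / 2)))) * 2 * K + 1).
  by rewrite ltr_wpDl// !mulr_ge0 ?(ltW C2_gt0) ?(ltW C3_gt0) ?powR_ge0.
move=> i j v; rewrite ger0_norm ?(rt0 i)//.
pose A := 2 * (C2 * C3) * (rho_tot rho * (2 * pi) `^ (- (3 / 2))).
have A_ge0 : 0 <= A by rewrite /A !mulr_ge0 ?(ltW C2_gt0) ?(ltW C3_gt0) ?powR_ge0 ?(rt0 i).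
have c0 : 0 <= A * (1 + enorm v) * 2 by rewrite mulr_ge0// mulr_ge0// addr_ge0// enorm_ge0.
(* The angular dyadic factor is at least 1; it is inserted so that [schur_dyad] applies, with e =
   1. *)
pose G (q : vel R * vel R) : \bar R := ((expR (- 4^-1 * enorm q.1 ^+ 2))%:E *
  dyad del (enorm (v - q.1)%R) * dyad del (enorm (q.2 - 1 *: dir (v - q.1))%R))%E.
have G0 q : (0 <= G q)%E by rewrite /G !mule_ge0 ?lee_fin ?expR_ge0// dyad_ge0.
have mG : measurable_fun setT G.
  by rewrite /G; apply: emeasurable_funM; [apply: emeasurable_funM|]; [mfv|apply: mf_dyad; mfv|apply: mf_dyad; mfv].
have mk := mf_kk hB i j; have mM := mf_maxw rho j.
apply: (@le_trans _ _ (\int[sfprod leb3 surf]_q ((A * (1 + enorm v) * 2)%:E * G q))%E).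
  apply: ge0_le_integral.
  - exact: measurableT.
  - move=> q _; rewrite lee_fin mulr_ge0 ?kk_ge0//; exact/ltW/maxw_gt0.
  - by mfv.
  - by apply: emeasurable_funM => //.
  move=> [w s] _ /=.
  have h1 : kk B i j (v, w, s) * maxw rho j w <=
      A * (1 + enorm v) * expR (- 4^-1 * enorm w ^+ 2) * (1 + enorm (v - w) `^ (- del)).
    have x0 : 0 <= enorm (v - w) `^ (- del) by exact: powR_ge0.
    apply: (@le_trans _ _ (2 * (C2 * C3) * (enorm (v - w) + enorm (v - w) `^ (- del)) *
       (rho_tot rho * (2 * pi) `^ (- (3 / 2)) * expR (- (enorm w ^+ 2 / 2))))).
      apply: ler_pM.
      - exact: kk_ge0.
      - exact/ltW/maxw_gt0.
      - exact: (kk_le0 hA2 Phi_le b_le C2_gt0 C3_gt0 i j (v, w, s)).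
      - by rewrite /maxw ler_wpM2r ?expR_ge0// ler_wpM2r ?powR_ge0// rho_le_tot.
    have := dist_gauss_le v w x0.
    move: (enorm (v - w) + _) (expR (- (_ / 2))) (expR (- 4^-1 * _)) => a e f h.
    have -> : 2 * (C2 * C3) * a * (rho_tot rho * (2 * pi) `^ (- (3 / 2)) * e) = A * (a * e).
      by rewrite /A; ring.
    have -> : A * (1 + enorm v) * f * (1 + enorm (v - w) `^ (- del)) =
      A * ((1 + enorm v) * (1 + enorm (v - w) `^ (- del)) * f) by ring.
    exact: ler_wpM2l.
  apply: (@le_trans _ _ ((A * (1 + enorm v) * expR (- 4^-1 * enorm w ^+ 2))%:E *
    (1 + enorm (v - w)%R `^ (- del))%:E)%E); first by rewrite -EFinM lee_fin.
  have h2 : ((1 + enorm (v - w)%R `^ (- del))%:E <= 2%:E * dyad del (enorm (v - w)%R))%E.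
    apply: one_addr_le; first exact: dyad_ge1.
    by have := dyad_powR del_gt0 (enorm (v - w)); rewrite ger0_norm ?enorm_ge0.
  have e0 : 0 <= A * (1 + enorm v) * expR (- 4^-1 * enorm w ^+ 2).
    by rewrite mulr_ge0 ?expR_ge0// mulr_ge0// addr_ge0// enorm_ge0.
  apply: (le_trans (lee_wpmul2l _ h2)); first by rewrite lee_fin.
  have -> : ((A * (1 + enorm v) * expR (- 4^-1 * enorm w ^+ 2))%:E * (2%:E * dyad del (enorm (v - w)%R)) =
    (A * (1 + enorm v) * 2)%:E * ((expR (- 4^-1 * enorm w ^+ 2))%:E * dyad del (enorm (v - w)%R)))%E.
    rewrite !muleA -!EFinM; congr (_%:E * _)%E; ring.
  rewrite lee_wpmul2l ?lee_fin// /G/= lee_pemulr ?dyad_ge1//.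
  by rewrite mule_ge0 ?lee_fin ?expR_ge0// dyad_ge0.
apply: (@le_trans _ _ ((A * (1 + enorm v) * 2)%:E * \int[sfprod leb3 surf]_q G q)%E).
  by apply: le_eq; exact: (ge0_integralZl_EFin (sfprod leb3 surf) measurableT (fun q _ => G0 q) mG c0).
apply: (@le_trans _ _ ((A * (1 + enorm v) * 2)%:E * K%:E)%E).
  apply: lee_wpmul2l; first by rewrite lee_fin.
  exact: (hK v 1).
rewrite -EFinM lee_fin -/A.
have -> : A * (1 + enorm v) * 2 * K = A * 2 * K * (1 + enorm v) by ring.
by rewrite ler_wpM2r ?addr_ge0 ?enorm_ge0// lerDl.
Qed.

End upper_bound.

Section lower_bound.
Variable (C1 : R).
Hypothesis C1_gt0 : 0 < C1.
Hypothesis Phi_ge : forall i j r, 1 <= r -> C1 <= Phi i j r.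
Hypothesis Cb_gt0 : (0 < Cb b)%E.

(** The infimum in [Cb] is read on the diagonal of S2 x S2, where the minimum of the two kernels is
    the kernel itself. An infinite [Cb] is replaced by 1. *)
Lemma Cb_lower : exists2 c : R, 0 < c & forall i e, enorm e = 1 ->
  (c%:E <= \int[surf]_(s in S2) (b i i (dot e s))%:E)%E.
Proof.
have [c c0 hc] : exists2 c : R, 0 < c & (c%:E <= Cb b)%E.
  case: (Cb b) Cb_gt0 => [c| |]//; first by rewrite lte_fin => c0; exists c.
  by exists 1; rewrite ?leey.
exists c => // i e e1; apply: (le_trans hc); rewrite /Cb.
apply: (@le_trans _ _ (ereal_inf [set \int[surf]_(s in S2)
   (Num.min (b i i (dot s12.1 s)) (b i i (dot s12.2 s)))%:E | s12 in S2 `*` S2]))%E.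
  exact: bigmin_le_cond.
apply: ereal_inf_lbound; exists (e, e) => //=.
by apply: eq_integral => s _; rewrite minxx.
Qed.

(** A unit box across the plane w_1 = 0 from v. Its points are at distance at least 1 from v, where
    Phi >= C1, and satisfy |w|^2 <= 6, where the Maxwellian is bounded below. *)
Definition far_box (v : vel R) : set (vel R) :=
  ((if 0 <= v.1.1 then `[-2, -1]%classic else `[1, 2]%classic) `*` `[0, 1]) `*` `[0, 1].

Lemma measurable_far_box v : measurable (far_box v).
Proof. by rewrite /far_box; case: ifP => _; do !apply: measurableX => //; exact: measurable_itv. Qed.

Lemma leb3_far_box v : leb3 (far_box v) = 1%E.
Proof.
rewrite /far_box; set I := (if _ then _ else _).
have mI : measurable (I : set (measurableTypeR R)) by rewrite /I; case: ifP => _; exact: measurable_itv.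
have mJ : measurable (`[0, 1]%classic : set (measurableTypeR R)) by exact: measurable_itv.
rewrite (leb3_box mI mJ mJ).
have e1 : lebesgue_measure (`[0, 1]%classic : set (measurableTypeR R)) = 1%:E :> \bar R.
  by rewrite lebesgue_measure_itv/= lte01 -EFinD subr0.
have e2 : lebesgue_measure I = 1%:E.
  rewrite /I; case: ifP => _; rewrite lebesgue_measure_itv/= lte_fin.
    by rewrite ltrN2 ltr1n -EFinD; congr EFin; ring.
  by rewrite ltr1n -EFinD; congr EFin; ring.
by rewrite e1 e2 !mule1.
Qed.

Lemma far_box_dist v w : far_box v w -> 1 <= enorm (v - w) /\ enorm w ^+ 2 <= 6.
Proof.
move=> [[h1 h2] h3]; move: h2 h3; rewrite /= !in_itv/= => /andP[a1 a2] /andP[b1 b2].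
have [h4 h5] : 1 <= `|(v - w).1.1| /\ w.1.1 ^+ 2 <= 4.
  move: h1; case: ifPn => v0 /=; rewrite in_itv/= => /andP[c1 c2]; split.
  - by rewrite ger0_norm/=; lra.
  - nra.
  - by rewrite ler0_norm/=; move: v0; rewrite -ltNge => v0; lra.
  - nra.
split; first exact: (le_trans h4 (enorm_coord1 _)).
rewrite enorm_sqr /dot; nra.
Qed.

Lemma nuE_ge : exists2 c : R, 0 < c & forall i v, (c%:E <= nuE rho B i i v)%E.
Proof.
have [c c0 hc] := Cb_lower; have [m m0 hm] := pos_lower_bound hrho.
(* The factor exp(-3) is the Gaussian at |w|^2 = 6. *)
pose M := m * (2 * pi) `^ (- (3 / 2)) * expR (- 3).
have M0 : 0 < M by rewrite /M !mulr_gt0 ?expR_gt0// powR_gt0// mulr_gt0// pi_gt0.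
exists (C1 * c * M); first by rewrite mulr_gt0// mulr_gt0.
move=> i v; have mk := mf_kk hB i i; have mM := mf_maxw rho i.
have mF : measurable_fun setT (fun q : vel R * vel R => kk B i i (v, q.1, q.2) * maxw rho i q.1) by mfv.
have F0 q : 0 <= kk B i i (v, q.1, q.2) * maxw rho i q.1.
  by rewrite mulr_ge0 ?kk_ge0//; exact/ltW/maxw_gt0.
apply: le_trans (le_eq (esym (sf_fubini1R leb3 surf mF F0))).
have mFF : measurable_fun setT (fun w => \int[surf]_s (kk B i i (v, w, s) * maxw rho i w)%:E)%E.
  exact: (measurable_fubini1R surf mF F0).
apply: (@le_trans _ _ (\int[leb3]_(w in far_box v) (C1 * c * M)%:E)%E).
  have CM0 : 0 <= C1 * c * M by rewrite ltW// mulr_gt0// mulr_gt0.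
  have h : (\int[leb3]_(w in far_box v) (C1 * c * M)%:E = (C1 * c * M)%:E * leb3 (far_box v))%E.
    exact: (integral_cst _ (measurable_far_box v)).
  by apply: le_eq; rewrite h leb3_far_box mule1.
apply: (@le_trans _ _ (\int[leb3]_(w in far_box v)
    \int[surf]_s (kk B i i (v, w, s) * maxw rho i w)%:E)%E); last first.
  apply: ge0_subset_integral => //; first exact: measurable_far_box.
  by move=> w _; apply: integral_ge0 => s _; rewrite lee_fin; exact: (F0 (w, s)).
apply: ge0_le_integral.
- exact: measurable_far_box.
- by move=> w _; rewrite lee_fin ltW// mulr_gt0// mulr_gt0.
- exact: measurable_cst.
- exact: measurable_funTS.
move=> w /far_box_dist[r1 w6].
have vw : v != w by rewrite -subr_eq0 -enorm_gt0 (lt_le_trans _ r1).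
have mS2 := @measurable_S2 R.
have e1 : enorm (dir (v - w)) = 1 by rewrite enorm_dir// subr_eq0.
have mb : measurable_fun setT (fun s : vel R => kk B i i (v, w, s)) by mfv.
apply: (@le_trans _ _ (\int[surf]_(s in S2) (kk B i i (v, w, s) * maxw rho i w)%:E)%E); last first.
  apply: ge0_subset_integral => //; first by mfv.
  by move=> s _; rewrite lee_fin; exact: (F0 (w, s)).
have key s : S2 s -> C1 * M * b i i (dot (dir (v - w)) s) <= kk B i i (v, w, s) * maxw rho i w.
  move=> /= s1; have gp : good (v, w, s) by rewrite /good/= vw s1 eqxx.
  have x1 := cosdev_le1 gp; have [h1 h2 h3] := hA2 i i.
  rewrite /kk gp /kern h3 ?(lt_le_trans _ r1)//.
  have -> : cosdev v w s = dot (dir (v - w)) s by rewrite /cosdev /dir dotZl mulrC dotC.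
  have b0 : 0 <= b i i (dot (dir (v - w)) s).
    by apply: h2; rewrite (_ : dot _ _ = cosdev v w s)//; rewrite /cosdev /dir dotZl mulrC dotC.
  rewrite [leRHS]mulrAC; apply: ler_wpM2r => //; apply: ler_pM; [exact: ltW|exact: ltW|exact: Phi_ge|].
  rewrite /M /maxw ler_pM ?expR_ge0//.
  - by rewrite mulr_ge0 ?powR_ge0// ltW.
  - by rewrite ler_wpM2r ?powR_ge0.
  - rewrite ler_expR; move: w6; lra.
have CM0 : 0 <= C1 * M by rewrite mulr_ge0// ltW.
have b0 s : S2 s -> 0 <= b i i (dot (dir (v - w)) s).
  move=> /= s1; have [h1 h2 h3] := hA2 i i; apply: h2.
  by rewrite -ler_norml; apply: (le_trans (dot_le _ _)); rewrite e1 s1 mulr1.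
(* Only B is assumed measurable. The angular factor is recovered from it by dividing by Phi, which
   is positive at distance at least 1. *)
have mbb : measurable_fun S2 (fun s => (b i i (dot (dir (v - w)) s))%:E).
  have [h1 h2 h3] := hA2 i i.
  have P0 : 0 < Phi i i (enorm (v - w)) by apply: (lt_le_trans C1_gt0); exact: Phi_ge.
  apply: (eq_measurable_fun (fun s => ((Phi i i (enorm (v - w)))^-1 * kk B i i (v, w, s))%:E)).
    move=> s; rewrite inE => /= s1; have gp : good (v, w, s) by rewrite /good/= vw s1 eqxx.
    rewrite /kk gp /kern h3 ?(lt_le_trans _ r1)//; last exact: cosdev_le1.
    by rewrite mulKf ?gt_eqF// /cosdev /dir dotZl mulrC dotC.
  by apply: measurable_funTS; mfv.
have -> : (C1 * c * M)%:E = ((C1 * M)%:E * c%:E)%E by rewrite -EFinM; congr EFin; ring.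
apply: (@le_trans _ _ ((C1 * M)%:E * \int[surf]_(s in S2) (b i i (dot (dir (v - w)) s))%:E)%E).
  by apply: lee_wpmul2l; [rewrite lee_fin|exact: hc].
rewrite -ge0_integralZl_EFin//.
apply: ge0_le_integral => //.
- by move=> s /b0 h; rewrite -EFinM lee_fin mulr_ge0.
- by apply: emeasurable_funM => //; exact: measurable_cst.
- by apply: measurable_funTS; mfv.
Qed.

End lower_bound.
End collision_frequency.

(** * Completeness *)

Section dyadic_sequences.
Context {R : realType}.

Lemma dyadic_cauchy (a : nat -> R) (M : R) : 0 <= M ->
  (forall j, (a j.+1 - a j) ^+ 2 <= M * 2^-1 ^+ j) ->
  forall m j, (a (j + m)%N - a j) ^+ 2 <= 12 * M * 2^-1 ^+ j.
Proof.
move=> M0 ha; elim=> [|m IH] j.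
  by rewrite addn0 subrr expr0n/= !mulr_ge0 ?exprn_ge0 ?invr_ge0.
have h1 := ha j; have h2 := IH j.+1; rewrite addnS -addSn.
have -> : a (j.+1 + m)%N - a j = (a (j.+1 + m)%N - a j.+1) + (a j.+1 - a j) by ring.
rewrite [_ ^+ j.+1]exprS in h2; move: h1 h2.
have : 0 <= 2^-1 ^+ j :> R by rewrite exprn_ge0 ?invr_ge0.
move: (a j.+1 - a j) (a (j.+1 + m)%N - a j.+1) (2^-1 ^+ j) => x y e e0 hx hy.
(* This gives (x + y)^2 <= 3 x^2 + (3/2) y^2. With x^2 <= M e and y^2 <= (12 / 2) M e the total is 3
   + 9 = 12 times M e, so the constant 12 reproduces itself. *)
have := sqr_ge0 (y - 2 * x); nra.
Qed.

Lemma half_expr_small (c e : R) : 0 < e ->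
  exists J : nat, forall j : nat, (J <= j)%N -> c * 2^-1 ^+ j < e.
Proof.
move=> e0; have h : (fun j : nat => c * 2^-1 ^+ j) @ \oo --> (c * 0 : R).
  by apply: cvgMr; apply: cvg_expr; rewrite ger0_norm ?invr_ge0// invf_lt1// ltr1n.
rewrite mulr0 in h; have [N _ hN] := cvgr_lt _ h _ e0.
by exists N => j Nj; exact: hN.
Qed.

Lemma dyadic_limit (a : nat -> R) (M : R) : 0 <= M ->
  (forall j, (a j.+1 - a j) ^+ 2 <= M * 2^-1 ^+ j) ->
  exists l : R, a @ \oo --> l /\ forall j, (a j - l) ^+ 2 <= 12 * M * 2^-1 ^+ j.
Proof.
move=> M0 ha; have hc := dyadic_cauchy M0 ha.
have /cauchy_cvgP cv : cauchy (a @ \oo).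
  apply: cauchy_exP => e e0.
  have [j /(_ _ (leqnn j)) hj] := half_expr_small (12 * M) (mulr_gt0 e0 e0).
  exists (a j); exists j => // k /= jk.
  rewrite /ball/=; have := hc (k - j)%N j; rewrite subnKC// => h.
  rewrite distrC -(@ltr_pXn2r _ 2) ?nnegrE ?(ltW e0)// real_normK ?num_real//.
  by rewrite [ltRHS]expr2; exact: le_lt_trans h hj.
exists (limn a); split => // j.
have h : (fun k => (a j - a k) ^+ 2) @ \oo --> (a j - limn a) ^+ 2.
  rewrite expr2; under eq_fun do rewrite expr2.
  by apply: cvgM; apply: cvgB => //; exact: cvg_cst.
apply: (cvgr_to_le h); exists j => // k /= jk.
by have := hc (k - j)%N j; rewrite subnKC// -sqrrN opprB.
Qed.

Lemma sum_half (c : R) k : \sum_(j < k) c * 2^-1 ^+ j = 2 * c * (1 - 2^-1 ^+ k).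
Proof.
elim: k => [|k IH]; first by rewrite big_ord0 expr0 subrr mulr0.
by rewrite big_ord_recr/= IH exprS; field.
Qed.

End dyadic_sequences.

Section square_integrable_complete.
Context {R : realType} d (T : measurableType d) (m : {measure set T -> \bar R}).

(** As the increments are of order 4^-j, G = sum of 2^j (u_(j+1) - u_j)^2 is integrable. Where G is
    finite the squared increments are at most G 2^-j, so the sequence converges there with a rate,
    and G dominates the error. *)
Lemma L2_dyadic_complete (u : nat -> T -> R) (C : R) : (forall j, sqi m (u j)) -> 0 <= C ->
  (forall j, L2ip m (fun x => u j.+1 x - u j x) (fun x => u j.+1 x - u j x) <= C * 4^-1 ^+ j) ->
  exists2 v : T -> R, sqi m v & exists K : R, forall j,
    L2ip m (fun x => u j x - v x) (fun x => u j x - v x) <= K * 2^-1 ^+ j.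
Proof.
move=> su C0 hu; have mu j : measurable_fun setT (u j) := (su j).1.
pose D j x : \bar R := (2 ^+ j * (u j.+1 x - u j x) ^+ 2)%:E.
have D0 j x : (0 <= D j x)%E by rewrite lee_fin mulr_ge0 ?sqr_ge0 ?exprn_ge0.
have mD j : measurable_fun setT (D j) by have := mu j; have := mu j.+1 => h1 h2; rewrite /D; mfv.
pose G x := (\sum_(j <oo) D j x)%E.
have G0 x : (0 <= G x)%E by apply: nneseries_ge0 => j _ _; exact: D0.
have mG : measurable_fun setT G by apply: (ge0_emeasurable_sum (P := xpredT)) => // k x _ _; exact: D0.
have Goo : (\int[m]_x G x <= (2 * C)%:E)%E.
  rewrite integral_nneseries//.
  apply: lime_le; first by apply: is_cvg_nneseries => j _ _; apply: integral_ge0 => x _; exact: D0.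
  apply: nearW => k; rewrite big_mkord.
  apply: (@le_trans _ _ (\sum_(j < k) (C * 2^-1 ^+ j)%:E)%E).
    apply: lee_sum => j _; rewrite /D.
    under eq_integral do rewrite EFinM.
    have sd := sqiB (su j.+1) (su j).
    have mdd : measurable_fun setT (fun x => ((u j.+1 x - u j x) ^+ 2)%:E).
      by have := sd.1 => h; mfv.
    rewrite ge0_integralZl_EFin//; last by move=> x _; rewrite lee_fin sqr_ge0.
    rewrite -(L2ipE sd) -EFinM lee_fin.
    apply: (@le_trans _ _ (2 ^+ j * (C * 4^-1 ^+ j))); first by rewrite ler_wpM2l ?exprn_ge0.
    have e24 : 2 * 4^-1 = 2^-1 :> R by field.
    by rewrite mulrCA -exprMn e24.
  rewrite sumEFin sum_half lee_fin; have : 0 <= 2^-1 ^+ k :> R by rewrite exprn_ge0 ?invr_ge0.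
  by move=> e0; rewrite ler_piMr ?mulr_ge0// lerBlDr lerDl.
have iG : m.-integrable setT G.
  apply/integrableP; split => //; under eq_integral do rewrite gee0_abs//.
  by apply: (le_lt_trans Goo); rewrite ltry.
have aeG := integrable_ae measurableT iG.
pose S := [set x | G x \is a fin_num].
have mS : measurable S by rewrite -[S]setTI; exact: emeasurable_fin_num.
pose M x := fine (G x).
have M0 x : 0 <= M x by exact: fine_ge0.
have mM : measurable_fun setT M by exact: measurableT_comp.
(* Cutting to the set where G is finite makes the sequence converge at every point, so the limit is
   measurable; almost everywhere nothing changes. *)
pose w j x := u j x * \1_S x.
have mw j : measurable_fun setT (w j) by apply: measurable_funM => //; exact: measurable_indic.
have hw x j : (w j.+1 x - w j x) ^+ 2 <= M x * 2^-1 ^+ j.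
  rewrite /w -mulrBl; have [Sx|Sx] := pselect (S x); last first.
    by rewrite indicE memNset// mulr0 expr0n/= mulr_ge0 ?exprn_ge0 ?invr_ge0.
  rewrite indicE mem_set// mulr1 exprVn ler_pdivlMr ?exprn_gt0// mulrC.
  have : (D j x <= G x)%E.
    apply: le_trans (nneseries_lim_ge j.+1 (fun n _ _ => D0 n x)).
    by rewrite big_nat_recr//= leeDr// sume_ge0.
  by rewrite -[G x]fineK// lee_fin.
have [v hv] := choice (fun x => dyadic_limit (M0 x) (hw x)).
have mv : measurable_fun setT v by apply: (measurable_fun_cvg mw) => x _; exact: (hv x).1.
have iM : (\int[m]_x (M x)%:E <= (2 * C)%:E)%E.
  apply: le_trans Goo; apply: ge0_le_integral => //.
  - by move=> x _; rewrite lee_fin.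
  - exact/measurable_EFinP.
  - move=> x _; rewrite /M; have := G0 x; case: (G x) => //= _; rewrite leey//.
have aeuw j : {ae m, forall x, u j x = w j x}.
  apply: filterS aeG => x /= /(_ I) fx; rewrite /w indicE mem_set ?mulr1//.
have bd j : (\int[m]_x ((u j x - v x) ^+ 2)%:E <= (12 * (2 * C) * 2^-1 ^+ j)%:E)%E.
  have mj := mu j; have mwj := mw j.
  have -> : (\int[m]_x ((u j x - v x) ^+ 2)%:E = \int[m]_x ((w j x - v x) ^+ 2)%:E)%E.
    apply: ae_eq_integral => //; [by mfv|by mfv|].
    by apply: filterS (aeuw j) => x -> _.
  apply: (@le_trans _ _ (\int[m]_x ((12 * 2^-1 ^+ j)%:E * (M x)%:E))%E).
    apply: ge0_le_integral => //.
    - by move=> x _; rewrite lee_fin sqr_ge0.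
    - by mfv.
    - by apply: emeasurable_funM => //; exact/measurable_EFinP.
    - move=> x _; rewrite -EFinM lee_fin; apply: (le_trans ((hv x).2 j)).
      by rewrite mulrAC.
  rewrite ge0_integralZl_EFin//; last 2 first.
  - by move=> x _; rewrite lee_fin.
  - exact/measurable_EFinP.
  apply: (le_trans (lee_wpmul2l _ iM)); first by rewrite lee_fin mulr_ge0 ?exprn_ge0 ?invr_ge0.
  by rewrite -EFinM lee_fin mulrAC.
have sdiff j : sqi m (fun x => u j x - v x).
  split; last by apply: (le_lt_trans (bd j)); rewrite ltry.
  by apply: measurable_funB.
exists v.
  have := sqiB (su 0%N) (sdiff 0%N); under eq_fun do rewrite subKr; exact.
by exists (12 * (2 * C)) => j; rewrite -lee_fin L2ipE.
Qed.

End square_integrable_complete.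

(** * Qualitative spectral gap *)

Lemma L2ip_expand4 {R : realType} d (T : measurableType d) (m : {measure set T -> \bar R})
    (a b c e : T -> R) : sqi m a -> sqi m b -> sqi m c -> sqi m e ->
  L2ip m (fun x => c x + e x - a x - b x) (fun x => c x + e x - a x - b x) =
  L2ip m a a + L2ip m b b + L2ip m c c + L2ip m e e + 2 * L2ip m c e + 2 * L2ip m a b
  - 2 * L2ip m c a - 2 * L2ip m c b - 2 * L2ip m e a - 2 * L2ip m e b.
Proof.
move=> sa sb sc se; have s1 := sqiD sc se; have s2 := sqiB s1 sa; have s3 := sqiB s2 sb.
have h g : sqi m g -> L2ip m (fun x => c x + e x - a x - b x) g =
    L2ip m c g + L2ip m e g - L2ip m a g - L2ip m b g.
  by move=> sg; rewrite L2ipBl// L2ipBl// L2ipDl.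
rewrite h// !(L2ipC m _ (fun x => c x + e x - a x - b x)) !h//.
rewrite (L2ipC m a c) (L2ipC m b c) (L2ipC m e c) (L2ipC m a e) (L2ipC m b e) (L2ipC m b a).
ring.
Qed.

Section gain_loss_norm.
Context {R : realType} d (T : measurableType d) (m : {measure set T -> \bar R}).
Variables (a b c e : T -> R) (N N' : R).
Hypotheses (sa : sqi m a) (sb : sqi m b) (sc : sqi m c) (se : sqi m e).
Hypotheses (aN : L2ip m a a = N) (bN : L2ip m b b = N') (cN : L2ip m c c = N) (eN : L2ip m e e = N').

Lemma L2ip_gain_loss (A D D' E : R) : L2ip m c e = A -> L2ip m a b = A ->
  L2ip m a c = D -> L2ip m e b = D' -> L2ip m c b = E -> L2ip m a e = E ->
  L2ip m (fun x => c x + e x - a x - b x) (fun x => c x + e x - a x - b x) =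
  2 * N + 2 * N' + 4 * A - 2 * D - 2 * D' - 4 * E.
Proof.
move=> h1 h2 h3 h4 h5 h6; rewrite L2ip_expand4// aN bN cN eN h1 h2 h4 h5 (L2ipC m c a) h3.
rewrite (L2ipC m e a) h6; ring.
Qed.

Lemma L2ip_gain_loss_le :
  L2ip m (fun x => c x + e x - a x - b x) (fun x => c x + e x - a x - b x) <= 8 * N + 8 * N'.
Proof.
have y f g : sqi m f -> sqi m g -> - (L2ip m f f + L2ip m g g) <= 2 * L2ip m f g <= L2ip m f f + L2ip m g g.
  move=> sf sg; have := L2ip_young ltr01 sf sg; rewrite invr1 !mul1r -ler_norml => h.
  by rewrite normrM ger0_norm.
rewrite L2ip_expand4//.
have /andP[_ h1] := y _ _ sc se; have /andP[_ h2] := y _ _ sa sb.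
have /andP[h3 _] := y _ _ sc sa; have /andP[h4 _] := y _ _ sc sb.
have /andP[h5 _] := y _ _ se sa; have /andP[h6 _] := y _ _ se sb.
move: h1 h2 h3 h4 h5 h6; rewrite aN bN cN eN; lra.
Qed.

End gain_loss_norm.

Lemma sum_symmetrize {R : numFieldType} (n : nat) (N A D E : 'I_n -> 'I_n -> R) :
  4^-1 * \sum_i \sum_j (2 * N i j + 2 * N j i + 4 * A i j - 2 * D i j - 2 * D j i - 4 * E i j) =
  \sum_i \sum_j N i j + \sum_i \sum_j (A i j - D i j - E i j).
Proof.
have h (F : 'I_n -> 'I_n -> R) c : \sum_i \sum_j (c * F i j) = c * \sum_i \sum_j F i j.
  by rewrite mulr_sumr; apply: eq_bigr => i _; rewrite mulr_sumr.
have hB (F G : 'I_n -> 'I_n -> R) :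
    \sum_i \sum_j (F i j - G i j) = \sum_i \sum_j F i j - \sum_i \sum_j G i j.
  by rewrite -sumrB; apply: eq_bigr => i _; rewrite sumrB.
have hD (F G : 'I_n -> 'I_n -> R) :
    \sum_i \sum_j (F i j + G i j) = \sum_i \sum_j F i j + \sum_i \sum_j G i j.
  by rewrite -big_split; apply: eq_bigr => i _; rewrite big_split.
rewrite !hB !hD !h [\sum_i \sum_j N j i]exchange_big [\sum_i \sum_j D j i]exchange_big/=.
by field.
Qed.

(** * Expansion of the form into the H norm and cross terms *)

Section form_expansion.
Context {R : realType} {n : nat}.
Local Notation trip := (vel R * vel R * vel R)%type.
Variables (rho : 'I_n -> R) (B : 'I_n -> 'I_n -> R -> R -> R).
Hypotheses (hrho : forall i, 0 < rho i) (hB : collision_kernel B) (hS : kernel_sym B).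
Hypothesis nufin : forall i j v, (nuE rho B i j v < +oo)%E.
Implicit Types (i j : 'I_n) (p : trip) (f g : 'I_n -> vel R -> R).

Local Notation SS := (SS rho B).
Local Notation U1 := (U1 rho B).
Local Notation U2 := (U2 rho B).
Local Notation U3 := (U3 rho B).
Local Notation U4 := (U4 rho B).
Local Notation Hsp := (Hsp rho B).

Lemma U2_norm i j f : Hsp f -> L2ip Pi3 (U2 i j f) (U2 i j f) = L2ip Pi3 (U1 j i f) (U1 j i f).
Proof.
move=> hf; have s := sqi_U1 hrho hB nufin j i hf.
exact: (L2ip_mp (@mp_Sw R) s.1 s.1).
Qed.

Lemma U3_norm i j f : Hsp f -> L2ip Pi3 (U3 i j f) (U3 i j f) = L2ip Pi3 (U1 i j f) (U1 i j f).
Proof.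
move=> hf; have s := sqi_U1 hrho hB nufin i j hf.
exact: (L2ip_mp (@mp_Tc R) s.1 s.1).
Qed.

Lemma U4_norm i j f : Hsp f -> L2ip Pi3 (U4 i j f) (U4 i j f) = L2ip Pi3 (U1 j i f) (U1 j i f).
Proof.
move=> hf; have s := sqi_U2 hrho hB nufin i j hf.
exact: (etrans (L2ip_mp (@mp_Tc R) s.1 s.1) (U2_norm i j hf)).
Qed.

Lemma U34 i j f : Hsp f -> L2ip Pi3 (U3 i j f) (U4 i j f) = L2ip Pi3 (U1 i j f) (U2 i j f).
Proof.
move=> hf; have s1 := sqi_U1 hrho hB nufin i j hf; have s2 := sqi_U2 hrho hB nufin i j hf.
exact: (L2ip_mp (@mp_Tc R) s1.1 s2.1).
Qed.

Lemma U42 i j f : Hsp f -> L2ip Pi3 (U4 i j f) (U2 i j f) = L2ip Pi3 (U1 j i f) (U3 j i f).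
Proof.
move=> hf; have s1 := sqi_U1 hrho hB nufin j i hf; have s3 := sqi_U3 hrho hB nufin j i hf.
rewrite L2ipC -[RHS](L2ip_mp (@mp_Sw R) s1.1 s3.1).
by congr (L2ip Pi3 _ _); apply/funext => p; rewrite /U4 /U2 /U3 /= Tc_Sw.
Qed.

Lemma U32 i j f : Hsp f -> L2ip Pi3 (U3 i j f) (U2 i j f) = L2ip Pi3 (U1 i j f) (U4 i j f).
Proof.
move=> hf; have s1 := sqi_U1 hrho hB nufin i j hf; have s4 := sqi_U4 hrho hB nufin i j hf.
rewrite -[RHS](L2ip_mp (@mp_Tc R) s1.1 s4.1).
by congr (L2ip Pi3 _ _); apply/funext => p; rewrite /U4 /= TcK.
Qed.

(** The collision map identifies U3.U4 with U1.U2 and U3.U2 with U1.U4; with the exchange of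
    particles it identifies U4.U2 with U1.U3 for the pair (j, i). The remaining products are three
    kinds of cross terms. *)
Lemma SS_norm i j f : Hsp f -> L2ip Pi3 (SS i j f) (SS i j f) =
  2 * L2ip Pi3 (U1 i j f) (U1 i j f) + 2 * L2ip Pi3 (U1 j i f) (U1 j i f)
  + 4 * L2ip Pi3 (U1 i j f) (U2 i j f) - 2 * L2ip Pi3 (U1 i j f) (U3 i j f)
  - 2 * L2ip Pi3 (U1 j i f) (U3 j i f) - 4 * L2ip Pi3 (U1 i j f) (U4 i j f).
Proof.
move=> hf; apply: L2ip_gain_loss.
- exact: sqi_U1.
- exact: sqi_U2.
- exact: sqi_U3.
- exact: sqi_U4.
- by [].
- exact: U2_norm.
- exact: U3_norm.
- exact: U4_norm.
- exact: U34.
- by [].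
- by [].
- exact: U42.
- exact: U32.
- by [].
Qed.

(** f_i nu_i^(1/2), through which the H norm becomes an L^2 norm. *)
Definition nuw f i v : R := f i v * Num.sqrt (nu rho B i v).
Definition nuip f g : R := \sum_i L2ip leb3 (nuw f i) (nuw g i).

Lemma mf_nuw i f : measurable_fun setT (f i) -> measurable_fun setT (nuw f i).
Proof. by move=> mf; have mn := mf_nu hrho hB i; rewrite /nuw; mfv. Qed.

Lemma nuw_sqr i f v : nuw f i v ^+ 2 = f i v ^+ 2 * nu rho B i v.
Proof. by rewrite /nuw exprMn sqr_sqrtr// nu_ge0. Qed.

Lemma HspP f : Hsp f <-> forall i, measurable_fun setT (f i) /\ sqi leb3 (nuw f i).
Proof.
split=> hf i; have [mf h] := hf i; split => //.
  split; first exact: mf_nuw.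
  by under eq_integral do rewrite nuw_sqr.
by case: h => _; under eq_integral do rewrite nuw_sqr.
Qed.

Lemma Hsp_sqi f i : Hsp f -> sqi leb3 (nuw f i).
Proof. by move=> /HspP /(_ i)[]. Qed.

Lemma nuipE f : Hsp f -> nuip f f = \sum_i \sum_j L2ip Pi3 (U1 i j f) (U1 i j f).
Proof.
move=> hf; apply: eq_bigr => i _; apply: EFin_inj.
have [mf _] := hf i.
rewrite L2ipE; last exact: Hsp_sqi.
rewrite -sumEFin; 
have e j : (L2ip Pi3 (U1 i j f) (U1 i j f))%:E = (\int[leb3]_v (f i v ^+ 2 * nu_ij rho B i j v)%:E)%E.
  exact: (etrans (L2ipE (sqi_U1 hrho hB nufin i j hf)) (U1_norm hrho hB nufin j mf)).
under [in RHS]eq_bigr do rewrite e.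
rewrite -ge0_integral_sum//; last 2 first.
- by move=> j; have mn := mf_nu_ij hrho hB i j; mfv.
- by move=> j v _; rewrite lee_fin mulr_ge0 ?sqr_ge0// nu_ij_ge0.
by apply: eq_integral => v _; rewrite sumEFin nuw_sqr /nu mulr_sumr.
Qed.

Definition crossf f : R :=
  \sum_i \sum_j (L2ip Pi3 (U1 i j f) (U2 i j f) - L2ip Pi3 (U1 i j f) (U3 i j f)
    - L2ip Pi3 (U1 i j f) (U4 i j f)).

Lemma bq_expand f : Hsp f -> bq rho B f f = nuip f f + crossf f.
Proof.
move=> hf; rewrite /bq nuipE// /crossf.
under eq_bigr => i _ do under eq_bigr => j _ do rewrite (SS_norm i j hf).
exact: sum_symmetrize.
Qed.

(** The square of a sum of four terms is at most four times the sum of the squares, and the four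
    norms are equal in pairs. *)
Lemma bq_le f : Hsp f -> bq rho B f f <= 4 * nuip f f.
Proof.
move=> hf; have e : 4 * nuip f f = 4^-1 * \sum_i \sum_j
    (8 * L2ip Pi3 (U1 i j f) (U1 i j f) + 8 * L2ip Pi3 (U1 j i f) (U1 j i f)).
  rewrite nuipE//; have := sum_symmetrize (fun i j => L2ip Pi3 (U1 i j f) (U1 i j f))
    (fun=> fun=> 0) (fun=> fun=> 0) (fun=> fun=> 0).
  rewrite [X in _ + X]big1 ?addr0 => [<-|i _]; last by rewrite big1// => j _; rewrite !subr0.
  rewrite mulrCA; congr (_ * _); rewrite mulr_sumr; apply: eq_bigr => i _.
  by rewrite mulr_sumr; apply: eq_bigr => j _; ring.
rewrite e /bq ler_wpM2l ?invr_ge0//; apply: ler_sum => i _; apply: ler_sum => j _.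
apply: L2ip_gain_loss_le.
- exact: sqi_U1.
- exact: sqi_U2.
- exact: sqi_U3.
- exact: sqi_U4.
- by [].
- exact: U2_norm.
- exact: U3_norm.
- exact: U4_norm.
Qed.

End form_expansion.

(** * Control of the H norm up to finitely many functionals *)

Section cross_compactness.
Context {R : realType} {n : nat}.
Local Notation trip := (vel R * vel R * vel R)%type.
Variables (rho : 'I_n -> R) (B : 'I_n -> 'I_n -> R -> R -> R).
Hypotheses (hrho : forall i, 0 < rho i) (hB : collision_kernel B) (hS : kernel_sym B).
Hypothesis nufin : forall i j v, (nuE rho B i j v < +oo)%E.
Variable c0 : R.
Hypotheses (c0_gt0 : 0 < c0) (nu_lower : forall i v, c0 <= nu rho B i v).
Implicit Types (i j : 'I_n) (p : trip) (f g : 'I_n -> vel R -> R).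

Local Notation SS := (SS rho B).
Local Notation U1 := (U1 rho B).
Local Notation U2 := (U2 rho B).
Local Notation U3 := (U3 rho B).
Local Notation U4 := (U4 rho B).
Local Notation Hsp := (Hsp rho B).
Local Notation nuip := (nuip rho B).
Local Notation bq := (bq rho B).

Lemma Hsp_sqi0 f i : Hsp f -> sqi leb3 (f i).
Proof.
move=> hf; have [mf s] := (HspP hrho hB f).1 hf i.
have c1 : 0 <= Num.sqrt c0^-1 by exact: sqrtr_ge0.
apply: (sqi_le mf (sqiZ (Num.sqrt c0^-1) s)) => v.
rewrite /nuw !normrM (ger0_norm c1) mulrCA ler_peMr ?normr_ge0//.
rewrite ger0_norm ?sqrtr_ge0// -sqrtrM ?invr_ge0 ?(ltW c0_gt0)//.
by rewrite -[leLHS]sqrtr1 ler_wsqrtr// mulrC ler_pdivlMr// mul1r.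
Qed.

Lemma ip_nuip f : Hsp f -> c0 * ip f f <= nuip f f.
Proof.
move=> hf; rewrite /ip /nuip mulr_sumr; apply: ler_sum => i _.
have s0 := Hsp_sqi0 i hf; have s1 := Hsp_sqi hrho hB i hf.
rewrite -[X in c0 * X]/(L2ip leb3 (f i) (f i)) -lee_fin EFinM !L2ipE//.
rewrite -ge0_integralZl_EFin//; last 3 first.
- by move=> v _; rewrite lee_fin sqr_ge0.
- by have := s0.1 => h; mfv.
- exact: ltW.
have m0 := s0.1; have m1 := s1.1.
apply: ge0_le_integral => //.
- by move=> v _; rewrite -EFinM lee_fin mulr_ge0 ?sqr_ge0// ltW.
- by apply: emeasurable_funM; [exact: measurable_cst|mfv].
- by mfv.
- by move=> v _; rewrite -EFinM lee_fin nuw_sqr// mulrC ler_wpM2l ?sqr_ge0.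
Qed.

Definition l2form N (l : 'I_N -> 'I_n * (vel R -> R)) f : R :=
  \sum_k (L2ip leb3 (f (l k).1) (l k).2) ^+ 2.

Definition compact_form (X : ('I_n -> vel R -> R) -> R) : Prop := forall e : R, 0 < e ->
  exists N (l : 'I_N -> 'I_n * (vel R -> R)) (K : R), [/\ 0 < K,
    forall k, sqi leb3 (l k).2
  & forall f, Hsp f -> `|X f| <= e * ip f f + K * l2form l f].

Definition join_fam N1 N2 (l1 : 'I_N1 -> 'I_n * (vel R -> R)) (l2 : 'I_N2 -> 'I_n * (vel R -> R))
    (k : 'I_(N1 + N2)) :=
  match fintype.split k with inl a => l1 a | inr a => l2 a end.

Lemma l2form_join N1 N2 l1 l2 f : l2form (@join_fam N1 N2 l1 l2) f = l2form l1 f + l2form l2 f.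
Proof.
rewrite /l2form big_split_ord; congr (_ + _); apply: eq_bigr => k _; rewrite /join_fam.
  by rewrite -[lshift _ _]/(unsplit (inl k)) unsplitK.
by rewrite -[rshift _ _]/(unsplit (inr k)) unsplitK.
Qed.

Lemma sqi_join N1 N2 (l1 : 'I_N1 -> 'I_n * (vel R -> R)) l2 :
  (forall k, sqi leb3 (l1 k).2) -> (forall k, sqi leb3 (l2 k).2) ->
  forall k, sqi leb3 (@join_fam N1 N2 l1 l2 k).2.
Proof. by move=> h1 h2 k; rewrite /join_fam; case: (fintype.split k). Qed.

Lemma l2form_ge0 N (l : 'I_N -> 'I_n * (vel R -> R)) f : 0 <= l2form l f.
Proof. by apply: sumr_ge0 => k _; exact: sqr_ge0. Qed.

Lemma ip_ge0 f : 0 <= ip f f.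
Proof. by apply: sumr_ge0 => i _; exact: L2ip_ge0. Qed.

Lemma compact_formD X Y : compact_form X -> compact_form Y -> compact_form (fun f => X f + Y f).
Proof.
move=> hX hY e e0; have e2 : 0 < e / 2 by exact: divr_gt0.
have [N1 [l1 [K1 [K10 s1 h1]]]] := hX _ e2; have [N2 [l2 [K2 [K20 s2 h2]]]] := hY _ e2.
exists (N1 + N2)%N, (join_fam l1 l2), (K1 + K2); split; [exact: addr_gt0|exact: sqi_join|].
move=> f hf; rewrite l2form_join; apply: (le_trans (ler_normD _ _)).
have := h1 f hf; have := h2 f hf; have := l2form_ge0 l1 f; have := l2form_ge0 l2 f.
move: (l2form l1 f) (l2form l2 f) (ip f f) `|X f| `|Y f| => a c z x y c1 a1 hy hx.
have h3 : 0 <= K1 * c by rewrite mulr_ge0// ltW.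
have h4 : 0 <= K2 * a by rewrite mulr_ge0// ltW.
move: hx hy h3 h4; rewrite mulrDr !mulrDl => hx hy h3 h4.
have -> : e * z = e / 2 * z + e / 2 * z by field.
move: (e / 2 * z) (K1 * a) (K1 * c) (K2 * a) (K2 * c) hx hy h3 h4 => p q r s t; lra.
Qed.

Lemma compact_formN X : compact_form X -> compact_form (fun f => - X f).
Proof.
move=> hX e e0; have [N [l [K [K0 s h]]]] := hX _ e0; exists N, l, K; split => // f hf.
by rewrite normrN; exact: h.
Qed.

Lemma compact_form_sum (I : Type) (r : seq I) (X : I -> ('I_n -> vel R -> R) -> R) :
  (forall k, compact_form (X k)) -> compact_form (fun f => \sum_(k <- r) X k f).
Proof.
move=> hX; elim: r => [|k r IH].
  move=> e e0; exists 0%N, (fun k : 'I_0 => False_rect _ (notF (ltn_ord k))), 1.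
  split; [exact: ltr01|by case|move=> f hf].
  rewrite big_nil normr0; apply: addr_ge0; apply: mulr_ge0;
    [exact: ltW|exact: ip_ge0|exact: ler01|exact: l2form_ge0].
under eq_fun do rewrite big_cons; exact: compact_formD.
Qed.

Lemma L2ip_le_ip f i : L2ip leb3 (f i) (f i) <= ip f f.
Proof. by rewrite /ip (bigD1 i)//= lerDl sumr_ge0// => j _; exact: L2ip_ge0. Qed.

Lemma compact_form_cross W tau i j : cross_cpt W tau ->
  (forall f, Hsp f -> Pi3.-integrable setT (EFin \o (fun p => W p * (f i p.1.1 * f j (tsnd tau p))))) ->
  compact_form (fun f => \int[Pi3]_p (W p * (f i p.1.1 * f j (tsnd tau p)))).
Proof.
move=> hW iW e e0; have e2 : 0 < e / 2 by exact: divr_gt0.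
have [N [K [a [b' [K0 sa sb h]]]]] := hW _ e2.
exists (N + N)%N, (join_fam (fun k : 'I_N => (i, a k)) (fun k : 'I_N => (j, b' k))), K.
split => //; first by apply: sqi_join => k /=.
move=> f hf; have sf k := Hsp_sqi0 k hf.
apply: le_trans (h (f i) (f j) (sf i) (sf j) (iW f hf)) _.
rewrite l2form_join /l2form big_split/=; apply: lerD => //.
have -> : e * ip f f = e / 2 * (ip f f + ip f f) by field.
by apply: ler_wpM2l; [exact: ltW|apply: lerD; exact: L2ip_le_ip].
Qed.

Hypothesis cA : forall i j, cross_cpt (WA rho B i j) (@Sw R).
Hypothesis cB : forall i j, cross_cpt (WB rho B i j) (@Tc R).
Hypothesis cC : forall i j, cross_cpt (WC rho B i j) (@ScTc R).

Lemma U12E i j f g p : U1 i j f p * U2 i j g p = WA rho B i j p * (f i p.1.1 * g j (tsnd (@Sw R) p)).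
Proof. by rewrite U2E// /U1 /WA -[kk B i j p](skk_sqr hB) /tsnd/=; ring. Qed.

Lemma U13E i j f g p : U1 i j f p * U3 i j g p = WB rho B i j p * (f i p.1.1 * g i (tsnd (@Tc R) p)).
Proof. by rewrite U3E// /U1 /WB -[kk B i j p](skk_sqr hB) /tsnd; ring. Qed.

Lemma U14E i j f g p : U1 i j f p * U4 i j g p = WC rho B i j p * (f i p.1.1 * g j (tsnd (@ScTc R) p)).
Proof. by rewrite U4E// /U1 /WC -[kk B i j p](skk_sqr hB) /tsnd /ScTc/=; ring. Qed.

Lemma compact_form_ext X Y : (forall f, Hsp f -> X f = Y f) -> compact_form Y -> compact_form X.
Proof.
move=> XY hY e e0; have [N [l [K [K0 s h]]]] := hY _ e0; exists N, l, K; split => // f hf.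
by rewrite XY//; exact: h.
Qed.

Lemma compact_crossf : compact_form (crossf rho B).
Proof.
have h1 i j : compact_form (fun f => L2ip Pi3 (U1 i j f) (U2 i j f)).
  have e f := funext (U12E i j f f).
  apply: (compact_form_ext (Y := fun f => \int[Pi3]_p (WA rho B i j p * (f i p.1.1 * f j (tsnd (@Sw R) p))))).
    by move=> f _; rewrite -e.
  apply: (compact_form_cross (cA i j)) => f hf; rewrite -e.
  exact: (sqi_mul (sqi_U1 hrho hB nufin i j hf) (sqi_U2 hrho hB nufin i j hf)).
have h2 i j : compact_form (fun f => L2ip Pi3 (U1 i j f) (U3 i j f)).
  have e f := funext (U13E i j f f).
  apply: (compact_form_ext (Y := fun f => \int[Pi3]_p (WB rho B i j p * (f i p.1.1 * f i (tsnd (@Tc R) p))))).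
    by move=> f _; rewrite -e.
  apply: (compact_form_cross (cB i j)) => f hf; rewrite -e.
  exact: (sqi_mul (sqi_U1 hrho hB nufin i j hf) (sqi_U3 hrho hB nufin i j hf)).
have h3 i j : compact_form (fun f => L2ip Pi3 (U1 i j f) (U4 i j f)).
  have e f := funext (U14E i j f f).
  apply: (compact_form_ext (Y := fun f => \int[Pi3]_p (WC rho B i j p * (f i p.1.1 * f j (tsnd (@ScTc R) p))))).
    by move=> f _; rewrite -e.
  apply: (compact_form_cross (cC i j)) => f hf; rewrite -e.
  exact: (sqi_mul (sqi_U1 hrho hB nufin i j hf) (sqi_U4 hrho hB nufin i j hf)).
apply: compact_form_sum => i; apply: compact_form_sum => j.
exact: (compact_formD (compact_formD (h1 i j) (compact_formN (h2 i j))) (compact_formN (h3 i j))).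
Qed.

(** Compactness of the cross terms is used with e = c0 / 2: the L^2 norm it produces is then at most
    half of the H norm and is absorbed. *)
Lemma nuip_compact : exists N (l : 'I_N -> 'I_n * (vel R -> R)) (C : R), [/\ 0 < C,
  forall k, sqi leb3 (l k).2
  & forall f, Hsp f -> nuip f f <= C * (bq f f + l2form l f)].
Proof.
have c2 : 0 < c0 / 2 by exact: divr_gt0.
have [N [l [K [K0 s h]]]] := compact_crossf c2.
exists N, l, (2 + 2 * K); split => //; first by rewrite ltr_wpDr// mulr_ge0// ltW.
move=> f hf; have e := bq_expand hrho hB nufin hf.
have h1 := h f hf; have h2 := ip_nuip hf; have h3 := l2form_ge0 l f.
have b0 : 0 <= bq f f.
  by rewrite mulr_ge0 ?invr_ge0// sumr_ge0// => i _; apply: sumr_ge0 => j _; exact: L2ip_ge0.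
have h4 : - crossf rho B f <= `|crossf rho B f| by rewrite -normrN ler_norm.
have h5 : 0 <= K * bq f f by rewrite mulr_ge0// ltW.
have -> : (2 + 2 * K) * (bq f f + l2form l f) =
  2 * bq f f + 2 * l2form l f + 2 * (K * bq f f) + 2 * (K * l2form l f) by ring.
rewrite (mulrAC c0 _ (ip f f)) in h1.
move: (nuip f f) (bq f f) (l2form l f) (K * l2form l f) (K * bq f f) (c0 * ip f f)
  (crossf rho B f) e h1 h2 h3 b0 h4 h5 => x y z w u t v e h1 h2 h3 b0 h4 h5.
lra.
Qed.

Lemma l2form_term N (l : 'I_N -> 'I_n * (vel R -> R)) : (forall k, sqi leb3 (l k).2) ->
  exists2 C : R, 0 < C & forall k f, Hsp f ->
    (L2ip leb3 (f (l k).1) (l k).2) ^+ 2 <= C * ip f f.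
Proof.
move=> s; exists (1 + \sum_k L2ip leb3 (l k).2 (l k).2).
  by rewrite ltr_wpDr// sumr_ge0// => k _; exact: L2ip_ge0.
move=> k f hf; apply: (le_trans (L2ip_cs (Hsp_sqi0 _ hf) (s k))).
rewrite mulrC; apply: ler_pM; [exact: L2ip_ge0|exact: L2ip_ge0| |exact: L2ip_le_ip].
rewrite (bigD1 k)//= addrCA lerDl addr_ge0//; apply: sumr_ge0 => j _; exact: L2ip_ge0.
Qed.

End cross_compactness.

(** Monotone convergence along the truncations N <= k. *)
Lemma truncated_integral_le {R : realType} d (T : measurableType d)
    (m : {measure set T -> \bar R}) (F N : T -> R) (C : \bar R) :
  measurable_fun setT F -> measurable_fun setT N -> (forall x, 0 <= F x) ->
  (forall k : nat, (\int[m]_x (F x * (N x <= k%:R)%R%:R)%:E <= C)%E) ->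
  (\int[m]_x (F x)%:E <= C)%E.
Proof.
move=> mF mN F0 h; pose g (k : nat) x : \bar R := (F x * (N x <= k%:R)%R%:R)%:E.
have mg k : measurable_fun setT (g k).
  have mS : measurable [set x | N x <= k%:R].
    by rewrite -[X in measurable X]setTI; apply: (measurable_fun_ler mN (measurable_cst _) measurableT) => //.
  apply/measurable_EFinP; apply: measurable_funM => //.
  rewrite (_ : (fun x => _) = \1_[set x | N x <= k%:R]); first exact: measurable_indic.
  by apply/funext => x; rewrite indicE mem_setE.
have g0 k x : (0 <= g k x)%E by rewrite lee_fin mulr_ge0 ?ler0n.
have nd x : {homo g^~ x : a c / (a <= c)%N >-> (a <= c)%E}.
  move=> a c ac; rewrite lee_fin ler_wpM2l// ler_nat.
  case: (leP (N x) a%:R) => // h1; rewrite (le_trans h1)// ?ler_nat//.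
have lim x : (limn (g^~ x) = (F x)%:E)%E.
  apply: cvg_lim => //; apply: cvg_near_cst.
  near=> k; rewrite /g (_ : (N x <= k%:R) = true) ?mulr1//.
  near: k; exact: nbhs_infty_ger.
under eq_integral do rewrite -lim.
rewrite (monotone_convergence m measurableT mg (fun k x _ => g0 k x) (fun x _ => nd x)).
apply: lime_le; last by apply: nearW => k; exact: h.
apply: ereal_nondecreasing_is_cvgn => a c ac; apply: ge0_le_integral => //.
by move=> x _; exact: nd.
Unshelve. all: by end_near. Qed.

(** The bilinear form does not see the scaling of F by t^(1/2) and of G by t^(-1/2), which provides
    the free parameter t; the finitely many functionals are bounded by Cauchy-Schwarz. *)
Lemma cross_bounded {R : realType} (W : vel R * vel R * vel R -> R) tau :
  cross_cpt W tau -> exists K : R, 0 < K /\ forall F G : vel R -> R,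
    sqi leb3 F -> sqi leb3 G ->
    Pi3.-integrable setT (EFin \o (fun p => W p * (F p.1.1 * G (tsnd tau p)))) ->
    forall t : R, 0 < t ->
    `|\int[Pi3]_p (W p * (F p.1.1 * G (tsnd tau p)))| <=
      K * (t * L2ip leb3 F F + t^-1 * L2ip leb3 G G).
Proof.
move=> hW; have [N [K [a [b' [K0 sa sb h]]]]] := hW 1 ltr01.
pose S := \sum_(k < N) (L2ip leb3 (a k) (a k) + L2ip leb3 (b' k) (b' k)).
have S0 : 0 <= S by apply: sumr_ge0 => k _; rewrite addr_ge0//; exact: L2ip_ge0.
have KS : 0 <= K * S by rewrite mulr_ge0// ltW.
exists (1 + K * S); split; first by rewrite ltr_wpDr.
move=> F G sF sG iFG t t0; have s0 : Num.sqrt t != 0 by rewrite gt_eqF// sqrtr_gt0.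
have st : Num.sqrt t ^+ 2 = t by rewrite sqr_sqrtr// ltW.
have sF' := sqiZ (Num.sqrt t) sF; have sG' := sqiZ (Num.sqrt t)^-1 sG.
have e : (fun p => W p * (F p.1.1 * G (tsnd tau p))) =
    (fun p => W p * ((Num.sqrt t * F p.1.1) * ((Num.sqrt t)^-1 * G (tsnd tau p)))).
  by apply/funext => p; field.
have := h _ _ sF' sG'; rewrite -e => /(_ iFG) {}h.
apply: (le_trans h); rewrite mul1r.
have eF : L2ip leb3 (fun x => Num.sqrt t * F x) (fun x => Num.sqrt t * F x) = t * L2ip leb3 F F.
  by rewrite L2ipZl// L2ipZr// mulrA -expr2 st.
have eG : L2ip leb3 (fun x => (Num.sqrt t)^-1 * G x) (fun x => (Num.sqrt t)^-1 * G x) = t^-1 * L2ip leb3 G G.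
  by rewrite L2ipZl// L2ipZr// mulrA -invfM -expr2 st.
rewrite eF eG; set X := t * _; set Y := t^-1 * _.
have X0 : 0 <= X by rewrite mulr_ge0 ?L2ip_ge0// ltW.
have Y0 : 0 <= Y by rewrite mulr_ge0 ?L2ip_ge0// invr_ge0 ltW.
rewrite mulrDl mul1r lerD2l -mulrA; apply: ler_wpM2l; first exact: ltW.
rewrite /S mulr_suml; apply: ler_sum => k _.
rewrite mulrDl; apply: lerD.
  apply: (le_trans (L2ip_cs sF' (sa k))); rewrite eF mulrC; apply: ler_wpM2l; first exact: L2ip_ge0.
  by rewrite -/X lerDl.
apply: (le_trans (L2ip_cs sG' (sb k))); rewrite eG mulrC; apply: ler_wpM2l; first exact: L2ip_ge0.
by rewrite -/Y lerDr.
Qed.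

(** * The three forms on the space with finite H norm *)

Section coercivity.
Context {R : realType} {n : nat}.
Local Notation trip := (vel R * vel R * vel R)%type.
Variables (rho : 'I_n -> R) (B : 'I_n -> 'I_n -> R -> R -> R).
Hypotheses (hrho : forall i, 0 < rho i) (hB : collision_kernel B) (hS : kernel_sym B).
Hypothesis nufin : forall i j v, (nuE rho B i j v < +oo)%E.
Variable c0 : R.
Hypotheses (c0_gt0 : 0 < c0) (nu_lower : forall i v, c0 <= nu rho B i v).
Hypothesis cA : forall i j, cross_cpt (WA rho B i j) (@Sw R).
Hypothesis cB : forall i j, cross_cpt (WB rho B i j) (@Tc R).
Hypothesis cC : forall i j, cross_cpt (WC rho B i j) (@ScTc R).
Implicit Types (i j : 'I_n) (p : trip) (f g : 'I_n -> vel R -> R).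

Local Notation SS := (SS rho B).
Local Notation U1 := (U1 rho B).
Local Notation U2 := (U2 rho B).
Local Notation U3 := (U3 rho B).
Local Notation U4 := (U4 rho B).
Local Notation Hsp := (Hsp rho B).
Local Notation nuip := (nuip rho B).
Local Notation bq := (bq rho B).
Local Notation E := ('I_n -> vel R -> R^o).

Lemma HspD f g : Hsp f -> Hsp g -> Hsp (f + g).
Proof.
move=> hf hg; apply/(HspP hrho hB) => i; split.
  by apply: measurable_funD; [exact: (hf i).1|exact: (hg i).1].
have -> : nuw rho B (f + g) i = (fun v => nuw rho B f i v + nuw rho B g i v).
  by apply/funext => v; rewrite /nuw -mulrDl.
by apply: sqiD; exact: Hsp_sqi.
Qed.

Lemma HspZ (c : R) (f : E) : Hsp f -> Hsp (c *: f).
Proof.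
move=> hf; apply/(HspP hrho hB) => i; split.
  by apply: measurable_funM => //; exact: (hf i).1.
have -> : nuw rho B (c *: f) i = (fun v => c * nuw rho B f i v).
  by apply/funext => v; rewrite /nuw mulrA.
by apply: sqiZ; exact: Hsp_sqi.
Qed.

Lemma Hsp0 : Hsp 0.
Proof.
apply/(HspP hrho hB) => i; split; first exact: measurable_cst.
have -> : nuw rho B 0 i = fun=> 0 by apply/funext => v; rewrite /nuw mul0r.
exact: sqi0.
Qed.

Lemma semi_inner_ip : semi_inner (E := E) Hsp ip.
Proof.
split.
- by move=> f g _ _; apply: eq_bigr => i _; exact: L2ipC.
- move=> f g h hf hg hh; rewrite /ip -big_split; apply: eq_bigr => i _.
  by have s := Hsp_sqi0 hrho hB c0_gt0 nu_lower i; exact: (L2ipDl (s _ hf) (s _ hg) (s _ hh)).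
- move=> c f g hf hg; rewrite /ip mulr_sumr; apply: eq_bigr => i _.
  by have s := Hsp_sqi0 hrho hB c0_gt0 nu_lower i; exact: (L2ipZl _ (s _ hf) (s _ hg)).
- by move=> f _; exact: ip_ge0.
Qed.

Lemma nuwD f g i : nuw rho B (f + g) i = fun v => nuw rho B f i v + nuw rho B g i v.
Proof. by apply/funext => v; rewrite /nuw -mulrDl. Qed.

Lemma nuwZ (c : R) (f : E) i : nuw rho B (c *: f) i = fun v => c * nuw rho B f i v.
Proof. by apply/funext => v; rewrite /nuw mulrA. Qed.

Lemma semi_inner_nuip : semi_inner (E := E) Hsp nuip.
Proof.
split.
- by move=> f g _ _; apply: eq_bigr => i _; exact: L2ipC.
- move=> f g h hf hg hh; rewrite /nuip -big_split; apply: eq_bigr => i _; rewrite nuwD.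
  by apply: L2ipDl; exact: Hsp_sqi.
- move=> c f g hf hg; rewrite /nuip mulr_sumr; apply: eq_bigr => i _; rewrite nuwZ.
  by apply: L2ipZl; exact: Hsp_sqi.
- by move=> f _; apply: sumr_ge0 => i _; exact: L2ip_ge0.
Qed.

Lemma SSD i j f g : SS i j (f + g) = fun p => SS i j f p + SS i j g p.
Proof.
have u k l p : U1 k l (f + g) p = U1 k l f p + U1 k l g p.
  by rewrite /U1 -mulrDr -mulrDl.
apply/funext => p; rewrite /SS /U3 /U4 /U2 !u.
have h (a1 a2 b1 b2 c1 c2 d1 d2 : R) :
  a1 + a2 + (b1 + b2) - (c1 + c2) - (d1 + d2) = a1 + b1 - c1 - d1 + (a2 + b2 - c2 - d2) by ring.
exact: h.
Qed.

Lemma SSZ i j (c : R) (f : E) : SS i j (c *: f) = fun p => c * SS i j f p.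
Proof.
have u k l p : U1 k l (c *: f) p = c * U1 k l f p.
  have e : (c *: f) k p.1.1 = c * f k p.1.1 by [].
  by rewrite /U1 e -mulrA mulrCA.
by apply/funext => p; rewrite /SS /U3 /U4 /U2 !u !mulrBr mulrDr.
Qed.

Lemma semi_inner_bq : semi_inner (E := E) Hsp bq.
Proof.
have s i j f : Hsp f -> sqi Pi3 (SS i j f) by move=> hf; exact: sqi_SS.
split.
- move=> f g _ _; rewrite /bq; congr (_ * _); apply: eq_bigr => i _; apply: eq_bigr => j _.
  exact: L2ipC.
- move=> f g h hf hg hh; rewrite /bq -mulrDr -big_split; congr (_ * _); apply: eq_bigr => i _.
  rewrite -big_split; apply: eq_bigr => j _; rewrite SSD.
  exact: (L2ipDl (s i j f hf) (s i j g hg) (s i j h hh)).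
- move=> c f g hf hg; rewrite /bq mulrCA; congr (_ * _); rewrite mulr_sumr; apply: eq_bigr => i _.
  rewrite mulr_sumr; apply: eq_bigr => j _; rewrite SSZ.
  exact: (L2ipZl _ (s i j f hf) (s i j g hg)).
- move=> f _; rewrite mulr_ge0 ?invr_ge0// sumr_ge0// => i _; apply: sumr_ge0 => j _.
  exact: L2ip_ge0.
Qed.

(** The limit is taken in L^2 for each f_i nu_i^(1/2) and divided by nu_i^(1/2), which the lower
    bound on nu keeps positive. The form passes to the limit because [bq_le] bounds it by the H
    norm. *)
Lemma Hsp_closed (x : nat -> E) : (forall j : nat, Hsp (x j)) ->
  (exists C, forall j : nat, nuip (x j.+1 - x j) (x j.+1 - x j) <= C * 4^-1 ^+ j) ->
  (exists C, forall j : nat, bq (x j) (x j) <= C * 4^-1 ^+ j) ->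
  exists y : E, [/\ Hsp y, bq y y = 0 &
    forall e, 0 < e -> exists J, forall j : nat, (J <= j)%N -> nuip (x j - y) (x j - y) < e].
Proof.
move=> hx [C hC] [C' hC'].
have [_ _ _ nu0] := semi_inner_nuip; have [_ _ _ bq0] := semi_inner_bq.
have hsub f g : Hsp f -> Hsp g -> Hsp (f - g).
  by move=> hf hg; apply: HspD => //; rewrite -scaleN1r; exact: (@HspZ (-1) g hg).
have nuwB f g i : nuw rho B (f - g) i = fun v => nuw rho B f i v - nuw rho B g i v.
  by apply/funext => v; rewrite /nuw -mulrBl.
have C0 : 0 <= C.
  by have := hC 0%N; rewrite expr0 mulr1; apply: le_trans; apply: nu0; exact: hsub.
have ex_v i : exists v : vel R -> R, sqi leb3 v /\ exists K : R, forall j : nat,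
    L2ip leb3 (fun w => nuw rho B (x j) i w - v w) (fun w => nuw rho B (x j) i w - v w) <= K * 2^-1 ^+ j.
  have hj (j : nat) : L2ip leb3 (fun w => nuw rho B (x j.+1) i w - nuw rho B (x j) i w)
      (fun w => nuw rho B (x j.+1) i w - nuw rho B (x j) i w) <= C * 4^-1 ^+ j.
    apply: le_trans (hC j); rewrite -nuwB /nuip (bigD1 i)//= lerDl.
    by apply: sumr_ge0 => k _; exact: L2ip_ge0.
  have [v sv hv] := L2_dyadic_complete (fun j : nat => Hsp_sqi hrho hB i (hx j)) C0 hj.
  by exists v.
have [v hv] := choice ex_v.
have [K hK] := choice (fun i => (hv i).2).
pose y : E := fun i w => v i w / Num.sqrt (nu rho B i w).
have sn i w : Num.sqrt (nu rho B i w) != 0.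
  by rewrite gt_eqF// sqrtr_gt0 (lt_le_trans c0_gt0).
have yv i : nuw rho B y i = v i by apply/funext => w; rewrite /nuw /y divfK.
have hy : Hsp y.
  apply/(HspP hrho hB) => i; split; last by rewrite yv; exact: (hv i).1.
  by have mn := mf_nu hrho hB i; have mv := (hv i).1.1; rewrite /y; mfv.
have hd (j : nat) : nuip (x j - y) (x j - y) <= (\sum_i K i) * 2^-1 ^+ j.
  rewrite /nuip mulr_suml; apply: ler_sum => i _; rewrite nuwB yv; exact: hK.
exists y; split => //; last first.
  move=> e e0; have [J hJ] := half_expr_small (\sum_i K i) e0; exists J => j /hJ.
  exact: le_lt_trans.
apply/eqP; rewrite eq_le bq0// andbT; apply/ler_addgt0Pr => e e0; rewrite add0r.
have [J hJ] := half_expr_small (2 * `|C'| + 8 * (\sum_i K i)) e0.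
apply: le_trans (ltW (hJ J (leqnn J))).
have -> : bq y y = bq (x J - (x J - y)) (x J - (x J - y)) by rewrite opprB addrC subrK.
have := semi_innerBB_le (E := E) HspD HspZ semi_inner_bq (hx J) (hsub _ _ (hx J) hy).
move=> h; apply: (le_trans h); rewrite [leRHS]mulrDl; apply: lerD.
  rewrite -mulrA ler_wpM2l//; apply: (le_trans (hC' J)).
  apply: (@le_trans _ _ (`|C'| * 4^-1 ^+ J)); first by rewrite ler_wpM2r ?exprn_ge0 ?invr_ge0// ler_norm.
  by rewrite ler_wpM2l// lerXn2r ?nnegrE ?invr_ge0// lef_pV2 ?posrE// ler_nat.
have h2 := bq_le hrho hB nufin (hsub _ _ (hx J) hy).
have -> : 8 * (\sum_i K i) * 2^-1 ^+ J = 2 * (4 * ((\sum_i K i) * 2^-1 ^+ J)) by ring.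
rewrite ler_wpM2l//; apply: (le_trans h2); rewrite ler_wpM2l//.
Qed.

End coercivity.

Lemma norm3_le {R : realDomainType} (x y z a b c w : R) :
  `|x| <= a * w -> `|y| <= b * w -> `|z| <= c * w -> - (x - y - z) <= (a + b + c) * w.
Proof. by rewrite !ler_norml !mulrDl => /andP[? _] /andP[_ ?] /andP[_ ?]; lra. Qed.

Lemma L2ip_comb4 {R : realType} d (T : measurableType d) (m : {measure set T -> \bar R})
    (x a b c e : T -> R) : sqi m x -> sqi m a -> sqi m b -> sqi m c -> sqi m e ->
  L2ip m x (fun p => c p + e p - a p - b p) = - (L2ip m x a + (L2ip m x b - L2ip m x c - L2ip m x e)).
Proof.
move=> sx sa sb sc se; have s1 := sqiD sc se; have s2 := sqiB s1 sa.
by rewrite L2ipBr// L2ipBr// L2ipDr//; ring.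
Qed.

(** * Regularity of null vectors and existence of a gap *)

Section regularity.
Context {R : realType} {n : nat}.
Local Notation trip := (vel R * vel R * vel R)%type.
Variables (rho : 'I_n -> R) (B : 'I_n -> 'I_n -> R -> R -> R).
Hypotheses (hrho : forall i, 0 < rho i) (hB : collision_kernel B) (hS : kernel_sym B).
Hypothesis nufin : forall i j v, (nuE rho B i j v < +oo)%E.
Variable c0 : R.
Hypotheses (c0_gt0 : 0 < c0) (nu_lower : forall i v, c0 <= nu rho B i v).
Hypothesis cA : forall i j, cross_cpt (WA rho B i j) (@Sw R).
Hypothesis cB : forall i j, cross_cpt (WB rho B i j) (@Tc R).
Hypothesis cC : forall i j, cross_cpt (WC rho B i j) (@ScTc R).
Implicit Types (i j : 'I_n) (p : trip) (f g : 'I_n -> vel R -> R).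

Local Notation SS := (SS rho B).
Local Notation U1 := (U1 rho B).
Local Notation U2 := (U2 rho B).
Local Notation U3 := (U3 rho B).
Local Notation U4 := (U4 rho B).
Local Notation Hsp := (Hsp rho B).
Local Notation nuip := (nuip rho B).
Local Notation bq := (bq rho B).
Local Notation E := ('I_n -> vel R -> R^o).

Definition single i (u : vel R -> R) k v : R := if k == i then u v else 0.

Lemma single_Hsp i (u : vel R -> R) : measurable_fun setT u ->
  sqi leb3 (fun v => u v * Num.sqrt (nu rho B i v)) -> Hsp (single i u).
Proof.
move=> mu su; apply/(HspP hrho hB) => k; rewrite /nuw /single.
case: (eqVneq k i) => [->|ki]; first by split.
split; first exact: measurable_cst.
by under eq_fun do rewrite mul0r; exact: sqi0.
Qed.

Lemma single_pairing i u f : Hsp (single i u) -> Hsp f ->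
  \sum_j L2ip Pi3 (U1 i j (single i u)) (SS i j f) = - bq (single i u) f.
Proof.
move=> hs hf; rewrite -weak_form// [RHS](bigD1 i)//= [X in _ + X]big1 ?addr0// => k ki.
apply: big1 => j _; rewrite /L2ip.
rewrite (_ : (fun p => _) = fun=> 0); last first.
  by apply/funext => p; rewrite /U1 /single (negbTE ki) mul0r mulr0 mul0r.
by rewrite Rintegral_cst// mul0r.
Qed.

(** In the weak form only the loss term carries the weight nu; the other three are bounded by L^2
    norms alone, with a balance t to be chosen. *)
Lemma cross_test_bound i : exists2 T : R, 0 < T & forall (h : vel R -> R) f, sqi leb3 h -> Hsp (single i h) ->
  Hsp f -> forall t, 0 < t ->
  - \sum_j (L2ip Pi3 (U1 i j (single i h)) (U2 i j f) - L2ip Pi3 (U1 i j (single i h)) (U3 i j f)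
    - L2ip Pi3 (U1 i j (single i h)) (U4 i j f)) <= T * (t * L2ip leb3 h h + t^-1 * ip f f).
Proof.
have [KA hA] := choice (fun j => cross_bounded (cA i j)).
have [KB hB'] := choice (fun j => cross_bounded (cB i j)).
have [KC hC] := choice (fun j => cross_bounded (cC i j)).
exists (1 + \sum_j (KA j + KB j + KC j)).
  rewrite ltr_wpDr// sumr_ge0// => j _.
  by rewrite !addr_ge0// ltW ?(hA j).1 ?(hB' j).1 ?(hC j).1.
move=> h f sh hh hf t t0.
have sf k := Hsp_sqi0 hrho hB c0_gt0 nu_lower k hf.
have ii : single i h i = h by apply/funext => v; rewrite /single eqxx.
have Z0 k : t * L2ip leb3 h h + t^-1 * L2ip leb3 (f k) (f k) <= t * L2ip leb3 h h + t^-1 * ip f f.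
  by rewrite lerD2l ler_wpM2l ?invr_ge0 ?(ltW t0)// L2ip_le_ip.
have Z1 : 0 <= t * L2ip leb3 h h + t^-1 * ip f f.
  by rewrite addr_ge0// mulr_ge0 ?invr_ge0 ?(ltW t0) ?L2ip_ge0 ?ip_ge0.
set Z := (X in _ <= _ * X) in Z0 Z1 *.
apply: (@le_trans _ _ ((\sum_j (KA j + KB j + KC j)) * Z)); last by rewrite ler_wpM2r// lerDr.
rewrite -sumrN mulr_suml; apply: ler_sum => j _.
have s1 := sqi_U1 hrho hB nufin i j hh.
have a1 : `|L2ip Pi3 (U1 i j (single i h)) (U2 i j f)| <= KA j * Z.
  have e := funext (U12E rho hB hS i j (single i h) f); rewrite ii in e.
  have iI := sqi_mul s1 (sqi_U2 hrho hB nufin i j hf); rewrite e in iI.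
  have := (hA j).2 _ _ sh (sf j) iI t t0; rewrite -e => /le_trans; apply.
  by rewrite ler_wpM2l// ltW// (hA j).1.
have a2 : `|L2ip Pi3 (U1 i j (single i h)) (U3 i j f)| <= KB j * Z.
  have e := funext (U13E rho hB i j (single i h) f); rewrite ii in e.
  have iI := sqi_mul s1 (sqi_U3 hrho hB nufin i j hf); rewrite e in iI.
  have := (hB' j).2 _ _ sh (sf i) iI t t0; rewrite -e => /le_trans; apply.
  by rewrite ler_wpM2l// ltW// (hB' j).1.
have a3 : `|L2ip Pi3 (U1 i j (single i h)) (U4 i j f)| <= KC j * Z.
  have e := funext (U14E rho hB hS i j (single i h) f); rewrite ii in e.
  have iI := sqi_mul s1 (sqi_U4 hrho hB nufin i j hf); rewrite e in iI.
  have := (hC j).2 _ _ sh (sf j) iI t t0; rewrite -e => /le_trans; apply.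
  by rewrite ler_wpM2l// ltW// (hC j).1.
exact: norm3_le a1 a2 a3.
Qed.

(** The weak form is tested with h = f_i nu_i cut off where nu_i > m. Its loss term is exactly
    |h|^2, so |h|^2 equals minus the cross terms, at most T (t |h|^2 + |f|^2 / t). With t = 1 / (2
    T) half of |h|^2 is absorbed, and the resulting bound does not depend on m. *)
Lemma null_regular f : Hsp f -> bq f f = 0 -> domL rho B f.
Proof.
move=> hf f0; split; first by move=> i; apply/Lfun2P; exact: (Hsp_sqi0 hrho hB c0_gt0 nu_lower i hf).
apply: lte_sum_pinfty => i _.
have [T T0 hT] := cross_test_bound i.
have mf := (hf i).1; have mn := mf_nu hrho hB i.
have I0 := ip_ge0 f.
apply: (@le_lt_trans _ _ (4 * T ^+ 2 * ip f f)%:E); last by rewrite ltry.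
apply: (truncated_integral_le (N := nu rho B i)).
- by mfv.
- exact: mn.
- by move=> v; rewrite mulr_ge0 ?sqr_ge0.
move=> m; pose chi v : R := (nu rho B i v <= m%:R)%R%:R.
have mchi : measurable_fun setT chi.
  have mS : measurable [set v | nu rho B i v <= m%:R].
    by rewrite -[X in measurable X]setTI; apply: (measurable_fun_ler mn (measurable_cst _) measurableT).
  rewrite (_ : chi = \1_[set v | nu rho B i v <= m%:R]); first exact: measurable_indic.
  by apply/funext => v; rewrite indicE mem_setE.
pose h v := f i v * nu rho B i v * chi v.
(* An intermediate function with k^2 = h f_i and k nu_i^(1/2) = h: the pairing of the loss terms of
   h and f is the H norm of k, that is |h|^2. *)
pose k v := f i v * Num.sqrt (nu rho B i v) * chi v.
have kh v : k v * Num.sqrt (nu rho B i v) = h v.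
  by rewrite /k /h -[in RHS](sqr_sqrtr (nu_ge0 hrho hB i v)); ring.
have sfi := Hsp_sqi hrho hB i hf.
have sh : sqi leb3 h.
  apply: (sqi_le (g := fun v => Num.sqrt m%:R * nuw rho B f i v)); [by rewrite /h; mfv|exact: sqiZ|].
  move=> v; rewrite /h /nuw /chi; case: (leP (nu rho B i v) m%:R) => hm; last by rewrite mulr0 normr0.
  have n0 := nu_ge0 hrho hB i v.
  have -> : f i v * nu rho B i v * true%:R = Num.sqrt (nu rho B i v) * (f i v * Num.sqrt (nu rho B i v)).
    by rewrite mulr1 mulrCA -expr2 sqr_sqrtr.
  by rewrite !normrM ler_wpM2r ?mulr_ge0// !ger0_norm ?sqrtr_ge0// ler_wsqrtr.
have shn : sqi leb3 (fun v => h v * Num.sqrt (nu rho B i v)).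
  apply: (sqi_le (g := fun v => m%:R * nuw rho B f i v)); [by rewrite /h; mfv|exact: sqiZ|].
  move=> v; rewrite /h /nuw /chi; case: (leP (nu rho B i v) m%:R) => hm; last by rewrite mulr0 mul0r normr0.
  have n0 := nu_ge0 hrho hB i v.
  rewrite mulr1 [f i v * nu _ _ _ _]mulrC -mulrA normrM [leRHS]normrM; apply: ler_wpM2r => //.
  by rewrite !ger0_norm.
have skn : sqi leb3 (fun v => k v * Num.sqrt (nu rho B i v)).
  apply: (sqi_ae (f := h)) => //; first by rewrite /k; mfv.
  by apply: aeW => v; rewrite kh.
have hh : Hsp (single i h) by apply: single_Hsp => //; exact: sh.1.
have hk : Hsp (single i k) by apply: single_Hsp => //; rewrite /k; mfv.
have e1 : \sum_j L2ip Pi3 (U1 i j (single i h)) (U1 i j f) = L2ip leb3 h h.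
  transitivity (nuip (single i k) (single i k)); last first.
    rewrite /nuip (bigD1 i)//= [X in _ + X]big1 ?addr0 => [|l li].
      by congr (L2ip _ _ _); apply/funext => v; rewrite /nuw /single eqxx kh.
    rewrite (_ : nuw _ _ _ _ = fun=> 0) ?ae_L2ip0//; first exact: aeW.
    by apply/funext => v; rewrite /nuw /single (negbTE li) mul0r.
  rewrite nuipE// [RHS](bigD1 i)//= [X in _ + X]big1 ?addr0 => [|l li]; last first.
    apply: big1 => j _; rewrite (_ : U1 l j _ = fun=> 0) ?ae_L2ip0//; first exact: aeW.
    by apply/funext => p; rewrite /U1 /single (negbTE li) mul0r mulr0.
  apply: eq_bigr => j _; congr (Rintegral _ _ _); apply/funext => p.
  rewrite /U1 /single eqxx /h /k /chi -{1}(sqr_sqrtr (nu_ge0 hrho hB i p.1.1)).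
  by case: (nu rho B i p.1.1 <= m%:R) => /=; ring.
have e2 : \sum_j L2ip Pi3 (U1 i j (single i h)) (SS i j f) = 0.
  rewrite single_pairing//.
  have [bqC _ _ _] := semi_inner_bq hrho hB nufin.
  have := semi_inner_null (E := E) (HspD hrho hB) (HspZ hrho hB) (semi_inner_bq hrho hB nufin) hf hh f0.
  by rewrite (bqC _ _ hf hh) => ->; rewrite oppr0.
have e3 : L2ip leb3 h h = - \sum_j (L2ip Pi3 (U1 i j (single i h)) (U2 i j f)
    - L2ip Pi3 (U1 i j (single i h)) (U3 i j f) - L2ip Pi3 (U1 i j (single i h)) (U4 i j f)).
  have e j : L2ip Pi3 (U1 i j (single i h)) (SS i j f) = - (L2ip Pi3 (U1 i j (single i h)) (U1 i j f) +
      (L2ip Pi3 (U1 i j (single i h)) (U2 i j f) - L2ip Pi3 (U1 i j (single i h)) (U3 i j f)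
       - L2ip Pi3 (U1 i j (single i h)) (U4 i j f))).
    have s1 := sqi_U1 hrho hB nufin i j hf; have s2 := sqi_U2 hrho hB nufin i j hf.
    have s3 := sqi_U3 hrho hB nufin i j hf; have s4 := sqi_U4 hrho hB nufin i j hf.
    have sx := sqi_U1 hrho hB nufin i j hh.
    exact: L2ip_comb4.
  move: e2; under eq_bigr do rewrite e.
  by rewrite sumrN big_split/= e1 => /eqP; rewrite oppr_eq0 addr_eq0 => /eqP.
have t0 : 0 < (2 * T)^-1 by rewrite invr_gt0 mulr_gt0.
have e4 := hT h f sh hh hf _ t0; rewrite -e3 invrK in e4.
have e5 : L2ip leb3 h h <= 4 * T ^+ 2 * ip f f.
  have e6 : T * ((2 * T)^-1 * L2ip leb3 h h + 2 * T * ip f f) =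
      L2ip leb3 h h / 2 + 2 * T ^+ 2 * ip f f by field; rewrite gt_eqF.
  have half (x y : R) : x <= x / 2 + y -> x <= 2 * y.
    by rewrite -lerBlDl {1}[x]splitr addrK ler_pdivrMr// mulrC.
  by rewrite e6 in e4; have := half _ _ e4; rewrite !mulrA -natrM.
apply: le_trans (_ : ((L2ip leb3 h h)%:E <= _)%E); last by rewrite lee_fin.
rewrite L2ipE//; apply: le_eq; apply: eq_integral => v _; congr EFin.
by rewrite /h /chi !exprMn; case: (_ <= _); rewrite ?expr1n ?expr0n.
Qed.

Lemma nuip_le_bq_ip : exists2 C : R, 0 < C & forall f, Hsp f -> nuip f f <= C * (bq f f + ip f f).
Proof.
have [N [l [C [C0 sl hC]]]] := nuip_compact hrho hB hS nufin c0_gt0 nu_lower cA cB cC.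
have [K K0 hK] := l2form_term hrho hB c0_gt0 nu_lower sl.
have NK : 0 <= N%:R * K by rewrite mulr_ge0// ltW.
exists (C * (1 + N%:R * K)); first by rewrite mulr_gt0// ltr_wpDr.
move=> f hf; apply: (le_trans (hC f hf)); rewrite -mulrA; apply: ler_wpM2l; first exact: ltW.
have b0 : 0 <= bq f f by have [_ _ _ h] := semi_inner_bq hrho hB nufin; exact: h.
have i0 := ip_ge0 f.
have h1 : l2form l f <= N%:R * K * ip f f.
  apply: (@le_trans _ _ (\sum_(k < N) K * ip f f)); first by apply: ler_sum => k _; exact: hK.
  by rewrite sumr_const card_ord -mulrA mulr_natl.
rewrite mulrDl mul1r mulrDr; apply: (@le_trans _ _ (bq f f + N%:R * K * ip f f)).
  by rewrite lerD2l.
have h2 : 0 <= N%:R * K * bq f f by exact: mulr_ge0.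
by move: (N%:R * K * ip f f) (N%:R * K * bq f f) h2 => x y; lra.
Qed.

Lemma Hsp_projection f : Hsp f -> exists2 p, null (E := E) Hsp bq p &
  forall h, null (E := E) Hsp bq h -> ip (f - p) h = 0.
Proof.
have [C C0 hC] := nuip_le_bq_ip.
exact: (null_projection (E := E) (Hsp0 hrho hB) (HspD hrho hB) (HspZ hrho hB)
  (semi_inner_ip hrho hB c0_gt0 nu_lower) (semi_inner_bq hrho hB nufin) c0_gt0 C0
  (ip_nuip hrho hB c0_gt0 nu_lower) hC (Hsp_closed hrho hB nufin c0_gt0 nu_lower)).
Qed.

Lemma Hsp_gap : exists2 lam : R, 0 < lam & forall f (p : E), Hsp f -> null (E := E) Hsp bq p ->
  (forall h, null (E := E) Hsp bq h -> ip (f - p) h = 0) ->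
  lam * nuip (f - p) (f - p) <= bq f f.
Proof.
have [C C0 hC] := nuip_le_bq_ip.
have [N [l [K [K0 sl hK]]]] := nuip_compact hrho hB hS nufin c0_gt0 nu_lower cA cB cC.
have [C' C'0 hC'] := l2form_term hrho hB c0_gt0 nu_lower sl.
have C'c : 0 <= C' / c0 by rewrite divr_ge0// ltW.
have [_ _ _ bq0] := semi_inner_bq hrho hB nufin.
have [_ _ _ nu0] := semi_inner_nuip hrho hB.
have C3 : 0 < K + C' / c0 by rewrite ltr_wpDr.
apply: (coercive_gap (E := E) (HspD hrho hB) (HspZ hrho hB)
  (semi_inner_ip hrho hB c0_gt0 nu_lower) (semi_inner_nuip hrho hB) (semi_inner_bq hrho hB nufin)
  c0_gt0 C3 (ip_nuip hrho hB c0_gt0 nu_lower) hC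
  (l := fun k f => L2ip leb3 (f (l k).1) (l k).2)).
- move=> k f g hf hg; have s h := Hsp_sqi0 hrho hB c0_gt0 nu_lower (l k).1 (f := h).
  exact: (L2ipBl (s f hf) (s g hg) (sl k)).
- move=> f hf; apply: (le_trans (hK f hf)); rewrite ler_wpM2r ?lerDl//.
  by rewrite addr_ge0 ?bq0// l2form_ge0.
- move=> k f hf; apply: (le_trans (hC' k f hf)).
  have := ip_nuip hrho hB c0_gt0 nu_lower hf; rewrite mulrC -ler_pdivlMr// => h.
  apply: (@le_trans _ _ (C' * (nuip f f / c0))); first by rewrite ler_wpM2l// ltW.
  rewrite mulrCA mulrC mulrDl lerDr mulr_ge0 ?nu0// ltW//.
- exact: (Hsp_closed hrho hB nufin c0_gt0 nu_lower).
Qed.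

Lemma null_nullspace f : null (E := E) Hsp bq f <-> nullspace rho B (Lop rho B) f.
Proof.
split=> [[hf f0]|].
  by apply/(nullspace_LopP hrho hB hS nufin); split => //; exact: null_regular.
by move=> /(nullspace_LopP hrho hB hS nufin)[dL h]; split => //; exact: domL_Hsp.
Qed.

Lemma orth_proj_LopP f : Hsp f -> let p := orth_proj (nullspace rho B (Lop rho B)) f in
  nullspace rho B (Lop rho B) p /\ forall h, nullspace rho B (Lop rho B) h -> ip (f - p) h = 0.
Proof.
move=> hf; have [p np hp] := Hsp_projection hf.
apply: (@getPex _ [set g | nullspace rho B (Lop rho B) g /\
  forall h, nullspace rho B (Lop rho B) h -> ip (f - g) h = 0]).
exists p; split; first exact/null_nullspace.
by move=> h /null_nullspace; exact: hp.
Qed.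

Lemma normH2E f : Hsp f -> normH2 rho B f = (nuip f f)%:E.
Proof.
move=> hf; rewrite /normH2 /nuip -sumEFin; apply: eq_bigr => i _.
by rewrite L2ipE; [apply: eq_integral => v _; rewrite nuw_sqr|exact: Hsp_sqi].
Qed.

Lemma spectral_gap_ex : exists2 lam : R, 0 < lam & spectral_gap rho B lam.
Proof.
have [lam l0 hl] := Hsp_gap; exists lam => // f df; have hf := domL_Hsp hrho hB df.
have [np hp] := orth_proj_LopP hf; set p := orth_proj _ f in np hp *.
have [hpp _] := (null_nullspace p).2 np.
have hfp : Hsp (f - p).
  by apply: HspD => //; rewrite -scaleN1r; exact: (HspZ hrho hB (-1) hpp).
rewrite normH2E// -EFinM lee_fin (ip_Lop hrho hB hS nufin hf hf) opprK; apply: hl => //.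
  exact/null_nullspace.
by move=> h /null_nullspace; exact: hp.
Qed.

End regularity.

(** * Estimates drawn from the kernel assumptions *)

Section assumptions.
Context {R : realType} {n : nat}.
Variables (rho : 'I_n -> R) (B : 'I_n -> 'I_n -> R -> R -> R) (Phi b : 'I_n -> 'I_n -> R -> R).
Hypotheses (hrho : forall i, 0 < rho i) (hB : collision_kernel B) (hS : kernel_sym B).
Hypotheses (hA2 : kernel_factor B Phi b) (hA3 : kinetic_growth Phi) (hA4 : angular_cutoff b).

Lemma kernel_facts : [/\
  exists2 K : R, 0 < K & forall i j v, (nuE rho B i j v <= (K * (1 + enorm v))%:E)%E,
  exists2 c : R, 0 < c & forall i v, (c%:E <= nuE rho B i i v)%E,
  forall i j, cross_cpt (WA rho B i j) (@Sw R),
  forall i j, cross_cpt (WB rho B i j) (@Tc R)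
  & forall i j, cross_cpt (WC rho B i j) (@ScTc R)].
Proof.
case: hA3 => C1 [C2 [gam [del [C10 C20 /andP[g0 g1] /andP[d0 d1] hP]]]].
case: hA4 => [[C3 [C4 [C30 C40 hb]]] Cb0].
have Phi_le i j (r : R) : 0 < r -> Phi i j r <= C2 * (r + r `^ (- del)) by move=> /(hP i j r)/andP[].
have Phi_ge i j (r : R) : 1 <= r -> C1 <= Phi i j r.
  move=> r1; have /andP[h _] := hP i j r (lt_le_trans ltr01 r1); apply: le_trans h.
  by rewrite ler_peMr ?(ltW C10)// -[leLHS](powRr0 r) ler_powR.
have b_le i j (x : R) : -1 <= x <= 1 -> b i j x <= C3 * `|sin (acos x)|.
  move=> x1; have t1 : 0 <= acos x <= pi by rewrite acos_ge0 ?acos_lepi.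
  have [h _ _] := hb i j _ t1; rewrite acosK// in h; apply: (le_trans h).
  by rewrite ler_piMr ?ler_norml// mulr_ge0// ltW.
split.
- exact: (nuE_le hrho hB hA2 Phi_le b_le C20 C30 d0 d1).
- exact: (nuE_ge hrho hB hA2 C10 Phi_ge Cb0).
- by move=> i j; exact: (crossA hrho hB hS hA2 Phi_le b_le C20 C30 d0 d1).
- by move=> i j; exact: (crossB hrho hB hA2 Phi_le b_le C20 C30 d0 d1).
- by move=> i j; exact: (crossC hrho hB hS hA2 Phi_le b_le C20 C30 d0 d1).
Qed.

Lemma nuE_fin i j v : (nuE rho B i j v < +oo)%E.
Proof. by have [[K K0 hK] _ _ _ _] := kernel_facts; apply: (le_lt_trans (hK i j v)); rewrite ltry. Qed.

Lemma nu_lower_bound : exists2 c : R, 0 < c & forall i v, c <= nu rho B i v.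
Proof.
have [_ [c c_gt0 hc] _ _ _] := kernel_facts; exists c => // i v.
apply: le_trans (nu_ij_le hrho hB i i v); rewrite -lee_fin.
by apply: (le_trans (hc i v)); rewrite (nuEE hrho hB nuE_fin).
Qed.

End assumptions.

(** * Gaussian moments *)

Section nonneg_integrals.
Context {R : realType} d (T : measurableType d) (m : {measure set T -> \bar R}).

Lemma ge0_integral_scale (c : R) (f : T -> R) : 0 <= c -> measurable_fun setT f -> (forall x, 0 <= f x) ->
  (\int[m]_x (c * f x)%:E = c%:E * \int[m]_x (f x)%:E)%E.
Proof.
move=> c0 mf f0; under eq_integral do rewrite EFinM.
have mfE : measurable_fun setT (fun x => (f x)%:E) by exact/measurable_EFinP.
have f0E x : setT x -> (0 <= (f x)%:E)%E by rewrite lee_fin.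
exact: (ge0_integralZl_EFin m measurableT f0E mfE c0).
Qed.

Lemma ge0_integral_add (f g : T -> R) : measurable_fun setT f -> (forall x, 0 <= f x) ->
  measurable_fun setT g -> (forall x, 0 <= g x) ->
  (\int[m]_x (f x + g x)%:E = \int[m]_x (f x)%:E + \int[m]_x (g x)%:E)%E.
Proof.
move=> mf f0 mg g0; under eq_integral do rewrite EFinD.
have mfE : measurable_fun setT (fun x => (f x)%:E) by exact/measurable_EFinP.
have mgE : measurable_fun setT (fun x => (g x)%:E) by exact/measurable_EFinP.
by apply: ge0_integralD => // x _; rewrite lee_fin.
Qed.

Lemma ge0_integral_mono (f g : T -> R) : measurable_fun setT f -> (forall x, 0 <= f x) ->
  measurable_fun setT g -> (forall x, f x <= g x) ->
  (\int[m]_x (f x)%:E <= \int[m]_x (g x)%:E)%E.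
Proof.
move=> mf f0 mg fg; apply: ge0_le_integral => //.
- by move=> x _; rewrite lee_fin.
- exact/measurable_EFinP.
- exact/measurable_EFinP.
- by move=> x _; rewrite lee_fin.
Qed.

End nonneg_integrals.

(** Since b > 0, the first inequality also rules out x = +oo. *)
Lemma affine_bound {R : realType} (x : \bar R) (a b c y : R) : 0 < b ->
  (a%:E + b%:E * x <= c%:E)%E -> c <= a + b * y -> (x <= y%:E)%E.
Proof.
move=> b0; case: x => [x| |]; last by rewrite leNye.
  rewrite -EFinM -EFinD !lee_fin => h1 h2; rewrite -(ler_pM2l b0).
  by rewrite -(lerD2l a); exact: le_trans h2.
by rewrite gt0_muley ?lte_fin// addey// leye_eq.
Qed.

Section gaussian_moments.
Context {R : realType}.
Local Notation mR := (measurableTypeR R).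
Local Notation leb := (@lebesgue_measure R).

Lemma expR_ge_quad (z : R) : 0 <= z -> 1 + z + z ^+ 2 / 2 <= expR z.
Proof.
move=> z0; have := nondecreasing_cvgn_le _ (is_cvg_series_exp_coeff z) 3.
rewrite -[limn _]/(expR z) /series/= !big_nat_recr//= big_nil /exp_coeff/=.
rewrite !expr0 !expr1 !divr1 add0r; apply.
apply/nondecreasing_seqP => k; rewrite /series/= big_nat_recr//= lerDl.
by rewrite divr_ge0 ?exprn_ge0.
Qed.

(** With a = e^(x/2), e^x + e^-x - 2 is the square of a - 1/a. For x >= 0, a - 1/a >= x follows from
    the quadratic lower bound on a. *)
Lemma expR_pair_ge (x : R) : 2 + x ^+ 2 <= expR x + expR (- x).
Proof.
wlog x0 : x / 0 <= x => [hw|].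
  have [/hw//|/ltW x0] := leP 0 x.
  have Nx0 : 0 <= - x by rewrite oppr_ge0.
  by have := hw _ Nx0; rewrite sqrrN opprK [leRHS]addrC.
have z0 : 0 <= x / 2 by exact: divr_ge0.
have h := expR_ge_quad z0.
have e1 : expR x = expR (x / 2) ^+ 2 by rewrite -expRM_natl; congr expR; field.
have e0 : 0 < expR (x / 2) by exact: expR_gt0.
rewrite expRN e1; move: (expR (x / 2)) h e0 => a h a0.
have a1 : 1 + x / 2 + (x / 2) ^+ 2 / 2 <= a by [].
have a_gt : 0 < 1 + x / 2 + (x / 2) ^+ 2 / 2.
  by rewrite !ltr_wpDr ?ltr01// ?divr_ge0 ?sqr_ge0.
have key : x <= a - a^-1.
  rewrite -(ler_pM2r a0) mulrBl mulVf ?gt_eqF//.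
  have := sqr_ge0 ((x / 2) ^+ 2); nra.
have -> : a ^+ 2 + (a ^+ 2)^-1 = 2 + (a - a^-1) ^+ 2 by field; rewrite gt_eqF.
by rewrite lerD2l lerXn2r ?nnegrE// (le_trans x0).
Qed.

Lemma gauss1_exact (s : R) : 0 < s ->
  (\int[leb]_x (expR (- (s ^+ 2 / 2) * x ^+ 2))%:E = (Num.sqrt (2 * pi) / s)%:E)%E.
Proof.
move=> s0; have v0 : s^-1 != 0 by rewrite invr_eq0 gt_eqF.
have p0 := pi_gt0 R.
have pk : normal_peak s^-1 = s / Num.sqrt (2 * pi).
  rewrite /normal_peak -mulr_natl mulrCA sqrtrM ?sqr_ge0// sqrtr_sqr.
  by rewrite ger0_norm ?invr_ge0 ?(ltW s0)// invfM invrK.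
have pk0 := normal_peak_gt0 v0.
have := integral_normal_pdf (0 : R) s^-1; rewrite normal_pdfE// => h.
have e : (\int[leb]_x (normal_peak s^-1 * normal_fun 0 s^-1 x)%:E =
    (normal_peak s^-1)%:E * \int[leb]_x (expR (- (s ^+ 2 / 2) * x ^+ 2))%:E)%E.
  rewrite -ge0_integral_scale; [|exact: ltW|by apply: mf_expR; mf|by move=> x; exact: expR_ge0].
  apply: eq_integral => x _; rewrite /normal_fun; congr ((_ * expR _)%:E).
  by rewrite subr0 exprVn -mulr_natr; field; rewrite gt_eqF.
move: h; rewrite e; have := gauss1_fin (divr_gt0 (exprn_gt0 2 s0) (ltr0Sn R 1)).
case: (integral _ _ _) => [r| |]//; last 1 first.
- by rewrite gt0_muleNy ?lte_fin.
move=> _; rewrite -EFinM => -[] /(congr1 (fun y => (normal_peak s^-1)^-1 * y)).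
by rewrite mulKf ?gt_eqF// mulr1 => ->; rewrite pk invf_div.
Qed.

Lemma gauss3_exact (s : R) : 0 < s ->
  (\int[leb3]_w (expR (- (s ^+ 2 / 2) * enorm w ^+ 2))%:E = ((Num.sqrt (2 * pi) / s) ^+ 3)%:E)%E.
Proof.
move=> s0; set c := - (s ^+ 2 / 2); set G := Num.sqrt (2 * pi) / s.
pose f (x : mR) := (expR (c * x ^+ 2))%:E.
have f0 x : (0 <= f x)%E by rewrite lee_fin expR_ge0.
have mf1 : measurable_fun setT f by apply/measurable_EFinP; apply: mf_expR; mf.
have h : (\int[leb]_x f x = G%:E)%E by exact: gauss1_exact.
rewrite (eq_integral (fun w : vel R => (f w.1.1 * f w.1.2 * f w.2)%E)); last first.
  by move=> w _; rewrite /c expR_enorm !EFinM.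
have mff : measurable_fun setT (fun p : mR * mR => (f p.1 * f p.2)%E).
  by apply: emeasurable_funM; [exact: measurableT_comp mf1 measurable_fst|exact: measurableT_comp mf1 measurable_snd].
apply: (etrans (sf_int_tensor (sfprod leb leb) leb mff mf1 _ f0)).
  by move=> p; rewrite mule_ge0.
have -> : (\int[sfprod leb leb]_x (f x.1 * f x.2) = G%:E * G%:E)%E.
  by rewrite -!h; exact: (sf_int_tensor leb leb mf1 mf1 f0 f0).
by rewrite h -!EFinM; congr EFin; ring.
Qed.

Definition unit_maxw (v : vel R) : R := (2 * pi) `^ (- (3 / 2)) * expR (- (enorm v ^+ 2 / 2)).

Lemma mf_unit_maxw : measurable_fun setT unit_maxw.
Proof. by rewrite /unit_maxw; mfv. Qed.

Lemma unit_maxw_gt0 v : 0 < unit_maxw v.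
Proof. by rewrite mulr_gt0 ?expR_gt0// powR_gt0// mulr_gt0// pi_gt0. Qed.

Lemma maxwE n (rho : 'I_n -> R) i v : maxw rho i v = rho i * unit_maxw v.
Proof. by rewrite /maxw /unit_maxw mulrA. Qed.

Lemma unit_maxw_exp (s : R) : 0 < s ->
  (\int[leb3]_v (unit_maxw v * expR ((1 - s ^+ 2) / 2 * enorm v ^+ 2))%:E = (s ^- 3)%:E)%E.
Proof.
move=> s0; have p0 : 0 < 2 * pi :> R by rewrite mulr_gt0// pi_gt0.
transitivity (((2 * pi) `^ (- (3 / 2)))%:E *
    \int[leb3]_v (expR (- (s ^+ 2 / 2) * enorm v ^+ 2))%:E)%E.
  rewrite -ge0_integral_scale; [|exact: powR_ge0|by mfv|by move=> v; exact: expR_ge0].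
  apply: eq_integral => v _; rewrite /unit_maxw -mulrA -expRD.
  by congr ((_ * expR _)%:E); field.
rewrite gauss3_exact// -EFinM; congr EFin.
have e : Num.sqrt (2 * pi) ^+ 3 = (2 * pi) `^ (3 / 2) :> R.
  rewrite -powR12_sqrt ?(ltW p0)// -[LHS](powR_mulrn 3 (powR_ge0 _ _)) -powRrM.
  by congr (_ `^ _); field.
rewrite exprMn exprVn e mulrA -powRD; last by apply/implyP => _; rewrite gt_eqF.
by rewrite addrC subrr powRr0 mul1r.
Qed.

Lemma unit_maxw_mass : (\int[leb3]_v (unit_maxw v)%:E = 1)%E.
Proof.
have := unit_maxw_exp ltr01; rewrite !expr1n invr1 => <-; apply: eq_integral => v _.
by rewrite subrr mul0r mul0r expR0 mulr1.
Qed.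

(* For x = |v|^2, h^2 x^2 <= e^(hx) + e^(-hx) - 2, and the Gaussian integrals of
   e^(hx), e^(-hx) are (1 - 2h)^(-3/2), (1 + 2h)^(-3/2); the choice
   1 - 2h = (17/25)^2 makes 1 + 2h = (31/25)^2 and both integrals rational. *)
Lemma unit_maxw_fourth : (\int[leb3]_v (unit_maxw v * enorm v ^+ 4)%:E <= 24%:E)%E.
Proof.
pose s : R := 17 / 25; pose t : R := 31 / 25; pose h : R := (1 - s ^+ 2) / 2.
have s0 : 0 < s by rewrite divr_gt0.
have t0 : 0 < t by rewrite divr_gt0.
have ht : (1 - t ^+ 2) / 2 = - h by rewrite /h /s /t; field.
have g0 v : 0 <= unit_maxw v by exact/ltW/unit_maxw_gt0.
have mg := mf_unit_maxw.
have h2 : 0 <= h ^+ 2 by exact: sqr_ge0.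
have key : (\int[leb3]_v (2 * unit_maxw v + h ^+ 2 * (unit_maxw v * enorm v ^+ 4))%:E <=
    \int[leb3]_v (unit_maxw v * expR (h * enorm v ^+ 2) + unit_maxw v * expR (- h * enorm v ^+ 2))%:E)%E.
  apply: ge0_integral_mono; [by mfv| |by mfv|].
    by move=> v; apply: addr_ge0; [exact: mulr_ge0|rewrite mulr_ge0// mulr_ge0// exprn_ge0 ?enorm_ge0].
  move=> v; have -> : 2 * unit_maxw v + h ^+ 2 * (unit_maxw v * enorm v ^+ 4) =
    unit_maxw v * (2 + h ^+ 2 * enorm v ^+ 4) by ring.
  rewrite -mulrDr; apply: ler_wpM2l => //.
  by have := expR_pair_ge (h * enorm v ^+ 2); rewrite exprMn mulNr -[(_ ^+ 2) ^+ 2]exprM.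
have e1 : (\int[leb3]_v (2 * unit_maxw v + h ^+ 2 * (unit_maxw v * enorm v ^+ 4))%:E =
   2%:E + (h ^+ 2)%:E * \int[leb3]_v (unit_maxw v * enorm v ^+ 4)%:E)%E.
  rewrite ge0_integral_add; [|by mfv|by move=> v; rewrite mulr_ge0|by mfv|]; last first.
    by move=> v; rewrite mulr_ge0// mulr_ge0// exprn_ge0 ?enorm_ge0.
  rewrite ge0_integral_scale// unit_maxw_mass mule1 ge0_integral_scale; [by []|exact: h2|by mfv|].
  by move=> v; rewrite mulr_ge0 ?exprn_ge0 ?enorm_ge0.
have e2 : (\int[leb3]_v (unit_maxw v * expR (h * enorm v ^+ 2) + unit_maxw v * expR (- h * enorm v ^+ 2))%:E =
   (s ^- 3 + t ^- 3)%:E)%E.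
  rewrite ge0_integral_add; [|by mfv|by move=> v; rewrite mulr_ge0 ?expR_ge0|by mfv|]; last first.
    by move=> v; rewrite mulr_ge0 ?expR_ge0.
  by rewrite EFinD -ht; congr (_ + _)%E; exact: unit_maxw_exp.
have h0 : 0 < h ^+ 2 by rewrite /h /s; apply: exprn_gt0; lra.
apply: (affine_bound (a := 2) (c := s ^- 3 + t ^- 3) h0).
  by apply: (le_trans (le_eq (esym e1))); apply: (le_trans key); exact: le_eq.
by rewrite -!exprVn /h /s /t !invf_div; lra.
Qed.

Lemma poly_gauss_fin (k : nat) : (\int[leb3]_v ((1 + enorm v ^+ 2) ^+ k * unit_maxw v)%:E < +oo)%E.
Proof.
have q0 : 0 < 4^-1 :> R by rewrite invr_gt0.
have mg := mf_unit_maxw.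
(* With c = 4 (k + 1) one has 1 + y <= c e^(y / c), whose k-th power costs at most e^(y/4), half of
   the Gaussian. *)
pose K : R := ((4 * k.+1)%:R) ^+ k * (2 * pi) `^ (- (3 / 2)).
have K0 : 0 <= K by rewrite mulr_ge0 ?exprn_ge0 ?powR_ge0.
apply: (@le_lt_trans _ _ (\int[leb3]_v (K * expR (- 4^-1 * enorm v ^+ 2))%:E)%E); last first.
  rewrite ge0_integral_scale; [|exact: K0|by mfv|by move=> v; exact: expR_ge0].
  apply: lte_mul_pinfty; [by rewrite lee_fin|by []|exact: gauss3_fin].
apply: ge0_integral_mono; [by mfv| |by mfv|].
  by move=> v; rewrite mulr_ge0 ?exprn_ge0 ?addr_ge0 ?sqr_ge0//; exact/ltW/unit_maxw_gt0.
move=> v; rewrite /unit_maxw /K.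
have y0 : 0 <= enorm v ^+ 2 by exact: sqr_ge0.
move: (enorm v ^+ 2) y0 => y y0.
have m0 : 0 < (4 * k.+1)%:R :> R by rewrite ltr0n.
have h1 : 1 + y <= (4 * k.+1)%:R * expR (y / (4 * k.+1)%:R).
  have := expR_ge1Dx (y / (4 * k.+1)%:R); rewrite -(ler_pM2l m0) => /(le_trans _); apply.
  by rewrite mulrDr mulr1 mulrCA divff ?gt_eqF// mulr1 lerD2r ler1n.
have h2 : (1 + y) ^+ k <= (4 * k.+1)%:R ^+ k * expR (4^-1 * y).
  apply: (@le_trans _ _ (((4 * k.+1)%:R * expR (y / (4 * k.+1)%:R)) ^+ k)).
    by rewrite lerXn2r// nnegrE ?addr_ge0// mulr_ge0 ?expR_ge0.
  rewrite exprMn -expRM_natl ler_wpM2l ?exprn_ge0// ler_expR mulrCA [leRHS]mulrC ler_wpM2l//.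
  rewrite ler_pdivrMr// natrM mulrA mulVf// mul1r ler_nat; exact: leqnSn.
have -> : - (y / 2) = - (4^-1 * y) + - 4^-1 * y by field.
rewrite mulNr expRD expRN; move: (expR (4^-1 * y)) (expR_gt0 (4^-1 * y)) h2 => E E0 h2.
move: ((2 * pi) `^ _) (powR_ge0 (2 * pi : R) (- (3 / 2))) => P P0.
have -> : (1 + y) ^+ k * (P * (E^-1 * E^-1)) = (1 + y) ^+ k / E * (P / E) by ring.
rewrite -[leRHS]mulrA; apply: ler_wpM2r; first by rewrite divr_ge0// ltW.
by rewrite ler_pdivrMr.
Qed.

End gaussian_moments.

(** * The kernel of the mono-species operator *)

Section orthogonal_sums.
Context {R : realType} d (T : measurableType d) (m : {measure set T -> \bar R}).

Lemma L2ip_suml (I : Type) (r : seq I) (F : I -> T -> R) (g : T -> R) :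
  (forall i, sqi m (F i)) -> sqi m g ->
  L2ip m (fun x => \sum_(i <- r) F i x) g = \sum_(i <- r) L2ip m (F i) g.
Proof.
move=> sF sg; elim: r => [|i r IH].
  rewrite big_nil /L2ip; under eq_Rintegral do rewrite big_nil mul0r.
  by rewrite Rintegral_cst// mul0r.
by under eq_fun do rewrite big_cons; rewrite L2ipDl// ?big_cons ?IH//; exact: sqi_sum.
Qed.

Lemma L2ip_orth_sum (I : finType) (c : I -> R) (Y : I -> T -> R) : (forall i, sqi m (Y i)) ->
  (forall i j, i != j -> L2ip m (Y i) (Y j) = 0) ->
  L2ip m (fun x => \sum_i c i * Y i x) (fun x => \sum_i c i * Y i x) =
  \sum_i c i ^+ 2 * L2ip m (Y i) (Y i).
Proof.
move=> sY oY; have scY i : sqi m (fun x => c i * Y i x) by exact: sqiZ.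
rewrite L2ip_suml//; last exact: sqi_sum.
apply: eq_bigr => i _; rewrite L2ipC L2ip_suml// (bigD1 i)//= [X in _ + X]big1 ?addr0 => [|j ji].
  by rewrite L2ipZl// L2ipZr// mulrA.
by rewrite L2ipZl// L2ipZr// oY ?mulr0// eq_sym.
Qed.

Lemma L2ip_odd_even (S : T -> T) f g : mp m m S -> sqi m f -> sqi m g ->
  (forall x, f (S x) = - f x) -> (forall x, g (S x) = g x) -> L2ip m f g = 0.
Proof.
move=> mS sf sg fo ge; have := L2ip_mp mS sf.1 sg.1.
under eq_fun do rewrite fo; under [X in L2ip _ _ X]eq_fun do rewrite ge.
by rewrite L2ipNl// => /eqP; rewrite -subr_eq0 -opprD oppr_eq0 -mulr2n mulrn_eq0/= => /eqP.
Qed.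

End orthogonal_sums.

(** * Coordinate isometries and their action on collisions *)

Section isometries.
Context {R : realType}.
Local Notation trip := (vel R * vel R * vel R)%type.

(* The reflections kill the mixed second moments of v, and the cyclic
   permutation equates the three pure ones. *)
Definition refl (a : nat) (v : vel R) : vel R :=
  (((-1) ^+ (a == 1%N) * v.1.1, (-1) ^+ (a == 2%N) * v.1.2), (-1) ^+ (a == 3%N) * v.2).
Definition cyc (v : vel R) : vel R := ((v.1.2, v.2), v.1.1).

Definition lin_isometry (g : vel R -> vel R) : Prop :=
  [/\ mp leb3 leb3 g, forall x y, g (x + y) = g x + g y, forall c x, g (c *: x) = c *: g x
    & forall x y, dot (g x) (g y) = dot x y].

Lemma refl_isometry a : lin_isometry (refl a).
Proof.
split; first exact: mp_leb3_refl.
- by move=> x y; apply: vel_ext; rewrite /= mulrDr.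
- by move=> c x; apply: vel_ext; rewrite /= /GRing.scale/= mulrCA.
- move=> x y; rewrite /dot /refl/=.
  by case: (a == 1%N); case: (a == 2%N); case: (a == 3%N); rewrite ?expr1 ?expr0; ring.
Qed.

Lemma cyc_isometry : lin_isometry cyc.
Proof.
split; first exact: mp_leb3_cycle.
- by [].
- by [].
- by move=> x y; rewrite /dot /cyc/=; ring.
Qed.

Section isometry_theory.
Variables (g : vel R -> vel R) (hg : lin_isometry g).

Lemma iso_enorm x : enorm (g x) = enorm x.
Proof. by have [_ _ _ h] := hg; rewrite /enorm h. Qed.

Lemma iso_sub x y : g (x - y) = g x - g y.
Proof. by have [_ hD hZ _] := hg; rewrite -scaleN1r hD hZ scaleN1r. Qed.

Lemma iso_eq x y : (g x == g y) = (x == y).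
Proof. by rewrite -subr_eq0 -iso_sub -enorm_eq0 iso_enorm enorm_eq0 subr_eq0. Qed.

Definition iso3 (p : trip) : trip := (g p.1.1, g p.1.2, g p.2).

Lemma mp_iso3 : mp Pi3 Pi3 iso3.
Proof.
have [hm hD hZ hd] := hg.
exact: (mp_prod (mp_prod hm hm) (mp_surf hm hZ iso_enorm)).
Qed.

Lemma good_iso3 p : good (iso3 p) = good p.
Proof. by rewrite /good/= iso_eq iso_enorm. Qed.

Lemma kk_iso3 n (B : 'I_n -> 'I_n -> R -> R -> R) i j p : kk B i j (iso3 p) = kk B i j p.
Proof.
have [_ _ _ hd] := hg.
by rewrite /kk good_iso3 /kern /cosdev/= -iso_sub hd iso_enorm.
Qed.

Lemma Tc_iso3 p : Tc (iso3 p) = iso3 (Tc p).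
Proof.
have [_ hD hZ hd] := hg.
rewrite /Tc good_iso3; case: ifP => // _; rewrite /Tc0 /iso3/=.
by rewrite /vpost /vpost_star /dir -!iso_sub !iso_enorm !(hZ, iso_sub) !(hZ, hD).
Qed.

End isometry_theory.
End isometries.

(** * Weighted collision invariants of one species *)

Section maxwellian_basis.
Context {R : realType}.

Definition smw0 (v : vel R) : R := Num.sqrt (unit_maxw v).

Lemma smw0_gt0 v : 0 < smw0 v.
Proof. by rewrite sqrtr_gt0 unit_maxw_gt0. Qed.

Lemma smw0_sqr v : smw0 v ^+ 2 = unit_maxw v.
Proof. by rewrite sqr_sqrtr// ltW// unit_maxw_gt0. Qed.

Lemma mf_smw0 : measurable_fun setT smw0.
Proof. by have mg := @mf_unit_maxw R; rewrite /smw0; mfv. Qed.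

Lemma smw0_iso g v : lin_isometry g -> smw0 (g v) = smw0 v.
Proof. by move=> hg; rewrite /smw0 /unit_maxw (iso_enorm hg). Qed.

(** The collision invariants 1, v_1, v_2, v_3 and |v|^2 - m. The shift m = [mean_energy] makes the
    last orthogonal to the first; m = 0 gives plain |v|^2. Indices above 4 give 0. *)
Definition monom (m : R) (k : nat) (v : vel R) : R :=
  nth 0 [:: 1; v.1.1; v.1.2; v.2; enorm v ^+ 2 - m] k.

Definition bas m k v : R := smw0 v * monom m k v.

Lemma mf_monom m k : measurable_fun setT (monom m k).
Proof. by rewrite /monom; case: k => [|[|[|[|[|k]]]]] /=; mfv. Qed.

Lemma sqi_weighted (F : vel R -> R) (A : R) : measurable_fun setT F ->
  (forall v, `|F v| <= A * (1 + enorm v ^+ 2) ^+ 2) -> sqi leb3 (fun v => smw0 v * F v).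
Proof.
move=> mF hF; have ms := mf_smw0; have mg := @mf_unit_maxw R; split; first by mfv.
have g0 (v : vel R) : 0 <= unit_maxw v by exact/ltW/unit_maxw_gt0.
apply: (@le_lt_trans _ _ (\int[leb3]_v (A ^+ 2 * ((1 + enorm v ^+ 2) ^+ 4 * unit_maxw v))%:E)%E).
  apply: ge0_integral_mono; [by mfv| by move=> v; exact: sqr_ge0|by mfv|].
  move=> v; rewrite exprMn smw0_sqr mulrC mulrA; apply: ler_wpM2r => //.
  have h := hF v; rewrite -[F v ^+ 2]real_normK ?num_real//.
  have -> : A ^+ 2 * (1 + enorm v ^+ 2) ^+ 4 = (A * (1 + enorm v ^+ 2) ^+ 2) ^+ 2 by ring.
  by rewrite lerXn2r// nnegrE// (le_trans _ h).
rewrite ge0_integral_scale; [|exact: sqr_ge0|by mfv|]; last first.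
  by move=> v; rewrite mulr_ge0// exprn_ge0// addr_ge0// sqr_ge0.
by apply: lte_mul_pinfty; [rewrite lee_fin sqr_ge0|by []|exact: poly_gauss_fin].
Qed.

Lemma coord_le_quad (v : vel R) : enorm v <= 1 + enorm v ^+ 2.
Proof. by have := sqr_ge0 (enorm v - 1); have := sqr_ge0 (enorm v); nra. Qed.

Lemma monom_le m k v : `|monom m k v| <= (1 + `|m|) * (1 + enorm v ^+ 2).
Proof.
have y0 := sqr_ge0 (enorm v); have m0 := normr_ge0 m.
have h : 1 + enorm v ^+ 2 <= (1 + `|m|) * (1 + enorm v ^+ 2) by rewrite ler_peMl ?lerDl// addr_ge0.
have hc := coord_le_quad v.
rewrite /monom; case: k => [|[|[|[|[|k]]]]] /=.
- by apply: le_trans h; rewrite normr1 lerDl.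
- by apply: le_trans h; apply: le_trans hc; exact: enorm_coord1.
- by apply: le_trans h; apply: le_trans hc; exact: enorm_coord2.
- by apply: le_trans h; apply: le_trans hc; exact: enorm_coord3.
- apply: (le_trans (ler_normB _ _)); rewrite (ger0_norm y0); move: y0 m0.
  by move: (enorm v ^+ 2) `|m| => y z; nra.
- by rewrite nth_nil normr0 mulr_ge0 ?addr_ge0.
Qed.

Lemma sqi_bas m k : sqi leb3 (bas m k).
Proof.
apply: (sqi_weighted (A := 1 + `|m|)); first exact: mf_monom.
move=> v; apply: (le_trans (monom_le m k v)); rewrite ler_wpM2l ?addr_ge0//.
by rewrite ler_eXnr// lerDl sqr_ge0.
Qed.

Lemma bas_refl_odd m (k : nat) v : (0 < k)%N && (k < 4)%N -> bas m k (refl k v) = - bas m k v.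
Proof.
move=> hk; rewrite /bas (smw0_iso _ (refl_isometry k)) -mulrN; congr (_ * _).
by case: k hk => [|[|[|[|k]]]]//= _; rewrite /monom/= expr1 mulN1r.
Qed.

Lemma bas_refl_even m (a k : nat) v : k != a -> bas m k (refl a v) = bas m k v.
Proof.
move=> ka; rewrite /bas (smw0_iso _ (refl_isometry a)); congr (_ * _).
case: k ka => [|[|[|[|[|k]]]]] ka; rewrite /monom/= ?(iso_enorm (refl_isometry a))//.
all: by rewrite eq_sym in ka; rewrite (negbTE ka) expr0 mul1r.
Qed.

Lemma bas_orth m (k l : nat) : k != l -> ~~ ((k == 0%N) && (l == 4)) -> ~~ ((k == 4) && (l == 0%N)) ->
  (k < 5)%N -> (l < 5)%N -> L2ip leb3 (bas m k) (bas m l) = 0.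
Proof.
move=> kl n1 n2 k5 l5.
have h a b : (0 < a)%N && (a < 4)%N -> b != a -> L2ip leb3 (bas m a) (bas m b) = 0.
  move=> ha ba; have [hm _ _ _] := @refl_isometry R a.
  apply: (L2ip_odd_even hm); [exact: sqi_bas|exact: sqi_bas| |].
    by move=> v; exact: bas_refl_odd.
  by move=> v; exact: bas_refl_even.
have [hk|hk] := boolP ((0 < k)%N && (k < 4)%N); first by apply: h => //; rewrite eq_sym.
have [hl|hl] := boolP ((0 < l)%N && (l < 4)%N); first by rewrite L2ipC; exact: h.
by case: k k5 kl n1 n2 hk => [|[|[|[|[|k]]]]]//; case: l l5 hl => [|[|[|[|[|l]]]]].
Qed.

(** Mean of |v|^2 under the unit Maxwellian, kept as an integral: only the orthogonality it produces
    is used. *)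
Definition mean_energy : R := L2ip leb3 (bas 0 4) (bas 0 0).

Lemma bas0_norm m : L2ip leb3 (bas m 0) (bas m 0) = 1.
Proof.
apply: EFin_inj; rewrite L2ipE; last exact: sqi_bas.
rewrite -unit_maxw_mass; apply: eq_integral => v _.
by rewrite /bas /monom/= mulr1 smw0_sqr.
Qed.

Lemma bas_orth04 : L2ip leb3 (bas mean_energy 4) (bas mean_energy 0) = 0.
Proof.
have e : bas mean_energy 4 = fun v => bas 0 4 v - mean_energy * bas 0 0 v.
  by apply/funext => v; rewrite /bas /monom/=; ring.
have e0 : bas mean_energy 0 = bas 0 0 by [].
have sZ : sqi leb3 (fun v => mean_energy * bas 0 0 v) by apply: sqiZ; exact: sqi_bas.
rewrite e e0 (L2ipBl (sqi_bas 0 4) sZ (sqi_bas 0 0)) (L2ipZl _ (sqi_bas 0 0) (sqi_bas 0 0)).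
by rewrite bas0_norm mulr1 subrr.
Qed.

Lemma bas_orthE (k l : nat) : k != l -> (k < 5)%N -> (l < 5)%N ->
  L2ip leb3 (bas mean_energy k) (bas mean_energy l) = 0.
Proof.
move=> kl k5 l5; have [/andP[/eqP-> /eqP->]|h1] := boolP ((k == 0%N) && (l == 4)).
  by rewrite L2ipC; exact: bas_orth04.
have [/andP[/eqP-> /eqP->]|h2] := boolP ((k == 4) && (l == 0%N)); first exact: bas_orth04.
exact: bas_orth.
Qed.

(** Beyond any plane v_1 = a there is a box of positive volume. Such a witness shows that a function
    is not almost everywhere zero. *)
Lemma ae_box_witness (P : vel R -> Prop) (a : R) : {ae leb3, forall v, P v} ->
  exists2 v, P v & a <= v.1.1.
Proof.
move=> [N [mN N0 hN]]; apply: contrapT => nex.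
pose A : set (vel R) := ((`[a, a + 1] : set (measurableTypeR R)) `*` (`[0, 1] : set (measurableTypeR R))) `*` (`[0, 1] : set (measurableTypeR R)).
have mA : measurable A by do 2! apply: measurableX => //; exact: measurable_itv.
have AN : A `<=` N.
  move=> v [[/= + _] _]; rewrite in_itv/= => /andP[av _]; apply: hN => /= Pv; apply: nex; by exists v.
have : (leb3 A <= leb3 N)%E by apply: le_measure; rewrite ?inE.
have mI (x y : R) : measurable (`[x, y]%classic : set (measurableTypeR R)) by exact: measurable_itv.
rewrite N0 (leb3_box (mI a (a + 1)) (mI 0 1) (mI 0 1)).
have e1 (x : R) : lebesgue_measure (`[x, x + 1]%classic : set (measurableTypeR R)) = 1%:E :> \bar R.
  by rewrite lebesgue_measure_itv/= lte_fin ltrDl ltr01 -EFinD; congr EFin; ring.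
have e2 := e1 0; rewrite add0r in e2.
by rewrite e1 e2 !mule1 lee_fin ler10.
Qed.

(** At points with v_1 >= 1 + |m| neither v_1 nor |v|^2 - m vanishes; the norms for v_2 and v_3
    equal that for v_1 by cyclic permutation. *)
Lemma bas_norm_gt0 m (k : nat) : (k < 5)%N -> 0 < L2ip leb3 (bas m k) (bas m k).
Proof.
move=> k5; rewrite lt_neqAle L2ip_ge0 andbT eq_sym; apply/eqP => h0.
have s1 k' v : bas m k' v = 0 -> monom m k' v = 0.
  by move/eqP; rewrite mulf_eq0 gt_eqF ?smw0_gt0//= => /eqP.
have key k' : (forall v, 1 + `|m| <= v.1.1 -> monom m k' v != 0) ->
    L2ip leb3 (bas m k') (bas m k') = 0 -> False.
  move=> hk' h; have := L2ip_eq0 (sqi_bas m k') h => /(ae_box_witness (1 + `|m|))[v /s1 v0 hv].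
  by move: (hk' v hv); rewrite v0 eqxx.
have cyc_norm k' : (0 < k')%N && (k' < 3)%N ->
    L2ip leb3 (bas m k') (bas m k') = L2ip leb3 (bas m k'.+1) (bas m k'.+1).
  move=> hk'; have [hm _ _ _] := @cyc_isometry R.
  rewrite -[RHS]/(L2ip _ _ _).
  rewrite -(L2ip_mp hm (sqi_bas m k').1 (sqi_bas m k').1).
  have e : (fun x => bas m k' (cyc x)) = bas m k'.+1.
    apply/funext => x; rewrite /bas (smw0_iso _ (@cyc_isometry R)); congr (_ * _).
    by case: k' hk' => [|[|[|k']]].
  by rewrite e.
have m0 := normr_ge0 m.
have h1 : L2ip leb3 (bas m 1) (bas m 1) = 0 -> False.
  by apply: key => v hv; rewrite /monom/= gt_eqF// (lt_le_trans _ hv)// ltr_wpDr.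
case: k k5 h0 => [|[|[|[|[|k]]]]]//= _.
- by rewrite bas0_norm => /eqP; rewrite oner_eq0.
- by rewrite -(cyc_norm 1%N).
- by rewrite -(cyc_norm 2)// -(cyc_norm 1%N).
- apply: key => v hv; rewrite /monom/= gt_eqF// subr_gt0.
  have h2 : v.1.1 <= enorm v by apply: le_trans (enorm_coord1 v); exact: ler_norm.
  have h3 : 1 + `|m| <= enorm v by exact: le_trans h2.
  have := ler_norm m; move: (enorm v) `|m| m0 h3 => x y y0 h3 h4.
  by apply: (le_lt_trans h4); nra.
Qed.

(** The four terms are orthogonal. The constant 24 is the bound on the fourth moment; it also covers
    the coordinates, as v_k^2 <= (1 + |v|^4) / 2 has mean at most 25 / 2. *)
Lemma bas_quad_norm (w : vel R) (c : R) :
  L2ip leb3 (fun v => smw0 v * (dot w v + c * enorm v ^+ 2)) (fun v => smw0 v * (dot w v + c * enorm v ^+ 2))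
  <= 24 * (enorm w ^+ 2 + c ^+ 2).
Proof.
pose cf (k : 'I_4) : R := nth 0 [:: w.1.1; w.1.2; w.2; c] k.
pose Y (k : 'I_4) := bas 0 k.+1.
have e : (fun v => smw0 v * (dot w v + c * enorm v ^+ 2)) = fun v => \sum_k cf k * Y k v.
  apply/funext => v; rewrite !big_ord_recl big_ord0 /cf /Y /bas /monom/= /dot; ring.
have n4 : L2ip leb3 (bas 0 4) (bas 0 4) <= 24.
  rewrite -lee_fin L2ipE; last exact: sqi_bas.
  apply: le_trans (@unit_maxw_fourth R); apply: le_eq; apply: eq_integral => v _.
  by rewrite /bas /monom/= subr0 exprMn smw0_sqr -exprM.
have nk (k : nat) : (0 < k)%N && (k < 4)%N -> L2ip leb3 (bas 0 k) (bas 0 k) <= 24.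
  move=> hk; have s04 := sqiD (sqi_bas 0 0) (sqi_bas 0 4).
  apply: (@le_trans _ _ ((1 + 24) / 2)); last by lra.
  have mg := @mf_unit_maxw R; have mm := mf_monom 0 k.
  have g0 (v : vel R) : 0 <= unit_maxw v by exact/ltW/unit_maxw_gt0.
  rewrite -lee_fin L2ipE; last exact: sqi_bas.
  apply: (@le_trans _ _ (\int[leb3]_v (2^-1 * (unit_maxw v + unit_maxw v * enorm v ^+ 4))%:E)%E).
    apply: ge0_integral_mono; [by have := (sqi_bas 0 k).1 => h; mfv|by move=> v; exact: sqr_ge0|by mfv|].
    move=> v; rewrite exprMn smw0_sqr; have -> : 2^-1 * (unit_maxw v + unit_maxw v * enorm v ^+ 4) =
      unit_maxw v * ((1 + enorm v ^+ 4) / 2) by field.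
    apply: ler_wpM2l => //.
    have : monom 0 k v ^+ 2 <= enorm v ^+ 2.
      rewrite -(real_normK (num_real (monom 0 k v))) lerXn2r ?nnegrE ?enorm_ge0//.
      by case: k hk mm => [|[|[|[|k]]]]//= _ _; rewrite /monom/=; [exact: enorm_coord1|exact: enorm_coord2|exact: enorm_coord3].
    have -> : enorm v ^+ 4 = (enorm v ^+ 2) ^+ 2 by rewrite -exprM.
    by move: (monom 0 k v ^+ 2) (enorm v ^+ 2) => z y; have := sqr_ge0 (y - 1); nra.
  have h4 (v : vel R) : 0 <= unit_maxw v * enorm v ^+ 4 by rewrite mulr_ge0// exprn_ge0 ?enorm_ge0.
  rewrite ge0_integral_scale; [|by rewrite invr_ge0|by mfv|by move=> v; rewrite addr_ge0].
  rewrite ge0_integral_add; [|by mfv|by []|by mfv|by []].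
  rewrite unit_maxw_mass mulrC EFinM; apply: lee_wpmul2l; first by rewrite lee_fin invr_ge0.
  by rewrite EFinD; apply: leeD => //; exact: unit_maxw_fourth.
rewrite e L2ip_orth_sum; last 2 first.
- by move=> k; exact: sqi_bas.
- move=> i j ij; apply: bas_orth.
  + by rewrite eqSS.
  + by [].
  + by rewrite andbF.
  + by rewrite ltnS; exact: ltn_ord.
  + by rewrite ltnS; exact: ltn_ord.
rewrite enorm_sqr /dot !big_ord_recl big_ord0 /cf /Y/=.
have sq (x : R) : 0 <= x ^+ 2 := sqr_ge0 x.
have b1 := ler_wpM2l (sq w.1.1) (nk 1%N isT); have b2 := ler_wpM2l (sq w.1.2) (nk 2 isT).
have b3 := ler_wpM2l (sq w.2) (nk 3 isT); have b4 := ler_wpM2l (sq c) n4.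
rewrite addr0 !mulrDr -!expr2 [24 * w.1.1 ^+ 2]mulrC [24 * w.1.2 ^+ 2]mulrC [24 * w.2 ^+ 2]mulrC [24 * c ^+ 2]mulrC.
rewrite -!addrA; apply: lerD => //; apply: lerD => //; exact: lerD.
Qed.

End maxwellian_basis.

Section bessel.
Context {R : realType} (E : lmodType R).
Variables (D : set E) (b : E -> E -> R).
Hypotheses (D0 : D 0) (DD : forall x y, D x -> D y -> D (x + y))
  (DZ : forall c x, D x -> D (c *: x)) (hb : semi_inner D b).

Lemma D_sum (I : Type) (r : seq I) (F : I -> E) : (forall i, D (F i)) -> D (\sum_(i <- r) F i).
Proof. by move=> DF; elim/big_ind : _ => //; exact: DD. Qed.

Lemma semi_inner_suml (I : Type) (r : seq I) (F : I -> E) z : (forall i, D (F i)) -> D z ->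
  b (\sum_(i <- r) F i) z = \sum_(i <- r) b (F i) z.
Proof.
move=> DF Dz; have [_ bD bZ _] := hb; elim: r => [|i r IH].
  by rewrite !big_nil -[0]/(0 : E) -(scale0r (0 : E)) bZ// mul0r.
by rewrite !big_cons bD ?IH//; exact: D_sum.
Qed.

Lemma bessel_identity (T : finType) (e : T -> E) x : D x -> (forall a, D (e a)) ->
  (forall a a', b (e a) (e a') = (a == a')%:R) ->
  b (x - \sum_a b x (e a) *: e a) (x - \sum_a b x (e a) *: e a) = b x x - \sum_a b x (e a) ^+ 2.
Proof.
move=> Dx De oe; have [bC _ bZ _] := hb.
have DF a : D (b x (e a) *: e a) by exact: DZ.
have DS : D (\sum_a b x (e a) *: e a) by exact: D_sum.
have h1 : b x (\sum_a b x (e a) *: e a) = \sum_a b x (e a) ^+ 2.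
  rewrite bC// semi_inner_suml//; apply: eq_bigr => a _.
  by rewrite bZ// (bC (e a))// expr2.
have h2 : b (\sum_a b x (e a) *: e a) (\sum_a b x (e a) *: e a) = \sum_a b x (e a) ^+ 2.
  rewrite semi_inner_suml//; apply: eq_bigr => a _; rewrite bZ// expr2; congr (_ * _).
  rewrite bC// semi_inner_suml// (bigD1 a)//= [X in _ + X]big1 ?addr0 => [|a' aa'].
    by rewrite bZ// oe eqxx mulr1.
  by rewrite bZ// oe (negbTE aa') mulr0.
rewrite (semi_innerBB DD DZ hb Dx DS) h1 h2; ring.
Qed.

(* The Bessel defects of the [psi k] are nonnegative and, by Parseval for the
   [e a] and equality of the two cardinals, sum to 0. *)
Lemma same_size_orthonormal (T U : finType) (e : T -> E) (psi : U -> E) : #|T| = #|U| ->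
  (forall a, D (e a)) -> (forall k, D (psi k)) ->
  (forall a a', b (e a) (e a') = (a == a')%:R) ->
  (forall k k', b (psi k) (psi k') = (k == k')%:R) ->
  (forall a, b (e a) (e a) = \sum_k b (e a) (psi k) ^+ 2) ->
  forall k, b (psi k - \sum_a b (psi k) (e a) *: e a) (psi k - \sum_a b (psi k) (e a) *: e a) = 0.
Proof.
move=> TU De Dp oe op pars k; have [bC _ bZ b_ge0] := hb.
have DS l : D (\sum_a b (psi l) (e a) *: e a) by apply: D_sum => a; exact: DZ.
have nn l : 0 <= 1 - \sum_a b (psi l) (e a) ^+ 2.
  have := b_ge0 _ (DB DD DZ (Dp l) (DS l)).
  by rewrite bessel_identity// op eqxx.
have s0 : \sum_l (1 - \sum_a b (psi l) (e a) ^+ 2) = 0.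
  rewrite sumrB exchange_big/= sumr_const -TU.
  rewrite (eq_bigr (fun=> 1)); first by rewrite sumr_const subrr.
  move=> a _; transitivity (b (e a) (e a)); last by rewrite oe eqxx.
  by rewrite pars; apply: eq_bigr => l _; rewrite bC.
rewrite bessel_identity// op eqxx.
have /eqP := s0; rewrite psumr_eq0; last by move=> l _; exact: nn.
by move=> /allP /(_ k (mem_index_enum k)) /eqP.
Qed.

End bessel.

(** * Polynomial elements of the null spaces *)

Section maxwellian_polynomials.
Context {R : realType} {n : nat}.
Local Notation trip := (vel R * vel R * vel R)%type.
Variables (rho : 'I_n -> R) (B : 'I_n -> 'I_n -> R -> R -> R).
Hypotheses (hrho : forall i, 0 < rho i) (hB : collision_kernel B) (hS : kernel_sym B).
Hypothesis nufin : forall i j v, (nuE rho B i j v < +oo)%E.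
Variables c0 K : R.
Hypotheses (c0_gt0 : 0 < c0) (nu_lower : forall i v, c0 <= nu rho B i v).
Hypotheses (K_gt0 : 0 < K) (nu_upper : forall i j v, (nuE rho B i j v <= (K * (1 + enorm v))%:E)%E).
Implicit Types (i j : 'I_n) (f g : 'I_n -> vel R -> R) (u : 'I_n -> vel R) (al e : 'I_n -> R).
Local Notation E := ('I_n -> vel R -> R^o).

Definition polyf al u e : 'I_n -> vel R -> R :=
  fun i v => smw rho i v * (al i + dot (u i) v + e i * enorm v ^+ 2).

Lemma smwE i v : smw rho i v = Num.sqrt (rho i) * smw0 v.
Proof. by rewrite /smw maxwE sqrtrM// ltW. Qed.

Lemma nu_le i v : nu rho B i v <= n%:R * K * (1 + enorm v).
Proof.
rewrite /nu; apply: (@le_trans _ _ (\sum_(j < n) K * (1 + enorm v))).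
  by apply: ler_sum => j _; rewrite -lee_fin -(nuEE hrho hB nufin); exact: nu_upper.
by rewrite sumr_const card_ord -mulrA mulr_natl.
Qed.

Lemma poly_le (a c : R) (w v : vel R) :
  `|a + dot w v + c * enorm v ^+ 2| <= (`|a| + enorm w + `|c|) * (1 + enorm v ^+ 2).
Proof.
have h := coord_le_quad v; have d := dot_le w v; have y0 := sqr_ge0 (enorm v).
have w0 := enorm_ge0 w; have v0 := enorm_ge0 v.
apply: (le_trans (ler_normD _ _)); rewrite 2!mulrDl; apply: lerD.
  apply: (le_trans (ler_normD _ _)); apply: lerD; first by rewrite ler_peMr// lerDl.
  by apply: (le_trans d); exact: ler_wpM2l.
by rewrite normrM (ger0_norm y0) ler_wpM2l// lerDr.
Qed.

Lemma sqi_polyf_weight al u e i (N : vel R -> R) (A : R) : measurable_fun setT N ->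
  (forall v, 0 <= N v) -> (forall v, N v <= A * (1 + enorm v ^+ 2)) ->
  sqi leb3 (fun v => polyf al u e i v * N v).
Proof.
move=> mN N0 hN.
have -> : (fun v => polyf al u e i v * N v) = (fun v => smw0 v *
    (Num.sqrt (rho i) * (al i + dot (u i) v + e i * enorm v ^+ 2) * N v)).
  by apply/funext => v; rewrite /polyf smwE; ring.
apply: (sqi_weighted (A := Num.sqrt (rho i) * (`|al i| + enorm (u i) + `|e i|) * A)); first by mfv.
move=> v; rewrite !normrM (ger0_norm (sqrtr_ge0 _)) (ger0_norm (N0 v)).
have y0 : 0 <= 1 + enorm v ^+ 2 by rewrite addr_ge0// sqr_ge0.
have -> : Num.sqrt (rho i) * (`|al i| + enorm (u i) + `|e i|) * A * (1 + enorm v ^+ 2) ^+ 2 =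
  Num.sqrt (rho i) * ((`|al i| + enorm (u i) + `|e i|) * (1 + enorm v ^+ 2)) * (A * (1 + enorm v ^+ 2)) by ring.
apply: ler_pM; [by rewrite mulr_ge0 ?sqrtr_ge0|exact: N0| |exact: hN].
by rewrite ler_wpM2l ?sqrtr_ge0// poly_le.
Qed.

Lemma polyf_domL al u e : domL rho B (polyf al u e).
Proof.
split.
  move=> i; apply/Lfun2P.
  have e1 : (fun v => polyf al u e i v * 1) = polyf al u e i.
    by apply/funext => v; rewrite mulr1.
  rewrite -e1; apply: (@sqi_polyf_weight al u e i (fun=> 1) 1) => //.
  by move=> v; rewrite mul1r lerDl sqr_ge0.
apply: lte_sum_pinfty => i _; have mn := mf_nu hrho hB i.
have [] := @sqi_polyf_weight al u e i (nu rho B i) (n%:R * K * 2) mn (nu_ge0 hrho hB i) _.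
  move=> v; apply: (le_trans (nu_le i v)); rewrite -[leRHS]mulrA ler_wpM2l//.
    by rewrite mulr_ge0// ltW.
  by have := coord_le_quad v; have := sqr_ge0 (enorm v); lra.
by move=> _; under eq_integral do rewrite exprMn.
Qed.

Lemma polyf_Hsp al u e : Hsp rho B (polyf al u e).
Proof. exact: domL_Hsp hrho hB _ (polyf_domL al u e). Qed.

Lemma hfun_polyf al u e i v :
  hfun rho i (polyf al u e i) v = al i + dot (u i) v + e i * enorm v ^+ 2.
Proof. by rewrite /hfun /polyf -/(smw rho i v) mulrAC divff ?mul1r// gt_eqF// smw_gt0. Qed.

(** Conservation of momentum and energy eliminates the partner's post-collisional velocity. The
    coefficients alpha cancel, and only differences of u and of e remain. *)
Lemma SS_polyf al u e i j p : SS rho B i j (polyf al u e) p =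
  skk B i j p * (smw rho i p.1.1 * smw rho j p.1.2) *
  (dot (u i - u j) ((Tc p).1.1 - p.1.1) + (e i - e j) * (enorm (Tc p).1.1 ^+ 2 - enorm p.1.1 ^+ 2)).
Proof.
rewrite SSE// !hfun_polyf; congr (_ * _).
have h1 := momentum_Tc p; have h2 := energy_Tc p.
have -> : (Tc p).1.2 = p.1.1 + p.1.2 - (Tc p).1.1 by rewrite -h1 addrC addKr.
have {}h2 : enorm (Tc p).1.2 ^+ 2 = enorm p.1.1 ^+ 2 + enorm p.1.2 ^+ 2 - enorm (Tc p).1.1 ^+ 2.
  by rewrite -h2; ring.
have -> : enorm (p.1.1 + p.1.2 - (Tc p).1.1) ^+ 2 =
    enorm p.1.1 ^+ 2 + enorm p.1.2 ^+ 2 - enorm (Tc p).1.1 ^+ 2.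
  by rewrite -h2 -h1 [_ + (Tc p).1.2]addrC addrK.
rewrite !dotE; move: (dot _ _) (dot _ _) (dot _ _) (dot _ _) (dot _ _) => x1 x2 x3 x4 x5.
by move: (enorm _ ^+ 2) (enorm _ ^+ 2) (enorm _ ^+ 2) => y1 y2 y3; ring.
Qed.

Lemma SS_polyf0 al u e i j : u i = u j -> e i = e j ->
  L2ip Pi3 (SS rho B i j (polyf al u e)) (SS rho B i j (polyf al u e)) = 0.
Proof.
move=> uu ee; have -> : SS rho B i j (polyf al u e) = fun=> 0.
  apply/funext => p; rewrite SS_polyf uu ee !subrr mul0r addr0.
  by rewrite /dot/= !mul0r !addr0 mulr0.
by rewrite ae_L2ip0//; exact: aeW.
Qed.

Lemma polyf_nullspace_mono al u e : nullspace rho B (Lmono rho B) (polyf al u e).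
Proof.
apply/(nullspace_LmonoP hrho hB hS nufin); split; first exact: polyf_domL.
by move=> i; exact: SS_polyf0.
Qed.

Lemma polyf_nullspace al (w : vel R) (c : R) :
  nullspace rho B (Lop rho B) (polyf al (fun=> w) (fun=> c)).
Proof.
apply/(nullspace_LopP hrho hB hS nufin); split; first exact: polyf_domL.
rewrite /bq big1 ?mulr0// => i _; apply: big1 => j _; exact: SS_polyf0.
Qed.

Definition is_polyf f : Prop := exists al u e, f = polyf al u e.

Lemma is_polyfD f g : is_polyf f -> is_polyf g -> is_polyf (f + g).
Proof.
move=> [a [u [c ->]]] [a' [u' [c' ->]]].
exists (fun i => a i + a' i), (fun i => u i + u' i), (fun i => c i + c' i).
apply/funext => i; apply/funext => v; rewrite /polyf dotDl -[LHS]/(polyf a u c i v + polyf a' u' c' i v).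
rewrite /polyf; ring.
Qed.

Lemma is_polyfZ (t : R) (f : E) : is_polyf f -> is_polyf (t *: f).
Proof.
move=> [a [u [c ->]]]; exists (fun i => t * a i), (fun i => t *: u i), (fun i => t * c i).
apply/funext => i; apply/funext => v; rewrite -[LHS]/(t * polyf a u c i v) /polyf dotZl.
ring.
Qed.

Lemma is_polyf0 : is_polyf 0.
Proof.
exists (fun=> 0), (fun=> 0), (fun=> 0); apply/funext => i; apply/funext => v.
by rewrite /polyf /dot/= !mul0r !addr0 mulr0.
Qed.

Lemma is_polyf_sum (I : Type) (r : seq I) (F : I -> E) :
  (forall k, is_polyf (F k)) -> is_polyf (\sum_(k <- r) F k).
Proof. by move=> hF; elim/big_ind : _ => //; [exact: is_polyf0|exact: is_polyfD]. Qed.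

Lemma is_polyf_single i (m : R) (k : nat) : is_polyf (single i (bas m k)).
Proof.
have h (a c : R) (w : vel R) : is_polyf (single i (fun v => smw0 v * (a + dot w v + c * enorm v ^+ 2))).
  exists (fun l => if l == i then a / Num.sqrt (rho i) else 0),
    (fun l => if l == i then (Num.sqrt (rho i))^-1 *: w else 0),
    (fun l => if l == i then c / Num.sqrt (rho i) else 0).
  apply/funext => l; apply/funext => v; rewrite /single /polyf smwE; case: (eqVneq l i) => [->|li].
    by rewrite dotZl; field; rewrite gt_eqF// sqrtr_gt0.
  by rewrite /dot/= !mul0r !addr0 mulr0.
have ext F : (forall v, monom m k v = F v) -> single i (bas m k) = single i (fun v => smw0 v * F v).
  by move=> hF; apply/funext => l; apply/funext => v; rewrite /single /bas hF.
case: k ext => [|[|[|[|[|k]]]]] ext.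
- by rewrite (ext (fun v => 1 + dot 0 v + 0 * enorm v ^+ 2)) => [|v]; [exact: h|rewrite /monom /dot/=; ring].
- by rewrite (ext (fun v => 0 + dot ((1, 0), 0) v + 0 * enorm v ^+ 2)) => [|v]; [exact: h|rewrite /monom /dot/=; ring].
- by rewrite (ext (fun v => 0 + dot ((0, 1), 0) v + 0 * enorm v ^+ 2)) => [|v]; [exact: h|rewrite /monom /dot/=; ring].
- by rewrite (ext (fun v => 0 + dot ((0, 0), 1) v + 0 * enorm v ^+ 2)) => [|v]; [exact: h|rewrite /monom /dot/=; ring].
- by rewrite (ext (fun v => - m + dot 0 v + 1 * enorm v ^+ 2)) => [|v]; [exact: h|rewrite /monom /dot/=; ring].
- by rewrite (ext (fun v => 0 + dot 0 v + 0 * enorm v ^+ 2)) => [|v]; [exact: h|rewrite /monom /= nth_nil /dot/=; ring].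
Qed.

Definition ae_eqv f g : Prop := forall i, {ae leb3, forall v, f i v = g i v}.

Lemma ae_ip f g h : (forall i, measurable_fun setT (f i)) -> (forall i, measurable_fun setT (g i)) ->
  (forall i, measurable_fun setT (h i)) -> ae_eqv f g -> ip f h = ip g h.
Proof. by move=> mf mg mh fg; apply: eq_bigr => i _; exact: (L2ip_ae (mf i) (mg i) (mh i) (fg i)). Qed.

Lemma ae_nuip f g : Hsp rho B f -> Hsp rho B g -> ae_eqv f g ->
  nuip rho B f f = nuip rho B g g.
Proof.
move=> hf hg fg; apply: eq_bigr => i _.
have sf := Hsp_sqi hrho hB i hf; have sg := Hsp_sqi hrho hB i hg.
have e : {ae leb3, forall v, nuw rho B f i v = nuw rho B g i v}.
  by apply: filterS (fg i) => v h; rewrite /nuw h.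
by rewrite (L2ip_ae sf.1 sg.1 sf.1 e) L2ipC (L2ip_ae sf.1 sg.1 sg.1 e).
Qed.

Lemma ip0_ae f : Hsp rho B f -> ip f f = 0 -> ae_eqv f (fun=> fun=> 0).
Proof.
move=> hf /eqP; rewrite psumr_eq0; last by move=> i _; exact: L2ip_ge0.
move=> /allP h i; have /eqP h0 := h i (mem_index_enum i).
exact: L2ip_eq0 (Hsp_sqi0 hrho hB c0_gt0 nu_lower i hf) h0.
Qed.

Lemma sum_at (I : Type) (r : seq I) (F : I -> E) i v :
  (\sum_(k <- r) F k) i v = \sum_(k <- r) F k i v.
Proof. by elim: r => [|k r IH]; rewrite ?big_nil// !big_cons -IH. Qed.

Variables (m : nat) (psi : 'I_m -> 'I_n -> vel R -> R).
Hypothesis hpsi : orthonormal_basis (nullspace rho B (Lmono rho B)) psi.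

Let ipS := semi_inner_ip hrho hB c0_gt0 nu_lower.
Let hD := HspD hrho hB.
Let hZ := HspZ hrho hB.
Let h0 := Hsp0 hrho hB.

Lemma mono_Hsp f : nullspace rho B (Lmono rho B) f -> Hsp rho B f.
Proof. by move=> [df _]; exact: domL_Hsp hrho hB _ df. Qed.

Lemma psi_Hsp k : Hsp rho B (psi k).
Proof. by have [h _ _] := hpsi; exact: mono_Hsp. Qed.

Lemma psi_expand f : nullspace rho B (Lmono rho B) f -> exists c : 'I_m -> R,
  [/\ Hsp rho B (\sum_k c k *: (psi k : E)), ae_eqv f (\sum_k c k *: (psi k : E)),
      forall k, ip f (psi k) = c k & ip f f = \sum_k c k ^+ 2].
Proof.
move=> nf; have [_ op hsp] := hpsi; have [c hc] := hsp f nf; exists c.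
have hf := mono_Hsp nf; have hP := psi_Hsp.
have hcP k : Hsp rho B (c k *: (psi k : E)) by exact: (hZ (c k) (hP k)).
have hS' : Hsp rho B (\sum_k c k *: (psi k : E)) by exact: (D_sum (E := E) h0 hD).
have e : ae_eqv f (\sum_k c k *: (psi k : E)).
  by move=> i; apply: filterS (hc i) => v ->; rewrite sum_at.
have mm g : Hsp rho B g -> forall i, measurable_fun setT (g i) by move=> hg i; exact: (hg i).1.
have [ipC _ ipZ _] := ipS.
have e1 k : ip f (psi k) = c k.
  rewrite (ae_ip (mm _ hf) (mm _ hS') (mm _ (hP k)) e).
  rewrite (semi_inner_suml (E := E) h0 hD ipS _ _ (hP k))// (bigD1 k)//= [X in _ + X]big1 ?addr0 => [|l lk].
    by rewrite (ipZ (c k) _ _ (hP k) (hP k)) op eqxx mulr1.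
  by rewrite (ipZ (c l) _ _ (hP l) (hP k)) op (negbTE lk) mulr0.
split => //; rewrite (ae_ip (mm _ hf) (mm _ hS') (mm _ hf) e).
rewrite (semi_inner_suml (E := E) h0 hD ipS _ _ hf)//; apply: eq_bigr => k _.
by rewrite (ipZ (c k) _ _ (hP k) hf) (ipC _ _ (hP k) hf) e1 expr2.
Qed.

(** The double sum of |c_k c_l| <= (c_k^2 + c_l^2) / 2 yields the number of basis elements, the
    source of the factor 5 n in [Ck]. *)
Lemma gram_bound (M : R) : (forall k l, `|nuip rho B (psi k) (psi l)| <= M) ->
  forall f, nullspace rho B (Lmono rho B) f -> nuip rho B f f <= m%:R * M * ip f f.
Proof.
move=> hM f nf; have [c [hS' e e1 e2]] := psi_expand nf; have hP := psi_Hsp.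
have hcP k : Hsp rho B (c k *: (psi k : E)) by exact: (hZ (c k) (hP k)).
have [nuC _ nuZ _] := semi_inner_nuip hrho hB.
rewrite (ae_nuip (mono_Hsp nf) hS' e) e2.
rewrite (semi_inner_suml (E := E) h0 hD (semi_inner_nuip hrho hB) _ _ hS')//.
have [m0|m_gt0] := posnP m.
  move: c {e e1 e2 hS' hcP} => c; rewrite [X in _ <= _ * _ * X]big1 ?big1 ?mulr0// => k _; by have := ltn_ord k; rewrite [X in (_ < X)%N]m0.
have M0 : 0 <= M by apply: le_trans (hM (Ordinal m_gt0) (Ordinal m_gt0)).
apply: (@le_trans _ _ (\sum_k \sum_l M * ((c k ^+ 2 + c l ^+ 2) / 2))).
  apply: ler_sum => k _; rewrite (nuC _ _ (hcP k) hS').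
  rewrite (semi_inner_suml (E := E) h0 hD (semi_inner_nuip hrho hB) _ _ (hcP k))//.
  apply: ler_sum => l _; rewrite (nuZ (c l) _ _ (hP l) (hcP k)) (nuC _ _ (hP l) (hcP k)).
  rewrite (nuZ (c k) _ _ (hP k) (hP l)) mulrA.
  apply: (le_trans (ler_norm _)); rewrite normrM mulrC; apply: ler_pM => //.
  have := sqr_ge0 (`|c l| - `|c k|); rewrite normrM sqrrB !real_normK ?num_real//.
  by move: (c k ^+ 2) (c l ^+ 2) (`|c l| * `|c k|) => x y z; lra.
have -> : \sum_k \sum_l M * ((c k ^+ 2 + c l ^+ 2) / 2) =
    M / 2 * (\sum_(k < m) \sum_(l < m) c k ^+ 2 + \sum_(k < m) \sum_(l < m) c l ^+ 2).
  rewrite -big_split/= mulr_sumr; apply: eq_bigr => k _; rewrite -big_split/= mulr_sumr.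
  by apply: eq_bigr => l _; ring.
rewrite [X in _ * (_ + X)]exchange_big/=.
have -> : \sum_(k < m) \sum_(l < m) c k ^+ 2 = m%:R * \sum_k c k ^+ 2.
  by rewrite mulr_sumr; apply: eq_bigr => k _; rewrite sumr_const card_ord mulr_natl.
by move: (\sum_k _) => s; have -> : M / 2 * (m%:R * s + m%:R * s) = m%:R * M * s by field.
Qed.

Lemma mono_is_polyf f : m = (5 * n)%N -> nullspace rho B (Lmono rho B) f ->
  exists2 g, is_polyf g & ae_eqv f g.
Proof.
move=> m5 nf; have hP := psi_Hsp; have [_ op _] := hpsi.
pose N (k : 'I_5) : R := (Num.sqrt (L2ip leb3 (bas (mean_energy (R := R)) k) (bas mean_energy k)))^-1.
pose ev (a : 'I_n * 'I_5) : E := N a.2 *: (single a.1 (bas mean_energy a.2) : E).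
have pe a : is_polyf (ev a) by apply: is_polyfZ; exact: is_polyf_single.
have ne a : nullspace rho B (Lmono rho B) (ev a).
  by have [al [u [c ->]]] := pe a; exact: polyf_nullspace_mono.
have he a : Hsp rho B (ev a) := mono_Hsp (ne a).
have N2 (k : 'I_5) : N k ^+ 2 * L2ip leb3 (bas mean_energy k) (bas mean_energy k) = 1.
  rewrite /N exprVn sqr_sqrtr ?L2ip_ge0// mulVf// gt_eqF// bas_norm_gt0//.
have oe a a' : ip (ev a) (ev a') = (a == a')%:R.
  have evE (b : 'I_n * 'I_5) i v : ev b i v = if i == b.1 then N b.2 * bas mean_energy b.2 v else 0.
    by rewrite /ev -[LHS]/(N b.2 * single b.1 (bas mean_energy b.2) i v) /single; case: ifP; rewrite ?mulr0.
  have sb k : sqi leb3 (bas (mean_energy (R := R)) k) by exact: sqi_bas.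
  case: a a' => [i k] [j l]; rewrite /ip (bigD1 i)//= [X in _ + X]big1 ?addr0; last first.
    move=> i' i'i; under eq_Rintegral do rewrite evE/= (negbTE i'i) mul0r.
    by rewrite Rintegral_cst// mul0r.
  rewrite xpair_eqE; case: (eqVneq i j) => [<-|ij] /=; last first.
    under eq_Rintegral do rewrite [ev (j, l) _ _]evE/= (negbTE ij) mulr0.
    by rewrite Rintegral_cst// mul0r.
  transitivity (L2ip leb3 (fun v => N k * bas mean_energy k v) (fun v => N l * bas mean_energy l v)).
    by apply: eq_Rintegral => v _; rewrite !evE/= eqxx.
  rewrite (L2ipZl _ (sb k) (sqiZ _ (sb l))) (L2ipZr _ (sb k) (sb l)).
  case: (eqVneq k l) => [<-|kl]; first by rewrite mulrA -expr2 N2.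
  by rewrite bas_orthE ?mulr0.
(* Polynomial elements lie in the null space, which psi spans, so Parseval holds for them. Equality
   of the cardinals then reverses the roles: each [psi k] is almost everywhere its projection on the
   polynomial elements. *)
have pars a : ip (ev a) (ev a) = \sum_k ip (ev a) (psi k) ^+ 2.
  have [c [_ _ e1 ->]] := psi_expand (ne a); by apply: eq_bigr => k _; rewrite e1.
have card : #|{: 'I_n * 'I_5}| = #|'I_m| by rewrite card_prod !card_ord m5 mulnC.
have hk := same_size_orthonormal (E := E) h0 hD hZ ipS card he hP oe op pars.
pose P k : E := \sum_a ip (psi k) (ev a) *: ev a.
have pP k : is_polyf (P k) by apply: is_polyf_sum => a; exact: is_polyfZ.
have hPk k : Hsp rho B (P k) by have [al [u [c ->]]] := pP k; exact: polyf_Hsp.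
have ePk k : ae_eqv (psi k) (P k).
  have hsub : Hsp rho B (psi k - P k) := DB (E := E) hD hZ (hP k) (hPk k).
  move=> i; apply: filterS (ip0_ae hsub (hk k) i) => v.
  by rewrite -[(psi k - P k) i v]/(psi k i v - P k i v) => /eqP; rewrite subr_eq0 => /eqP.
have [c [_ e _ _]] := psi_expand nf.
exists (\sum_k c k *: P k); first by apply: is_polyf_sum => k; exact: is_polyfZ.
move=> i; have ae2 : {ae leb3, forall v k, psi k i v = P k i v}.
  by apply: filter_forall => k; exact: ePk.
apply: filterS2 (e i) ae2 => v -> h; rewrite !sum_at; apply: eq_bigr => k _.
by rewrite -[LHS]/(c k * psi k i v) h.
Qed.

End maxwellian_polynomials.

(** * Lower bound on the dissipation constant *)

Section collision_box.
Context {R : realType}.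

(* For v, w, s / |s| in these sets the collision is not grazing and
   |v'| < |v|, so that the integrand defining D_b is positive. *)
Definition box_v : set (vel R) := ((`[100, 101] : set (measurableTypeR R)) `*` (`[0, 1] : set (measurableTypeR R))) `*` (`[0, 1] : set (measurableTypeR R)).
Definition box_w : set (vel R) := ((`[0, 1] : set (measurableTypeR R)) `*` (`[0, 1] : set (measurableTypeR R))) `*` (`[0, 1] : set (measurableTypeR R)).
Definition box_s : set (vel R) := ((`[3/10, 4/10] : set (measurableTypeR R)) `*` (`[5/10, 6/10] : set (measurableTypeR R))) `*` (`[0, 1/10] : set (measurableTypeR R)).
Definition cap : set (vel R) := [set s | enorm s = 1 /\ 1/5 <= s.1.1 <= 7/10].

Lemma measurable_boxes : [/\ measurable box_v, measurable box_w & measurable box_s].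
Proof. by split; do 2! apply: measurableX => //; exact: measurable_itv. Qed.

Lemma leb3_box_gt0 (a1 b1 a2 b2 a3 b3 : R) : a1 < b1 -> a2 < b2 -> a3 < b3 ->
  (0 < leb3 (((`[a1, b1] : set (measurableTypeR R)) `*` (`[a2, b2] : set (measurableTypeR R))) `*`
    (`[a3, b3] : set (measurableTypeR R))))%E.
Proof.
have mI (x y : R) : measurable (`[x, y]%classic : set (measurableTypeR R)) by exact: measurable_itv.
have e (x y : R) : x < y -> lebesgue_measure (`[x, y]%classic : set (measurableTypeR R)) = (y - x)%:E :> \bar R.
  by move=> xy; rewrite lebesgue_measure_itv/= lte_fin xy.
move=> h1 h2 h3; rewrite (leb3_box (mI _ _) (mI _ _) (mI _ _)) !e// -!EFinM lte_fin.
by rewrite !mulr_gt0// subr_gt0.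
Qed.

Lemma measurable_cap : measurable cap.
Proof.
have m1 : measurable_fun setT (fun s : vel R => s.1.1) by mfv.
have -> : cap = @S2 R `&` ((fun s : vel R => s.1.1) @^-1` `[1/5, 7/10]).
  by apply/seteqP; split => s; rewrite /cap/= in_itv/=.
apply: measurableI; first exact: measurable_S2.
by rewrite -[X in measurable X]setTI; apply: (m1 measurableT); exact: measurable_itv.
Qed.

(** The cone over [cap] in the unit ball contains [box_s], which has positive volume. *)
Lemma surf_cap_gt0 : (0 < surf cap)%E.
Proof.
have [_ _ mb] := measurable_boxes; have mc := measurable_cap.
rewrite surfE mule_gt0//.
apply: (@lt_le_trans _ _ (leb3 box_s)); first by apply: leb3_box_gt0; lra.
apply: le_measure; rewrite ?inE//.
  apply: measurableI; last exact: measurable_ball1.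
  by rewrite -[X in measurable X]setTI; exact: measurable_dir.
move=> x [[/= + +] +]; rewrite !in_itv/= => /andP[a1 a2] /andP[b1 b2] /andP[c1 c2].
have e2 := enorm_sqr x; rewrite /dot in e2.
have n0 := enorm_ge0 x.
have l1 : 34/100 <= enorm x ^+ 2 by rewrite e2; nra.
have l2 : enorm x ^+ 2 <= 53/100 by rewrite e2; nra.
have xp : 0 < enorm x by rewrite lt_neqAle n0 andbT eq_sym; apply/eqP => h; move: l1; rewrite h expr0n/=; lra.
have x0 : x != 0 by rewrite -enorm_gt0.
have x1 : enorm x <= 1 by rewrite -(@ler_pXn2r _ 2) ?nnegrE// expr1n; lra.
split; last by rewrite /ball1/= xp x1.
split; first exact: enorm_dir.
have -> : (dir x).1.1 = x.1.1 / enorm x by rewrite /dir/= mulrC.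
rewrite ler_pdivlMr// ler_pdivrMr//; apply/andP; split.
  by apply: (@le_trans _ _ (1/5 * 1)); [rewrite ler_wpM2l//; lra|lra].
rewrite -(@ler_pXn2r _ 2) ?nnegrE//; [|lra|by rewrite mulr_ge0//; lra].
rewrite exprMn; move: l1 a1 a2; move: (enorm x ^+ 2) (x.1.1) => y z; nra.
Qed.

Let long_side (x y : R) : 100 <= x -> x <= 101 -> 0 <= y -> y <= 1 ->
  99 <= x - y <= 101 /\ 100 <= x + y <= 102.
Proof. by move=> *; split; apply/andP; split; lra. Qed.

Let short_side (x y : R) : 0 <= x -> x <= 1 -> 0 <= y -> y <= 1 -> `|x - y| <= 1 /\ `|x + y| <= 2.
Proof. by move=> *; rewrite !ler_norml; split; apply/andP; split; lra. Qed.

Let dot_itv (x y : vel R) (a b c d e : R) : 0 <= a -> 0 <= c ->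
  a <= x.1.1 <= b -> c <= y.1.1 <= d -> `|x.1.2| <= e -> `|x.2| <= e -> `|y.1.2| <= 1 -> `|y.2| <= 1 ->
  a * c - 2 * e <= dot x y <= b * d + 2 * e.
Proof.
move=> a0 c0 /andP[xa xb] /andP[yc yd] x2 x3 y2 y3.
have h1 : a * c <= x.1.1 * y.1.1 by exact: ler_pM.
have h2 : x.1.1 * y.1.1 <= b * d by apply: ler_pM => //; [exact: le_trans xa|exact: le_trans yc].
have h (p q : R) : `|p| <= e -> `|q| <= 1 -> - e <= p * q <= e.
  by move=> hp hq; rewrite -ler_norml normrM -[e]mulr1; exact: ler_pM.
have /andP[h3 h3'] := h _ _ x2 y2; have /andP[h4 h4'] := h _ _ x3 y3.
rewrite /dot; move: (x.1.1 * _) (x.1.2 * _) (x.2 * _) h1 h2 h3 h3' h4 h4'.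
by move=> p q r *; apply/andP; split; lra.
Qed.

(** With z = v - w and c = v + w, |v|^2 - |v'|^2 = (c.z - |z| c.s) / 2. On the boxes c.z >= 99^2,
    while s_1 <= 7/10 keeps |z| (c.s) <= 103 * (102 * 7/10 + 4) < 99^2. *)
Lemma collision_box v w s : box_v v -> box_w w -> cap s ->
  [/\ v != w, 0 < dot s (v - w) < enorm (v - w)
    & enorm (vpost v w s) ^+ 2 < enorm v ^+ 2].
Proof.
have n1 (x : R) : 1/5 * 99 - 2 * 1 <= x <= 7/10 * 101 + 2 * 1 -> 0 < x /\ x < 99.
  by case/andP=> *; split; lra.
have n2 (x : R) : x <= 101 * 101 + 2 * 1 -> x <= 103 ^+ 2 by move=> ?; lra.
have n3 (x y : R) : x <= 103 -> y <= 102 * (7/10) + 2 * 2 -> 0 <= x -> x * y < 99 * 99.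
  move=> x3 y3 x0; apply: le_lt_trans (ler_wpM2l x0 y3) _.
  by apply: le_lt_trans (ler_wpM2r _ x3) _; lra.
have n4 (x : R) : 100 * 99 - 2 * 2 <= x -> 99 * 99 <= x by move=> ?; lra.
move=> [[/= + +] +] [[/= + +] +] [s1 /andP[s2 s3]].
rewrite !in_itv/= => /andP[v1 v1'] /andP[v2 v2'] /andP[v3 v3'] /andP[w1 w1'] /andP[w2 w2'] /andP[w3 w3'].
have t1 : 1/5 <= s.1.1 <= 7/10 by rewrite s2 s3.
have t2 : `|s.1.2| <= 1 by rewrite -s1; exact: enorm_coord2.
have t3 : `|s.2| <= 1 by rewrite -s1; exact: enorm_coord3.
set z := v - w; set c := v + w.
have [z1 c1] : 99 <= z.1.1 <= 101 /\ 100 <= c.1.1 <= 102 by exact: long_side.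
have [z2 c2] : `|z.1.2| <= 1 /\ `|c.1.2| <= 2 by exact: short_side.
have [z3 c3] : `|z.2| <= 1 /\ `|c.2| <= 2 by exact: short_side.
have zr : z.1.1 <= enorm z by apply: le_trans (enorm_coord1 z); exact: ler_norm.
have r99 : 99 <= enorm z by case/andP: z1 => h _; exact: le_trans zr.
have p1 : 0 <= 99 :> R by []. have p2 : 0 <= 100 :> R by []. have p3 : 0 <= 1/5 :> R by [].
have [d1 d2] := n1 _ (dot_itv p3 p1 t1 z1 t2 t3 z2 z3).
have r103 : enorm z <= 103.
  rewrite -(@ler_pXn2r _ 2) ?nnegrE ?enorm_ge0// enorm_sqr.
  by apply: n2; case/andP: (dot_itv p1 p1 z1 z1 z2 z3 z2 z3).
have e2 : 99 * 99 <= dot c z by apply: n4; case/andP: (dot_itv p2 p1 c1 z1 c2 c3 z2 z3).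
have e3 : enorm z * dot c s < 99 * 99.
  by apply: n3 r103 _ (enorm_ge0 z); case/andP: (dot_itv p2 p3 c1 t1 c2 c3 t2 t3).
split.
- by rewrite -subr_eq0 -enorm_gt0; apply: lt_le_trans r99.
- by rewrite d1/=; exact: lt_le_trans d2 r99.
have ss : dot s s = 1 by rewrite -enorm_sqr s1 expr1n.
have ev : enorm v ^+ 2 = 4^-1 * dot c c + 2^-1 * dot c z + 4^-1 * enorm z ^+ 2.
  rewrite !enorm_sqr /c /z !dotE (dotC w v).
  by move: (dot v v) (dot v w) (dot w w) => a1 a2 a3; field.
have ep (x y : vel R) (r : R) : enorm (2^-1 *: x + (r / 2) *: y) ^+ 2 =
    4^-1 * dot x x + 2^-1 * (r * dot x y) + 4^-1 * (r ^+ 2 * dot y y).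
  rewrite enorm_sqr !dotE (dotC y x).
  by move: (dot x x) (dot x y) (dot y y) => a1 a2 a3; field.
rewrite /vpost -/c -/z ep ss mulr1 [ltRHS]ev ltrD2r ltrD2l ltr_pM2l ?invr_gt0//.
exact: lt_le_trans e3 e2.
Qed.

End collision_box.

(** * The dissipation constant and the bi-species form *)

Section dissipation_constant.
Context {R : realType} {n : nat}.
Local Notation trip := (vel R * vel R * vel R)%type.
Variables (rho : 'I_n -> R) (B : 'I_n -> 'I_n -> R -> R -> R) (Phi b : 'I_n -> 'I_n -> R -> R).
Hypotheses (hrho : forall i, 0 < rho i) (hB : collision_kernel B) (hS : kernel_sym B).
Hypothesis nufin : forall i j v, (nuE rho B i j v < +oo)%E.
Variables K : R.
Hypotheses (K_gt0 : 0 < K) (nu_upper : forall i j v, (nuE rho B i j v <= (K * (1 + enorm v))%:E)%E).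
Hypothesis hn : (2 <= n)%N.
Implicit Types (i j : 'I_n).

Definition jump_min (v v' : vel R) : R :=
  Num.min (1 / 3 * enorm (v - v') ^+ 2) ((enorm v' ^+ 2 - enorm v ^+ 2) ^+ 2).

Lemma jump_min_ge0 v v' : 0 <= jump_min v v'.
Proof. by rewrite /jump_min le_min sqr_ge0 andbT mulr_ge0 ?sqr_ge0// divr_ge0. Qed.

(** The integral for the pair (i, j) in D_b, rewritten with [kk] and [Tc] so that the symmetries
    apply, and kept extended-valued until its finiteness is known. *)
Definition DE i j : \bar R :=
  (\int[Pi3]_p (kk B i j p * (jump_min p.1.1 (Tc p).1.1 * maxw rho i p.1.1 * maxw rho j p.1.2))%:E)%E.

Lemma mf_jump_min d (T : measurableType d) (x y : T -> vel R) : measurable_fun setT x ->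
  measurable_fun setT y -> measurable_fun setT (fun p => jump_min (x p) (y p)).
Proof. by move=> mx my; apply: measurable_minr; mfv. Qed.

Lemma mf_DE i j : measurable_fun setT
  (fun p : trip => kk B i j p * (jump_min p.1.1 (Tc p).1.1 * maxw rho i p.1.1 * maxw rho j p.1.2)).
Proof.
have mk := mf_kk hB i j; have [mT _] := @mp_Tc R.
have mi := mf_maxw rho i; have mj := mf_maxw rho j.
have mTf : measurable_fun setT (fun p : trip => (Tc p).1.1) by apply: mf_fst; exact: mf_fst.
have mJ : measurable_fun setT (fun p : trip => jump_min p.1.1 (Tc p).1.1).
  by apply: mf_jump_min mTf; mfv.
by mfv.
Qed.

Lemma DE_integrand_ge0 i j (p : trip) :
  0 <= kk B i j p * (jump_min p.1.1 (Tc p).1.1 * maxw rho i p.1.1 * maxw rho j p.1.2).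
Proof.
by rewrite mulr_ge0 ?kk_ge0// mulr_ge0 ?(ltW (maxw_gt0 _ _ _))// mulr_ge0 ?jump_min_ge0// ltW// maxw_gt0.
Qed.

Lemma DbE : Db rho B = fine (\big[mine/+oo]_(i < n) \big[mine/+oo]_(j < n) DE i j)%E.
Proof.
rewrite /Db; congr fine; apply: eq_bigr => i _; apply: eq_bigr => j _.
pose X (p : trip) : R := jump_min p.1.1 (vpost p.1.1 p.1.2 p.2) * maxw rho i p.1.1 * maxw rho j p.1.2.
have mi := mf_maxw rho i; have mj := mf_maxw rho j.
have mJ : measurable_fun setT (fun p : trip => jump_min p.1.1 (vpost p.1.1 p.1.2 p.2)).
  by apply: mf_jump_min; [mfv|exact: mf_vpost3].
have mX : measurable_fun setT X by rewrite /X; mfv.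
transitivity (\int[Pi3]_(p in setT `*` S2) (kern B i j p.1.1 p.1.2 p.2 * X p)%:E)%E.
  by apply: eq_integral => p _; rewrite /X /jump_min !mulrA.
apply: (etrans (kern_integral3 hB i j mX)); apply: eq_integral => p _; congr EFin.
rewrite /X /kk /Tc; case: (boolP (good p)) => gp; last by rewrite !mul0r.
by [].
Qed.

(** Weighted jumps of the three velocity components and of the energy in a collision. On a
    polynomial element S_ij is a linear combination of these four. *)
Definition jumpY i j (k : nat) (p : trip) : R :=
  skk B i j p * (smw rho i p.1.1 * smw rho j p.1.2) *
  nth 0 [:: ((Tc p).1.1 - p.1.1).1.1; ((Tc p).1.1 - p.1.1).1.2; ((Tc p).1.1 - p.1.1).2;
    enorm (Tc p).1.1 ^+ 2 - enorm p.1.1 ^+ 2] k.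

(** For distinct species the jump is S_ij of a polynomial element carried by species i alone, hence
    square integrable. *)
Lemma sqi_jumpY i j k : i != j -> sqi Pi3 (jumpY i j k).
Proof.
move=> ij.
have h al u e : sqi Pi3 (SS rho B i j (polyf rho al u e)).
  by apply: sqi_SS => //; exact: (polyf_Hsp hrho hB nufin K_gt0 nu_upper).
pose ev (l : nat) : vel R := ((((l == 0%N)%:R, (l == 1%N)%:R) : R * R), (l == 2)%:R).
pose u (l : 'I_n) : vel R := if l == i then ev k else 0.
pose e (l : 'I_n) : R := if l == i then (k == 3 :> nat)%:R else 0.
have -> : jumpY i j k = SS rho B i j (polyf rho (fun=> 0) u e).
  apply/funext => p; rewrite SS_polyf// /u /e eqxx eq_sym (negbTE ij) !subr0 /jumpY /ev /dot.
  clear u e ev; congr (_ * _); case: k => [|[|[|[|k]]]]/=; rewrite ?nth_nil; ring.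
exact: h.
Qed.

Lemma SS_jumpY al u e i j : SS rho B i j (polyf rho al u e) = fun p =>
  \sum_(k < 4) nth 0 [:: (u i - u j).1.1; (u i - u j).1.2; (u i - u j).2; e i - e j] k * jumpY i j k p.
Proof.
apply/funext => p; rewrite SS_polyf// !big_ord_recl big_ord0 /jumpY /dot/=.
move: (skk _ _ _ _) (smw _ _ _) (smw _ _ _) => a b' c.
move: (u i - u j) (e i - e j) ((Tc p).1.1 - p.1.1) (enorm (Tc p).1.1 ^+ 2 - enorm p.1.1 ^+ 2) => x y d E.
ring.
Qed.

Lemma jumpY_iso g i j k (sg : R) (p : trip) : lin_isometry g ->
  (forall q : trip, nth 0 [:: (g ((Tc q).1.1 - q.1.1)).1.1; (g ((Tc q).1.1 - q.1.1)).1.2; (g ((Tc q).1.1 - q.1.1)).2;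
    enorm (Tc q).1.1 ^+ 2 - enorm q.1.1 ^+ 2] k = sg *
   nth 0 [:: ((Tc q).1.1 - q.1.1).1.1; ((Tc q).1.1 - q.1.1).1.2; ((Tc q).1.1 - q.1.1).2;
    enorm (Tc q).1.1 ^+ 2 - enorm q.1.1 ^+ 2] k) ->
  jumpY i j k (iso3 g p) = sg * jumpY i j k p.
Proof.
move=> hg h; have e : (iso3 g (Tc p)).1.1 - (iso3 g p).1.1 = g ((Tc p).1.1 - p.1.1) by rewrite (iso_sub hg).
have en1 (q : trip) : enorm (iso3 g q).1.1 = enorm q.1.1 by exact: iso_enorm.
have en2 (q : trip) : enorm (iso3 g q).1.2 = enorm q.1.2 by exact: iso_enorm.
rewrite /jumpY /skk (kk_iso3 hg) (Tc_iso3 hg) e /smw !maxwE /unit_maxw !en1 en2 h.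
by move: (nth _ _ _) (Num.sqrt _) (Num.sqrt _) (Num.sqrt _) => x y z t; ring.
Qed.

Lemma jumpY_orth i j (k l : nat) : i != j -> k != l -> (k < 4)%N -> (l < 4)%N ->
  L2ip Pi3 (jumpY i j k) (jumpY i j l) = 0.
Proof.
move=> ij; have s k' := sqi_jumpY k' ij.
have h (a c : nat) : a != c -> (a < 3)%N -> L2ip Pi3 (jumpY i j a) (jumpY i j c) = 0.
  (* Reflections are numbered from 1, the components of the jump from 0. *)
  move=> ac a3; have hr := @refl_isometry R a.+1.
  apply: (L2ip_odd_even (mp_iso3 hr)); [exact: s|exact: s| |] => p.
    rewrite -mulN1r; apply: jumpY_iso => // q; rewrite /refl.
    by case: a a3 {ac hr} => [|[|[|a]]]//= _; rewrite expr1.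
  rewrite -[RHS]mul1r; apply: jumpY_iso => // q; rewrite mul1r /refl.
  by case: a c ac a3 {hr} => [|[|[|a]]] [|[|[|[|c]]]] //= _ _; rewrite ?expr0 ?mul1r ?nth_nil.
move=> kl k4 l4; have [k3|k3] := ltnP k 3; first exact: h.
rewrite L2ipC; apply: h; first by rewrite eq_sym.
by move: k3 kl k4 l4; case: k => [|[|[|[|k]]]]//; case: l => [|[|[|[|l]]]].
Qed.

Lemma jumpY_cyc i j k : (k < 2)%N -> i != j ->
  L2ip Pi3 (jumpY i j k) (jumpY i j k) = L2ip Pi3 (jumpY i j k.+1) (jumpY i j k.+1).
Proof.
move=> k2 ij; have s := sqi_jumpY k ij; have hc := @cyc_isometry R.
rewrite -(L2ip_mp (mp_iso3 hc) s.1 s.1).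
have e : (fun p => jumpY i j k (iso3 cyc p)) = jumpY i j k.+1; last by rewrite e.
apply/funext => p; rewrite /jumpY /skk (kk_iso3 hc) (Tc_iso3 hc) /smw !maxwE /unit_maxw /iso3/= !(iso_enorm hc).
by congr (_ * _); case: k k2 {s} => [|[|k]].
Qed.

Lemma jumpY_norm i j k : i != j -> (L2ip Pi3 (jumpY i j k) (jumpY i j k))%:E =
  (\int[Pi3]_p (kk B i j p * (nth 0 [:: ((Tc p).1.1 - p.1.1).1.1; ((Tc p).1.1 - p.1.1).1.2; ((Tc p).1.1 - p.1.1).2;
    enorm (Tc p).1.1 ^+ 2 - enorm p.1.1 ^+ 2] k ^+ 2 * maxw rho i p.1.1 * maxw rho j p.1.2))%:E)%E.
Proof.
move=> ij; apply: (etrans (L2ipE (sqi_jumpY k ij))); apply: eq_integral => p _; congr EFin.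
rewrite /jumpY -(smw_sqr hrho) -(smw_sqr hrho) -(skk_sqr hB).
move: (skk _ _ _ _) (smw _ _ _) (smw _ _ _) (nth _ _ _) => a c d e; ring.
Qed.

(** The cyclic permutation gives the three velocity jumps equal norms, each a third of the integral
    of |v' - v|^2: this is the factor 1/3 in D_b. The energy jump is the other entry of the
    minimum. *)
Lemma DE_le_jumpY i j k : i != j -> (k < 4)%N -> (DE i j <= (L2ip Pi3 (jumpY i j k) (jumpY i j k))%:E)%E.
Proof.
move=> ij k4.
have mk := mf_kk hB i j; have [mT _] := @mp_Tc R.
have mi := mf_maxw rho i; have mj := mf_maxw rho j.
have mTf : measurable_fun setT (fun p : trip => (Tc p).1.1) by apply: mf_fst; exact: mf_fst.
have [k3|k3] := ltnP k 3; last first.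
  have -> : k = 3 by apply/eqP; rewrite eqn_leq k3 -ltnS k4.
  apply: le_trans (le_eq (esym (jumpY_norm 3 ij))).
  apply: ge0_integral_mono; [exact: mf_DE|exact: DE_integrand_ge0|by rewrite /=; mfv|] => p.
  apply: ler_wpM2l; first exact: kk_ge0.
  apply: ler_wpM2r; first exact/ltW/maxw_gt0.
  apply: ler_wpM2r; first exact/ltW/maxw_gt0.
  by rewrite /jump_min ge_min lexx orbT.
have e : L2ip Pi3 (jumpY i j k) (jumpY i j k) = 3^-1 * (L2ip Pi3 (jumpY i j 0) (jumpY i j 0)
   + L2ip Pi3 (jumpY i j 1) (jumpY i j 1) + L2ip Pi3 (jumpY i j 2) (jumpY i j 2)).
  have e0 := @jumpY_cyc i j 0 isT ij; have e1 := @jumpY_cyc i j 1 isT ij.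
  rewrite -e1 -e0; have -> : L2ip Pi3 (jumpY i j k) (jumpY i j k) = L2ip Pi3 (jumpY i j 0) (jumpY i j 0).
    by case: k k3 {k4} => [|[|[|k]]] k3; [exact: erefl|exact: esym e0|exact: esym (etrans e0 e1)|].
  by move: (L2ip _ _ _) => x; field.
rewrite e EFinM !EFinD !(jumpY_norm _ ij).
pose F (l : nat) (p : trip) : R := kk B i j p * (nth 0 [:: ((Tc p).1.1 - p.1.1).1.1; ((Tc p).1.1 - p.1.1).1.2; ((Tc p).1.1 - p.1.1).2;
    enorm (Tc p).1.1 ^+ 2 - enorm p.1.1 ^+ 2] l ^+ 2 * maxw rho i p.1.1 * maxw rho j p.1.2).
have mF l : (l < 3)%N -> measurable_fun setT (F l).
  have mv : measurable_fun setT (fun p : trip => p.1.1) by mfv.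
  have mD := mf_addv mTf (mf_oppv mv).
  have mw : measurable_fun setT (fun p : trip => p.1.2) by mfv.
  have gen (u : trip -> R) : measurable_fun setT u -> measurable_fun setT
      (fun p => kk B i j p * (u p ^+ 2 * maxw rho i p.1.1 * maxw rho j p.1.2)).
    move=> mu; apply: measurable_funM; first exact: mf_kk hB i j.
    apply: measurable_funM.
      apply: measurable_funM; first exact: measurable_funX.
      exact: (measurableT_comp (mf_maxw rho i) mv).
    exact: (measurableT_comp (mf_maxw rho j) mw).
  case: l => [|[|[|l]]]// _; apply: gen; cbn [nth].
  - exact: mf_fst (mf_fst mD).
  - exact: mf_snd (mf_fst mD).
  - exact: mf_snd mD.
have F0 l p : 0 <= F l p.
  by rewrite /F mulr_ge0 ?kk_ge0// mulr_ge0 ?(ltW (maxw_gt0 _ _ _))// mulr_ge0 ?sqr_ge0// ltW// maxw_gt0.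
have m0 := mF 0%N isT; have m1 := mF 1%N isT; have m2 := mF 2 isT.
have m01 : measurable_fun setT (fun p => F 0%N p + F 1%N p) by exact: measurable_funD.
have F01 p : 0 <= F 0%N p + F 1%N p by exact: addr_ge0.
apply: (@le_trans _ _ (\int[Pi3]_p (3^-1 * (F 0%N p + F 1%N p + F 2 p))%:E)%E); last first.
  apply: le_eq; rewrite ge0_integral_scale.
  - congr (_ * _)%E; rewrite (ge0_integral_add _ m01 F01 m2 (F0 2)); congr (_ + _)%E.
    exact: (ge0_integral_add _ m0 (F0 0%N) m1 (F0 1%N)).
  - by rewrite invr_ge0.
  - exact: measurable_funD.
  - by move=> p; rewrite addr_ge0.
apply: ge0_integral_mono.
- exact: mf_DE.
- exact: DE_integrand_ge0.
- by apply: measurable_funM => //; exact: measurable_funD.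
move=> p; pose d := (Tc p).1.1 - p.1.1.
have -> : 3^-1 * (F 0%N p + F 1%N p + F 2 p) =
    kk B i j p * (3^-1 * (d.1.1 ^+ 2 + d.1.2 ^+ 2 + d.2 ^+ 2) * maxw rho i p.1.1 * maxw rho j p.1.2).
  have f0 : F 0%N p = kk B i j p * (d.1.1 ^+ 2 * maxw rho i p.1.1 * maxw rho j p.1.2) by [].
  have f1 : F 1%N p = kk B i j p * (d.1.2 ^+ 2 * maxw rho i p.1.1 * maxw rho j p.1.2) by [].
  have f2 : F 2 p = kk B i j p * (d.2 ^+ 2 * maxw rho i p.1.1 * maxw rho j p.1.2) by [].
  have h (l a1 a2 a3 x y : R) : 3^-1 * (l * (a1 * x * y) + l * (a2 * x * y) + l * (a3 * x * y)) =
    l * (3^-1 * (a1 + a2 + a3) * x * y) by ring.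
  by rewrite f0 f1 f2 h.
apply: ler_wpM2l; first exact: kk_ge0.
apply: ler_wpM2r; first exact/ltW/maxw_gt0.
apply: ler_wpM2r; first exact/ltW/maxw_gt0.
rewrite /jump_min ge_min; apply/orP; left.
by rewrite enormB -/d enorm_sqr /dot !expr2 div1r.
Qed.

(** Orthogonality of the four jumps turns the norm into a sum of four squares, each weighted by a
    norm at least D. *)
Lemma SS_polyf_ge al u e i j (D : R) : i != j -> 0 <= D -> (D%:E <= DE i j)%E ->
  D * (enorm (u i - u j) ^+ 2 + (e i - e j) ^+ 2) <=
  L2ip Pi3 (SS rho B i j (polyf rho al u e)) (SS rho B i j (polyf rho al u e)).
Proof.
move=> ij D0 hD; rewrite SS_jumpY L2ip_orth_sum; last 2 first.
- by move=> k; exact: sqi_jumpY.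
- by move=> k l kl; apply: jumpY_orth.
have h k : (k < 4)%N -> D <= L2ip Pi3 (jumpY i j k) (jumpY i j k).
  by move=> k4; rewrite -lee_fin; apply: (le_trans hD); exact: DE_le_jumpY.
rewrite !big_ord_recl big_ord0/= addr0 enorm_sqr /dot.
have h0 := ler_wpM2l (sqr_ge0 (u i - u j).1.1) (h 0%N isT).
have h1 := ler_wpM2l (sqr_ge0 (u i - u j).1.2) (h 1%N isT).
have h2 := ler_wpM2l (sqr_ge0 (u i - u j).2) (h 2 isT).
have h3 := ler_wpM2l (sqr_ge0 (e i - e j)) (h 3 isT).
have -> : D * ((u i - u j).1.1 * (u i - u j).1.1 + (u i - u j).1.2 * (u i - u j).1.2 +
    (u i - u j).2 * (u i - u j).2 + (e i - e j) ^+ 2) =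
  (u i - u j).1.1 ^+ 2 * D + ((u i - u j).1.2 ^+ 2 * D + ((u i - u j).2 ^+ 2 * D + (e i - e j) ^+ 2 * D)) by ring.
apply: lerD; first exact: h0.
apply: lerD; first exact: h1.
by apply: lerD; [exact: h2|exact: h3].
Qed.

Hypothesis hA2 : kernel_factor B Phi b.
Hypothesis Phi_gt0 : forall i j r, 0 < r -> 0 < Phi i j r.
Hypothesis b_gt0 : forall i j x, -1 < x < 1 -> x != 0 -> 0 < b i j x.

(** A zero integral would make the product of the two boxes and the cap a null set, since the
    integrand is positive on it. *)
Lemma DE_gt0 i j : (0 < DE i j)%E.
Proof.
have [mv mw ms] := @measurable_boxes R; have mc := @measurable_cap R.
rewrite lt_neqAle; apply/andP; split; last first.
  by apply: integral_ge0 => p _; rewrite lee_fin; exact: DE_integrand_ge0.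
apply/eqP => h0.
pose F (p : trip) : R := kk B i j p * (jump_min p.1.1 (Tc p).1.1 * maxw rho i p.1.1 * maxw rho j p.1.2).
have mF : measurable_fun setT (fun p => (F p)%:E) by apply/measurable_EFinP; exact: mf_DE.
have e : (\int[Pi3]_p `|(F p)%:E| = 0)%E.
  rewrite h0 /DE; apply: eq_integral => p _; rewrite gee0_abs// lee_fin; exact: DE_integrand_ge0.
have [N [mN N0 hN]] := (ae_eq_integral_abs Pi3 measurableT mF).1 e.
have sub : ((@box_v R `*` @box_w R) `*` @cap R) `<=` N.
  move=> [[v w] s] [[/= hv hw] hs]; apply: hN => /= /(_ I)[] F0.
  have [vw /andP[d1 d2] en] := collision_box hv hw hs.
  have gp : good (v, w, s) by rewrite /good/= vw/=; case: hs => ->.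
  have x1 := cosdev_le1 gp; have r0 : 0 < enorm (v - w) by rewrite enorm_gt0 subr_eq0.
  have k0 : 0 < kk B i j (v, w, s).
    have [p1 p2 p3] := hA2 i j; rewrite /kk gp /kern p3// mulr_gt0 ?Phi_gt0//.
    apply: b_gt0; rewrite /cosdev/=.
      by rewrite ltr_pdivlMr// ltr_pdivrMr// mul1r d2 andbT mulN1r (lt_trans _ d1)// oppr_lt0.
    by rewrite mulf_neq0 ?invr_eq0 ?gt_eqF.
  have j0 : 0 < jump_min v (vpost v w s).
    rewrite /jump_min lt_min; apply/andP; split; last first.
      by rewrite lt_neqAle sqr_ge0 andbT eq_sym sqrf_eq0 subr_eq0 lt_eqF.
    rewrite mulr_gt0// ?divr_gt0// exprn_gt0// enorm_gt0 subr_eq0.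
    by apply/eqP => h; move: en; rewrite -h ltxx.
  have := gt_eqF (mulr_gt0 k0 (mulr_gt0 (mulr_gt0 j0 (maxw_gt0 hrho i v)) (maxw_gt0 hrho j w))).
  by move: F0; rewrite /F /Tc gp /= => ->; rewrite eqxx.
have : (Pi3 ((@box_v R `*` @box_w R) `*` @cap R) <= 0)%E.
  rewrite -N0; apply: le_measure; rewrite ?inE//.
  by apply: measurableX => //; exact: measurableX.
have -> : (Pi3 ((@box_v R `*` @box_w R) `*` @cap R) = leb3 (@box_v R) * leb3 (@box_w R) * surf (@cap R))%E.
  apply: (etrans (sfprodE (sfprod leb3 leb3) surf (measurableX mv mw) mc)).
  by congr (_ * _)%E; exact: (sfprodE leb3 leb3 mv mw).
apply/negP; rewrite -ltNge; apply: mule_gt0; last exact: surf_cap_gt0.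
apply: mule_gt0.
- by apply: leb3_box_gt0; rewrite ?ltr01 ?ltr_nat.
- by apply: leb3_box_gt0; rewrite ltr01.
Qed.

Lemma Db_bounds : 0 < Db rho B /\ forall i j, ((Db rho B)%:E <= DE i j)%E.
Proof.
pose X : \bar R := (\big[mine/+oo]_(i < n) \big[mine/+oo]_(j < n) DE i j)%E.
have Xle i j : (X <= DE i j)%E.
  apply: (@le_trans _ _ (\big[mine/+oo]_(j < n) DE i j)%E); exact: bigmin_le_cond.
have X0 : (0 < X)%E.
  apply: lt_bigmin => // i _; apply: lt_bigmin => // j _; exact: DE_gt0.
(* Two distinct species are needed here: the minimum is shown finite through an off-diagonal entry,
   bounded by a jump norm. *)
have [i0 [j0 ij]] : exists i j : 'I_n, i != j.
  have n0 : (0 < n)%N by exact: ltn_trans hn.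
  by exists (Ordinal n0), (Ordinal hn).
have Xoo : (X < +oo)%E.
  apply: (le_lt_trans (Xle i0 j0)); apply: (le_lt_trans (DE_le_jumpY (k := 0) ij isT)); exact: ltry.
have Xfin : X \is a fin_num by rewrite ge0_fin_numE// ltW.
have e : Db rho B = fine X by exact: DbE.
rewrite e; split; first by rewrite -lte_fin fineK.
by move=> i j; rewrite fineK.
Qed.

End dissipation_constant.

(** * Explicit spectral gap *)

(** N stands for |f - p|_H^2 and S for the dispersion of the coefficients of p. With lambda = eta D
    / (8 Ck) the coefficients of S agree exactly. Those of N require eta D / (4 Ck) + 4 eta <= Cm,
    that is eta (16 Ck + D) <= 4 Cm Ck, which is the second entry of the minimum defining eta. *)
Lemma gap_algebra {R : realFieldType} (Cm Ck D N S Q bqf : R) :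
  0 < Cm -> 0 < Ck -> 0 < D -> 0 <= N -> 0 <= S ->
  let eta := Num.min 1 (4 * Cm * Ck / (16 * Ck + D)) in
  Q <= 2 * N + Ck * S ->
  Cm * N + eta * (2^-1 * (D / 4 * S) - 4 * N) <= bqf ->
  0 < eta * D / (8 * Ck) /\ eta * D / (8 * Ck) * Q <= bqf.
Proof.
move=> Cm0 Ck0 D0 N0 S0 eta hQ hb.
have den : 0 < 16 * Ck + D by rewrite addr_gt0// mulr_gt0.
have eta0 : 0 < eta by rewrite lt_min ltr01 divr_gt0// !mulr_gt0.
have h1 : eta * (16 * Ck + D) <= 4 * Cm * Ck by rewrite -ler_pdivlMr// ge_min lexx orbT.
have l0 : 0 < eta * D / (8 * Ck) by rewrite divr_gt0// mulr_gt0.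
split => //; move: (eta) h1 hb eta0 l0 => et {}h1 {}hb et0 l0.
apply: le_trans hb; apply: (le_trans (ler_wpM2l (ltW l0) hQ)).
have h2 : et * D / (4 * Ck) + 4 * et <= Cm.
  have -> : et * D / (4 * Ck) + 4 * et = et * (16 * Ck + D) / (4 * Ck) by field; rewrite gt_eqF.
  by rewrite ler_pdivrMr ?mulr_gt0// mulrCA mulrA.
have -> : et * D / (8 * Ck) * (2 * N + Ck * S) = et * D / (4 * Ck) * N + et * D * S / 8.
  by field; rewrite gt_eqF.
have -> : Cm * N + et * (2^-1 * (D / 4 * S) - 4 * N) = (Cm - 4 * et) * N + et * D * S / 8 by field.
by rewrite lerD2r ler_wpM2r// lerBrDr.
Qed.

Lemma L2ip_sub_le {R : realType} d (T : measurableType d) (m : {measure set T -> \bar R})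
    (a c : T -> R) : sqi m a -> sqi m c ->
  2^-1 * L2ip m (fun x => a x - c x) (fun x => a x - c x) - L2ip m c c <= L2ip m a a.
Proof.
move=> sa sc; have sac := sqiB sa sc.
have sac' := sqiD sa sc; have h := L2ip_ge0 m (fun x => a x + c x).
have e1 : L2ip m (fun x => a x + c x) (fun x => a x + c x) = L2ip m a a + 2 * L2ip m a c + L2ip m c c.
  by rewrite (L2ipDl sa sc sac') (L2ipDr sa sc sa) (L2ipDr sa sc sc) (L2ipC m c a); ring.
have -> : L2ip m (fun x => a x - c x) (fun x => a x - c x) = L2ip m a a - 2 * L2ip m a c + L2ip m c c.
  by rewrite (L2ipBl sa sc sac) (L2ipBr sa sc sa) (L2ipBr sa sc sc) (L2ipC m c a); ring.
by move: h; rewrite e1; move: (L2ip m a a) (L2ip m a c) (L2ip m c c) => x y z; lra.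
Qed.

Section explicit_gap.
Context {R : realType} {n : nat}.
Local Notation trip := (vel R * vel R * vel R)%type.
Variables (rho : 'I_n -> R) (B : 'I_n -> 'I_n -> R -> R -> R).
Hypotheses (hrho : forall i, 0 < rho i) (hB : collision_kernel B) (hS : kernel_sym B).
Hypothesis nufin : forall i j v, (nuE rho B i j v < +oo)%E.
Variables c0 K : R.
Hypotheses (c0_gt0 : 0 < c0) (nu_lower : forall i v, c0 <= nu rho B i v).
Hypotheses (K_gt0 : 0 < K) (nu_upper : forall i j v, (nuE rho B i j v <= (K * (1 + enorm v))%:E)%E).
Hypothesis cA : forall i j, cross_cpt (WA rho B i j) (@Sw R).
Hypothesis cB : forall i j, cross_cpt (WB rho B i j) (@Tc R).
Hypothesis cC : forall i j, cross_cpt (WC rho B i j) (@ScTc R).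
Hypothesis hn : (2 <= n)%N.
Variables (beta lm D : R).
Hypotheses (beta_gt0 : 0 < beta) (hbeta : diag_control B beta).
Hypotheses (lm_gt0 : 0 < lm) (hlm : mono_spectral_gap rho B lm).
Hypotheses (D_gt0 : 0 < D) (hD : forall i j, (D%:E <= DE rho B i j)%E).
Variable psi : 'I_(5 * n) -> 'I_n -> vel R -> R.
Hypothesis hpsi : orthonormal_basis (nullspace rho B (Lmono rho B)) psi.
Implicit Types (i j : 'I_n) (f g : 'I_n -> vel R -> R) (u : 'I_n -> vel R) (al e : 'I_n -> R).
Local Notation E := ('I_n -> vel R -> R^o).
Local Notation SS := (SS rho B).
Local Notation Hsp := (Hsp rho B).
Local Notation nuip := (nuip rho B).
Local Notation bq := (bq rho B).
Local Notation Nm := (nullspace rho B (Lmono rho B)).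
Local Notation NL := (nullspace rho B (Lop rho B)).

Let ipS := semi_inner_ip hrho hB c0_gt0 nu_lower.
Let nuS := semi_inner_nuip hrho hB.
Let hspD := HspD hrho hB.
Let hspZ := HspZ hrho hB.
Let hsp0 := Hsp0 hrho hB.

Lemma hspB f g : Hsp f -> Hsp g -> Hsp (f - g).
Proof. exact: (DB (E := E) hspD hspZ). Qed.

Lemma rho_tot_gt0 : 0 < rho_tot rho.
Proof.
have n0 : (0 < n)%N by exact: ltn_trans hn.
exact: lt_le_trans (hrho (Ordinal n0)) (rho_le_tot hrho _).
Qed.

(** The diagonal control gives nu_ij <= beta (rho_j / rho_i) nu_ii. Summing over j, nu_i <= beta
    (rho_tot / rho_i) nu_ii, whence the denominator beta rho_tot in C^m. *)
Lemma nu_diag_control i v :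
  lm / (beta * rho_tot rho) * nu rho B i v <= lm / rho i * nu_ij rho B i i v.
Proof.
have r0 := rho_tot_gt0; have ri := hrho i.
have h j : nu_ij rho B i j v <= beta * (rho j / rho i) * nu_ij rho B i i v.
  have c_ge0 : 0 <= beta * (rho j / rho i) by rewrite mulr_ge0 ?divr_ge0// ltW.
  rewrite -lee_fin EFinM -!(nuEE hrho hB nufin) /nuE.
  have mi := mf_maxw rho i; have mj := mf_maxw rho j.
  have mki := mf_kk hB i i; have mkj := mf_kk hB i j.
  rewrite -ge0_integral_scale//; last 2 first.
  - by mfv.
  - by move=> q; rewrite mulr_ge0 ?kk_ge0//; exact/ltW/maxw_gt0.
  apply: ge0_integral_mono; [by mfv| |by mfv|].
    by move=> q; rewrite mulr_ge0 ?kk_ge0//; exact/ltW/maxw_gt0.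
  move=> q; rewrite !maxwE.
  have -> : beta * (rho j / rho i) * (kk B i i (v, q.1, q.2) * (rho i * unit_maxw q.1)) =
     beta * kk B i i (v, q.1, q.2) * (rho j * unit_maxw q.1) by field; rewrite gt_eqF.
  apply: ler_wpM2r; first by rewrite mulr_ge0 ?(ltW (hrho j))//; exact/ltW/unit_maxw_gt0.
  rewrite /kk; case: (boolP (good _)) => gp; last by rewrite mulr0.
  rewrite /kern; apply: hbeta; last exact: cosdev_le1.
  by rewrite enorm_gt0 subr_eq0; case/andP: gp.
have h2 : nu rho B i v <= beta * rho_tot rho / rho i * nu_ij rho B i i v.
  rewrite /nu; apply: (le_trans (ler_sum _ (fun j _ => h j))).
  rewrite -mulr_suml -mulr_sumr -mulr_suml -/(rho_tot rho) mulrA //.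
have l0 : 0 <= lm / (beta * rho_tot rho) by rewrite divr_ge0 ?mulr_ge0// ltW.
apply: (le_trans (ler_wpM2l l0 h2)); rewrite mulrA le_eqVlt; apply/orP; left; apply/eqP.
by congr (_ * _); field; rewrite !gt_eqF.
Qed.

(** [orth_proj] is only a chosen representative. The projection is built from psi, each [psi k]
    being replaced by the polynomial element equal to it almost everywhere; uniqueness up to null
    sets then links it to the chosen one. *)
Lemma mono_projection f : Hsp f -> exists al u e,
  let p := polyf rho al u e in [/\ forall h, Nm h -> ip (f - p) h = 0, Nm (orth_proj Nm f) & ae_eqv p (orth_proj Nm f)].
Proof.
move=> hf; have hP := psi_Hsp hrho hB hpsi; have [np op _] := hpsi.
have [ipC ipD ipZ _] := ipS.
have pex k := mono_is_polyf hrho hB hS nufin c0_gt0 nu_lower K_gt0 nu_upper hpsi erefl (np k).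
have exP k : exists P : E, is_polyf rho P /\ ae_eqv (psi k) P.
  by have [g pg eg] := pex k; exists g.
have [P hPP] := choice exP.
have hspP g : is_polyf rho g -> Hsp g.
  by move=> [al [u [e ->]]]; exact: (polyf_Hsp hrho hB nufin K_gt0 nu_upper).
have mm g : Hsp g -> forall i, measurable_fun setT (g i) by move=> hg i; exact: (hg i).1.
have hPk k : Hsp (P k) := hspP _ (hPP k).1.
pose p : E := \sum_k ip f (psi k) *: P k.
have pp : is_polyf rho p by apply: is_polyf_sum => k; apply: is_polyfZ; exact: (hPP k).1.
have hp := hspP _ pp.
have orthk l : ip (f - p) (psi l) = 0.
  rewrite (semi_innerB (E := E) hspZ ipS hf hp (hP l)).
  have hk k : Hsp (ip f (psi k) *: P k) := hspZ _ (hPk k).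
  rewrite (semi_inner_suml (E := E) hsp0 hspD ipS _ hk (hP l)) (bigD1 l)//= [X in - (_ + X)]big1 => [|k kl].
    rewrite (ipZ _ _ _ (hPk l) (hP l)) -(ae_ip (mm _ (hP l)) (mm _ (hPk l)) (mm _ (hP l)) (hPP l).2).
    by rewrite op eqxx mulr1 addr0 subrr.
  rewrite (ipZ _ _ _ (hPk k) (hP l)) -(ae_ip (mm _ (hP k)) (mm _ (hPk k)) (mm _ (hP l)) (hPP k).2).
  by rewrite op (negbTE kl) mulr0.
have orth h : Nm h -> ip (f - p) h = 0.
  move=> nh; have [c [hS' ec _ _]] := psi_expand hrho hB c0_gt0 nu_lower hpsi nh.
  have hh := mono_Hsp hrho hB nh; have hfp := hspB hf hp.
  have hc k : Hsp (c k *: (psi k : E)) := hspZ _ (hP k).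
  rewrite (ipC _ _ hfp hh) (ae_ip (mm _ hh) (mm _ hS') (mm _ hfp) ec).
  rewrite (semi_inner_suml (E := E) hsp0 hspD ipS _ hc hfp); apply: big1 => k _.
  by rewrite (ipZ _ _ _ (hP k) hfp) (ipC _ _ (hP k) hfp) orthk mulr0.
have npp : Nm p.
  by have [al [u [e ->]]] := pp; exact: (polyf_nullspace_mono hrho hB hS nufin K_gt0 nu_upper).
have [nr hr] : Nm (orth_proj Nm f) /\ forall h, Nm h -> ip (f - orth_proj Nm f) h = 0.
  apply: (@getPex _ [set g | Nm g /\ forall h, Nm h -> ip (f - g) h = 0]); by exists p.
set r := orth_proj Nm f in nr hr *.
have hr' := mono_Hsp hrho hB nr.
have [al [u [e pE]]] := pp; exists al, u, e; rewrite -pE; split => //.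
have hpr := hspB hp hr'.
have d0 h : Nm h -> ip (p - r) h = 0.
  move=> nh; have hh := mono_Hsp hrho hB nh.
  have := hr h nh; have := orth h nh.
  rewrite !(semi_innerB (E := E) hspZ ipS _ _ hh)//.
  by move: (ip f h) (ip p h) (ip r h) => x y z; lra.
have z0 : ip (p - r) (p - r) = 0.
  rewrite (ipC _ _ hpr hpr) (semi_innerB (E := E) hspZ ipS hp hr' hpr).
  by rewrite (ipC _ _ hp hpr) (ipC _ _ hr' hpr) !d0// subrr.
move=> i; apply: filterS (ip0_ae hrho hB c0_gt0 nu_lower hpr z0 i) => v.
by rewrite -[(p - r) i v]/(p i v - r i v) => /eqP; rewrite subr_eq0 => /eqP.
Qed.

(** The mono-species gap is stated with nu_ii and the chosen projection; [nu_diag_control] brings in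
    the full frequency, and p replaces the projection almost everywhere. *)
Lemma mono_gap_le f p i : domL rho B f -> Hsp p -> Nm (orth_proj Nm f) -> ae_eqv p (orth_proj Nm f) ->
  lm / (beta * rho_tot rho) * L2ip leb3 (nuw rho B (f - p) i) (nuw rho B (f - p) i) <=
  4^-1 * L2ip Pi3 (SS i i f) (SS i i f).
Proof.
move=> df hp nr ep; have hf := domL_Hsp hrho hB df.
have mn := mf_nu_ij hrho hB i i; have mnu := mf_nu hrho hB i.
have mfi := (hf i).1; have mpi := (hp i).1.
have g1 : (fun v => nu_ij rho B i i v * f i v) \in Lfun leb3 2%:E.
  apply/Lfun2P; split; first by mfv.
  have h : (\int[leb3]_v ((f i v) ^+ 2 * (nu rho B i v) ^+ 2)%:E < +oo)%E.
    move: df.2; rewrite (bigD1 i)//=; apply: le_lt_trans; rewrite leeDl//.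
    by apply: sume_ge0 => k _; apply: integral_ge0 => v _; rewrite lee_fin mulr_ge0 ?sqr_ge0.
  apply: le_lt_trans h; apply: ge0_integral_mono; [by mfv|by move=> v; exact: sqr_ge0|by mfv|].
  move=> v; rewrite exprMn mulrC ler_wpM2l ?sqr_ge0// lerXn2r ?nnegrE ?nu_ij_ge0 ?nu_ge0//.
  exact: nu_ij_le.
have := @hlm i f df.1 g1.
have lr : 0 <= lm / rho i by rewrite divr_ge0// ltW.
have e1 : ((lm / (beta * rho_tot rho) * L2ip leb3 (nuw rho B (f - p) i) (nuw rho B (f - p) i))%:E <=
   (lm / rho i)%:E * \int[leb3]_v ((f i v - p i v) ^+ 2 * nu_ij rho B i i v)%:E)%E.
  have cm : 0 <= lm / (beta * rho_tot rho) by rewrite divr_ge0 ?mulr_ge0 ?(ltW rho_tot_gt0)// ltW.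
  rewrite EFinM L2ipE; last exact: (Hsp_sqi hrho hB i (hspB hf hp)).
  rewrite -!ge0_integral_scale//.
  - apply: ge0_integral_mono.
    + by have := (Hsp_sqi hrho hB i (hspB hf hp)).1 => h; mfv.
    + by move=> v; rewrite mulr_ge0 ?sqr_ge0.
    + by mfv.
    + move=> v; rewrite nuw_sqr// mulrCA [leRHS]mulrCA; apply: ler_wpM2l; first exact: sqr_ge0.
      exact: nu_diag_control.
  - by mfv.
  - by move=> v; rewrite mulr_ge0 ?sqr_ge0// nu_ij_ge0.
  - by have := (Hsp_sqi hrho hB i (hspB hf hp)).1 => h; mfv.
  - by move=> v; exact: sqr_ge0.
move=> h; rewrite -lee_fin; apply: (le_trans e1).
have e2 : (\int[leb3]_v ((f i v - p i v) ^+ 2 * nu_ij rho B i i v)%:E =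
   \int[leb3]_v ((f i v - orth_proj Nm f i v) ^+ 2 * nu_ij rho B i i v)%:E)%E.
  have mr := (mono_Hsp hrho hB nr i).1.
  apply: ae_eq_integral => //; [by mfv|by mfv|].
  by apply: filterS (ep i) => v -> _.
rewrite e2; apply: (le_trans h); rewrite div1r EFinM.
pose X (q : trip) : R := (hfun rho i (f i) (vpost q.1.1 q.1.2 q.2) + hfun rho i (f i) (vpost_star q.1.1 q.1.2 q.2)
    - hfun rho i (f i) q.1.1 - hfun rho i (f i) q.1.2) ^+ 2 * maxw rho i q.1.1 * maxw rho i q.1.2.
have mX : measurable_fun setT X.
  have mh := mf_hfun rho i mfi; have mM := mf_maxw rho i.
  have m1 : measurable_fun setT (fun q : trip => vpost q.1.1 q.1.2 q.2) by exact: mf_vpost3.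
  have m2 : measurable_fun setT (fun q : trip => vpost_star q.1.1 q.1.2 q.2) by exact: mf_vstar3.
  have m3 := measurableT_comp mh m1; have m4 := measurableT_comp mh m2.
  have m5 : measurable_fun setT (fun q : trip => q.1.1) by mfv.
  have m6 : measurable_fun setT (fun q : trip => q.1.2) by mfv.
  apply: measurable_funM; last exact: (measurableT_comp mM m6).
  apply: measurable_funM; last exact: (measurableT_comp mM m5).
  apply: measurable_funX; apply: measurable_funB; last exact: (measurableT_comp mh m6).
  apply: measurable_funB; last exact: (measurableT_comp mh m5).
  by apply: measurable_funD; [exact: m3|exact: m4].
apply: lee_wpmul2l; first by rewrite lee_fin invr_ge0.
apply: le_eq; transitivity (\int[Pi3]_(q in setT `*` S2) (kern B i i q.1.1 q.1.2 q.2 * X q)%:E)%E.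
  by apply: eq_integral => q _; rewrite /X !mulrA.
apply: (etrans (kern_integral3 hB i i mX)).
apply: (etrans _ (esym (L2ipE (sqi_SS hrho hB nufin i i hf)))); apply: eq_integral => q _; congr EFin.
rewrite SSE// exprMn exprMn (skk_sqr hB) exprMn !(smw_sqr hrho) /X /kk.
case: (boolP (good q)) => gq; last by rewrite !mul0r.
rewrite /Tc gq /Tc0/=; move: (kern _ _ _ _ _ _) (maxw _ _ _) (maxw _ _ _) (_ ^+ 2) => a c d e; ring.
Qed.

(* The mono-species part keeps a factor 1 - eta, while
   |S p|^2 / 2 - |S (f - p)|^2 <= |S f|^2 is used on the bi-species part, weighted
   by eta. *)
Lemma bq_lower f p (eta : R) : Hsp f -> Hsp p -> 0 <= eta -> eta <= 1 ->
  (forall i, L2ip Pi3 (SS i i p) (SS i i p) = 0) ->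
  4^-1 * \sum_i L2ip Pi3 (SS i i f) (SS i i f) + eta * (2^-1 * bq p p - 4 * nuip (f - p) (f - p)) <= bq f f.
Proof.
move=> hf hp e0 e1 hpp; have hg := hspB hf hp.
have hfull : 4^-1 * \sum_i L2ip Pi3 (SS i i f) (SS i i f)
    + eta * (2^-1 * bq p p - bq (f - p) (f - p)) <= bq f f.
  have -> : 4^-1 * \sum_i L2ip Pi3 (SS i i f) (SS i i f) + eta * (2^-1 * bq p p - bq (f - p) (f - p)) =
    4^-1 * \sum_i \sum_j ((i == j)%:R * L2ip Pi3 (SS i i f) (SS i i f) +
      eta * (2^-1 * L2ip Pi3 (SS i j p) (SS i j p) - L2ip Pi3 (SS i j (f - p)) (SS i j (f - p)))).
    rewrite /bq.
    have hdiag : \sum_i \sum_j (i == j)%:R * L2ip Pi3 (SS i i f) (SS i i f) = \sum_i L2ip Pi3 (SS i i f) (SS i i f).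
      apply: eq_bigr => i _; rewrite (bigD1 i)//= eqxx mul1r big1 ?addr0// => j ji.
      by rewrite eq_sym (negbTE ji) mul0r.
    under [in RHS]eq_bigr do rewrite big_split/= -mulr_sumr sumrB -mulr_sumr.
    rewrite [in RHS]big_split/= -mulr_sumr sumrB -mulr_sumr hdiag.
    by rewrite [in RHS]mulrDr; congr (_ + _); rewrite [in RHS]mulrCA [2^-1 * (_ * _)]mulrCA -mulrBr.
  rewrite /bq; apply: ler_wpM2l; first by rewrite invr_ge0.
  apply: ler_sum => i _; apply: ler_sum => j _.
  have b0 : 0 <= L2ip Pi3 (SS i j f) (SS i j f) := L2ip_ge0 _ _.
  have g0 : 0 <= L2ip Pi3 (SS i j (f - p)) (SS i j (f - p)) := L2ip_ge0 _ _.
  case: (eqVneq i j) => [eij|ij].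
    rewrite -eij mul1r hpp mulr0 sub0r mulrN -[leRHS]subr0 lerD2l lerN2.
    by apply: mulr_ge0 e0 _; exact: L2ip_ge0.
  rewrite mul0r add0r.
  have h := L2ip_sub_le (sqi_SS hrho hB nufin i j hf) (sqi_SS hrho hB nufin i j hg).
  have e : SS i j p = fun q => SS i j f q - SS i j (f - p) q.
    apply/funext => q; have := SSD rho B i j (f - p) p; rewrite subrK => /(congr1 (fun F => F q)) ->.
    by rewrite addrAC subrr add0r.
  rewrite -e in h; apply: (@le_trans _ _ (eta * L2ip Pi3 (SS i j f) (SS i j f))).
    exact: ler_wpM2l.
  by rewrite ler_piMl.
apply: le_trans hfull; rewrite lerD2l; apply: ler_wpM2l => //.
by apply: lerB => //; exact: (bq_le hrho hB nufin hg).
Qed.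

Definition disp u e : R := \sum_i \sum_j (enorm (u i - u j) ^+ 2 + (e i - e j) ^+ 2).

Lemma disp_ge0 u e : 0 <= disp u e.
Proof. by apply: sumr_ge0 => i _; apply: sumr_ge0 => j _; rewrite addr_ge0 ?sqr_ge0. Qed.

Lemma bq_polyf_ge al u e : D / 4 * disp u e <= bq (polyf rho al u e) (polyf rho al u e).
Proof.
rewrite /bq mulrAC [leLHS]mulrC; apply: ler_wpM2l; first by rewrite invr_ge0.
rewrite /disp mulr_sumr; apply: ler_sum => i _; rewrite mulr_sumr; apply: ler_sum => j _.
case: (eqVneq i j) => [<-|ij]; last first.
  exact: (SS_polyf_ge hrho hB hS nufin K_gt0 nu_upper al u e ij (ltW D_gt0) (hD i j)).
by rewrite !subrr enorm0 expr0n addr0 mulr0; exact: L2ip_ge0.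
Qed.

Lemma ip_polyf_le u e : ip (polyf rho (fun=> 0) u e) (polyf rho (fun=> 0) u e) <=
  24 * \sum_i rho i * (enorm (u i) ^+ 2 + e i ^+ 2).
Proof.
rewrite mulr_sumr; apply: ler_sum => i _; rewrite mulrCA.
have s : sqi leb3 (fun v => smw0 v * (dot (u i) v + e i * enorm v ^+ 2)).
  apply: (sqi_weighted (A := `|0| + enorm (u i) + `|e i|)); first by mfv.
  move=> v; have := poly_le 0 (e i) (u i) v; rewrite add0r => /le_trans; apply.
  apply: ler_wpM2l; first by rewrite !addr_ge0 ?enorm_ge0.
  by rewrite ler_eXnr// lerDl sqr_ge0.
have -> : \int[leb3]_v (polyf rho (fun=> 0) u e i v * polyf rho (fun=> 0) u e i v) =
    rho i * L2ip leb3 (fun v => smw0 v * (dot (u i) v + e i * enorm v ^+ 2))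
      (fun v => smw0 v * (dot (u i) v + e i * enorm v ^+ 2)).
  rewrite /L2ip -RintegralZR; last exact: sqi_mul.
  apply: eq_Rintegral => v _; rewrite /polyf smwE// add0r -[X in X * _ = _]/(_ * _).
  have := sqr_sqrtr (ltW (hrho i)); move: (Num.sqrt (rho i)) => t t2; rewrite -t2; ring.
by apply: ler_wpM2l; [exact: ltW|exact: bas_quad_norm].
Qed.

(* The kernel of L contains the elements whose velocity and energy coefficients
   are those of a single species k; averaging over k with weights
   rho_k / rho_tot bounds the distance of p to the kernel. *)
Lemma ip_proj_le f al u e P : let p := polyf rho al u e in Hsp f ->
  (forall h, Nm h -> ip (f - p) h = 0) -> NL P -> (forall h, NL h -> ip (f - P) h = 0) ->
  ip (p - P) (p - P) <= 6 * rho_tot rho * disp u e.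
Proof.
move=> p hf hp NP hP; have [ipC _ _ ip0] := ipS.
have hspp : Hsp p := polyf_Hsp hrho hB nufin K_gt0 nu_upper al u e.
have hNL h : NL h -> Hsp h by move=> nh; exact: (mono_Hsp hrho hB (nullspace_Lop_sub hrho hB hS nufin nh)).
have hspP := hNL _ NP; have hx := hspB hspp hspP.
have orth h : NL h -> ip (p - P) h = 0.
  move=> nh; have hh := hNL _ nh.
  have := hP h nh; have := hp h (nullspace_Lop_sub hrho hB hS nufin nh).
  rewrite !(semi_innerB (E := E) hspZ ipS _ _ hh)//.
  by move: (ip f h) (ip p h) (ip P h) => x y z; lra.
have hi0 i0 : ip (p - P) (p - P) <= 24 * \sum_i rho i * (enorm (u i - u i0) ^+ 2 + (e i - e i0) ^+ 2).
  pose q := polyf rho al (fun=> u i0) (fun=> e i0).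
  have nq : NL q := polyf_nullspace hrho hB hS nufin K_gt0 nu_upper al (u i0) (e i0).
  have hq := hNL _ nq; have hPq := hspB hspP hq.
  have e1 : p - q = polyf rho (fun=> 0) (fun i => u i - u i0) (fun i => e i - e i0).
    apply/funext => i; apply/funext => v; rewrite -[LHS]/(p i v - q i v) /p /q /polyf dotDl dotNl; ring.
  apply: le_trans (ip_polyf_le _ _); rewrite -e1.
  have -> : p - q = (p - P) + (P - q) by rewrite addrA subrK.
  rewrite (semi_innerDD (E := E) hspD ipS hx hPq).
  have -> : ip (p - P) (P - q) = 0.
    rewrite (ipC _ _ hx hPq) (semi_innerB (E := E) hspZ ipS hspP hq hx).
    by rewrite (ipC _ _ hspP hx) (ipC _ _ hq hx) !orth// subrr.
  by rewrite mulr0 addr0 lerDl; exact: ip0.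
have r0 := rho_tot_gt0.
rewrite -(ler_pM2l r0) {1}/rho_tot mulr_suml.
apply: (@le_trans _ _ (\sum_i0 rho i0 * (24 * \sum_i rho i * (enorm (u i - u i0) ^+ 2 + (e i - e i0) ^+ 2)))).
  by apply: ler_sum => i0 _; apply: ler_wpM2l; [exact: ltW|exact: hi0].
have -> : rho_tot rho * (6 * rho_tot rho * disp u e) = \sum_i0 \sum_i (6 * rho_tot rho ^+ 2 * (enorm (u i0 - u i) ^+ 2 + (e i0 - e i) ^+ 2)).
  have -> : rho_tot rho * (6 * rho_tot rho * disp u e) = 6 * rho_tot rho ^+ 2 * disp u e by ring.
  by rewrite /disp mulr_sumr; apply: eq_bigr => i0 _; rewrite mulr_sumr.
apply: ler_sum => i0 _; rewrite mulrA mulr_sumr; apply: ler_sum => i _.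
rewrite mulrA enormB -(sqrrN (e i - e i0)) opprB.
have X0 : 0 <= enorm (u i0 - u i) ^+ 2 + (e i0 - e i) ^+ 2 by rewrite addr_ge0 ?sqr_ge0.
(* For distinct species 24 rho_i rho_k <= 6 (rho_i + rho_k)^2 <= 6 rho_tot^2; equal species
   contribute 0. *)
case: (eqVneq i0 i) => [->|ii]; first by rewrite !subrr enorm0 expr0n addr0 !mulr0.
apply: ler_wpM2r => //.
have h1 : rho i0 + rho i <= rho_tot rho.
  rewrite /rho_tot (bigD1 i0)//= lerD2l (bigD1 i) ?(eq_sym i)//= lerDl sumr_ge0// => k _; exact: ltW.
have p0 := ltW (hrho i0); have p1 := ltW (hrho i).
have h2 : (rho i0 + rho i) ^+ 2 <= rho_tot rho ^+ 2 by rewrite lerXn2r ?nnegrE ?addr_ge0// ltW.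
move: h2; have := sqr_ge0 (rho i0 - rho i); rewrite sqrrB sqrrD.
by move: (rho i0) (rho i) (rho_tot rho ^+ 2) => x y z; nra.
Qed.

Let M : R := \big[Num.max/0]_(k < 5 * n) \big[Num.max/0]_(l < 5 * n)
    `| \sum_i \int[leb3]_v (psi k i v * psi l i v * nu rho B i v) |.

Lemma nuip_psi k l : nuip (psi k) (psi l) = \sum_i \int[leb3]_v (psi k i v * psi l i v * nu rho B i v).
Proof.
apply: eq_bigr => i _; apply: eq_Rintegral => v _; rewrite /nuw mulrACA -expr2 sqr_sqrtr//.
exact: nu_ge0.
Qed.

Lemma gram_le k l : `|nuip (psi k) (psi l)| <= M.
Proof.
rewrite nuip_psi /M; apply: (le_trans _ (le_bigmax _ _ k)).
exact: (le_bigmax _ (fun l => `| \sum_i \int[leb3]_v (psi k i v * psi l i v * nu rho B i v) |) l).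
Qed.

Lemma M_gt0 : 0 < M.
Proof.
have n0 : (0 < 5 * n)%N by rewrite muln_gt0; exact: ltn_trans hn.
pose k := Ordinal n0; apply: lt_le_trans (gram_le k k).
have [_ op _] := hpsi; have hk := psi_Hsp hrho hB hpsi k.
have := ip_nuip hrho hB c0_gt0 nu_lower hk; rewrite op eqxx mulr1 => h.
by apply: (lt_le_trans c0_gt0); apply: (le_trans h); exact: ler_norm.
Qed.

Lemma explicit_spectral_gap :
  let Cm := lm / (beta * rho_tot rho) in let C_k := Ck rho B psi in
  let eta := Num.min 1 (4 * Cm * C_k / (16 * C_k + D)) in
  let lam := eta * D / (8 * C_k) in
  0 < lam /\ spectral_gap rho B lam.
Proof.
move=> Cm C_k eta lam; have r0 := rho_tot_gt0; have M0 := M_gt0.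
have Cm0 : 0 < Cm by rewrite divr_gt0// mulr_gt0.
have n0 : 0 < n%:R :> R by rewrite ltr0n; exact: ltn_trans hn.
have CkE : C_k = 60 * n%:R * rho_tot rho * M by [].
have Ck0 : 0 < C_k by rewrite CkE mulr_gt0// mulr_gt0// mulr_gt0.
have alg := gap_algebra Cm0 Ck0 D_gt0.
(* Positivity does not depend on f and is read off from [gap_algebra] with all quantities equal to
   0. *)
have lam0 : 0 < lam.
  have h1 : 0 <= 2 * (0 : R) + C_k * 0 by rewrite !mulr0 addr0.
  have h2 : Cm * 0 + eta * (2^-1 * (D / 4 * 0) - 4 * 0) <= 0 by rewrite !mulr0 subrr mulr0 addr0.
  by have [h _] := alg 0 0 0 0 (lexx _) (lexx _) h1 h2.
split => // f df; have hf := domL_Hsp hrho hB df.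
have [NP hP] := orth_proj_LopP hrho hB hS nufin c0_gt0 nu_lower cA cB cC hf.
set P := orth_proj NL f in NP hP *.
have [al [u [e [hp nr ep]]]] := mono_projection hf.
set p := polyf rho al u e in hp ep.
have hspp : Hsp p := polyf_Hsp hrho hB nufin K_gt0 nu_upper al u e.
have NPm : Nm P := nullspace_Lop_sub hrho hB hS nufin NP.
have hspP := mono_Hsp hrho hB NPm.
rewrite (normH2E hrho hB (hspB hf hspP)) -EFinM lee_fin (ip_Lop hrho hB hS nufin hf hf) opprK.
have hg := hspB hf hspp; have hx := hspB hspp hspP.
have [_ _ _ nu0] := nuS.
have den : 0 < 16 * C_k + D by rewrite addr_gt0// mulr_gt0.
have num0 : 0 < 4 * Cm * C_k by rewrite mulr_gt0// mulr_gt0.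
have eta0 : 0 <= eta by rewrite le_min ler01/=; apply: divr_ge0; exact: ltW.
have eta1 : eta <= 1 by rewrite ge_min lexx.
have SSp i : L2ip Pi3 (SS i i p) (SS i i p) = 0 by exact: SS_polyf0.
have hQ : nuip (f - P) (f - P) <= 2 * nuip (f - p) (f - p) + C_k * disp u e.
  apply: (le_trans (semi_inner_triangle (E := E) hspD hspZ nuS hf hspp hspP)); rewrite lerD2l.
  (* P is only a representative; its polynomial version P' makes p - P' a polynomial element, hence
     a null vector of L^m to which [gram_bound] applies. *)
  have [P' pP' eP'] := mono_is_polyf hrho hB hS nufin c0_gt0 nu_lower K_gt0 nu_upper hpsi erefl NPm.
  have pp : is_polyf rho p by exists al, u, e.
  have hP' : Hsp P' by have [a' [u' [e' ->]]] := pP'; exact: (polyf_Hsp hrho hB nufin K_gt0 nu_upper).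
  have px : is_polyf rho (p - P').
    by apply: is_polyfD => //; rewrite -scaleN1r; exact: (is_polyfZ (-1) pP').
  have nx : Nm (p - P').
    by have [a' [u' [e' ->]]] := px; exact: (polyf_nullspace_mono hrho hB hS nufin K_gt0 nu_upper).
  have ex : ae_eqv (p - P) (p - P').
    move=> i; apply: filterS (eP' i) => v h.
    by rewrite -[LHS]/(p i v - P i v) -[RHS]/(p i v - P' i v) h.
  have hx' := hspB hspp hP'.
  have mm g : Hsp g -> forall i, measurable_fun setT (g i) by move=> hgg i; exact: (hgg i).1.
  have [ipC _ _ _] := ipS.
  have ipx : ip (p - P') (p - P') = ip (p - P) (p - P).
    rewrite -(ae_ip (mm _ hx) (mm _ hx') (mm _ hx') ex) (ipC _ _ hx hx').
    by rewrite -(ae_ip (mm _ hx) (mm _ hx') (mm _ hx) ex).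
  rewrite (ae_nuip hrho hB hx hx' ex).
  have h1 := gram_bound hrho hB c0_gt0 nu_lower hpsi gram_le nx.
  have h2 := ip_proj_le hf hp NP hP; rewrite -/p -ipx in h2.
  apply: (le_trans (ler_wpM2l _ h1)) => //.
  have m5 : 0 <= (5 * n)%:R * M by rewrite mulr_ge0// ltW.
  apply: (le_trans (ler_wpM2l _ (ler_wpM2l m5 h2))) => //.
  (* 60 n rho_tot is 2 * 5 n * 6 rho_tot: the triangle inequality, the Gram bound and the distance
     to the null space of L. *)
  rewrite CkE natrM le_eqVlt; apply/orP; left; apply/eqP; ring.
have hb : Cm * nuip (f - p) (f - p) + eta * (2^-1 * (D / 4 * disp u e) - 4 * nuip (f - p) (f - p)) <= bq f f.
  apply: le_trans (bq_lower hf hspp eta0 eta1 SSp); apply: lerD.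
    rewrite /nuip !mulr_sumr; apply: ler_sum => i _.
    exact: mono_gap_le.
  apply: ler_wpM2l => //; rewrite lerD2r; apply: ler_wpM2l; first by rewrite invr_ge0.
  exact: bq_polyf_ge.
by have [_] := alg _ _ _ _ (nu0 _ hg) (disp_ge0 u e) hQ hb.
Qed.

End explicit_gap.

Lemma kernel_factor_gt0 {R : realType} (n : nat) (Phi b : 'I_n -> 'I_n -> R -> R) :
  kinetic_growth Phi -> angular_cutoff b ->
  (forall i j r, 0 < r -> 0 < Phi i j r) /\
  (forall i j x, -1 < x < 1 -> x != 0 -> 0 < b i j x).
Proof.
move=> [C1 [C2 [gam [del [C10 _ _ _ hP]]]]] [[C3 [C4 [_ _ hb]]] _]; split.
  move=> i j r r0; have /andP[h _] := hP i j r r0; apply: lt_le_trans h.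
  by rewrite mulr_gt0// powR_gt0.
move=> i j x /andP[x1 x2] x0; have x12 : -1 <= x <= 1 by rewrite !ltW.
have t1 : 0 <= acos x <= pi by rewrite acos_ge0 ?acos_lepi.
have [_ h _] := hb i j _ t1; rewrite acosK// in h; apply: h; rewrite mulf_neq0//.
rewrite sin_acos// gt_eqF// sqrtr_gt0 subr_gt0 -real_normK ?num_real//.
by rewrite expr_lt1// ltr_norml x1.
Qed.

Theorem theorem3 (R : realType) (n : nat) (hn : (2 <= n)%N)
    (rho : 'I_n -> R) (hrho : forall i, 0 < rho i)
    (B : 'I_n -> 'I_n -> R -> R -> R) (Phi b : 'I_n -> 'I_n -> R -> R)
    (hB : collision_kernel B) (hA1 : kernel_sym B)
    (hA2 : kernel_factor B Phi b) (hA3 : kinetic_growth Phi)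
    (hA4 : angular_cutoff b) :
  (exists2 lam : R, 0 < lam & spectral_gap rho B lam) /\
  (forall beta : R, 0 < beta -> diag_control B beta ->
   forall lm : R, 0 < lm -> mono_spectral_gap rho B lm ->
   forall psi : 'I_(5 * n) -> 'I_n -> vel R -> R,
     orthonormal_basis (nullspace rho B (Lmono rho B)) psi ->
   let C_m := lm / (beta * rho_tot rho) in
   let D_b := Db rho B in
   let C_k := Ck rho B psi in
   let eta := Num.min 1 (4 * C_m * C_k / (16 * C_k + D_b)) in
   let lam := eta * D_b / (8 * C_k) in
   0 < lam /\ spectral_gap rho B lam).
Proof.
have [Phi0 b0] := kernel_factor_gt0 hA3 hA4.
have [[K K0 hK] _ cA cB cC] := kernel_facts hrho hB hA1 hA2 hA3 hA4.
have nufin := nuE_fin hrho hB hA1 hA2 hA3 hA4.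
have [c0 c0_gt0 nu_lower] := nu_lower_bound hrho hB hA1 hA2 hA3 hA4.
split; first exact: (spectral_gap_ex hrho hB hA1 nufin c0_gt0 nu_lower cA cB cC).
move=> beta beta0 hbeta lm lm0 hlm psi hpsi.
have [D0 hD] := Db_bounds hrho hB hA1 nufin K0 hK hn hA2 Phi0 b0.
exact: (explicit_spectral_gap hrho hB hA1 nufin c0_gt0 nu_lower K0 hK cA cB cC hn
  beta0 hbeta lm0 hlm D0 hD hpsi).
Qed.
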